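(* For every integer $r\geqslant 3$ there is a pair of finitely generated $r$-nilpotent groups whose asymptotic cones are bilipschitz but whose Dehn functions have different growth types (i.e. are not $\asymp$-equivalent). Likewise, for every $r\geqslant 3$ there is a pair of simply connected $r$-nilpotent Lie groups whose asymptotic cones are bilipschitz but whose Dehn functions have different growth types.
   Context: A group (or Lie group) is $r$-nilpotent (step $r$) if $r$ is the smallest integer with $\gamma_{r+1}G=\{1\}$, where $\gamma_1G=G$, $\gamma_{i+1}G=[G,\gamma_iG]$. Two groups have bilipschitz asymptotic cones if, with respect to any given non-principal ultrafilter, their asymptotic cones are bilipschitz homeomorphic; finitely generated groups carry word metrics, simply connected Lie groups carry left-invariant Riemannian metrics (or word metrics with respect to compact generating sets). The Dehn function of a finitely presented group with finite presentation $\langle S\mid R\rangle$ is $\delta(n)=\sup \mathrm{Area}(w)$ over words $w\in F_S$ of length at most $n$ representing the identity, where $\mathrm{Area}(w)$ is the minimal $k$ such that $w=\prod_{i=1}^k u_i^{-1}r_iu_i$ in the free group $F_S$ with $u_i\in F_S$, $r_i\in R^{\pm1}$. The Dehn function of a simply connected Lie group with a left-invariant Riemannian metric is the smallest $\delta(r)$ such that every rectifiable loop of length $\leqslant r$ has a Lipschitz disc filling of area $\leqslant \delta(r)$. For functions $f,g$ on $\mathbf Z_{\geqslant 0}$, $f\preccurlyeq g$ means $|f(n)|\leqslant A|g(An+A)|+A$ for some $A\geqslant 0$ and all $n$, and $f\asymp g$ means $f\preccurlyeq g\preccurlyeq f$. *)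

(* Defs.v *)
From HB Require Import structures.
From mathcomp Require Import all_boot all_order all_algebra.
From mathcomp Require Import all_classical all_reals all_analysis.

Set Implicit Arguments.
Unset Strict Implicit.
Unset Printing Implicit Defensive.

Import Order.TTheory GRing.Theory Num.Theory.
Import numFieldNormedType.Exports.

Local Open Scope classical_set_scope.
Local Open Scope ring_scope.

Section Growth.
Context {R : realType}.
Implicit Types f g : nat -> \bar R.

(* The constant is a natural number because [g] is only defined at integers. *)
Definition growth_le f g := exists A : nat, forall n : nat,
  (`|f n| <= A%:R%:E * `|g (A * n + A)%N| + A%:R%:E)%E.

Definition growth_eq f g := growth_le f g /\ growth_le g f.

End Growth.

Section Nilpotent.
Context {G : groupType}.
Implicit Types A : set G.

Definition is_subgroup A := A 1%g /\ (forall x y, A x -> A y -> A (x * y^-1)%g).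

Definition commutator_subgroup (A B : set G) : set G :=
  smallest is_subgroup [set z | exists x y, [/\ A x, B y & z = [~ x, y]%g]].

(* Shifted indexing: [lower_central i] is gamma_(i+1). *)
Fixpoint lower_central (i : nat) : set G :=
  if i is j.+1 then commutator_subgroup setT (lower_central j) else setT.

Definition nilpotent_of_step (r : nat) :=
  lower_central r = [set 1%g] /\
  forall k, (k < r)%N -> lower_central k <> [set 1%g].

End Nilpotent.
Arguments nilpotent_of_step : clear implicits.

(* Words in the letters [(i, false)] = s_i and [(i, true)] = s_i^-1. *)
Definition word (m : nat) := seq ('I_m * bool).

Section FreeGroup.
Context {m : nat}.

Definition letter_inv (a : 'I_m * bool) := (a.1, ~~ a.2).

Definition word_inv (w : word m) : word m := rev (map letter_inv w).

Inductive free_eq : word m -> word m -> Prop :=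
| free_cancel u v a : free_eq (u ++ [:: a; letter_inv a] ++ v) (u ++ v)
| free_refl w : free_eq w w
| free_sym v w : free_eq v w -> free_eq w v
| free_trans u v w : free_eq u v -> free_eq v w -> free_eq u w.

Definition conjugates_prod (us : seq (word m * word m)) : word m :=
  flatten [seq word_inv u.1 ++ u.2 ++ u.1 | u <- us].

(* [us] lists pairs (u_i, r_i) with r_i a relator or the inverse of one. *)
Definition filling (rels : seq (word m)) (w : word m)
    (us : seq (word m * word m)) :=
  all (fun u => (u.2 \in rels) || (word_inv u.2 \in rels)) us /\
  free_eq w (conjugates_prod us).

Definition word_area (R : realType) (rels : seq (word m)) (w : word m) : \bar R :=
  ereal_inf [set (size us)%:R%:E | us in filling rels w].

Definition word_eval (G : groupType) (s : 'I_m -> G) (w : word m) : G :=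
  (\prod_(a <- w) (if a.2 then (s a.1)^-1 else s a.1))%g.

End FreeGroup.

Record finite_genset (G : groupType) := FiniteGenset {
  gens_rank : nat;
  gens :> 'I_gens_rank -> G;
  gensP : forall x : G, exists w, word_eval gens w = x
}.

Definition finitely_generated (G : groupType) := inhabited (finite_genset G).

Record finite_presentation (G : groupType) := FinitePresentation {
  pres_gens :> finite_genset G;
  pres_rels : seq (word (gens_rank pres_gens));
  presP : forall w, word_eval pres_gens w = 1%g <-> exists us, filling pres_rels w us
}.

Definition finitely_presented (G : groupType) :=
  inhabited (finite_presentation G).

Definition word_dist (R : realType) (G : groupType) (s : finite_genset G)
    (x y : G) : R :=
  inf [set (size w)%:R | w in [set w | word_eval s w = (x^-1 * y)%g]].

Definition dehn (R : realType) (G : groupType) (P : finite_presentation G)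
    (n : nat) : \bar R :=
  ereal_sup [set word_area R (pres_rels P) w
            | w in [set w | (size w <= n)%N /\ word_eval P w = 1%g]].

(* The cone of a metric space (X, d), given as a bare distance function, along
   the ultrafilter F: the ultralimit of the spaces (X, d / n) based at e. *)
Section AsymptoticCone.
Context {R : realType} {X : Type} (d : X -> X -> R) (e : X).
Context (F : set_system nat).

Definition cone_seq (x : nat -> X) :=
  exists C : R, \forall n \near F, d e (x n) <= C * n%:R.

Definition ultradist (x y : nat -> X) : R :=
  lim ((fun n => d (x n) (y n) / n%:R) @ F).

Definition cone_class (x : nat -> X) : set (nat -> X) :=
  [set y | cone_seq y /\ ultradist x y = 0].

Definition cone := {A : set (nat -> X) | exists2 x, cone_seq x & A = cone_class x}.

Definition cone_repr (a : cone) : nat -> X := s2val (cid2 (proj2_sig a)).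

Definition cone_dist (a b : cone) : R := ultradist (cone_repr a) (cone_repr b).

End AsymptoticCone.

Definition bilipschitz_homeomorphic (R : realType) (X Y : Type)
    (dX : X -> X -> R) (dY : Y -> Y -> R) :=
  exists f : X -> Y, bijective f /\
    exists2 K : R, 0 < K &
      forall x y, K^-1 * dX x y <= dY (f x) (f y) <= K * dX x y.

Definition nonprincipal (F : set_system nat) := forall n, ~ F [set n].

Definition bilipschitz_cones (R : realType) (X Y : Type)
    (dX : X -> X -> R) (eX : X) (dY : Y -> Y -> R) (eY : Y) :=
  forall F : set_system nat, UltraFilter F -> nonprincipal F ->
    bilipschitz_homeomorphic (@cone_dist R X dX eX F) (@cone_dist R Y dY eY F).

Section SmoothMaps.
Context {R : realType} {V W : normedModType R}.

(* Meant for open U in finite-dimensional V, where it is the usual C^k. *)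
Fixpoint Ck_on (k : nat) (U : set V) (f : V -> W) : Prop :=
  if k is j.+1 then
    (forall x, U x -> differentiable f x) /\
    forall v, Ck_on j U (fun x => 'd f x v)
  else forall x, U x -> {for x, continuous f}.

Definition smooth_on (U : set V) (f : V -> W) := forall k, Ck_on k U f.

End SmoothMaps.

Record chart (R : realType) (n : nat) (M : topologicalType) := Chart {
  chart_dom : set M;
  chart_map :> M -> 'rV[R]_n;
  chart_inv : 'rV[R]_n -> M;
  chart_dom_open : open chart_dom;
  chart_img_open : open (chart_map @` chart_dom);
  chart_mapK : forall x, chart_dom x -> chart_inv (chart_map x) = x;
  chart_map_continuous : {within chart_dom, continuous chart_map};
  chart_inv_continuous : {within chart_map @` chart_dom, continuous chart_inv}
}.

Definition chart_img R n M (a : chart R n M) : set 'rV[R]_n := a @` chart_dom a.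

#[short(type="groupTopologicalType")]
HB.structure Definition GroupTopological := {G of Group G & Topological G}.

Record lieGroup (R : realType) (n : nat) := LieGroup {
  lie_sort :> groupTopologicalType;
  lie_hausdorff : hausdorff_space lie_sort;
  lie_second_countable : @second_countable lie_sort;
  lie_atlas : set (chart R n lie_sort);
  lie_atlas_cover : forall x, exists2 a, lie_atlas a & chart_dom a x;
  lie_atlas_compat : forall a b, lie_atlas a -> lie_atlas b ->
    smooth_on (a @` (chart_dom a `&` chart_dom b)) (b \o chart_inv a);
  lie_mul_continuous : continuous (fun p : lie_sort * lie_sort => (p.1 * p.2)%g);
  lie_mul_smooth : forall a b c, lie_atlas a -> lie_atlas b -> lie_atlas c ->
    smooth_on [set p : 'rV[R]_n * 'rV[R]_n |
        [/\ chart_img a p.1, chart_img b p.2 &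
            chart_dom c (chart_inv a p.1 * chart_inv b p.2)%g]]
      (fun p => c (chart_inv a p.1 * chart_inv b p.2)%g);
  lie_inv_continuous : continuous (fun x : lie_sort => (x^-1)%g);
  lie_inv_smooth : forall a b, lie_atlas a -> lie_atlas b ->
    smooth_on [set u : 'rV[R]_n | chart_img a u /\ chart_dom b (chart_inv a u)^-1%g]
      (fun u => b (chart_inv a u)^-1%g)
}.

Arguments lie_atlas {R n} G _ : rename.

Section SimplyConnected.
Context (R : realType) (M : topologicalType).

Definition is_path (c : R -> M) := {within `[0, 1], continuous c}.

Definition path_connected :=
  forall x y : M, exists c, [/\ is_path c, c 0 = x & c 1 = y].

Definition null_homotopic (c : R -> M) :=
  exists2 h : R * R -> M, {within `[0, 1] `*` `[0, 1], continuous h} &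
    forall t : R, 0 <= t <= 1 ->
      [/\ h (0, t) = c t, h (1, t) = c 0, h (t, 0) = c 0 & h (t, 1) = c 0].

Definition simply_connected :=
  path_connected /\
  forall c : R -> M, is_path c -> c 0 = c 1 -> null_homotopic c.

End SimplyConnected.

Section BilinearForm.
Context {R : realType} {n : nat}.

Definition bform (Q : 'M[R]_n) (u v : 'rV[R]_n) : R := (u *m Q *m v^T) 0 0.

Definition positive_definite (Q : 'M[R]_n) :=
  Q^T = Q /\ forall u, u != 0 -> 0 < bform Q u u.

End BilinearForm.

(* A left-invariant Riemannian metric is an inner product on the tangent space
   at 1, which a chart at 1 identifies with R^n. *)
Record leftinv_metric (R : realType) (n : nat) (G : lieGroup R n) :=
  LeftinvMetric {
  li_chart : chart R n G;
  li_atlas : lie_atlas G li_chart;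
  li_dom1 : chart_dom li_chart 1%g;
  li_form : 'M[R]_n;
  li_posdef : positive_definite li_form
}.

Section LeftInvariantGeometry.
Context {R : realType} {n : nat} {G : lieGroup R n} (g : leftinv_metric G).

(* Derivatives of maps into G are left-translated to the tangent space at 1:
   that of f at p is read off from q |-> f(p)^-1 f(q). *)
Definition translate (V : Type) (f : V -> G) (p q : V) : 'rV[R]_n :=
  li_chart g ((f p)^-1 * f q)%g.

Definition velocity (c : R -> G) (t : R) : 'rV[R]_n := 'D_1 (translate c t) t.

Definition C1_curve (c : R -> G) :=
  [/\ continuous c,
      forall t : R, 0 <= t <= 1 -> derivable (translate c t) t 1 &
      {within `[0, 1], continuous (velocity c)}].

Definition smooth_length (c : R -> G) : R :=
  \int[lebesgue_measure]_(t in `[0, 1])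
    Num.sqrt (bform (li_form g) (velocity c t) (velocity c t)).

(* Every piecewise C^1 curve has a C^1 reparametrization, stopping at the
   corners, so C^1 curves suffice. *)
Definition riem_dist (x y : G) : R :=
  inf [set smooth_length c | c in [set c | [/\ C1_curve c, c 0 = x & c 1 = y]]].

Definition chord_sum (c : R -> G) (s : seq R) : R :=
  \sum_(p <- zip (0 :: s) s) riem_dist (c p.1) (c p.2).

Definition curve_length (c : R -> G) : \bar R :=
  ereal_sup [set (chord_sum c s)%:E | s in itv_partition 0 1].

Definition closed_disc : set (R * R) := [set p | p.1 ^+ 2 + p.2 ^+ 2 <= 1].
Definition open_disc : set (R * R) := [set p | p.1 ^+ 2 + p.2 ^+ 2 < 1].

(* The norm on R * R is the sup norm, equivalent to the Euclidean one. *)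
Definition lipschitz_disc (phi : R * R -> G) :=
  exists K : R, forall p q, closed_disc p -> closed_disc q ->
    riem_dist (phi p) (phi q) <= K * `|p - q|.

(* The partial derivatives of a Lipschitz disc exist almost everywhere. *)
Definition area_density (phi : R * R -> G) (p : R * R) : R :=
  let v1 := 'D_((1, 0) : R * R) (translate phi p) p in
  let v2 := 'D_((0, 1) : R * R) (translate phi p) p in
  let B := bform (li_form g) in
  Num.sqrt (B v1 v1 * B v2 v2 - B v1 v2 ^+ 2).

Definition disc_area (phi : R * R -> G) : \bar R :=
  (\int[(@lebesgue_measure R \x @lebesgue_measure R)%E]_(p in open_disc)
     (area_density phi p)%:E)%E.

(* A rectifiable loop need not be Lipschitz as parametrized; the boundary of a
   filling disc is the loop up to monotone reparametrization. *)
Definition disc_fills (phi : R * R -> G) (c : R -> G) :=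
  exists s : R -> R,
    [/\ {within `[0, 1], continuous s},
        {in `[0, 1] &, {homo s : x y / x <= y}}, s 0 = 0, s 1 = 1 &
        forall t : R, 0 <= t <= 1 ->
          c t = phi (cos (2 * pi * s t), sin (2 * pi * s t))].

Definition loop_of_length_le (c : R -> G) (l : R) :=
  [/\ is_path c, c 0 = c 1 & (curve_length c <= l%:E)%E].

Definition lie_dehn (l : R) : \bar R :=
  ereal_inf [set D%:E | D in [set D : R |
    forall c, loop_of_length_le c l ->
      exists phi, [/\ lipschitz_disc phi, disc_fills phi c &
                      (disc_area phi <= D%:E)%E]]].

End LeftInvariantGeometry.

(* Main.v *)
(* L is the filiform group of class r, generated by x (coordinate a) and y
 (coordinate p_0).  G = L x R^2 and H, the central product of L and a Heisenberg
 group, differ by a cocycle that is sublinear in the distance, so that their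
 cones are bilipschitz.  The word y^(n c_0) x^n y^(n c_1) x^n ... y^(n c_r) x^(-rn),
 c_i = (-1)^i binomial(r, i), is trivial in G but is central of size n^(r+1) in
 the filiform group of class r + 1: relators lift to bounded central elements,
 and over a Lipschitz disc the lifted coordinate is the integral of an invariant
 2-form, by Green's formula.  In H a loop splits into a loop in L and one in the
 Heisenberg factor K.  The dilations contract the latter; the former is coned off
 along a spiral in the plane (u, v) whose rotation absorbs the central
 displacement.  Both take O(n^(r-1)) rows of O(n) cells. *)
Require Import Defs.
From mathcomp Require Import all_boot all_order all_algebra.
From mathcomp Require Import all_classical all_reals all_analysis.
From mathcomp Require Import measurable_realfun ring lra zify.
From HB Require Import structures.

Set Implicit Arguments.
Unset Strict Implicit.
Unset Printing Implicit Defensive.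

Import Order.TTheory GRing.Theory Num.Theory.
Import numFieldNormedType.Exports.

Local Open Scope classical_set_scope.
Local Open Scope ring_scope.

(** The same n steps performed from 1 in G and in H end at points that differ by a central element
    of size O(n^2). The last coordinate of L has weight r >= 3, so that such an element is reached
    in O(n^(2/3)) steps, by a second difference in the last three coordinates; for class 2 the cost
    would be linear and the error no longer sublinear. The same cost governs the splitting of loops
    in H.

    What obstructs a filling of size n^r by dilations of L is the centre: with O(n^(r-1)) rows,
    consecutive rows are boundedly close in all coordinates except the last, which drifts by O(n)
    per row. In H a rotation of radius of order n by an angle of order 1/n sweeps an area of order
    n, hence a central displacement that cancels this drift. In G no such rotation is available.

    Fillings are constructed once, as grids of real points with bounded steps. Rounding to the
    lattice turns a grid into a product of relators coming from boundedly many squares;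
    interpolation turns it into a Lipschitz disc. *)

Ltac lra2 := apply/andP; split; lra.

Section NormTriangle.
Context {R : numDomainType} {V : normedZmodType R}.
Implicit Types (x y : V) (c : R).

Lemma normD_le x y c : `|x| + `|y| <= c -> `|x + y| <= c.
exact: le_trans (ler_normD _ _). Qed.
Lemma normB_le x y c : `|x| + `|y| <= c -> `|x - y| <= c.
exact: le_trans (ler_normB _ _). Qed.

End NormTriangle.

(** * Pascal matrices and the group law *)

Section Pascal.
Context {S : comNzRingType} (r : nat).

Definition pascal (a : S) : 'M[S]_r :=
 \matrix_(j, k) ('C(k, j)%:R * a ^+ (k - j)).

Lemma pascal0 : pascal 0 = 1%:M.
apply/matrixP => j k; rewrite !mxE expr0n subn_eq0.
have [->|jk] := eqVneq j k; first by rewrite leqnn binn mulr1.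
case: leqP => kj; last by rewrite mulr0.
by rewrite bin_small ?mul0r// ltn_neqAle eq_sym jk.
Qed.

Lemma pascalD a b : pascal (a + b) = pascal a *m pascal b.
apply/matrixP => j k; rewrite !mxE.
under eq_bigr do rewrite !mxE.
rewrite -(big_mkord xpredT (fun i => 'C(i, j)%:R * a ^+ (i - j) *
 ('C(k, i)%:R * b ^+ (k - i)))) /=.
have [kj|jk] := ltnP k j.
 rewrite bin_small// mul0r big_nat_cond big1// => i /andP[/andP[_ ir] _].
 have [ij|ji] := ltnP i j; first by rewrite bin_small// !mul0r.
 by rewrite (@bin_small k)// ?mul0r ?mulr0//; apply: leq_trans ji.
rewrite (big_cat_nat (n := j))//=; last exact/ltnW/ltn_ord.
rewrite big_nat_cond big1 ?add0r; last first.
 by move=> i /andP[/andP[_ ij] _]; rewrite bin_small// !mul0r.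
rewrite (big_cat_nat (n := k.+1))//=; last by rewrite ltnW.
rewrite [X in _ = _ + X]big_nat_cond [X in _ = _ + X]big1 ?addr0; last first.
 move=> i /andP[/andP[ki _] _].
 by rewrite (@bin_small k)// ?mul0r ?mulr0.
rewrite -[index_iota j _]/(index_iota (0 + j) k.+1) big_addn subSn// big_mkord exprDn mulr_sumr.
rewrite [RHS](reindex_inj rev_ord_inj)/=.
apply: eq_bigr => i _; rewrite subSS.
have ik : (i <= k - j)%N by rewrite -ltnS.
set m := (k - j - i)%N.
have -> : (m + j - j)%N = m by rewrite addnK.
have -> : (k - (m + j))%N = i by rewrite /m; lia.
(* Trinomial revision: both sides equal k! / (j! i! m!). *)
suff E : ('C(k, j) * 'C(k - j, i) = 'C(m + j, j) * 'C(k, m + j))%N.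
 have := congr1 (fun n => n%:R : S) E; rewrite !natrM => E'.
 by rewrite mulrnAr -mulr_natl mulrA mulrA [_%:R * _%:R]mulrC E'; ring.
have mk : (m + j <= k)%N by rewrite /m; lia.
apply/eqP; rewrite -(@eqn_pmul2r (j`! * (i`! * m`!)))%N; last first.
 by rewrite !muln_gt0 !fact_gt0.
have e1 := bin_fact jk; have e2 := bin_fact ik.
have e3 := bin_fact mk; have e4 := bin_fact (leq_addl m j).
rewrite addnK in e4; rewrite -/m in e2.
have ki : (k - (m + j))%N = i by rewrite /m; lia.
rewrite ki in e3.
apply/eqP; transitivity (k`!); first by rewrite -{}e1 -{}e2; nia.
rewrite -{}e3 -{}e4; nia.
Qed.

End Pascal.

(* A row (a, u, v | p) with p in S^r stands for an element of the central
 product of the model filiform group S \ltimes S^r, whose factor S acts on S^r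
 by Pascal matrices, and the Heisenberg group with coordinates u, v; the two
 centres are identified with the last coordinate of p when [e], and the
 Heisenberg group is replaced by S^2 when [~~ e]. *)
Definition filiprod (S : comNzRingType) (r : nat) (e : bool) : Type :=
 'rV[S]_(3 + r).

HB.instance Definition _ (S : comNzRingType) r e :=
 Choice.on (filiprod S r e).

Section Filiprod.
Context {S : comNzRingType} {r : nat} {e : bool}.
Implicit Types x y z : 'rV[S]_(3 + r).

Definition cA x : S := x 0 (lshift r 0).
Definition cU x : S := x 0 (lshift r 1).
Definition cV x : S := x 0 (lshift r 2%:R).
Definition cP x : 'rV[S]_r := rsubmx x.

(** Sends v to e u v in the last coordinate of p: the polarized Heisenberg cocycle, with values in
    the common centre. *)
Definition heis (u : S) : 'M[S]_(3, r) :=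
 \matrix_(i, j) (if (i == 2%:R) && (j.+1 == r) then e%:R * u else 0).

Definition act (a u : S) : 'M[S]_(3 + r) :=
 block_mx 1%:M (heis u) 0 (pascal r a).

Definition actx x := act (cA x) (cU x).
Definition actxV x := act (- cA x) (- cU x).

Lemma heisD u u' : heis (u + u') = heis u + heis u'.
by apply/matrixP => i j; rewrite !mxE; case: ifP; rewrite ?addr0// mulrDr.
Qed.

(** The last row of a Pascal matrix is the last unit vector, so the action of a fixes the common
    centre. This makes [act] additive in the pair (a, u). *)
Lemma heis_pascal u a : heis u *m pascal r a = heis u.
apply/matrixP => i j; rewrite !mxE; under eq_bigr do rewrite !mxE.
case i2: (i == 2%:R) => /=; last by rewrite big1// => k _; rewrite mul0r.
have [jr|jr] := eqVneq j.+1 r.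
 rewrite (bigD1 j)//= jr eqxx binn subnn expr0 !mulr1 big1 ?addr0// => k kj.
 case: eqP => [kr|]; rewrite ?mul0r//.
 case/eqP: kj; apply/val_inj => /=; lia.
rewrite big1// => k _; case: eqP => [kr|]; rewrite ?mul0r// bin_small.
 by rewrite mul0r mulr0.
have := ltn_ord j; rewrite -{2}kr ltnS leq_eqVlt => /orP[/eqP jk|//].
by move: jr; rewrite jk kr eqxx.
Qed.

Lemma act0 : act 0 0 = 1%:M.
rewrite /act pascal0 (_ : heis 0 = 0) -?scalar_mx_block//.
by apply/matrixP => i j; rewrite !mxE mulr0 if_same.
Qed.

Lemma actD a u a' u' : act (a + a') (u + u') = act a u *m act a' u'.
rewrite /act mulmx_block !mul1mx !mulmx0 !mul0mx add0r addr0 pascalD heis_pascal.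
by rewrite add0r heisD [heis u + _]addrC.
Qed.

Lemma fixed_act a u x : [/\ cA (x *m act a u) = cA x,
 cU (x *m act a u) = cU x & cV (x *m act a u) = cV x].
rewrite -{1 3 5}[x]hsubmxK /act mul_row_block mulmx1 mulmx0 addr0 /cA /cU /cV.
by rewrite !row_mxEl; split; rewrite mxE.
Qed.

Lemma cA_act a u x : cA (x *m act a u) = cA x. by case: (fixed_act a u x). Qed.
Lemma cU_act a u x : cU (x *m act a u) = cU x. by case: (fixed_act a u x). Qed.
Lemma cV_act a u x : cV (x *m act a u) = cV x. by case: (fixed_act a u x). Qed.

Lemma cAD x y : cA (x + y) = cA x + cA y. exact: mxE. Qed.
Lemma cUD x y : cU (x + y) = cU x + cU y. exact: mxE. Qed.
Lemma cVD x y : cV (x + y) = cV x + cV y. exact: mxE. Qed.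
Lemma cPD x y : cP (x + y) = cP x + cP y. exact: linearD. Qed.
Lemma cAN x : cA (- x) = - cA x. exact: mxE. Qed.
Lemma cUN x : cU (- x) = - cU x. exact: mxE. Qed.
Lemma cVN x : cV (- x) = - cV x. exact: mxE. Qed.
Lemma cPN x : cP (- x) = - cP x. exact: linearN. Qed.

End Filiprod.

HB.lock Definition fmul (S : comNzRingType) (r : nat) (e : bool)
 (x y : 'rV[S]_(3 + r)) : 'rV[S]_(3 + r) := x + y *m actx (e := e) x.
HB.lock Definition finv (S : comNzRingType) (r : nat) (e : bool)
 (x : 'rV[S]_(3 + r)) : 'rV[S]_(3 + r) := - x *m actxV (e := e) x.

Section FiliprodGroup.
Context {S : comNzRingType} {r : nat} {e : bool}.
Implicit Types x y z : 'rV[S]_(3 + r).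
Local Notation fmul := (@fmul S r e).
Local Notation finv := (@finv S r e).

(** [act] depends only on a and u, which it leaves fixed; associativity is therefore its
    additivity. *)
Lemma fmulA : associative fmul.
move=> x y z; rewrite !unlock mulmxDl addrA -mulmxA /actx; congr (_ + _ *m _).
by rewrite -actD cAD cUD cA_act cU_act [cA _ + _]addrC [cU _ + _]addrC.
Qed.

Lemma actxV_actx x : actxV (e := e) x *m actx (e := e) x = 1%:M.
by rewrite -actD !addNr act0. Qed.
Lemma actx_actxV x : actx (e := e) x *m actxV (e := e) x = 1%:M.
by rewrite -actD !addrN act0. Qed.

Lemma fmul0x : left_id (0 : 'rV[S]_(3 + r)) fmul.
by move=> x; rewrite unlock /actx /cA /cU !mxE act0 mulmx1 add0r. Qed.
Lemma fmulx0 : right_id (0 : 'rV[S]_(3 + r)) fmul.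
by move=> x; rewrite unlock mul0mx addr0. Qed.
Lemma fmulxV : right_inverse (0 : 'rV[S]_(3 + r)) finv fmul.
by move=> x; rewrite !unlock -mulmxA actxV_actx mulmx1 subrr. Qed.
Lemma fmulVx : left_inverse (0 : 'rV[S]_(3 + r)) finv fmul.
move=> x; rewrite !unlock /actx cA_act cU_act cAN cUN.
by rewrite -/(actxV x) -mulmxDl addNr mul0mx.
Qed.

End FiliprodGroup.

HB.instance Definition _ (S : comNzRingType) r e :=
 isGroup.Build (filiprod S r e) (@fmulA S r e) (@fmul0x S r e) (@fmulx0 S r e)
 (@fmulVx S r e) (@fmulxV S r e).

HB.lock Definition mk (S : comNzRingType) (r : nat) (e : bool) (a u v : S)
 (p : 'rV[S]_r) : filiprod S r e := row_mx (\row_(i < 3) [:: a; u; v]`_i) p.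
Arguments mk {S r e}.

Section FiliprodTheory.
Context {S : comNzRingType} {r : nat} {e : bool}.
Local Notation Q := (filiprod S r e).
Local Notation row := ('rV[S]_(3 + r)).
Implicit Types x y z : Q.

Lemma mulE x y : (x * y)%g = (x : row) + (y : row) *m actx (e := e) x :> row.
by rewrite -[LHS]/(fmul e x y) unlock. Qed.
Lemma invE x : (x^-1)%g = - (x : row) *m actxV (e := e) x :> row.
by rewrite -[LHS]/(finv e x) unlock. Qed.
Lemma oneE : (1%g : Q) = 0 :> row. by []. Qed.

(** Left translations are affine in the coordinates: a quotient, and later a left-translated
    derivative, is a difference moved by a linear map that depends on a and u only. *)
Lemma divE x y : (x^-1 * y)%g = ((y : row) - (x : row)) *m actxV (e := e) x :> row.
rewrite mulE invE /actx cA_act cU_act cAN cUN -/(actxV (e := e) x) -mulmxDl.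
by rewrite addrC.
Qed.

Lemma cA_mul x y : cA (x * y)%g = cA x + cA y.
by rewrite mulE cAD cA_act. Qed.
Lemma cU_mul x y : cU (x * y)%g = cU x + cU y.
by rewrite mulE cUD cU_act. Qed.
Lemma cV_mul x y : cV (x * y)%g = cV x + cV y.
by rewrite mulE cVD cV_act. Qed.

Lemma cP_act a u (x : row) :
 cP (x *m act (e := e) a u) = lsubmx x *m heis (e := e) u + cP x *m pascal r a.
by rewrite -{1}[x]hsubmxK /act mul_row_block /cP row_mxKr. Qed.

Lemma lsub_heis u (x : row) (k : 'I_r) : (lsubmx x *m heis (e := e) u) 0 k =
 if k.+1 == r then e%:R * u * cV x else 0.
rewrite mxE (bigD1 2%:R)//= big1 => [|i /negPf i2]; last by rewrite !mxE i2 mulr0.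
by rewrite !mxE eqxx /=; case: ifP; rewrite ?mulr0 ?addr0// mulrC.
Qed.

Lemma cP_mul x y (k : 'I_r) : cP (x * y)%g 0 k = cP x 0 k +
 \sum_(j < r) cP y 0 j * ('C(k, j)%:R * cA x ^+ (k - j)) +
 (if k.+1 == r then e%:R * cU x * cV y else 0).
rewrite mulE cPD cP_act mxE -addrA; congr (_ + _); rewrite mxE addrC lsub_heis.
congr (_ + _); rewrite mxE; apply: eq_bigr => j _; by rewrite [pascal _ _ _ _]mxE.
Qed.

Lemma cP_div x y (k : 'I_r) : cP (x^-1 * y)%g 0 k =
 \sum_(j < r) (cP y 0 j - cP x 0 j) * ('C(k, j)%:R * (- cA x) ^+ (k - j)) -
 (if k.+1 == r then e%:R * cU x * (cV y - cV x) else 0).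
rewrite divE cP_act mxE lsub_heis addrC; congr (_ + _).
 rewrite mxE; apply: eq_bigr => j _.
 by rewrite [pascal _ _ _ _]mxE cPD cPN mxE [X in _ + X]mxE.
by rewrite cVD cVN; case: ifP; rewrite ?oppr0// mulrN mulNr.
Qed.

Lemma cA_div x y : cA (x^-1 * y)%g = cA y - cA x.
by rewrite divE cA_act cAD cAN. Qed.
Lemma cU_div x y : cU (x^-1 * y)%g = cU y - cU x.
by rewrite divE cU_act cUD cUN. Qed.
Lemma cV_div x y : cV (x^-1 * y)%g = cV y - cV x.
by rewrite divE cV_act cVD cVN. Qed.

Lemma mkE a u v p : [/\ cA (mk a u v p : Q) = a, cU (mk a u v p : Q) = u,
 cV (mk a u v p : Q) = v & cP (mk a u v p : Q) = p].
by split; rewrite unlock /cA /cU /cV /cP ?row_mxEl ?mxE// row_mxKr. Qed.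

Lemma cAmk a u v p : cA (mk a u v p : Q) = a. by case: (mkE a u v p). Qed.
Lemma cUmk a u v p : cU (mk a u v p : Q) = u. by case: (mkE a u v p). Qed.
Lemma cVmk a u v p : cV (mk a u v p : Q) = v. by case: (mkE a u v p). Qed.
Lemma cPmk a u v p : cP (mk a u v p : Q) = p. by case: (mkE a u v p). Qed.

Lemma colP (P : 'I_(3 + r) -> Prop) :
 P (lshift r 0) -> P (lshift r 1) -> P (lshift r 2%:R) ->
 (forall k, P (rshift 3 k)) -> forall i, P i.
move=> P0 P1 P2 Pk i; rewrite -[i]splitK; case: (fintype.split i) => [j|j]; last exact: Pk.
case: j => [[|[|[|j]]] lt3] //.
- by rewrite (_ : Ordinal _ = 0) //; apply/val_inj.
- by rewrite (_ : Ordinal _ = 1) //; apply/val_inj.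
- by rewrite (_ : Ordinal _ = 2%:R) //; apply/val_inj.
Qed.

Lemma filiprodP x y : cA x = cA y -> cU x = cU y -> cV x = cV y ->
 (forall k, cP x 0 k = cP y 0 k) -> x = y.
move=> a u v p; apply/rowP; apply: colP => // k.
by have := p k; rewrite !mxE.
Qed.

End FiliprodTheory.

(** * The nilpotency class *)

Section Step.
Context {S : numDomainType} {r : nat} {e : bool} (r2 : (1 < r)%N).
Local Notation Q := (filiprod S r e).
Local Notation row := ('rV[S]_(3 + r)).
Implicit Types x y z : Q.

Lemma commE x y : [~ x, y]%g = ((y * x)^-1 * (x * y))%g.
by rewrite /commg /conjg invgM !mulgA. Qed.

Lemma comm_vertical x y : cA y = 0 -> cU y = 0 -> cV y = 0 ->
 [~ x, y]%g = (y : row) - (y : row) *m actxV (e := e) x :> row.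
move=> a u v; rewrite commE divE !mulE [actx y]/actx a u act0 mulmx1.
rewrite -[actxV _]/(act _ _) !cAD !cUD a u !add0r -/(actxV (e := e) x).
rewrite opprD [- _ - _]addrC addrACA subrr add0r mulmxBl -mulmxA.
by rewrite actx_actxV mulmx1.
Qed.

Lemma cP_comm_vertical x y k : cA y = 0 -> cU y = 0 -> cV y = 0 ->
 cP [~ x, y]%g 0 k = cP y 0 k - (cP y *m pascal r (- cA x)) 0 k.
move=> a u v; rewrite comm_vertical// cPD cPN /actxV cP_act mxE; congr (_ + _).
by rewrite mxE; congr (- _); rewrite [LHS]mxE lsub_heis v mulr0 if_same add0r.
Qed.

Definition vfilt i : set Q := [set x | [/\ cA x = 0, cU x = 0, cV x = 0 &
 forall k : 'I_r, (k < i)%N -> cP x 0 k = 0]].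

Lemma pascal_up a (j l : 'I_r) : (l < j)%N -> pascal r a j l = 0 :> S.
by move=> lj; rewrite mxE bin_small// mul0r. Qed.
Lemma pascal_diag a (j : 'I_r) : pascal r a j j = 1 :> S.
by rewrite mxE binn subnn mulr1. Qed.

Lemma vfilt_subgroup i : is_subgroup (vfilt i).
split=> [|x y [ax ux vx px] [ay uy vy py]].
 by split=> [|||k _]; rewrite oneE /cA /cU /cV /cP !mxE.
suff E : (x * y^-1)%g = (x : row) - (y : row) :> row.
 by split=> [|||k ki]; rewrite E ?(cAD, cAN, cUD, cUN, cVD, cVN, cPD, cPN)
 ?ax ?ay ?ux ?uy ?vx ?vy ?subrr// mxE px// [X in _ + X]mxE py// subrr.
rewrite mulE invE /actx /actxV ax ux ay uy !oppr0 act0.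
by rewrite !mulmx1.
Qed.

(** A commutator has trivial a, u, v, and also p_0, which Pascal matrices fix and which the
    Heisenberg cocycle does not reach as r > 1. Afterwards, y minus its translate by a unipotent
    triangular matrix has one more leading zero than y. *)
Lemma lower_central_vfilt i : @lower_central Q i.+1 `<=` vfilt i.+1.
elim: i => [|i IH]; apply: smallest_sub; try exact: vfilt_subgroup.
 move=> _ [x [y [_ _ ->]]]; rewrite commE; split.
 - by rewrite cA_div !cA_mul [cA y + _]addrC subrr.
 - by rewrite cU_div !cU_mul [cU y + _]addrC subrr.
 - by rewrite cV_div !cV_mul [cV y + _]addrC subrr.
 case=> -[|//] k0 _.
 have r1 : (0.+1 == r) = false by apply/negbTE; rewrite neq_ltn r2.
 have s0 (z : Q) (c : S) : \sum_(j < r) cP z 0 j *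
 ('C(Ordinal k0, j)%:R * c ^+ (Ordinal k0 - j)) = cP z 0 (Ordinal k0).
 rewrite (bigD1 (Ordinal k0))//= big1 ?addr0 ?bin0 ?expr0 ?mulr1// => j jn.
 by rewrite bin_small ?mul0r ?mulr0// lt0n.
 rewrite cP_div /= r1 subr0 (bigD1 (Ordinal k0))//= big1 ?addr0.
 by rewrite !cP_mul /= r1 !s0 !addr0 [X in _ - X]addrC subrr mul0r.
 by move=> j jn; rewrite bin_small ?mul0r ?mulr0// lt0n.
move=> _ [x [y [_ /IH [a u v p] ->]]].
have E := comm_vertical x a u v; split=> [|||k ki].
- by rewrite E cAD cAN cA_act subrr.
- by rewrite E cUD cUN cU_act subrr.
- by rewrite E cVD cVN cV_act subrr.
rewrite cP_comm_vertical// [(_ *m _) _ _]mxE (bigD1 k)//= pascal_diag mulr1 opprD addrA subrr.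
rewrite add0r big1 ?oppr0// => j jk; have [jk'|kj] := ltnP j k.
 by rewrite p ?mul0r//; apply: leq_trans jk' _.
by rewrite pascal_up ?mulr0// ltn_neqAle kj andbT eq_sym.
Qed.

(** The commutator with x = (1, 0, 0 | 0) moves the leading entry of y from index k to k + 1 and
    multiplies it by the binomial C(k + 1, k) = k + 1, which is nonzero in characteristic 0. *)
Lemma lower_central_neq k (kr : (k < r)%N) : exists y : Q, [/\ lower_central k y,
 vfilt k y, cA y = 0 /\ cU y = 0 /\ cV y = 0 & cP y 0 (Ordinal kr) != 0].
elim: k kr => [|k IH] kr.
 exists (mk 0 0 0 (delta_mx 0 (Ordinal kr))).
 split=> //; first by split=> //; rewrite ?cAmk ?cUmk ?cVmk.
 by rewrite ?cAmk ?cUmk ?cVmk.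
 by rewrite cPmk mxE !eqxx oner_neq0.
have kr' := ltnW kr; have [y [ly [_ _ _ py] [a [u v]] nz]] := IH kr'.
pose x : Q := mk 1 0 0 0.
have lz : @lower_central Q k.+1 [~ x, y]%g.
 by apply: sub_gen_smallest; exists x, y.
exists [~ x, y]%g; split => //; first exact: lower_central_vfilt.
 by have [] := lower_central_vfilt lz.
rewrite cP_comm_vertical// [(_ *m _) _ _]mxE (bigD1 (Ordinal kr))//= pascal_diag mulr1 opprD.
rewrite addrA subrr add0r (bigD1 (Ordinal kr'))//=; last by rewrite -val_eqE/= ltn_eqF.
rewrite big1 => [|j /andP[/eqP jk1 /eqP jk]].
 rewrite addr0 oppr_eq0 mulf_neq0// mxE /= subSnn expr1 binSn cAmk.
 by rewrite mulrN1 oppr_eq0 pnatr_eq0.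
have [jk'|kj] := ltnP j k; first by rewrite py ?mul0r.
rewrite pascal_up ?mulr0//=.
have : (j : nat) <> k by move=> h; apply: jk; apply/val_inj.
have : (j : nat) <> k.+1 by move=> h; apply: jk1; apply/val_inj.
by move: kj; lia.
Qed.

Lemma lower1 i : @lower_central Q i 1%g.
by case: i => // i A [[A1 _] _]. Qed.

Lemma filiprod_step : nilpotent_of_step Q r.
split=> [|k kr k1].
 apply/seteqP; split=> [x H|_ ->]; last exact: lower1.
 have := lower_central_vfilt (i := r.-1); rewrite prednK ?(ltnW r2)//.
 move=> /(_ x H) [a u v p].
 by apply: filiprodP => [|||k]; rewrite ?a ?u ?v ?p// oneE /cA /cU /cV /cP !mxE.
have [y [ly _ _]] := lower_central_neq kr.
by move: ly; rewrite k1 => -> ; rewrite oneE /cP !mxE eqxx.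
Qed.

End Step.

Ltac nneg := repeat first [ assumption | done | apply: addr_ge0 | apply: mulr_ge0
 | apply: exprn_ge0 | apply: normr_ge0 ].

Ltac nlia := repeat match goal with H : ?T |- _ =>
 lazymatch type of T with Prop => lazymatch T with
 | is_true (leq _ _) => fail | @eq nat _ _ => fail | @eq bool _ _ => fail
 | is_true (~~ leq _ _) => fail
 | _ => clear H end end end; lia.

(** * Size estimates in coordinates and the coarse adjacency relation *)

Section RealEstimates.
Context {R : realType}.
Implicit Types x y K : R.

Lemma normr_subXX n x y K : `|x| <= K -> `|y| <= K ->
 `|x ^+ n - y ^+ n| <= n%:R * `|x - y| * K ^+ n.-1.
move=> xK yK; case: n => [|n]; first by rewrite !expr0 subrr normr0 !mul0r.
have K0 : 0 <= K by apply: le_trans xK.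
rewrite subrXX normrM [_%:R * _]mulrC -mulrA ler_wpM2l//=.
apply: le_trans (ler_norm_sum _ _ _) _.
rewrite -[n.+1 in X in _ <= X]card_ord -mulr_natl.
apply: le_trans (ler_sum _ (G := fun _ => K ^+ n) _) _; last first.
 by rewrite sumr_const mulr1 mulr_natl.
move=> i _; rewrite normrM !normrX.
apply: le_trans (ler_pM _ _ (lerXn2r _ _ _ xK) (lerXn2r _ _ _ yK)) _;
 rewrite ?nnegrE ?exprn_ge0//.
by rewrite -exprD subnK// -ltnS.
Qed.

Lemma taylorX n x y : 0 <= x <= 1 -> 0 <= y <= 1 ->
 `|y ^+ n.+1 - x ^+ n.+1 - n.+1%:R * x ^+ n * (y - x)| <= (n.+1 ^ 2)%:R * (y - x) ^+ 2.
move=> /andP[x0 x1] /andP[y0 y1]; elim: n => [|n IH].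
 by rewrite !expr1 expr0 !mul1r subrr normr0 sqr_ge0.
have -> : y ^+ n.+2 - x ^+ n.+2 - n.+2%:R * x ^+ n.+1 * (y - x) =
 (y ^+ n.+1 - x ^+ n.+1 - n.+1%:R * x ^+ n * (y - x)) * x +
 (y ^+ n.+1 - x ^+ n.+1) * (y - x).
 by rewrite -(@natr1 R n.+1) !exprS; ring.
apply: normD_le; rewrite !normrM (ger0_norm x0).
have h1 : `|y ^+ n.+1 - x ^+ n.+1 - n.+1%:R * x ^+ n * (y - x)| * x <=
 (n.+1 ^ 2)%:R * (y - x) ^+ 2.
 by apply: le_trans IH; rewrite ler_piMr.
have h2 : `|y ^+ n.+1 - x ^+ n.+1| <= n.+1%:R * `|y - x|.
 have := @normr_subXX n.+1 y x 1; rewrite expr1n mulr1; apply.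
 by rewrite ger0_norm.
 by rewrite ger0_norm.
have h3 : `|y ^+ n.+1 - x ^+ n.+1| * `|y - x| <= n.+1%:R * (y - x) ^+ 2.
 by rewrite -[(y - x) ^+ 2]real_normK ?num_real// expr2 mulrA ler_wpM2r.
apply: le_trans (lerD h1 h3) _; rewrite -mulrDl ler_wpM2r ?sqr_ge0//.
by rewrite -natrD ler_nat; nia.
Qed.

End RealEstimates.

Lemma bin_leq_exp2 n m : ('C(n, m) <= 2 ^ n)%N.
by elim: n m => [|n IH] [|m]; rewrite ?bin0 ?expn_gt0// binS expnS mul2n -addnn leq_add.
Qed.

Section Bounds.
Context {R : realType} {r : nat} {e : bool}.
Local Notation Q := (filiprod R r e).
Local Notation row := ('rV[R]_(3 + r)).
Implicit Types (x y z : Q) (B b c K N : R).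

Definition bnd B (x : row) := forall i, `|x 0 i| <= B.

Lemma bndP B (x : row) : bnd B x <-> [/\ `|cA x| <= B, `|cU x| <= B, `|cV x| <= B &
 forall k, `|cP x 0 k| <= B].
split=> [h|[ha hu hv hp]]; first by split=> [|||k]; rewrite ?mxE; apply: h.
by apply: colP => // k; have := hp k; rewrite mxE.
Qed.

Lemma bnd_ge0 B (x : row) : bnd B x -> 0 <= B.
by move=> /(_ (lshift r 0)); apply: le_trans. Qed.
Lemma bndW B B' (x : row) : B <= B' -> bnd B x -> bnd B' x.
by move=> BB' h i; apply: le_trans BB'. Qed.
Lemma bnd0 B : 0 <= B -> bnd B (0 : row).
by move=> B0 i; rewrite mxE normr0. Qed.
(** Bound for the effect of a Pascal matrix of parameter at most B: r terms, each a binomial below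
    2^r times a power of B. *)
Definition pbd B : R := r%:R * 2 ^+ r * (1 + B) ^+ r.
Lemma pbd_ge0 B : 0 <= B -> 0 <= pbd B.
by move=> B0; rewrite /pbd !mulr_ge0 ?exprn_ge0 ?addr_ge0. Qed.

(* The entry k of a Pascal translate of q is homogeneous of weight k. *)
Lemma pascal_bound B c N a (q : 'I_r -> R) (k : 'I_r) :
 0 <= B -> 0 <= c -> 1 <= N -> `|a| <= B * N ->
 (forall j : 'I_r, (j <= k)%N -> `|q j| <= c * N ^+ j) ->
 `|\sum_(j < r) q j * ('C(k, j)%:R * a ^+ (k - j))| <= pbd B * c * N ^+ k.
move=> B0 c0 N1 aN qN; apply: le_trans (ler_norm_sum _ _ _) _.
have N0 : 0 <= N by apply: le_trans N1.
have B1 : 1 <= 1 + B by rewrite lerDl.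
apply: le_trans (ler_sum _ (G := fun _ => 2 ^+ r * (1 + B) ^+ r * c * N ^+ k) _) _;
 last by rewrite sumr_const card_ord -[leLHS]mulr_natl /pbd -!mulrA.
move=> j _; have [jk|kj] := leqP j k; last first.
 rewrite bin_small// mul0r mulr0 normr0.
 by rewrite !mulr_ge0 ?exprn_ge0// addr_ge0.
rewrite !normrM normr_nat normrX mulrC -[leLHS]mulrA.
have -> : 2 ^+ r * (1 + B) ^+ r * c * N ^+ k =
 2 ^+ r * (((1 + B) ^+ r * N ^+ (k - j)) * (c * N ^+ j)).
 by rewrite -{1}(subnK jk) exprD; ring.
apply: ler_pM; rewrite ?mulr_ge0 ?exprn_ge0 ?normr_ge0//.
 rewrite -natrX ler_nat; apply: leq_trans (leq_pexp2l _ (ltnW (ltn_ord k))) => //.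
 exact: bin_leq_exp2.
apply: ler_pM; rewrite ?mulr_ge0 ?exprn_ge0 ?normr_ge0 ?qN//.
apply: le_trans (lerXn2r _ _ _ aN) _; rewrite ?nnegrE ?mulr_ge0//.
rewrite exprMn ler_wpM2r ?exprn_ge0//.
apply: (@le_trans _ _ ((1 + B) ^+ (k - j))); last first.
 by rewrite ler_weXn2l// (leq_trans (leq_subr _ _))// ltnW.
by rewrite lerXn2r ?nnegrE ?addr_ge0// lerDr.
Qed.

Lemma pascal_bound1 B c a (q : 'I_r -> R) (k : 'I_r) :
 0 <= B -> 0 <= c -> `|a| <= B -> (forall j : 'I_r, `|q j| <= c) ->
 `|\sum_(j < r) q j * ('C(k, j)%:R * a ^+ (k - j))| <= pbd B * c.
move=> B0 c0 aB qc; rewrite -[pbd B * c]mulr1 -[X in _ * X](expr1n _ k).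
by apply: pascal_bound => // [|j _]; rewrite ?mulr1// expr1n mulr1.
Qed.

Lemma e1 : `|e%:R : R| <= 1. by rewrite normr_nat; case: e. Qed.
(** One modulus that serves products and inverses alike, so that symmetry and transitivity of
    [near_by] lose the same constant. *)
Definition bmul B : R := 2 * B + pbd B * B + B * B.

Lemma bmul_ge B : 0 <= B -> B <= bmul B.
move=> B0; have p0 := pbd_ge0 B0; rewrite /bmul mulrDl mul1r -!addrA lerDl.
by nneg.
Qed.

Lemma bnd_mul B x y : bnd B x -> bnd B y -> bnd (bmul B) (x * y)%g.
move=> bx by_; have B0 := bnd_ge0 bx; have p0 := pbd_ge0 B0.
move: bx by_ => /bndP[ax ux vx px] /bndP[ay uy vy py].
have d (s t : R) : `|s| <= B -> `|t| <= B -> `|s + t| <= bmul B.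
 move=> hs ht; apply: normD_le; apply: le_trans (lerD hs ht) _.
 by rewrite /bmul mulrDl mul1r -addrA lerDl; nneg.
apply/bndP; split=> [|||k]; rewrite ?cA_mul ?cU_mul ?cV_mul; try exact: d.
rewrite cP_mul; apply: normD_le; rewrite /bmul lerD//.
 apply: normD_le; rewrite lerD//.
 by apply: le_trans (px k) _; rewrite mulrDl mul1r lerDl.
 exact: pascal_bound1.
case: ifP => _; last by rewrite normr0 mulr_ge0.
by rewrite !normrM -[B * B]mul1r -mulrA ler_pM ?mulr_ge0 ?ler_pM ?e1.
Qed.

Lemma bnd_inv B x : bnd B x -> bnd (bmul B) x^-1%g.
move=> bx; have B0 := bnd_ge0 bx; have p0 := pbd_ge0 B0.
move: bx => /bndP[ax ux vx px]; have BB := bmul_ge B0.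
have E : x^-1%g = (x^-1 * 1)%g by rewrite mulg1.
have o (k : 'I_(3 + r)) : (1%g : Q) 0 k = 0 :> R by rewrite oneE mxE.
rewrite E; apply/bndP; split=> [|||k]; rewrite ?cA_div ?cU_div ?cV_div.
- by rewrite /cA o sub0r normrN; apply: le_trans ax _.
- by rewrite /cU o sub0r normrN; apply: le_trans ux _.
- by rewrite /cV o sub0r normrN; apply: le_trans vx _.
rewrite cP_div; apply: normB_le.
rewrite /bmul lerD//; last first.
 case: ifP => _; last by rewrite normr0 mulr_ge0.
 rewrite /cV o sub0r !normrM normrN -[B * B]mul1r -mulrA.
 by rewrite ler_pM ?mulr_ge0 ?ler_pM ?e1.
apply: ler_wpDl; first by rewrite mulr_ge0.
apply: pascal_bound1; rewrite ?normrN// => j.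
by rewrite {1}/cP mxE o sub0r normrN.
Qed.

(** The left-invariant adjacency in which all discrete homotopies are expressed. It is symmetric and
    transitive only up to [bmul]. *)
Definition near_by B x y := bnd B (x^-1 * y)%g.
Lemma near_refl B x : 0 <= B -> near_by B x x.
by move=> B0; rewrite /near_by mulVg; apply: bnd0. Qed.
Lemma nearW B B' x y : B <= B' -> near_by B x y -> near_by B' x y.
exact: bndW. Qed.
Lemma near_sym B x y : near_by B x y -> near_by (bmul B) y x.
by move=> /bnd_inv; rewrite /near_by invgM invgK. Qed.
Lemma near_trans B x y z : near_by B x y -> near_by B y z -> near_by (bmul B) x z.
by move=> h1 h2; have := bnd_mul h1 h2; rewrite /near_by -!mulgA mulVKg. Qed.
Lemma near_mull B x y z : near_by B (z * x)%g (z * y)%g <-> near_by B x y.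
by rewrite /near_by invgM -mulgA mulKg. Qed.

Definition wsize B N (x : row) := [/\ `|cA x| <= B * N, `|cU x| <= B * N,
 `|cV x| <= B * N & forall k, `|cP x 0 k| <= B * N ^+ k.+1].

(** A bounded step from a point of size N changes p_k by one power of N less than the size N^(k+1)
    of p_k itself. The cocycle contributes O(N) to the last index r - 1, which is acceptable because
    r > 1. *)
Lemma step_bound b B N x y : (1 < r)%N -> 0 <= b -> 0 <= B -> 1 <= N ->
 `|cA x| <= B * N -> `|cU x| <= B * N -> near_by b x y ->
 forall k, `|cP y 0 k - cP x 0 k| <= (pbd B * b + B * b) * N ^+ k.
move=> r2 b0 B0 N1 ax ux h k.
have N0 : 0 <= N by apply: le_trans N1.
have -> : y = (x * (x^-1 * y))%g by rewrite mulVKg.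
rewrite cP_mul; set h' := (x^-1 * y)%g.
have [_ _ hv hp] := (bndP _ _).1 h.
have -> (s t w : R) : s + t + w - s = t + w by ring.
rewrite mulrDl; apply: normD_le.
rewrite lerD//.
 apply: pascal_bound => // j _; apply: le_trans (hp j) _.
 by rewrite ler_peMr// exprn_ege1.
case: eqP => kr; last by rewrite normr0 !mulr_ge0 ?exprn_ge0.
rewrite !normrM -[B * b * _]mul1r -mulrA ler_pM ?mulr_ge0 ?e1//.
rewrite -mulrA [b * _]mulrC mulrA; apply: ler_pM => //.
apply: le_trans ux _; rewrite ler_wpM2l//.
by apply: ler_eXnr => //; move: r2 kr; lia.
Qed.

Definition wconst b : R := b + (pbd b * b + b * b).
Lemma wconst_ge0 b : 0 <= b -> 0 <= wconst b.
by move=> b0; have := pbd_ge0 b0; rewrite /wconst => ?; nneg. Qed.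

(** Summing [step_bound] over at most N steps gives the homogeneous sizes: N for a, u, v and N^(k+1)
    for p_k. *)
Lemma path_wsize b n (N : R) (f : nat -> Q) : (1 < r)%N -> 0 <= b -> 1 <= N ->
 n%:R <= N -> f 0%N = 1%g -> (forall i, (i < n)%N -> near_by b (f i) (f i.+1)) ->
 forall i, (i <= n)%N -> wsize (wconst b) N (f i).
move=> r2 b0 N1 nN f0 hf i i_n; have c0 := wconst_ge0 b0.
have N0 : 0 <= N by apply: le_trans N1.
have K0 : 0 <= pbd b * b + b * b by have := pbd_ge0 b0 => ?; nneg.
have o (k : 'I_(3 + r)) : (1%g : Q) 0 k = 0 :> R by rewrite oneE mxE.
have lin j : (j <= n)%N -> [/\ `|cA (f j)| <= b * j%:R, `|cU (f j)| <= b * j%:R &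
 `|cV (f j)| <= b * j%:R].
 elim: j => [|j IH] jn; first by rewrite f0 /cA /cU /cV !o normr0 mulr0.
 have [ha hu hv _] := (bndP _ _).1 (hf _ jn); have [ja ju jv] := IH (ltnW jn).
 rewrite cA_div cU_div cV_div in ha hu hv.
 have d (s t : R) : `|t - s| <= b -> `|s| <= b * j%:R -> `|t| <= b * j.+1%:R.
 move=> h1 h2; rewrite -[t](subrK s) -natr1 mulrDr mulr1 addrC.
 exact: le_trans (ler_normD _ _) (lerD _ _).
 by split; [exact: d ha ja|exact: d hu ju|exact: d hv jv].
have jN j : (j <= n)%N -> b * j%:R <= b * N.
 by move=> jn; rewrite ler_wpM2l//; apply: le_trans nN; rewrite ler_nat.
have bw : b <= wconst b by rewrite /wconst lerDl.
have bN : b * N <= wconst b * N by rewrite ler_wpM2r.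
have pj j (k : 'I_r) : (j <= n)%N ->
 `|cP (f j) 0 k| <= j%:R * ((pbd b * b + b * b) * N ^+ k).
 elim: j => [|j IH] jn; first by rewrite f0 /cP mxE o normr0 mul0r.
 have [ja ju _] := lin _ (ltnW jn).
 have := step_bound r2 b0 b0 N1 (le_trans ja (jN _ (ltnW jn)))
 (le_trans ju (jN _ (ltnW jn))) (hf _ jn) k.
 set K := (pbd b * b + b * b) * N ^+ k in IH *; rewrite -[j.+1%:R]natr1.
 rewrite mulrDl mul1r [_ + K]addrC => h1.
 rewrite -[cP (f j.+1) 0 k](subrK (cP (f j) 0 k)).
 exact: le_trans (ler_normD _ _) (lerD h1 (IH (ltnW jn))).
have [ja ju jv] := lin _ i_n; have bi := le_trans (jN _ i_n) bN.
split=> [|||k]; try exact: le_trans bi.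
apply: le_trans (pj _ _ i_n) _; rewrite mulrCA exprS.
apply: ler_pM; rewrite ?mulr_ge0 ?exprn_ge0//; first by rewrite /wconst lerDr.
by rewrite ler_wpM2r ?exprn_ge0// (le_trans _ nN)// ler_nat.
Qed.

End Bounds.

(** * The commuting factors L and K, and short paths to central elements *)

Section LK.
Context {R : realType} {r : nat} {e : bool} (r2 : (1 < r)%N).
Local Notation Q := (filiprod R r e).
Local Notation row := ('rV[R]_(3 + r)).
Implicit Types (x y z : Q) (B b c K N : R).

(** The factors commute and meet in the line of the last coordinate; a product of an element of each
    is the sum of the two rows. *)
Definition inL (x : row) := cU x = 0 /\ cV x = 0.
Definition inK (x : row) := cA x = 0 /\ forall k : 'I_r, k.+1 != r -> cP x 0 k = 0.

Lemma coord1 : [/\ cA (1%g : Q) = 0 :> R, cU (1%g : Q) = 0 :> R, cV (1%g : Q) = 0 :> R &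
 forall k, cP (1%g : Q) 0 k = 0 :> R].
by split=> [|||k]; rewrite oneE /cA /cU /cV /cP !mxE. Qed.

Lemma pascal_sum0 (q : 'I_r -> R) (k : 'I_r) :
 \sum_(j < r) q j * ('C(k, j)%:R * 0 ^+ (k - j)) = q k.
rewrite (bigD1 k)//= binn subnn expr0 !mulr1 big1 ?addr0// => j jk.
have [kj|jk'|kj] := ltngtP k j.
- by rewrite bin_small// mul0r mulr0.
- by rewrite expr0n subn_eq0 leqNgt jk' !mulr0.
- by case/eqP: jk; apply/val_inj.
Qed.

Lemma pascal_sum_top a (q : 'I_r -> R) (k : 'I_r) :
 (forall j : 'I_r, j.+1 != r -> q j = 0) ->
 \sum_(j < r) q j * ('C(k, j)%:R * a ^+ (k - j)) = q k.
move=> q0; rewrite (bigD1 k)//= binn subnn expr0 !mulr1 big1 ?addr0// => j jk.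
have [jr|jr] := eqVneq j.+1 r; last by rewrite q0// mul0r.
rewrite bin_small ?mul0r ?mulr0//.
have : (k : nat) <> j by move=> h; case/eqP: jk; apply/val_inj.
have := ltn_ord k; rewrite -[X in (_ < X)%N]jr; lia.
Qed.

Lemma LK_mul x y : inL x -> inK y -> (x * y)%g = (x : row) + (y : row) :> row.
move=> [u v] [a p]; apply: (@filiprodP _ _ e) => [|||k].
- by rewrite cA_mul cAD.
- by rewrite cU_mul cUD.
- by rewrite cV_mul cVD.
rewrite cP_mul pascal_sum_top// u mulr0 mul0r if_same addr0.
by rewrite cPD [RHS]mxE.
Qed.

Lemma KL_mul x y : inL x -> inK y -> (y * x)%g = (x : row) + (y : row) :> row.
move=> [u v] [a p]; apply: (@filiprodP _ _ e) => [|||k].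
- by rewrite cA_mul cAD addrC.
- by rewrite cU_mul cUD addrC.
- by rewrite cV_mul cVD addrC.
rewrite cP_mul a pascal_sum0 v mulr0 if_same addr0 addrC.
by rewrite cPD [RHS]mxE.
Qed.

Lemma LK_comm x y : inL x -> inK y -> (x * y = y * x)%g.
by move=> xL yK; rewrite [LHS]LK_mul// [RHS]KL_mul. Qed.
Lemma inL_div x y : inL x -> inL y -> inL (x^-1 * y)%g.
by move=> [u v] [u' v']; split; rewrite ?cU_div ?cV_div ?u ?v ?u' ?v' subrr. Qed.

Lemma inK_div x y : inK x -> inK y -> inK (x^-1 * y)%g.
move=> [a p] [a' p']; split=> [|k kr]; first by rewrite cA_div a a' subrr.
rewrite cP_div a oppr0 pascal_sum0 p// p'// (negPf kr).
by rewrite !subrr.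
Qed.

Lemma inL1 : inL (1%g : Q). by have [_ u v _] := coord1; split. Qed.
Lemma inK1 : inK (1%g : Q).
by have [a _ _ p] := coord1; split=> // k _; apply: p. Qed.
Lemma inL_mul x y : inL x -> inL y -> inL (x * y)%g.
by move=> [u v] [u' v']; split; rewrite ?cU_mul ?cV_mul ?u ?v ?u' ?v' addr0. Qed.

(** As the factors commute, the quotient of two products is the product of the quotients in L and in
    K. *)
Lemma near_LK B x x' y y' : inL x -> inL x' -> inK y -> inK y' ->
 near_by B x x' -> near_by B y y' -> near_by (bmul (r := r) B) (x * y)%g (x' * y')%g.
move=> xL xL' yK yK' hx hy; rewrite /near_by invgM.
have zL := inL_div xL xL'; have yVK := inK_div yK inK1; rewrite mulg1 in yVK.
rewrite -mulgA (mulgA (x^-1)%g x' y') (mulgA (y^-1)%g) -(LK_comm zL yVK) -mulgA.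
exact: (bnd_mul hx hy).
Qed.

Definition etop : 'rV[R]_r := \row_j (j.+1 == r)%:R.
Definition zt (A : R) : Q := mk 0 0 0 (A *: etop).

Lemma ztL A : inL (zt A). by split; rewrite ?cUmk ?cVmk. Qed.
(** Stated for indices that differ by at most one either way, since the deformations below stall
    along a path or run through it backwards. *)
Definition lip B n (f : nat -> Q) := forall i j, (i <= n)%N -> (j <= n)%N ->
 (i <= j.+1)%N -> (j <= i.+1)%N -> near_by B (f i) (f j).

Lemma lip_of b n f : 0 <= b -> (forall i, (i < n)%N -> near_by b (f i) (f i.+1)) ->
 lip (bmul (r := r) b) n f.
move=> b0 h i j i_n jn ij ji; have bb := bmul_ge (r := r) b0.
have [ij'|ij'|E] := ltngtP i j; last first.
- by rewrite E; apply: near_refl; apply: le_trans bb.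
- have -> : i = j.+1 by lia.
 by apply: near_sym; apply: h; lia.
have -> : j = i.+1 by lia.
by apply: nearW bb _; apply: h; lia.
Qed.

Section Reach.
Variable D : set Q.
(** [D] confines the path: to L when loops are split, to the whole group when the metrics are
    compared. *)
Definition reach B n x y := exists f : nat -> Q, [/\ f 0%N = x, f n = y,
 forall i, D (f i) & forall i, (i < n)%N -> near_by B (f i) (f i.+1)].

Lemma reach_trans B n m x y z : reach B n x y -> reach B m y z -> reach B (n + m) x z.
move=> [f [f0 fn fD hf]] [g [g0 gn gD hg]].
exists (fun i => if (i <= n)%N then f i else g (i - n)%N); split=> //.
- case: ifP => [|_]; last by rewrite addnC addnK.
 by rewrite -[leqRHS]addn0 leq_add2l leqn0 => /eqP m0; rewrite m0 addn0 fn -g0 -{1}m0.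
- by move=> i; case: ifP.
move=> i inm; case: (ltngtP i n) => h.
- exact: hf.
- rewrite subSn; last exact: ltnW.
 by apply: hg; lia.
- by rewrite h fn -g0 subSn// subnn; apply: hg; lia.
Qed.

Lemma reach_param B n x (h : R -> Q) b : (0 < n)%N -> 0 <= B ->
 h 0 = 1%g -> (forall s t, (h s)^-1 * h t = h (t - s))%g ->
 (forall s, `|s| <= B -> bnd B (h s)) -> (forall s, D (x * h s)%g) ->
 `|b| <= B * n%:R -> reach B n x (x * h b)%g.
move=> n0 B0 h0 hh hb hD bn; have n0' : n%:R != 0 :> R by rewrite pnatr_eq0 -lt0n.
exists (fun i => x * h (b * i%:R / n%:R)%R)%g; split=> //.
- by rewrite mulr0 mul0r h0 mulg1.
- by rewrite mulfK.
move=> i _; rewrite near_mull /near_by hh; apply: hb.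
rewrite -mulrBl -mulrBr -natrB// subSnn mulr1 normrM normfV normr_nat.
by rewrite ler_pdivrMr ?ltr0n.
Qed.

End Reach.

(* The second difference Y, X, -2Y, X, Y, -2X of a translate of y_(r-3) is central. *)
Lemma reach_zt (D : set Q) n A : (2 < r)%N -> (0 < n)%N ->
 (forall x, inL x -> D x) -> `|A| <= n%:R ^+ 3 -> reach D 1 (8 * n) 1%g (zt A).
move=> r3 n0 LD An.
have kr : (r - 3 < r)%N by lia.
pose X s : Q := mk s 0 0 0.
pose Y s : Q := mk 0 0 0 (s *: delta_mx 0 (Ordinal kr)).
have XL s : inL (X s) by split; rewrite ?cUmk ?cVmk.
have YL s : inL (Y s) by split; rewrite ?cUmk ?cVmk.
have X0 : X 0 = 1%g.
 by have [a u v p] := coord1; apply: filiprodP => [|||k];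
 rewrite ?a ?u ?v ?p ?cAmk ?cUmk ?cVmk ?cPmk ?mxE.
have Y0 : Y 0 = 1%g.
 by have [a u v p] := coord1; apply: filiprodP => [|||k];
 rewrite ?a ?u ?v ?p ?cAmk ?cUmk ?cVmk ?cPmk ?scale0r ?mxE.
have XX s t : ((X s)^-1 * X t)%g = X (t - s).
 apply: filiprodP => [|||k]; rewrite ?cA_div ?cU_div ?cV_div ?cP_div
 ?(cAmk, cUmk, cVmk, cPmk) ?subrr// mulr0 if_same subr0 big1 ?mxE// => j _.
 by rewrite subrr mul0r.
have YY s t : ((Y s)^-1 * Y t)%g = Y (t - s).
 apply: filiprodP => [|||k]; rewrite ?cA_div ?cU_div ?cV_div ?cP_div
 ?(cAmk, cUmk, cVmk, cPmk) ?subrr// mulr0 if_same subr0 oppr0 pascal_sum0.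
 by rewrite !mxE mulrBl.
have Xb s : `|s| <= 1 -> bnd 1 (X s).
 by move=> s1; apply/bndP; split=> [|||k]; rewrite ?(cAmk, cUmk, cVmk, cPmk) ?mxE ?normr0.
have Yb s : `|s| <= 1 -> bnd 1 (Y s).
 move=> s1; apply/bndP; split=> [|||k]; rewrite ?(cAmk, cUmk, cVmk, cPmk) ?normr0//.
 by rewrite !mxE eqxx/=; case: eqP; rewrite ?mulr1 ?mulr0 ?normr0.
have nn : 0 < n%:R :> R by rewrite ltr0n.
(* The combination of a^m over a = 0, n, 2n with weights 1, -2, 1 is 0, 0, 2 n^2 for m = 0, 1, 2.
   The last coordinate of the word is therefore c q n^2 with q = 2 C(r - 1, 2), and |A| <= n^3 gives
   |c| <= n. *)
pose q : R := (r - 1)%:R * (r - 2)%:R.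
have q1 : 1 <= q by rewrite /q -natrM ler1n; nia.
have qgt : 0 < q by exact: lt_le_trans q1.
have q0 : q != 0 by rewrite gt_eqF// (lt_le_trans _ q1).
pose c := A / (q * n%:R ^+ 2).
have cn : `|c| <= n%:R.
 rewrite /c normrM normfV (ger0_norm (x := q * _)); last first.
 by rewrite mulr_ge0 ?exprn_ge0// (le_trans _ q1).
 rewrite ler_pdivrMr; last exact: mulr_gt0 qgt (exprn_gt0 _ nn).
 by apply: le_trans An _; rewrite exprS ler_wpM2l// ler_peMl// exprn_ge0.
pose w := (Y c * X n%:R * Y (- (2 * c)) * X n%:R * Y c * X (- (2 * n%:R)))%g.
have wE : zt A = w.
 have P0 (x : Q) t k : cP (x * X t)%g 0 k = cP x 0 k.
 by rewrite cP_mul cPmk cVmk mulr0 if_same addr0 big1 ?addr0// => j _;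
 rewrite mxE mul0r.
 have PY (x : Q) t (k : 'I_r) : cP (x * Y t)%g 0 k =
 cP x 0 k + t * ('C(k, r - 3)%:R * cA x ^+ (k - (r - 3))).
 rewrite cP_mul cPmk cVmk mulr0 if_same addr0; congr (_ + _).
 rewrite (bigD1 (Ordinal kr))//= big1 => [|j /negPf jn].
 by rewrite addr0 !mxE !eqxx mulr1.
 by rewrite !mxE jn andbF mulr0 mul0r.
 have PY1 t (k : 'I_r) : cP (Y t) 0 k = t * ((k : nat) == (r - 3)%N)%:R.
 by rewrite cPmk !mxE eqxx.
 have AX s : cA (X s) = s by rewrite cAmk.
 have AY s : cA (Y s) = 0 by rewrite cAmk.
 have Pz (k : 'I_r) : cP (zt A) 0 k = A * (k.+1 == r)%:R by rewrite cPmk !mxE.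
 rewrite /w; apply: filiprodP => [|||k].
 - by rewrite [LHS]cAmk !cA_mul !AX !AY; ring.
 - by rewrite (ztL A).1 !cU_mul !(XL _).1 !(YL _).1 !addr0.
 - by rewrite (ztL A).2 !cV_mul !(XL _).2 !(YL _).2 !addr0.
 rewrite Pz !P0 !PY !P0 !PY !P0 PY1 !cA_mul !AX !AY.
 have /orP[/orP[k3|/eqP k3]|/orP[/eqP k3|/eqP k3]] :
 (k < r - 3)%N || ((k : nat) == r - 3)%N || (((k : nat) == r - 2)%N || ((k : nat) == r - 1)%N).
 by have := ltn_ord k; lia.
 - have -> : (k.+1 == r) = false by apply/negbTE; lia.
 have -> : ((k : nat) == (r - 3)%N) = false by apply/negbTE; lia.
 by rewrite bin_small//=; ring.
 - have -> : (k.+1 == r) = false by apply/negbTE; lia.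
 by rewrite k3 eqxx subnn binn !expr0 /=; ring.
 - have -> : (k - (r - 3) = 1)%N by lia.
 have -> : (k.+1 == r) = false by apply/negbTE; lia.
 have -> : ((k : nat) == (r - 3)%N) = false by apply/negbTE; lia.
 by rewrite !expr1 /=; ring.
 have -> : (k - (r - 3) = 2)%N by lia.
 have -> : ((k : nat) == (r - 3)%N) = false by apply/negbTE; lia.
 have -> : (k.+1 == r) = true by apply/eqP; lia.
 have -> : 'C(k, r - 3)%:R = q / 2 :> R.
 have : ('C(k, r - 3) * 2 = (r - 1) * (r - 2))%N.
 have E : (r - 3 = k - 2)%N by lia.
 rewrite E bin_sub; last by lia.
 have -> : (r - 1 = k)%N by lia.
 have -> : (r - 2 = k.-1)%N by lia.
 by have := bin_ffact k 2; rewrite ffactnS ffactn1.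
 move=> /(congr1 (fun n => n%:R : R)); rewrite !natrM -/q => <-.
 by rewrite mulfK// pnatr_eq0.
 rewrite /= /c; field.
 by rewrite q0 gt_eqF.
have -> : (8 * n = n + n + 2 * n + n + n + 2 * n)%N by lia.
rewrite wE /w; have n2 : (0 < 2 * n)%N by lia.
have o := inL1.
apply: (reach_trans (y := (Y c * X n%:R * Y (- (2 * c)) * X n%:R * Y c)%g)); last first.
 apply: (reach_param (h := X)); rewrite ?ler01//.
 by move=> s; apply: LD; repeat first [exact: o|exact: XL|exact: YL|apply: inL_mul].
 by rewrite mul1r normrN normrM !normr_nat natrM.
apply: (reach_trans (y := (Y c * X n%:R * Y (- (2 * c)) * X n%:R)%g)); last first.
 apply: (reach_param (h := Y)); rewrite ?ler01 ?mul1r//.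
 by move=> s; apply: LD; repeat first [exact: o|exact: XL|exact: YL|apply: inL_mul].
apply: (reach_trans (y := (Y c * X n%:R * Y (- (2 * c)))%g)); last first.
 apply: (reach_param (h := X)); rewrite ?ler01 ?mul1r ?normr_nat//.
 by move=> s; apply: LD; repeat first [exact: o|exact: XL|exact: YL|apply: inL_mul].
apply: (reach_trans (y := (Y c * X n%:R)%g)); last first.
 apply: (reach_param (h := Y)); rewrite ?ler01//.
 by move=> s; apply: LD; repeat first [exact: o|exact: XL|exact: YL|apply: inL_mul].
 by rewrite mul1r normrN normrM normr_nat natrM ler_wpM2l.
apply: (reach_trans (y := (Y c)%g)); last first.
 apply: (reach_param (h := X)); rewrite ?ler01 ?mul1r ?normr_nat//.
 by move=> s; apply: LD; repeat first [exact: o|exact: XL|exact: YL|apply: inL_mul].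
rewrite -[Y c]mul1g.
apply: (reach_param (h := Y)); rewrite ?ler01 ?mul1r//.
by move=> s; apply: LD; repeat first [exact: o|exact: XL|exact: YL|apply: inL_mul].
Qed.

End LK.

(** * Grids of points and dilations *)

Section Homotopies.
Context {R : realType} {r : nat} {e : bool}.
Local Notation Q := (filiprod R r e).
Implicit Types (B : R) (M T : nat) (g : nat -> Q).

Definition loop_by B M g := (forall i, (i < M)%N -> near_by B (g i) (g i.+1)) /\ g 0%N = g M.

(* Closed sequences of length M deformed into each other through T rows. *)
Definition grid B M T g g' := exists G : nat -> nat -> Q,
 [/\ forall t, (t <= T)%N -> loop_by B M (G t),
 forall t i, (t < T)%N -> (i <= M)%N -> near_by B (G t i) (G t.+1 i),
 forall i, (i <= M)%N -> G 0%N i = g i & forall i, (i <= M)%N -> G T i = g' i].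

Lemma loop_ext B M g g' : (forall i, (i <= M)%N -> g i = g' i) ->
 loop_by B M g -> loop_by B M g'.
move=> E [h c]; split=> [i iM|]; last by rewrite -!E.
by rewrite -!E//; [apply: h|apply: ltnW].
Qed.

Lemma gridW B B' M T g g' : B <= B' -> grid B M T g g' -> grid B' M T g g'.
move=> BB [G [h v G0 GT]]; exists G; split=> // [t tT|t i tT iM].
 by have [h1 h2] := h t tT; split=> // i iM; apply: nearW BB _; apply: h1.
by apply: nearW BB _; apply: v.
Qed.

Lemma grid_trans B M T T' g1 g2 g3 : grid B M T g1 g2 -> grid B M T' g2 g3 ->
 grid B M (T + T') g1 g3.
move=> [G [h v G0 GT]] [H [h' v' H0 HT]].
exists (fun t => if (t <= T)%N then G t else H (t - T)%N); split.
- by move=> t tT; case: leqP => tT'; [apply: h|apply: h'; nlia].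
- move=> t i tT iM; case: (ltngtP t T) => tT'.
 + exact: v.
 + by rewrite subSn; [apply: v'; nlia|nlia].
 by rewrite tT' GT// -H0// subSn// subnn; apply: v' => //; nlia.
- by move=> i iM; rewrite leq0n G0.
move=> i iM; case: leqP => [|_]; last by rewrite addKn HT.
rewrite -[leqRHS]addn0 leq_add2l leqn0 => /eqP T0.
by rewrite T0 addn0 GT// -HT// T0 H0.
Qed.

Lemma grid_sym B M T g1 g2 : 0 <= B -> grid B M T g1 g2 ->
 grid (bmul (r := r) B) M T g2 g1.
move=> B0 [G [h v G0 GT]]; have BB := bmul_ge (r := r) B0.
exists (fun t => G (T - t)%N); split.
- move=> t tT; have [h1 h2] := h (T - t)%N (leq_subr _ _).
 by split=> // i iM; apply: nearW BB _; apply: h1.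
- move=> t i tT iM; have -> : (T - t = (T - t.+1).+1)%N by nlia.
 by apply: near_sym; apply: v => //; nlia.
- by move=> i iM; rewrite subn0 GT.
by move=> i iM; rewrite subnn G0.
Qed.

End Homotopies.

Section Dilation.
Context {R : realType} {r : nat} {e : bool}.
Local Notation Q := (filiprod R r e).
Implicit Types (x y : Q) (s t : R).

(* An automorphism of weights 2 on a, 2(k+1) on p_k and r on u and v. *)
Definition dil s x : Q := mk (s ^+ 2 * cA x) (s ^+ r * cU x) (s ^+ r * cV x)
 (\row_k (s ^+ (2 * k.+1) * cP x 0 k)).

Lemma cP_dil s x k : cP (dil s x) 0 k = s ^+ (2 * k.+1) * cP x 0 k.
by rewrite cPmk mxE. Qed.

Lemma cA_dil s x : cA (dil s x) = s ^+ 2 * cA x. exact: cAmk. Qed.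
Lemma cU_dil s x : cU (dil s x) = s ^+ r * cU x. exact: cUmk. Qed.
Lemma cV_dil s x : cV (dil s x) = s ^+ r * cV x. exact: cVmk. Qed.

Lemma normr_subXX1 n s t : 0 <= s <= 1 -> 0 <= t <= 1 ->
 `|t ^+ n - s ^+ n| <= n%:R * `|t - s|.
move=> /andP[s0 s1] /andP[t0 t1]; have := @normr_subXX R n t s 1.
by rewrite expr1n mulr1; apply; rewrite ger0_norm.
Qed.

(** The cocycle sends u v to the last coordinate. Doubling the natural weights of L gives that
    coordinate weight 2r, so that u and v can have the integer weight r. *)
Lemma dilM s x y : dil s (x * y)%g = (dil s x * dil s y)%g.
apply: filiprodP => [|||k]; rewrite ?cA_mul ?cU_mul ?cV_mul ?cP_mul ?(cAmk, cUmk, cVmk).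
- by rewrite cA_mul mulrDr.
- by rewrite cU_mul mulrDr.
- by rewrite cV_mul mulrDr.
rewrite !cP_dil cP_mul !mulrDr; congr (_ + _ + _).
 rewrite mulr_sumr; apply: eq_bigr => j _; rewrite cP_dil.
 have [jk|kj] := leqP j k; last by rewrite bin_small// !(mul0r, mulr0).
 have -> : (2 * k.+1 = 2 * j.+1 + 2 * (k - j))%N by nlia.
 by rewrite exprD exprMn -[(s ^+ 2) ^+ _]exprM; ring.
case: eqP => [kr|]; rewrite ?mulr0// kr.
by rewrite mul2n -addnn exprD; ring.
Qed.

Lemma dil0 x : (0 < r)%N -> dil 0 x = 1%g.
move=> r0; have [a u v p] := coord1 (R := R) (r := r) (e := e).
apply: filiprodP => [|||k]; rewrite ?a ?u ?v ?p ?(cAmk, cUmk, cVmk) ?cP_dil.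
all: by rewrite expr0n ?(gtn_eqF r0) ?mul0r.
Qed.

Lemma dil1 x : dil 1 x = x.
by apply: filiprodP => [|||k]; rewrite ?(cAmk, cUmk, cVmk) ?cP_dil expr1n mul1r.
Qed.

Lemma dil_1 s : dil s (1%g : Q) = 1%g.
by apply: (mulgI (dil s 1%g)); rewrite -dilM !mulg1. Qed.
Lemma dil_div s x y : ((dil s x)^-1 * dil s y)%g = dil s (x^-1 * y)%g.
by apply: (mulgI (dil s x)); rewrite -dilM !mulVKg. Qed.

Lemma dil_bnd B s x : 0 <= s <= 1 -> bnd B x -> bnd B (dil s x).
move=> /andP[s0 s1] /bndP[a u v p].
have h n (z : R) : `|z| <= B -> `|s ^+ n * z| <= B.
 move=> zB; rewrite normrM ger0_norm ?exprn_ge0//; apply: le_trans zB.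
 by rewrite ler_piMl// exprn_ile1.
by apply/bndP; split=> [|||k]; rewrite ?(cAmk, cUmk, cVmk) ?cP_dil; apply: h.
Qed.

Lemma dil_near B s x y : 0 <= s <= 1 -> near_by B x y -> near_by B (dil s x) (dil s y).
by move=> s01; rewrite /near_by dil_div; apply: dil_bnd. Qed.

(* A small change of the parameter moves by a bounded amount the points whose
 size is governed by n^2 rather than by n^3. *)
Definition msize C (n : R) (x : Q) := [/\ `|cA x| <= C * n ^+ 2, `|cU x| <= C * n ^+ 3,
 `|cV x| <= C * n ^+ 3 & forall k, `|cP x 0 k| <= C * n ^+ (2 * k.+1)].

(** The displacements are |t - s| times n^2, n^3 or n^(2(k+1)), and n^6 for the cocycle. All these
    exponents are at most 3(r - 1), because 2r <= 3(r - 1) and 6 <= 3(r - 1) exactly when r >= 3. *)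
Lemma dil_slow C : (2 < r)%N -> 0 <= C -> exists2 D, 0 <= D &
 forall n s t x, 1 <= n -> 0 <= s <= 1 -> 0 <= t <= 1 ->
 `|t - s| * n ^+ (3 * r.-1) <= 1 -> msize C n x ->
 near_by D (dil s x) (dil t x).
move=> r3 C0.
have r1 : 1 <= r%:R :> R by rewrite ler1n; nlia.
have P0 := pbd_ge0 (r := r) C0.
exists (2 * r%:R * C + pbd (r := r) C * (2 * r%:R * C) + r%:R * C * C).
 by nneg.
move=> n s t x n1 s01 t01 st [ax ux vx px].
have n0 : 0 <= n by apply: le_trans n1.
have d k (z : R) j : (k <= 2 * r)%N -> (j <= 3 * r.-1)%N -> `|z| <= C * n ^+ j ->
 `|t ^+ k * z - s ^+ k * z| <= 2 * r%:R * C.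
 move=> kr jr zC; rewrite -mulrBl normrM.
 have h : `|t ^+ k - s ^+ k| <= (2 * r)%:R * `|t - s|.
 by apply: le_trans (normr_subXX1 _ s01 t01) _; rewrite ler_wpM2r// ler_nat.
 apply: le_trans (ler_pM _ _ h zC) _; rewrite ?normr_ge0//.
 have -> : (2 * r)%:R * `|t - s| * (C * n ^+ j) =
 (2 * r%:R * C) * (`|t - s| * n ^+ j) by rewrite natrM; ring.
 rewrite ler_piMr//; first by nneg.
 by apply: le_trans st; rewrite ler_wpM2l// ler_weXn2l.
have dA : `|cA (dil s x)| <= C * n ^+ 2.
 rewrite cA_dil normrM ger0_norm ?exprn_ge0//; last by case/andP: s01.
 by apply: le_trans ax; rewrite ler_piMl// exprn_ile1//; case/andP: s01.
have hA : 2 * r%:R * C <= 2 * r%:R * C + pbd (r := r) C * (2 * r%:R * C) + r%:R * C * C.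
 by rewrite -addrA lerDl; nneg.
apply/bndP; split=> [|||k].
- rewrite cA_div !cA_dil; apply: le_trans hA.
 apply: (d 2%N (cA x) 2%N _ _ ax); nlia.
- rewrite cU_div !cU_dil; apply: le_trans hA.
 apply: (d r (cU x) 3%N _ _ ux); nlia.
- rewrite cV_div !cV_dil; apply: le_trans hA.
 apply: (d r (cV x) 3%N _ _ vx); nlia.
rewrite cP_div; apply: normB_le; rewrite lerD//.
 apply: ler_wpDl; first by nneg.
 pose q (j : 'I_r) := cP (dil t x) 0 j - cP (dil s x) 0 j.
 have [k3|k3] := leqP (2 * k.+1) (3 * r.-1); last by have := ltn_ord k; nlia.
 pose N := n ^+ 2.
 have N1 : 1 <= N by rewrite exprn_ege1.
 have hq (j : 'I_r) : (j <= k)%N ->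
 `|q j| <= (`|t - s| * (2 * r%:R * C) * N) * N ^+ j.
 move=> jk; rewrite /q !cP_dil -mulrBl normrM.
 have h : `|t ^+ (2 * j.+1) - s ^+ (2 * j.+1)| <= (2 * r)%:R * `|t - s|.
 apply: le_trans (normr_subXX1 _ s01 t01) _; rewrite ler_wpM2r// ler_nat.
 by have := ltn_ord j; nlia.
 apply: le_trans (ler_pM _ _ h (px j)) _; rewrite ?normr_ge0//.
 rewrite exprM -/N exprS natrM le_eqVlt; apply/orP; left; apply/eqP; ring.
 have := @pascal_bound R r C _ N (- cA (dil s x)) q k C0 _ N1 _ hq.
 rewrite normrN => h; apply: le_trans (h _ dA) _.
 by nneg.
 set PB := pbd C in P0 *.
 have -> : PB * (`|t - s| * (2 * r%:R * C) * N) * N ^+ k =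
 PB * (2 * r%:R * C) * (`|t - s| * n ^+ (2 * k.+1)).
 by rewrite exprM -/N exprS; ring.
 rewrite ler_piMr//; first by nneg.
 by apply: le_trans st; rewrite ler_wpM2l// ler_weXn2l.
case: eqP => [kr|_]; last by rewrite normr0; nneg.
rewrite !cU_dil !cV_dil -mulrBl !normrM.
have h : `|t ^+ r - s ^+ r| <= r%:R * `|t - s|.
 exact: normr_subXX1.
have h1 : `|s ^+ r| * `|cU x| <= C * n ^+ 3.
 case/andP: s01 => s0 s1.
 by apply: le_trans ux; rewrite ler_piMl// ger0_norm ?exprn_ge0// exprn_ile1.
have h2 : `|e%:R : R| * (`|s ^+ r| * `|cU x|) <= C * n ^+ 3.
 by apply: le_trans h1; rewrite ler_piMl ?mulr_ge0// e1.
apply: le_trans (ler_pM _ _ h2 (ler_pM _ _ h vx)) _; rewrite ?mulr_ge0//.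
have -> : C * n ^+ 3 * (r%:R * `|t - s| * (C * n ^+ 3)) =
 (r%:R * C * C) * (`|t - s| * n ^+ (3 * 2)) by rewrite exprM; ring.
rewrite -[leRHS]mulr1 ler_wpM2l//; first by nneg.
by apply: le_trans st; rewrite ler_wpM2l// ler_weXn2l//; nlia.
Qed.

End Dilation.

(** * The spiral: rotations in the plane (u, v) against dilations of L *)

Section Rotation.
Context {R : realType}.

(* Integer powers of the rotation with tangent of the half angle 1/N. *)
Definition rcos (N : R) := (1 - N^-1 ^+ 2) / (1 + N^-1 ^+ 2).
Definition rsin (N : R) := 2 * N^-1 / (1 + N^-1 ^+ 2).

Fixpoint rot (N : R) (t : nat) : R * R :=
 if t is u.+1 then
 (rcos N * (rot N u).1 - rsin N * (rot N u).2, rcos N * (rot N u).2 + rsin N * (rot N u).1)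
 else (1, 0).

Lemma rcs N : rcos N ^+ 2 + rsin N ^+ 2 = 1.
have h : 1 + N^-1 ^+ 2 != 0 by rewrite gt_eqF// ltr_pwDl// sqr_ge0.
by rewrite /rcos /rsin; move: N^-1 h => n h; field.
Qed.

Lemma rot_norm N t : (rot N t).1 ^+ 2 + (rot N t).2 ^+ 2 = 1.
elim: t => [|t IH] /=; first by rewrite expr1n expr0n addr0.
transitivity ((rcos N ^+ 2 + rsin N ^+ 2) * ((rot N t).1 ^+ 2 + (rot N t).2 ^+ 2)).
 by ring.
by rewrite rcs IH mulr1.
Qed.

(** Twice the area of the triangle swept in one step on the unit circle. It is the same at every
    step, so a rotation at fixed radius displaces the centre at a constant rate. *)
Lemma rot_cross N t :
 (rot N t).1 * (rot N t.+1).2 - (rot N t).2 * (rot N t.+1).1 = rsin N.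
by rewrite /= -[RHS]mulr1 -(rot_norm N t); ring. Qed.

Lemma rot_le1 N t : `|(rot N t).1| <= 1 /\ `|(rot N t).2| <= 1.
have k (z w : R) : z ^+ 2 + w ^+ 2 = 1 -> `|z| <= 1.
 move=> zw; rewrite -(@ler_pXn2r _ 2) ?nnegrE// real_normK ?num_real//.
 by rewrite expr1n -zw lerDl sqr_ge0.
have cd := rot_norm N t; split; first exact: k cd.
by rewrite addrC in cd; apply: k cd.
Qed.

Lemma rsin_bound N : 1 <= N -> N^-1 <= rsin N <= 2 * N^-1.
move=> N1; have N0 : 0 < N by apply: lt_le_trans N1.
have i0 : 0 < N^-1 by rewrite invr_gt0.
have i1 : N^-1 <= 1 by rewrite invf_le1.
have h : 0 < 1 + N^-1 ^+ 2 by rewrite ltr_pwDl// sqr_ge0.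
rewrite /rsin ler_pdivlMr// ler_pdivrMr//; apply/andP; split; nra.
Qed.

Lemma rot_step N t : 1 <= N -> `|(rot N t.+1).1 - (rot N t).1| <= 4 * N^-1 /\
 `|(rot N t.+1).2 - (rot N t).2| <= 4 * N^-1.
move=> N1; have N0 : 0 < N by apply: lt_le_trans N1.
have i0 : 0 < N^-1 by rewrite invr_gt0.
have i1 : N^-1 <= 1 by rewrite invf_le1.
have h : 0 < 1 + N^-1 ^+ 2 by rewrite ltr_pwDl// sqr_ge0.
have [c1 d1] := rot_le1 N t.
have /andP[s0 s2] := rsin_bound N1.
have k : `|rcos N - 1| <= 2 * N^-1.
 have -> : rcos N - 1 = - (2 * N^-1 ^+ 2 / (1 + N^-1 ^+ 2)).
 by rewrite /rcos; move: N^-1 h => n h; field; rewrite gt_eqF.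
 have q0 : 0 <= 2 * N^-1 ^+ 2 / (1 + N^-1 ^+ 2).
 by apply: divr_ge0; [apply: mulr_ge0 => //; apply: sqr_ge0|apply: ltW].
 by rewrite normrN ger0_norm// ler_pdivrMr//; nra.
have s : `|rsin N| <= 2 * N^-1 by rewrite ger0_norm//; apply: le_trans s0; apply: ltW.
have four : 4 * N^-1 = 2 * N^-1 + 2 * N^-1 by ring.
have p x y : `|x| <= 2 * N^-1 -> `|y| <= 1 -> `|x * y| <= 2 * N^-1.
 by move=> hx hy; rewrite normrM -[leRHS]mulr1 ler_pM.
split => /=.
 have -> : rcos N * (rot N t).1 - rsin N * (rot N t).2 - (rot N t).1 =
 (rcos N - 1) * (rot N t).1 - rsin N * (rot N t).2 by ring.
 by rewrite four; apply: normB_le; rewrite lerD// p.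
have -> : rcos N * (rot N t).2 + rsin N * (rot N t).1 - (rot N t).2 =
 (rcos N - 1) * (rot N t).2 + rsin N * (rot N t).1 by ring.
by rewrite four; apply: normD_le; rewrite lerD// p.
Qed.

End Rotation.

Section Spiral.
Context {R : realType} {r : nat} (r2 : (1 < r)%N).
Local Notation Q := (filiprod R r true).
Implicit Types (x y : Q) (s t w m c d N B b : R).

(** The dilation of L with its natural weights 1 on a and k + 1 on p_k. On L it is [dil] at the
    square root of s. *)
Definition ds s x : Q := mk (s * cA x) 0 0 (\row_k (s ^+ k.+1 * cP x 0 k)).

Lemma cA_ds s x : cA (ds s x) = s * cA x. exact: cAmk. Qed.
Lemma cV_ds s x : cV (ds s x) = 0. exact: cVmk. Qed.
Lemma cU_ds s x : cU (ds s x) = 0. exact: cUmk. Qed.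
Lemma cP_ds s x k : cP (ds s x) 0 k = s ^+ k.+1 * cP x 0 k.
by rewrite cPmk mxE. Qed.

Lemma ds_dil s x : 0 <= s -> inL x -> ds s x = dil (Num.sqrt s) x.
move=> s0 [u v]; apply: filiprodP => [|||k].
- by rewrite cA_dil cA_ds sqr_sqrtr.
- by rewrite cU_dil cU_ds u mulr0.
- by rewrite cV_dil cV_ds v mulr0.
by rewrite cP_dil cP_ds exprM sqr_sqrtr.
Qed.

Lemma sqrt01 s : 0 <= s <= 1 -> 0 <= Num.sqrt s <= 1.
by move=> /andP[s0 s1]; rewrite sqrtr_ge0 -sqrtr1 ler_wsqrtr. Qed.

Lemma ds_near b s x y : inL x -> inL y -> 0 <= s <= 1 -> near_by b x y ->
 near_by b (ds s x) (ds s y).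
move=> xL yL s01 xy; case/andP: (s01) => s0 _.
by rewrite (ds_dil s0 xL) (ds_dil s0 yL); apply: dil_near (sqrt01 s01) xy.
Qed.

(* The point of L of coordinates s.x, displaced by (m c, m d) along the plane
 (u, v) and by w along the centre. *)
Definition xi s m c d w x : Q := mk (s * cA x) (m * c) (m * d)
 (\row_k (s ^+ k.+1 * cP x 0 k + (k.+1 == r)%:R * (w + m ^+ 2 * c * d / 2))).

Lemma cA_xi s m c d w x : cA (xi s m c d w x) = s * cA x. exact: cAmk. Qed.
Lemma cU_xi s m c d w x : cU (xi s m c d w x) = m * c. exact: cUmk. Qed.
Lemma cV_xi s m c d w x : cV (xi s m c d w x) = m * d. exact: cVmk. Qed.
Lemma cP_xi s m c d w x k : cP (xi s m c d w x) 0 k =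
 s ^+ k.+1 * cP x 0 k + (k.+1 == r)%:R * (w + m ^+ 2 * c * d / 2).
by rewrite cPmk mxE. Qed.

Lemma cP_div_top (X Y X' Y' : Q) k z1 z2 :
 cA X = cA X' -> cU X' = 0 -> (forall j, cP X 0 j = cP X' 0 j + (j.+1 == r)%:R * z1) ->
 (forall j, cP Y 0 j = cP Y' 0 j + (j.+1 == r)%:R * z2) ->
 cP (X^-1 * Y)%g 0 k = cP (X'^-1 * Y')%g 0 k +
 (k.+1 == r)%:R * (z2 - z1 - cU X * (cV Y - cV X)).
move=> hA hU hX hY; rewrite cP_div [in RHS]cP_div hU mulr0 mul0r if_same subr0 hA.
pose q (j : 'I_r) := (j.+1 == r)%:R * (z2 - z1).
rewrite (eq_bigr (fun j : 'I_r => (cP Y' 0 j - cP X' 0 j) *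
 ('C(k, j)%:R * (- cA X') ^+ (k - j)) + q j * ('C(k, j)%:R * (- cA X') ^+ (k - j)))).
 rewrite big_split/= (@pascal_sum_top _ _ r2 _ q) => [|j /negPf jr]; last by rewrite /q jr mul0r.
 rewrite -!addrA; congr (_ + _); rewrite /q.
 by case: eqP => _ /=; ring.
move=> j _; rewrite /q hX hY -mulrDl; congr (_ * _).
by case: eqP => _ /=; ring.
Qed.

(** The term m^2 c d / 2 in [xi] passes from the polarized to the symmetric coordinates of the
    Heisenberg group. The central part of a quotient is then the increment of w minus the signed
    area of a triangle with a vertex at the origin, up to half the product of the increments of u
    and v, which will be bounded. *)
Lemma cP_xi_div s m c d w x s' m' c' d' w' x' k :
 cP ((xi s m c d w x)^-1 * xi s' m' c' d' w' x')%g 0 k =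
 cP ((ds s x)^-1 * ds s' x')%g 0 k + (k.+1 == r)%:R *
 (w' - w - m * m' * (c * d' - d * c') / 2 + (m' * c' - m * c) * (m' * d' - m * d) / 2).
rewrite (@cP_div_top _ _ (ds s x) (ds s' x') k (w + m ^+ 2 * c * d / 2)
 (w' + m' ^+ 2 * c' * d' / 2)).
- rewrite cU_xi 2!cV_xi; congr (_ + _ * _); by field.
- by rewrite cA_xi cA_ds.
- exact: cU_ds.
- by move=> j; rewrite cP_xi cP_ds.
- by move=> j; rewrite cP_xi cP_ds.
Qed.

Lemma near_xi B s m c d w x s' m' c' d' w' x' : 0 <= B ->
 `|s' * cA x' - s * cA x| <= B -> `|m' * c' - m * c| <= B -> `|m' * d' - m * d| <= B ->
 (forall k : 'I_r, k.+1 != r -> `|cP ((ds s x)^-1 * ds s' x')%g 0 k| <= B) ->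
 (forall k : 'I_r, k.+1 = r -> `|cP ((ds s x)^-1 * ds s' x')%g 0 k +
 (w' - w - m * m' * (c * d' - d * c') / 2)| <= B) ->
 near_by (B + B * B) (xi s m c d w x) (xi s' m' c' d' w' x').
move=> B0 ha hu hv hk ht; have BB : B <= B + B * B by rewrite lerDl mulr_ge0.
apply/bndP; split=> [|||k].
- by rewrite cA_div !cA_xi; apply: le_trans BB.
- by rewrite cU_div !cU_xi; apply: le_trans BB.
- by rewrite cV_div !cV_xi; apply: le_trans BB.
rewrite cP_xi_div; have [kr|kr] := eqVneq k.+1 r; last first.
 by rewrite mul0r addr0; apply: le_trans BB; apply: hk.
rewrite mul1r addrA; apply: normD_le; rewrite lerD//.
 exact: ht.
rewrite !normrM (ger0_norm (x := 2^-1)) ?invr_ge0//.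
apply: (@le_trans _ _ (B * B * 1)); last by rewrite mulr1.
rewrite ler_pM ?mulr_ge0 ?invr_ge0//; last by rewrite invf_le1 ?ler1n.
by rewrite ler_pM.
Qed.

Lemma rB1 : (r.-1 < r)%N. by case: r r2. Qed.

(** The central component of the left-translated velocity at s = 1 of the orbit s -> [ds s x]: the
    rate at which dilating drifts along the centre. At parameter s it is multiplied by s^(r-1). *)
Definition euler x : R :=
 \sum_(j < r) (j.+1%:R * cP x 0 j) * ('C(r.-1, j)%:R * (- cA x) ^+ (r.-1 - j)).

Lemma euler_bound B N x : 0 <= B -> 1 <= N -> wsize B N x ->
 `|euler x| <= pbd (r := r) B * (r%:R * B) * N ^+ r.
move=> B0 N1 [ax _ _ px]; have N0 : 0 <= N by apply: le_trans N1.
have -> : N ^+ r = N * N ^+ (Ordinal rB1) by rewrite -exprS /= prednK//; apply: ltnW.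
rewrite mulrA -[_ * _ * N]mulrA; apply: (@pascal_bound _ _ _ _ _ _ _ (Ordinal rB1)); rewrite ?normrN//; first by nneg.
move=> j _; rewrite normrM normr_nat.
have -> : r%:R * B * N * N ^+ j = r%:R * (B * N ^+ j.+1) by rewrite exprS; ring.
by apply: ler_pM; rewrite ?ler_nat//; apply: px.
Qed.

Definition CQ' b B := pbd (r := r) B * (r%:R * (pbd (r := r) B * b + B * b)) +
 r%:R * (r%:R * B * 2 ^+ r * (r%:R * b * (1 + B) ^+ r)).

(** [euler] is homogeneous of degree r, so its variation between neighbours of size N has degree r -
    1. Divided by N^(r-1), as in the radius of the spiral, it varies boundedly along a row. *)
Lemma euler_step b B N x x' : 0 <= b -> 0 <= B -> 1 <= N ->
 wsize B N x -> wsize B N x' -> near_by b x x' ->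
 `|euler x' - euler x| <= CQ' b B * N ^+ r.-1.
move=> b0 B0 N1 [ax ux _ px] [ax' ux' _ px'] h.
have N0 : 0 <= N by apply: le_trans N1.
have B1 : 1 <= 1 + B by rewrite lerDl.
have sb := step_bound r2 b0 B0 N1 ax ux h.
rewrite /euler -sumrB.
rewrite (eq_bigr (fun j : 'I_r => (j.+1%:R * (cP x' 0 j - cP x 0 j)) *
 ('C(r.-1, j)%:R * (- cA x) ^+ (r.-1 - j)) + j.+1%:R * cP x' 0 j * 'C(r.-1, j)%:R *
 ((- cA x') ^+ (r.-1 - j) - (- cA x) ^+ (r.-1 - j)))); last by move=> j _; ring.
rewrite big_split/=; apply: normD_le; rewrite /CQ' mulrDl lerD//.
 apply: (@pascal_bound _ _ _ _ _ _ _ (Ordinal rB1)); rewrite ?normrN//.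
 by have := pbd_ge0 (r := r) B0 => ?; nneg.
 by move=> j _; rewrite normrM normr_nat -[r%:R * _ * _]mulrA; apply: ler_pM; rewrite ?ler_nat//; apply: sb.
apply: le_trans (ler_norm_sum _ _ _) _.
apply: le_trans (ler_sum _ (G := fun _ => r%:R * B * 2 ^+ r * (r%:R * b * (1 + B) ^+ r) * N ^+ r.-1) _) _;
 last by rewrite sumr_const card_ord -[leLHS]mulr_natl -[leRHS]mulrA.
move=> j _; have jr : (j <= r.-1)%N by have := ltn_ord j; nlia.
have [->|n0] := posnP (r.-1 - j)%N; first by rewrite subrr mulr0 normr0; nneg.
have K0 : 0 <= B * N by nneg.
have d := @normr_subXX R (r.-1 - j) (- cA x') (- cA x) (B * N).
rewrite !normrN in d; have {d} := d ax' ax.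
have -> : - cA x' - - cA x = - (cA x' - cA x) by ring.
have [ha _ _ _] := (bndP _ _).1 h; rewrite cA_div in ha; rewrite normrN => d.
rewrite !normrM !normr_nat.
have -> : r%:R * B * 2 ^+ r * (r%:R * b * (1 + B) ^+ r) * N ^+ r.-1 =
 r%:R * (B * N ^+ j.+1) * 2 ^+ r * (r%:R * b * ((1 + B) ^+ r * N ^+ (r.-1 - j).-1)).
 have -> : N ^+ r.-1 = N ^+ j.+1 * N ^+ (r.-1 - j).-1.
 by rewrite -exprD; congr (_ ^+ _); nlia.
 by ring.
rewrite ler_pM ?mulr_ge0//.
 rewrite ler_pM ?mulr_ge0//.
 by rewrite ler_pM ?ler_nat// px'.
 rewrite -natrX ler_nat; apply: leq_trans (leq_pexp2l _ (leq_pred r)) => //.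
 exact: bin_leq_exp2.
apply: le_trans d _; rewrite ler_pM ?mulr_ge0 ?exprn_ge0//.
 by rewrite ler_pM// ler_nat; nlia.
rewrite exprMn ler_wpM2r ?exprn_ge0//.
apply: (@le_trans _ _ ((1 + B) ^+ (r.-1 - j).-1)).
 by rewrite lerXn2r ?nnegrE ?addr_ge0// lerDr.
by rewrite ler_weXn2l//; nlia.
Qed.

(* Moving along the dilation orbit of a point x of size N. *)
Lemma ds_vertical B N x s s' (k : 'I_r) : 0 <= B -> 1 <= N -> wsize B N x ->
 0 <= s <= 1 -> 0 <= s' <= 1 -> `|s' - s| * N ^+ r.-1 <= 1 -> k.+1 != r ->
 `|cP ((ds s x)^-1 * ds s' x)%g 0 k| <= pbd (r := r) B * (r%:R * B).
move=> B0 N1 [ax _ _ px] s01 s01' ss kr; have N0 : 0 <= N by apply: le_trans N1.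
rewrite cP_div cU_ds mulr0 mul0r if_same subr0 cA_ds.
have := @pascal_bound R r B (r%:R * B * `|s' - s| * N) N (- (s * cA x))
 (fun j => cP (ds s' x) 0 j - cP (ds s x) 0 j) k B0 _ N1 _ _.
move=> h; apply: le_trans (h _ _ _) _.
- by nneg.
- rewrite normrN normrM ger0_norm; last by case/andP: s01.
 by apply: le_trans ax; rewrite ler_piMl//; case/andP: s01.
- move=> j jk; rewrite !cP_ds -mulrBl normrM.
 have d := normr_subXX1 j.+1 s01 s01'.
 apply: le_trans (ler_pM _ _ d (px j)) _; rewrite ?normr_ge0//.
 have -> : r%:R * B * `|s' - s| * N * N ^+ j = r%:R * `|s' - s| * (B * N ^+ j.+1).
 by rewrite exprS; ring.
 by rewrite ler_wpM2r ?mulr_ge0 ?exprn_ge0// ler_wpM2r// ler_nat.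
set PB := pbd B; have P0 : 0 <= PB by apply: pbd_ge0.
have -> : PB * (r%:R * B * `|s' - s| * N) * N ^+ k =
 PB * (r%:R * B) * (`|s' - s| * N ^+ k.+1) by rewrite exprS; ring.
rewrite ler_piMr//; first by nneg.
apply: le_trans ss; rewrite ler_wpM2l// ler_weXn2l//.
by move: (ltn_ord k) kr; nlia.
Qed.

(** Steps of N^-(r-1) are too long for the last coordinate, whose first-order drift can be of order
    N; this is what the rotation has to cancel. The Taylor remainder is of order (s' - s)^2 N^r,
    bounded because r <= 2(r - 1). *)
Lemma ds_vertical_top B N x s s' (k : 'I_r) : 0 <= B -> 1 <= N -> wsize B N x ->
 0 <= s <= 1 -> 0 <= s' <= 1 -> `|s' - s| * N ^+ r.-1 <= 1 -> k.+1 = r ->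
 `|cP ((ds s x)^-1 * ds s' x)%g 0 k - s ^+ r.-1 * euler x * (s' - s)| <=
 pbd (r := r) B * (r%:R ^+ 2 * B).
move=> B0 N1 [ax _ _ px] s01 s01' ss kr; have N0 : 0 <= N by apply: le_trans N1.
have kE : (k : nat) = r.-1 by move: kr; nlia.
rewrite cP_div cU_ds mulr0 mul0r if_same subr0 cA_ds.
pose q (j : 'I_r) := (s' ^+ j.+1 - s ^+ j.+1 - j.+1%:R * s ^+ j * (s' - s)) * cP x 0 j.
have -> : \sum_(j < r) (cP (ds s' x) 0 j - cP (ds s x) 0 j) *
 ('C(k, j)%:R * (- (s * cA x)) ^+ (k - j)) - s ^+ r.-1 * euler x * (s' - s) =
 \sum_(j < r) q j * ('C(k, j)%:R * (- (s * cA x)) ^+ (k - j)).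
 rewrite /euler mulrAC mulr_sumr -sumrB; apply: eq_bigr => j _.
 have jk : (j <= r.-1)%N by have := ltn_ord j; nlia.
 rewrite /q !cP_ds kE -[- (s * cA x)]mulrN exprMn.
 have -> : s ^+ r.-1 = s ^+ (r.-1 - j) * s ^+ j by rewrite -exprD subnK.
 by rewrite exprS; ring.
have := @pascal_bound R r B (r%:R ^+ 2 * B * (s' - s) ^+ 2 * N) N (- (s * cA x)) q k B0 _ N1 _ _.
move=> h; apply: le_trans (h _ _ _) _.
- by have := sqr_ge0 (s' - s) => ?; nneg.
- rewrite normrN normrM ger0_norm; last by case/andP: s01.
 by apply: le_trans ax; rewrite ler_piMl//; case/andP: s01.
- move=> j jk; rewrite /q normrM.
 have d := taylorX j s01 s01'.
 apply: le_trans (ler_pM _ _ d (px j)) _; rewrite ?normr_ge0//.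
 have -> : r%:R ^+ 2 * B * (s' - s) ^+ 2 * N * N ^+ j = (r ^ 2)%:R * (s' - s) ^+ 2 * (B * N ^+ j.+1).
 by rewrite [N ^+ j.+1]exprS natrX; ring.
 rewrite ler_wpM2r ?mulr_ge0 ?exprn_ge0// ler_wpM2r ?sqr_ge0// ler_nat.
 by rewrite leq_exp2r.
set PB := pbd B; have P0 : 0 <= PB by apply: pbd_ge0.
have -> : PB * (r%:R ^+ 2 * B * (s' - s) ^+ 2 * N) * N ^+ k =
 PB * (r%:R ^+ 2 * B) * ((s' - s) ^+ 2 * N ^+ r).
 have -> : N ^+ r = N * N ^+ k by rewrite -exprS kr.
 by ring.
rewrite ler_piMr//; first by nneg.
apply: (@le_trans _ _ ((`|s' - s| * N ^+ r.-1) ^+ 2)); last first.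
 by rewrite -(expr1n _ 2) lerXn2r ?nnegrE ?mulr_ge0 ?exprn_ge0.
rewrite exprMn real_normK ?num_real// ler_wpM2l ?sqr_ge0// -exprM ler_weXn2l//.
by move: r2; nlia.
Qed.

End Spiral.

(** * Coning off a loop of L along the spiral *)

Section SpiralCone.
Context {R : realType} {r : nat} (r2 : (1 < r)%N).
Local Notation Q := (filiprod R r true).
Implicit Types (x y : Q) (s t w m c d be : R).

Variables (b : R) (M : nat).
Hypotheses (b0 : 0 <= b) (M0 : (0 < M)%N).
Local Notation N := (M%:R : R).
Local Notation B := (wconst (r := r) b).
Local Notation CQ := (pbd (r := r) B * (r%:R * B)).
Local Notation K := (2 * (2 * CQ + 1)).
Local Notation D := (M ^ r.-1)%N.
Let N1 : 1 <= N. by rewrite ler1n. Qed.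
Let N0 : 0 < N. by rewrite ltr0n. Qed.
Let B0 : 0 <= B. exact: wconst_ge0. Qed.
Let CQ0 : 0 <= CQ. by have := pbd_ge0 (r := r) B0 => ?; nneg. Qed.
Let K1 : 1 <= K. by move: CQ0; lra. Qed.
Let D0 : (0 < D)%N. by rewrite expn_gt0 M0. Qed.
Let DE : D%:R = N ^+ r.-1. by rewrite natrX. Qed.
Let s0 : 0 < rsin N.
by have /andP[h _] := rsin_bound N1; apply: lt_le_trans h; rewrite invr_gt0. Qed.
(** A uniform central rate that exceeds by N the largest drift of a dilation orbit per row, so that
    [xx] remains between N and a multiple of N whatever the sign of [euler]. The parameter [be]
    interpolates between the constant radius [m0], at 0, and the radius adapted to the point, at
    1. *)
Let lam : R := (CQ + 1) * N.
Let xx be s x : R := lam + be * s ^+ r.-1 * euler x / N ^+ r.-1.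
(* The squared radius is proportional to the rate at which the spiral must
 produce central displacement to cancel that of the dilation orbit. *)
Let amp be s x : R := Num.sqrt (2 * xx be s x / rsin N).
Let m0 : R := Num.sqrt (2 * lam / rsin N).
Let small x := `|euler x| <= CQ * N ^+ r.
Let small1 : small 1%g.
have [_ _ _ p] := coord1 (R := R) (r := r) (e := true).
rewrite /small /euler big1 ?normr0; first by move: CQ0; set cq := (_ * _) => ?; nneg.
by move=> j _; rewrite p mulr0 mul0r.
Qed.
Let xx_bound be s x : 0 <= be <= 1 -> 0 <= s <= 1 -> small x -> N <= xx be s x <= K * N / 2.
move=> /andP[be0 be1] /andP[sg0 sg1] sx.
have h : `|be * s ^+ r.-1 * euler x / N ^+ r.-1| <= CQ * N.
 rewrite normrM normfV (ger0_norm (x := N ^+ _)) ?exprn_ge0//.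
 rewrite ler_pdivrMr ?exprn_gt0// -[leRHS]mulrA -exprS prednK; last exact: ltnW.
 apply: le_trans sx; rewrite normrM ler_piMl// ger0_norm ?mulr_ge0 ?exprn_ge0//.
 by rewrite mulr_ile1 ?exprn_ge0 ?exprn_ile1.
rewrite ler_norml in h; case/andP: h => h1 h2.
by rewrite /xx /lam; lra2.
Qed.
Let lam_bound : N <= lam <= K * N / 2.
have := @xx_bound 0 0 1%g; rewrite /xx !mul0r addr0.
by apply; rewrite ?lexx ?ler01//; apply: small1.
Qed.
Let sqrt_bound z : N <= z <= K * N / 2 -> N <= Num.sqrt (2 * z / rsin N) <= K * N.
move=> /andP[z1 z2]; have /andP[h1 h2] := rsin_bound N1.
have z0 : 0 <= z by apply: le_trans z1.
have i0 : 0 < N^-1 by rewrite invr_gt0.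
have nn : N * N^-1 = 1 by rewrite mulfV// gt_eqF.
apply/andP; split.
 rewrite -{1}(ger0_norm (ltW N0)) -sqrtr_sqr ler_wsqrtr// ler_pdivlMr//.
 apply: (@le_trans _ _ (N ^+ 2 * (2 * N^-1))); first by rewrite ler_wpM2l ?sqr_ge0.
 by rewrite expr2; nra.
have KN : 0 <= K * N by rewrite mulr_ge0// (le_trans _ K1).
rewrite -(ger0_norm KN) -sqrtr_sqr ler_wsqrtr// ler_pdivrMr//.
apply: (@le_trans _ _ ((K * N) ^+ 2 * N^-1)); last by rewrite ler_wpM2l ?sqr_ge0.
have -> : (K * N) ^+ 2 * N^-1 = K * (K * N) by rewrite expr2; field; rewrite gt_eqF.
apply: (@le_trans _ _ (K * N)); first by lra.
by rewrite ler_peMl.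
Qed.
(** Both roots are at least N while 1 / [rsin N] is at most N. Hence the difference of the squares,
    2 |z' - z| / [rsin N], divided by the sum of the roots, is at most |z' - z|. *)
Let sqrt_diff z z' : N <= z <= K * N / 2 -> N <= z' <= K * N / 2 ->
 `|Num.sqrt (2 * z' / rsin N) - Num.sqrt (2 * z / rsin N)| <= `|z' - z|.
move=> hz hz'; have /andP[h1 h2] := rsin_bound N1.
have /andP[p1 _] := sqrt_bound hz; have /andP[p1' _] := sqrt_bound hz'.
move: hz hz' => /andP[z1 _] /andP[z1' _].
have e1 : Num.sqrt (2 * z / rsin N) ^+ 2 = 2 * z / rsin N.
 by rewrite sqr_sqrtr// divr_ge0 ?(ltW s0)// mulr_ge0// (le_trans _ z1).
have e2 : Num.sqrt (2 * z' / rsin N) ^+ 2 = 2 * z' / rsin N.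
 by rewrite sqr_sqrtr// divr_ge0 ?(ltW s0)// mulr_ge0// (le_trans _ z1').
move: p1 p1' e1 e2; set u := Num.sqrt _; set v := Num.sqrt _ => p1 p1' e1 e2.
have uv : 0 < v + u by rewrite addr_gt0// (lt_le_trans N0).
have e3 : (v - u) * (v + u) = 2 * (z' - z) / rsin N.
 by rewrite -subr_sqr e1 e2 -mulrBl -mulrBr.
have e4 : `|v - u| * (v + u) = 2 * `|z' - z| / rsin N.
 rewrite -{1}(gtr0_norm uv) -normrM e3 !normrM normfV (gtr0_norm s0).
 by rewrite ger0_norm.
have : `|v - u| * (2 * N) <= 2 * `|z' - z| * N.
 apply: (@le_trans _ _ (`|v - u| * (v + u))); first by rewrite ler_wpM2l//; lra.
 rewrite e4; apply: ler_wpM2l; first by rewrite mulr_ge0.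
 by rewrite -[leRHS]invrK lef_pV2 ?posrE ?invr_gt0.
by rewrite mulrCA -mulrA ler_pM2l// ler_pM2r.
Qed.
Let C1 : R := b + @CQ' R r b B + r%:R * CQ + CQ + 4 * K + pbd (r := r) B * (r%:R * B) +
 pbd (r := r) B * (r%:R ^+ 2 * B) + K * (r%:R * CQ) + B + K.
Let C : R := C1 + C1 * C1.
Let CQ10 : 0 <= @CQ' R r b B.
by have := pbd_ge0 (r := r) B0 => ?; rewrite /CQ'; nneg. Qed.
Let P20 : 0 <= pbd (r := r) B * (r%:R ^+ 2 * B).
by have := pbd_ge0 (r := r) B0 => ?; nneg. Qed.
Let rCQ0 : 0 <= r%:R * CQ. by rewrite mulr_ge0. Qed.
Let KrCQ0 : 0 <= K * (r%:R * CQ).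
by rewrite mulr_ge0// (le_trans _ K1). Qed.
Let C10 : 0 <= C1.
by rewrite /C1; move: CQ10 P20 rCQ0 KrCQ0 CQ0 B0 K1 b0; lra. Qed.
Let c1 (z : R) : `|z| <= b + @CQ' R r b B + r%:R * CQ + CQ + 4 * K -> `|z| <= C1.
by rewrite /C1; move: CQ10 P20 rCQ0 KrCQ0 CQ0 B0 K1 b0; lra. Qed.
Let c1b (z : R) : `|z| <= b -> `|z| <= C1.
by rewrite /C1; move: CQ10 P20 rCQ0 KrCQ0 CQ0 B0 K1 b0; lra. Qed.
Let row_near s c d w be x x' : inL x -> inL x' -> wsize B N x -> wsize B N x' ->
 near_by b x x' -> 0 <= s <= 1 -> 0 <= be <= 1 -> `|c| <= 1 -> `|d| <= 1 ->
 near_by C (xi s (amp be s x) c d w x) (xi s (amp be s x') c d w x').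
move=> xL xL' wx wx' xx' s01 be01 cc dd.
have sx : small x := euler_bound r2 B0 N1 wx.
have sx' : small x' := euler_bound r2 B0 N1 wx'.
have dm : `|amp be s x' - amp be s x| <= @CQ' R r b B.
 apply: le_trans (sqrt_diff (xx_bound be01 s01 sx) (xx_bound be01 s01 sx')) _.
 rewrite /xx opprD addrACA subrr add0r -mulrBl -mulrBr normrM normfV.
 rewrite (ger0_norm (x := N ^+ _)) ?exprn_ge0// ler_pdivrMr ?exprn_gt0//.
 apply: le_trans (euler_step r2 b0 B0 N1 wx wx' xx').
 rewrite normrM ler_piMl// ger0_norm; case/andP: be01 => ? ?; case/andP: s01 => ? ?.
 by rewrite mulr_ile1 ?exprn_ge0 ?exprn_ile1.
 by rewrite mulr_ge0 ?exprn_ge0.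
have hn := ds_near xL xL' s01 xx'; have [ha _ _ hp] := (bndP _ _).1 hn.
rewrite cA_div !cA_ds in ha.
have dc z : `|z| <= 1 -> `|amp be s x' * z - amp be s x * z| <= C1.
 move=> z1; apply: c1; rewrite -mulrBl normrM.
 apply: (@le_trans _ _ (@CQ' R r b B)); last by move: rCQ0 CQ0 K1 b0; lra.
 by rewrite -[leRHS]mulr1 ler_pM.
apply: near_xi => //; [exact: c1b|exact: dc|exact: dc| |] => k kr.
 by apply: c1b.
by rewrite subrr [d * c]mulrC subrr mulr0 mul0r subr0 addr0; apply: c1b.
Qed.
(** The last hypothesis is the balance sheet of one row: the drift of the dilation, the increment of
    w and the area swept by the rotation must cancel up to a constant. *)
Let vert s s' m m' c c' d d' w w' x : wsize B N x -> 0 <= s <= 1 -> 0 <= s' <= 1 ->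
 `|s' - s| * N ^+ r.-1 <= 1 ->
 `|m' * c' - m * c| <= r%:R * CQ + CQ + 4 * K + K -> `|m' * d' - m * d| <= r%:R * CQ + CQ + 4 * K + K ->
 `|s ^+ r.-1 * euler x * (s' - s) + (w' - w - m * m' * (c * d' - d * c') / 2)|
 <= K * (r%:R * CQ) ->
 near_by C (xi s m c d w x) (xi s' m' c' d' w' x).
move=> wx s01 s01' ss hc hd ht; apply: near_xi => //.
- rewrite -mulrBl normrM; have [ax _ _ _] := wx.
 apply: (@le_trans _ _ B); last by rewrite /C1; move: CQ10 P20 rCQ0 KrCQ0 CQ0 B0 K1 b0; lra.
 apply: le_trans (ler_wpM2l _ ax) _; rewrite // mulrCA ler_piMr//.
 by apply: le_trans ss; rewrite ler_wpM2l// ler_eXnr//; move: r2; nlia.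
- by apply: le_trans hc _; rewrite /C1; move: CQ10 P20 rCQ0 KrCQ0 CQ0 B0 K1 b0; lra.
- by apply: le_trans hd _; rewrite /C1; move: CQ10 P20 rCQ0 KrCQ0 CQ0 B0 K1 b0; lra.
- move=> k kr; apply: le_trans (ds_vertical r2 B0 N1 wx s01 s01' ss kr) _.
 by rewrite /C1; move: CQ10 P20 rCQ0 KrCQ0 CQ0 B0 K1 b0; lra.
move=> k kr; have h := ds_vertical_top r2 B0 N1 wx s01 s01' ss kr.
move: h ht; set e1 := cP _ _ _; set e2 := _ * (s' - s); set e3 := w' - w - _ => h ht.
have -> : e1 + e3 = (e1 - e2) + (e2 + e3) by ring.
apply: normD_le; apply: le_trans (lerD h ht) _.
by rewrite /C1; move: CQ10 P20 rCQ0 KrCQ0 CQ0 B0 K1 b0; lra.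
Qed.
Let xi0 x : inL x -> xi 1 0 1 0 0 x = x.
move=> [u v]; apply: filiprodP => [|||k]; rewrite ?(cA_xi, cU_xi, cV_xi) ?cP_xi.
- by rewrite mul1r.
- by rewrite mul0r u.
- by rewrite mul0r v.
by rewrite expr1n mul1r expr0n !mul0r addr0 mulr0 addr0.
Qed.
Let row_loop (x : nat -> Q) s c d w be : (forall i, inL (x i)) -> loop_by b M x ->
 (forall i, (i <= M)%N -> wsize B N (x i)) -> 0 <= s <= 1 -> 0 <= be <= 1 ->
 `|c| <= 1 -> `|d| <= 1 ->
 loop_by C M (fun i => xi s (amp be s (x i)) c d w (x i)).
move=> xL [h cl] wx s01 be01 cc dd; split=> [i iM|]; last by rewrite cl.
by apply: row_near => //; [apply: wx; apply: ltnW|apply: wx|apply: h].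
Qed.
Let t01 (t T : nat) : (t <= T)%N -> 0 <= (t%:R / T%:R : R) <= 1.
move=> tT; have [->|T0] := posnP T; first by rewrite invr0 mulr0 lexx ler01.
by rewrite divr_ge0//= ler_pdivrMr ?ltr0n// mul1r ler_nat.
Qed.
Let dt (t T : nat) : (0 < T)%N -> t.+1%:R / T%:R - t%:R / T%:R = T%:R^-1 :> R.
by move=> T0; rewrite -mulrBl -natrB// subSnn mul1r. Qed.
Let m0K : N <= m0 <= K * N. exact: sqrt_bound lam_bound. Qed.
Let one : 0 <= (1 : R) <= 1. by rewrite ler01 lexx. Qed.
Let zero : 0 <= (0 : R) <= 1. by rewrite ler01 lexx. Qed.
Let n11 : `|1 : R| <= 1. by rewrite normr1. Qed.
Let n01 : `|0 : R| <= 1. by rewrite normr0. Qed.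
Let amp0 s x : amp 0 s x = m0. by rewrite /amp /xx !mul0r addr0. Qed.
Let amps0 be x : amp be 0 x = m0.
rewrite /amp /xx expr0n (_ : (r.-1 == 0)%N = false) ?mulr0 ?mul0r ?addr0//.
by apply/negbTE; move: r2; nlia.
Qed.
(** The loop is pushed out along the axis of u to the radius [m0], which is of order N and so takes
    N steps of bounded size. No area is swept. *)
Let openup (x : nat -> Q) : (forall i, inL (x i)) -> loop_by b M x ->
 (forall i, (i <= M)%N -> wsize B N (x i)) ->
 grid C M M x (fun i => xi 1 m0 1 0 0 (x i)).
move=> xL [h cl] wx; exists (fun (t i : nat) => xi 1 (m0 * (t%:R / N)) 1 0 0 (x i)); split.
- move=> t tM; split=> [i iM|]; last by rewrite cl.
 apply: near_xi => //.
 + by rewrite !mul1r -cA_div; apply: c1b; have [] := (bndP _ _).1 (h i iM).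
 + by rewrite subrr normr0.
 + by rewrite subrr normr0.
 + move=> k _; apply: c1b; have hn := ds_near (xL i) (xL i.+1) one (h i iM).
 by have [_ _ _ ->] := (bndP _ _).1 hn.
 move=> k _; rewrite !(mulr0, mul0r, subr0, addr0); apply: c1b.
 have hn := ds_near (xL i) (xL i.+1) one (h i iM).
 by have [_ _ _ ->] := (bndP _ _).1 hn.
- move=> t i tM iM; apply: (vert (wx i iM)) => //.
 + by rewrite subrr normr0 mul0r.
 + rewrite !mulr1 -mulrBr dt// normrM normfV normr_nat -/(_ / _) ler_pdivrMr//.
 case/andP: m0K => m1 m2; rewrite ger0_norm; last by apply: le_trans m1.
 by apply: le_trans m2 _; rewrite ler_wpM2r//; move: rCQ0 CQ0 K1; lra.
 + by rewrite !mulr0 subrr normr0; move: rCQ0 CQ0 K1; lra.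
 by rewrite !(subrr, mulr0, mul0r, subr0, addr0) normr0.
- by move=> i iM; rewrite mul0r mulr0 xi0.
by move=> i iM; rewrite mulfV ?gt_eqF// mulr1.
Qed.
Let lamE : m0 * m0 * rsin N / 2 = lam.
rewrite -expr2 /m0 sqr_sqrtr; first by field; rewrite gt_eqF.
by case/andP: lam_bound => h _; rewrite divr_ge0 ?(ltW s0)// mulr_ge0// (le_trans _ h).
Qed.
Let dmc m m' c c' A : 0 <= m <= K * N -> `|m' - m| <= A -> `|c'| <= 1 ->
 `|c' - c| <= 4 * N^-1 -> `|m' * c' - m * c| <= A + 4 * K.
move=> /andP[m0' mK] dm c1' dc.
have -> : m' * c' - m * c = (m' - m) * c' + m * (c' - c) by ring.
apply: normD_le; rewrite !normrM lerD//.
 by rewrite -[A]mulr1 ler_pM.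
apply: (@le_trans _ _ (K * N * (4 * N^-1))); first by rewrite ler_pM// ger0_norm.
by rewrite le_eqVlt; apply/orP; left; apply/eqP; field; rewrite gt_eqF.
Qed.
(** Rotation at constant radius, without dilation. The area swept per step is exactly [lam], and w
    grows by as much. *)
Let wind (x : nat -> Q) : (forall i, inL (x i)) -> loop_by b M x ->
 (forall i, (i <= M)%N -> wsize B N (x i)) ->
 grid C M D (fun i => xi 1 m0 1 0 0 (x i))
 (fun i => xi 1 m0 (rot N D).1 (rot N D).2 (lam * D%:R) (x i)).
move=> xL h wx.
exists (fun (t i : nat) => xi 1 m0 (rot N t).1 (rot N t).2 (lam * t%:R) (x i)); split=> //.
- move=> t tD; have [c1' d1'] := rot_le1 N t.
 by have := @row_loop x 1 (rot N t).1 (rot N t).2 (lam * t%:R) 0 xL h wx one zero c1' d1';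
 apply: loop_ext => i _; rewrite amp0.
- move=> t i tD iM; have [dc dd] := rot_step t N1; have [c1' d1'] := rot_le1 N t.+1.
 case/andP: m0K => m1 m2.
 have mm : 0 <= m0 <= K * N by rewrite m2 andbT; apply: le_trans m1.
 have z : `|m0 - m0| <= 0 by rewrite subrr normr0.
 apply: (vert (wx i iM)) => //.
 + by rewrite subrr normr0 mul0r.
 + by apply: le_trans (dmc mm z c1' dc) _; move: rCQ0 CQ0 K1; lra.
 + by apply: le_trans (dmc mm z d1' dd) _; move: rCQ0 CQ0 K1; lra.
 rewrite subrr mulr0 add0r rot_cross lamE -mulrBr -natrB// subSnn mulr1 subrr normr0.
 exact: KrCQ0.
by move=> i _; rewrite mulr0.
Qed.
(** At a fixed angle, the constant radius is changed into the one adapted to each point. The radii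
    differ by at most [CQ] N, hence N steps. *)
Let tune (x : nat -> Q) : (forall i, inL (x i)) -> loop_by b M x ->
 (forall i, (i <= M)%N -> wsize B N (x i)) ->
 grid C M M (fun i => xi 1 m0 (rot N D).1 (rot N D).2 (lam * D%:R) (x i))
 (fun i => xi 1 (amp 1 1 (x i)) (rot N D).1 (rot N D).2 (lam * D%:R) (x i)).
move=> xL h wx; have [c1' d1'] := rot_le1 N D.
exists (fun (t i : nat) => xi 1 (amp (t%:R / N) 1 (x i)) (rot N D).1 (rot N D).2 (lam * D%:R) (x i)).
split.
- by move=> t tM; apply: row_loop => //; apply: t01.
- move=> t i tM iM; have sx : small (x i) := euler_bound r2 B0 N1 (wx i iM).
 have dm : `|amp (t.+1%:R / N) 1 (x i) - amp (t%:R / N) 1 (x i)| <= CQ.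
 apply: le_trans (sqrt_diff (xx_bound (t01 (ltnW tM)) one sx) (xx_bound (t01 tM) one sx)) _.
 rewrite /xx opprD addrACA subrr add0r expr1n !mulr1 -2!mulrBl dt//.
 rewrite !normrM !normfV (ger0_norm (x := N ^+ _)) ?exprn_ge0// normr_nat.
 rewrite ler_pdivrMr ?exprn_gt0// mulrC ler_pdivrMr// -mulrA -exprSr prednK//.
 exact: ltnW.
 apply: (vert (wx i iM)) => //.
 + by rewrite subrr normr0 mul0r.
 + rewrite -mulrBl normrM; apply: (@le_trans _ _ (CQ * 1)); first by rewrite ler_pM.
 by move: rCQ0 CQ0 K1; lra.
 + rewrite -mulrBl normrM; apply: (@le_trans _ _ (CQ * 1)); first by rewrite ler_pM.
 by move: rCQ0 CQ0 K1; lra.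
 rewrite !subrr mulr0 add0r [_.2 * _]mulrC subrr mulr0 mul0r subr0 normr0.
 exact: KrCQ0.
- by move=> i iM; rewrite mul0r amp0.
by move=> i iM; rewrite mulfV ?gt_eqF.
Qed.
(** Dilation and rotation together, read from the apex to the loop. It starts at the constant row of
    radius [m0] and ends at the row where [tune] ends, since both have rotated D times and
    accumulated w = [lam] D. *)
Let shrink (x : nat -> Q) : (forall i, inL (x i)) -> loop_by b M x ->
 (forall i, (i <= M)%N -> wsize B N (x i)) ->
 grid C M D (fun i => xi 1 m0 1 0 0 1%g)
 (fun i => xi 1 (amp 1 1 (x i)) (rot N D).1 (rot N D).2 (lam * D%:R) (x i)).
move=> xL h wx.
exists (fun (t i : nat) => xi (t%:R / D%:R) (amp 1 (t%:R / D%:R) (x i)) (rot N t).1 (rot N t).2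
 (lam * t%:R) (x i)); split.
- move=> t tD; have [c1' d1'] := rot_le1 N t.
 by apply: row_loop => //; apply: t01.
- move=> t i tD iM; have sx : small (x i) := euler_bound r2 B0 N1 (wx i iM).
 have [dc dd] := rot_step t N1; have [c1' d1'] := rot_le1 N t.+1.
 have Dinv : 0 <= D%:R^-1 :> R by rewrite invr_ge0.
 have dm : `|amp 1 (t.+1%:R / D%:R) (x i) - amp 1 (t%:R / D%:R) (x i)| <= r%:R * CQ.
 apply: le_trans (sqrt_diff (xx_bound one (t01 (ltnW tD)) sx) (xx_bound one (t01 tD) sx)) _.
 rewrite /xx opprD addrACA subrr add0r !mul1r -!mulrBl.
 rewrite !normrM !normfV (ger0_norm (x := N ^+ _)) ?exprn_ge0//.
 rewrite ler_pdivrMr ?exprn_gt0//.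
 have := normr_subXX1 r.-1 (t01 (ltnW tD)) (t01 tD).
 rewrite dt// normfV normr_nat => h1.
 apply: le_trans (ler_pM _ _ h1 sx) _ => //.
 have -> : N ^+ r = N * N ^+ r.-1 by rewrite -exprS prednK//; apply: ltnW.
 have -> : r.-1%:R / D%:R * (CQ * (N * N ^+ r.-1)) =
 r.-1%:R * CQ * N ^+ r.-1 * (N / D%:R) by ring.
 have Nr0 : 0 <= N ^+ r.-1 by rewrite exprn_ge0.
 have q0 : 0 <= r.-1%:R * CQ by rewrite mulr_ge0.
 apply: (@le_trans _ _ (r.-1%:R * CQ * N ^+ r.-1)).
 rewrite ler_piMr//; first by rewrite mulr_ge0.
 rewrite ler_pdivrMr ?ltr0n// mul1r DE ler_eXnr//.
 by move: r2; nlia.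
 by rewrite ler_wpM2r// ler_wpM2r// ler_nat leq_pred.
 have /andP[a1 a2] := sqrt_bound (xx_bound one (t01 (ltnW tD)) sx).
 have mm : 0 <= amp 1 (t%:R / D%:R) (x i) <= K * N by rewrite a2 andbT; apply: le_trans a1.
 apply: (vert (wx i iM)) => //; try exact: t01.
 + exact: t01 (ltnW tD).
 + by rewrite dt// normfV normr_nat -DE mulVf// pnatr_eq0 -lt0n.
 + by apply: le_trans (dmc mm dm c1' dc) _; move: rCQ0 CQ0 K1; lra.
 + by apply: le_trans (dmc mm dm d1' dd) _; move: rCQ0 CQ0 K1; lra.
 rewrite rot_cross -mulrBr -natrB// subSnn mulr1 dt//.
 move: mm dm a1; set a := amp _ _ _; set a' := amp _ _ _ => mm dm a1.
 (* The radius was chosen for this identity: the area swept in one step is [lam] plus the drift of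
    the dilation. What remains is due to the change of radius within the step, a (a' - a) [rsin N] /
    2, of order N times 1 times 1/N. *)
 have e1 : a * a * rsin N / 2 = lam + (t%:R / D%:R) ^+ r.-1 * euler (x i) * D%:R^-1.
 have xb := xx_bound one (t01 (ltnW tD)) sx.
 rewrite -expr2 /a /amp sqr_sqrtr.
 by rewrite /xx mul1r DE; field; rewrite expf_neq0 ?gt_eqF.
 case/andP: xb => h1 _; rewrite divr_ge0 ?(ltW s0)// mulr_ge0//.
 exact: le_trans h1.
 have -> : (t%:R / D%:R) ^+ r.-1 * euler (x i) / D%:R + (lam - a * a' * rsin N / 2) =
 - (a * (a' - a) * rsin N / 2).
 transitivity ((lam + (t%:R / D%:R) ^+ r.-1 * euler (x i) / D%:R) - a * a' * rsin N / 2).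
 by ring.
 by rewrite -e1; ring.
 case/andP: mm => aa0 aK; have /andP[sn1 sn2] := rsin_bound N1.
 rewrite normrN [`|_ / 2|]normrM [`|_ * rsin N|]normrM [`|a * _|]normrM (ger0_norm aa0) (gtr0_norm s0) (ger0_norm (x := 2^-1)) ?invr_ge0//.
 apply: (@le_trans _ _ (K * N * (r%:R * CQ) * (2 * N^-1) / 2)).
 by rewrite ler_wpM2r ?invr_ge0// ler_pM ?mulr_ge0// ?(ltW s0)// ler_pM.
 by rewrite le_eqVlt; apply/orP; left; apply/eqP; field; rewrite gt_eqF.
- move=> i iM; rewrite mul0r amps0 mulr0.
 have [A1 _ _ P1] := coord1 (R := R) (r := r) (e := true).
 apply: filiprodP => [|||k].
 - by rewrite !cA_xi A1 mul0r mulr0.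
 - by rewrite !cU_xi.
 - by rewrite !cV_xi.
 by rewrite !cP_xi P1 exprS !mul0r !mulr0.
by move=> i iM; rewrite mulfV// pnatr_eq0 -lt0n.
Qed.

(** [openup], [wind] and [tune] lead to a row from which [shrink], run backwards, reaches a constant
    row; undoing [openup] for the constant loop brings it back to 1. The purpose of [wind] is to
    match the total rotation and the total w of [shrink]. *)
Lemma spiral_grid (x : nat -> Q) : (forall i, inL (x i)) -> loop_by b M x -> x 0%N = 1%g ->
 grid (bmul (r := r) C) M (M + D + M + D + M) x (fun=> 1%g).
move=> xL h x0.
have C0 : 0 <= C by rewrite /C addr_ge0 ?mulr_ge0.
have CC := bmul_ge (r := r) C0.
have wx i : (i <= M)%N -> wsize B N (x i).
 by apply: path_wsize => //; case: h.
have h1 : loop_by b M (fun=> 1%g : Q) by split=> // i _; apply: near_refl.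
have w1 i : (i <= M)%N -> wsize B N (1%g : Q).
 by move=> iM; have := wx 0%N (leq0n _); rewrite x0.
apply: grid_trans; last first.
 apply: grid_sym => //; apply: openup => //.
 by move=> i; apply: inL1.
apply: grid_trans; last exact: grid_sym (shrink xL h wx).
apply: grid_trans; last exact: gridW CC (tune xL h wx).
apply: grid_trans; first exact: gridW CC (openup xL h wx).
exact: gridW CC (wind xL h wx).
Qed.

End SpiralCone.

(** * Splitting a loop of H into a loop in L and a loop in the Heisenberg factor *)

Section SplitLoop.
Context {R : realType} {r : nat} (r3 : (2 < r)%N).
Local Notation Q := (filiprod R r true).
Implicit Types (x y : Q).
Let r2 : (1 < r)%N. exact: ltnW. Qed.

Section Loop.
Variables (b : R) (c nu : nat) (g : nat -> Q).
Hypotheses (b0 : 0 <= b) (c0 : (0 < c)%N) (bc : b ^+ 2 <= c%:R ^+ 3) (nu0 : (0 < nu)%N).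
Local Notation N := (nu ^ 3)%N.
Local Notation m := (16 * c + 2)%N.
Local Notation Ne := (8 * (c * nu ^ 2))%N.
Hypotheses (gl : loop_by b N g) (g0 : g 0%N = 1%g).
Let gs i : (i < N)%N -> near_by b (g i) (g i.+1). by case: gl => h _; apply: h. Qed.
Let gN : g N = 1%g. by case: gl => _ <-. Qed.
(** The discrete integral of u dv along the loop. Placed in the last coordinate of the component in
    K, it makes that path horizontal; removed from the component in L, it leaves bounded steps
    there. Both paths then fail to close by the same central element, of size O(N^2). *)
Let ar i : R := \sum_(j < i) cU (g j) * (cV (g j.+1) - cV (g j)).
Let l i : Q := mk (cA (g i)) 0 0 (cP (g i) - ar i *: etop).
Let k i : Q := mk 0 (cU (g i)) (cV (g i)) (ar i *: etop).
Let lL i : inL (l i). by split; rewrite ?cUmk ?cVmk. Qed.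
Let kK i : inK (k i).
by split=> [|j /negPf jr]; rewrite ?cAmk// cPmk !mxE jr mulr0. Qed.
Let lP i j : cP (l i) 0 j = cP (g i) 0 j - (j.+1 == r)%:R * ar i.
by rewrite cPmk mxE; congr (_ + _); rewrite mxE; congr (- _); rewrite !mxE mulrC. Qed.
Let kP i j : cP (k i) 0 j = (j.+1 == r)%:R * ar i.
by rewrite cPmk !mxE mulrC. Qed.
Let arS i : ar i.+1 = ar i + cU (g i) * (cV (g i.+1) - cV (g i)).
by rewrite /ar big_ord_recr. Qed.
Let ar0 : ar 0%N = 0. by rewrite /ar big_ord0. Qed.
Let gE i : g i = (l i * k i)%g.
rewrite [RHS]LK_mul//; apply: (@filiprodP _ _ true) => [|||j].
- by rewrite cAD !cAmk addr0.
- by rewrite cUD !cUmk add0r.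
- by rewrite cVD !cVmk add0r.
by rewrite cPD [RHS]mxE lP kP subrK.
Qed.
Let l0 : l 0%N = 1%g.
have [A1 U1 V1 P1] := coord1 (R := R) (r := r) (e := true).
apply: filiprodP => [|||j]; rewrite ?cAmk ?cUmk ?cVmk ?g0 ?A1 ?U1 ?V1//.
by rewrite lP g0 ar0 mulr0 subr0.
Qed.
Let k0 : k 0%N = 1%g.
by apply: (mulgI (l 0%N)); rewrite -gE l0 mulg1 g0. Qed.
Let kNE : k N = zt (ar N).
have [_ U1 V1 _] := coord1 (R := R) (r := r) (e := true).
by apply: filiprodP => [|||j]; rewrite ?cAmk ?cUmk ?cVmk ?cPmk ?gN ?U1 ?V1.
Qed.
Let ztV : (l N * zt (ar N))%g = 1%g. by rewrite -kNE -gE gN. Qed.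
Let uB i : (i <= N)%N -> `|cU (g i)| <= b * i%:R.
have [_ U1 _ _] := coord1 (R := R) (r := r) (e := true).
elim: i => [_|i IH iN]; first by rewrite g0 U1 normr0 mulr0.
have [_ h _ _] := (bndP _ _).1 (gs iN); rewrite cU_div in h.
rewrite -(subrK (cU (g i)) (cU _)) -natr1 mulrDr mulr1 addrC.
by apply: normD_le; rewrite lerD// IH// ltnW.
Qed.
Let vB i : (i <= N)%N -> `|cV (g i)| <= b * i%:R.
have [_ _ V1 _] := coord1 (R := R) (r := r) (e := true).
elim: i => [_|i IH iN]; first by rewrite g0 V1 normr0 mulr0.
have [_ _ h _] := (bndP _ _).1 (gs iN); rewrite cV_div in h.
rewrite -(subrK (cV (g i)) (cV _)) -natr1 mulrDr mulr1 addrC.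
by apply: normD_le; rewrite lerD// IH// ltnW.
Qed.
Let arB i : (i <= N)%N -> `|ar i| <= b ^+ 2 * N%:R ^+ 2.
move=> iN; apply: le_trans (ler_norm_sum _ _ _) _.
apply: le_trans (ler_sum _ (G := fun _ => b ^+ 2 * N%:R) _) _; last first.
 rewrite sumr_const card_ord -[leLHS]mulr_natl mulrCA ler_wpM2l ?exprn_ge0//.
 by rewrite expr2 ler_wpM2r// ler_nat.
move=> j _; have jN : (j < N)%N by exact: leq_trans iN.
have [_ _ h _] := (bndP _ _).1 (gs jN); rewrite cV_div in h.
rewrite normrM expr2 -mulrA mulrC; apply: ler_pM => //.
apply: le_trans (uB (ltnW jN)) _; rewrite ler_wpM2l// ler_nat.
exact: ltnW.
Qed.
Let ls i : (i < N)%N -> near_by b (l i) (l i.+1).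
move=> iN; have [ha hu hv hp] := (bndP _ _).1 (gs iN); apply/bndP; split=> [|||j].
- by rewrite cA_div !cAmk -cA_div.
- by rewrite cU_div !cUmk subrr normr0.
- by rewrite cV_div !cVmk subrr normr0.
have := hp j; rewrite (@cP_div_top _ _ r2 (g i) (g i.+1) (l i) (l i.+1) j (ar i) (ar i.+1)).
- by rewrite arS addrAC addrK subrr mulr0 addr0.
- by rewrite cAmk.
- by rewrite cUmk.
- by move=> j'; rewrite lP subrK.
by move=> j'; rewrite lP subrK.
Qed.
Let ks i : (i < N)%N -> near_by b (k i) (k i.+1).
move=> iN; have [ha hu hv hp] := (bndP _ _).1 (gs iN); apply/bndP; split=> [|||j].
- by rewrite cA_div !cAmk subrr normr0.
- by rewrite cU_div !cUmk -cU_div.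
- by rewrite cV_div !cVmk -cV_div.
rewrite cP_div cAmk oppr0 pascal_sum0 !kP !cUmk !cVmk arS -mulrBr [_ + _ - _]addrC addKr.
by case: eqP => _; rewrite ?mul0r ?mul1r subrr normr0.
Qed.
Let arN : `|ar N| <= (c * nu ^ 2)%:R ^+ 3.
apply: le_trans (arB (leqnn _)) _; rewrite natrM exprMn; apply: ler_pM; rewrite ?sqr_ge0//.
by rewrite -!natrX ler_nat -!expnM.
Qed.

Lemma split_area : `|\sum_(j < N) cU (g j) * (cV (g j.+1) - cV (g j))| <= (c * nu ^ 2)%:R ^+ 3.
exact: arN. Qed.
Let nN : (Ne <= 8 * c * N)%N.
by rewrite -mulnA leq_mul2l leq_mul2l leq_pexp2l ?orbT. Qed.
Let Nm : (N + Ne + (N + Ne) <= m * N)%N. by move: nN; nlia. Qed.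

Variables (ee : nat -> Q).
Hypotheses (ee0 : ee 0%N = 1%g) (eeN : ee Ne = zt (ar N)) (eeL : forall i, inL (ee i))
 (ees : forall i, (i < Ne)%N -> near_by 1 (ee i) (ee i.+1)).

Local Notation B1 := (bmul (r := r) b + bmul (r := r) (1 : R)).
Let bb := bmul_ge (r := r) b0.
Let b11 := bmul_ge (r := r) (@ler01 R).
Let B10 : 0 <= B1. by rewrite addr_ge0// (le_trans _ bb, le_trans _ b11). Qed.
Let bB : bmul (r := r) b <= B1. by rewrite lerDl (le_trans _ b11). Qed.
Let oB : bmul (r := r) 1 <= B1. by rewrite lerDr (le_trans _ bb). Qed.
Let ll i j : (i <= N)%N -> (j <= N)%N -> (i <= j.+1)%N -> (j <= i.+1)%N -> near_by B1 (l i) (l j).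
by move=> *; apply: nearW bB _; apply: (lip_of r2 b0 ls). Qed.
Let kl i j : (i <= N)%N -> (j <= N)%N -> (i <= j.+1)%N -> (j <= i.+1)%N -> near_by B1 (k i) (k j).
by move=> *; apply: nearW bB _; apply: (lip_of r2 b0 ks). Qed.
Let el i j : (i <= Ne)%N -> (j <= Ne)%N -> (i <= j.+1)%N -> (j <= i.+1)%N -> near_by B1 (ee i) (ee j).
by move=> *; apply: nearW oB _; apply: (lip_of r2 ler01 ees). Qed.

Local Notation B2 := (bmul (r := r) B1).
Let B12 := bmul_ge (r := r) B10.
(** Repeating each point m times leaves room to run through the component in L during the first N
    indices and through that in K during the last N. In between the row waits at [l N]. *)
Let separate : grid B2 (m * N) N (fun i => g (i %/ m))
 (fun i => l (minn i N) * k (i - (m * N - N)))%g.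
exists (fun t i => l (minn (minn i N) (i %/ m + t)) * k (maxn (i - (m * N - N)) (i %/ m - t)))%g.
have NM : (N <= m * N)%N by move: Nm; nlia.
have m1 : (0 < m)%N by rewrite addn2.
have dm i : (i <= m * N)%N -> (i %/ m <= N)%N by move=> h; rewrite -[leqRHS](@mulKn N m m1) leq_div2r.
have ds i : (i %/ m <= i.+1 %/ m <= (i %/ m).+1)%N.
 rewrite leq_div2r//=; have : (i.+1 <= i + m)%N by nlia.
 by move=> /(leq_div2r m) h; apply: leq_trans h _; rewrite divnDr// divnn m1 addn1.
have dl i : (i %/ m <= i)%N by apply: leq_div.
have dK i : (i <= m * N)%N -> (i - (m * N - N) <= i %/ m)%N.
 move=> h; rewrite leq_divRL//; move: h; nia.
split.
- move=> t tN; split=> [i iM|].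
 have := ds i; have := dm i.+1 iM; have := dm i (ltnW iM) => h1 h2 h3.
 apply: (near_LK r2) => //; [apply: ll|apply: kl]; move: NM tN iM h1 h2 h3;
 move: (m * N)%N (i %/ m)%N (i.+1 %/ m)%N N; clear; lia.
 rewrite div0n !min0n sub0n max0n sub0n.
 have -> : (minn (minn (m * N) N) (m * N %/ m + t) = N)%N by rewrite mulKn//; nlia.
 have -> : (maxn (m * N - (m * N - N)) (m * N %/ m - t) = N)%N by rewrite mulKn//; nlia.
 by rewrite -!gE gN.
- move=> t i tN iM; have := dm i iM => *.
 by apply: (near_LK r2) => //; [apply: ll|apply: kl]; nlia.
- move=> i iM; rewrite subn0 addn0 gE; have := dm i iM; have := dl i; have := dK i iM => *.
 by congr (l _ * k _)%g; nlia.
move=> i iM; congr (l _ * k _)%g; have dmi := dm i iM; move: dmi iM NM;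
 by move: (m * N)%N (i %/ m)%N N; clear; lia.
Qed.
Let P1 i := (l (minn i N) * ee (minn Ne (i - N)))%g.
Let P2 i := (l N * ee (minn Ne (m * N - N - i)) * k (i - (m * N - N)))%g.
Let P1L i : inL (P1 i). exact: inL_mul. Qed.

(* A loop [ee, ee^-1] is inserted where the row sits at [l N]. *)
Let insert : grid B2 (m * N) Ne
 (fun i => l (minn i N) * k (i - (m * N - N)))%g (fun i => P1 i * P2 i)%g.
exists (fun t i => l (minn i N) * ee (minn t (minn (i - N) (m * N - N - i))) *
 k (i - (m * N - N)))%g.
have lN0 j : (l N * ee Ne * k j = k j)%g by rewrite eeN ztV mul1g.
split.
- move=> t tN; split=> [i iM|]; last first.
 have -> : (minn t (minn (m * N - N) (m * N - N - m * N)) = 0)%N by nlia.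
 have -> : (minn t (minn (0 - N) (m * N - N - 0)) = 0)%N by nlia.
 have -> : (minn (m * N) N = N)%N by nlia.
 have -> : (m * N - (m * N - N) = N)%N by nlia.
 by rewrite ee0 !mulg1 min0n sub0n -!gE g0 gN.
 apply: (near_LK r2) => //; [exact: inL_mul|exact: inL_mul| |apply: kl; nlia].
 have [iN|iN] := boolP (i < N)%N.
 have -> : (minn t (minn (i - N) (m * N - N - i)) = 0)%N by nlia.
 have -> : (minn t (minn (i.+1 - N) (m * N - N - i.+1)) = 0)%N by nlia.
 by rewrite ee0 !mulg1; apply: ll; nlia.
 have -> : (minn i N = N)%N by nlia.
 have -> : (minn i.+1 N = N)%N by nlia.
 by rewrite near_mull; apply: el; nlia.
- move=> t i tN iM; apply: (near_LK r2) => //; [exact: inL_mul|exact: inL_mul| |apply: kl; nlia].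
 by rewrite near_mull; apply: el; nlia.
- by move=> i iM; rewrite min0n ee0 mulg1.
move=> i iM; rewrite /P1 /P2.
have [iN|iN] := boolP (i <= N)%N.
 have -> : (minn Ne (m * N - N - i) = Ne)%N by nlia.
 have -> : (minn Ne (i - N) = 0)%N by nlia.
 have -> : (minn Ne (minn (i - N) (m * N - N - i)) = 0)%N by nlia.
 by rewrite lN0.
have -> : (minn i N = N)%N by nlia.
have [h|h] := boolP (i - N <= m * N - N - i)%N.
 have -> : (minn Ne (m * N - N - i) = Ne)%N by nlia.
 have -> : (minn (i - N) (m * N - N - i) = i - N)%N by nlia.
 by rewrite lN0.
have -> : (minn Ne (i - N) = Ne)%N by nlia.
have -> : (minn (i - N) (m * N - N - i) = m * N - N - i)%N by nlia.
by rewrite eeN ztV mul1g.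
Qed.
Let lN1 : (l N * ee Ne)%g = 1%g. by rewrite eeN. Qed.
Let P2one i : (i + Ne + N <= m * N)%N -> P2 i = 1%g.
move=> h; rewrite /P2; have -> : (minn Ne (m * N - N - i) = Ne)%N by nlia.
have -> : (i - (m * N - N) = 0)%N by nlia.
by rewrite lN1 k0 mulg1.
Qed.
Let P1one i : (N + Ne <= i)%N -> P1 i = 1%g.
move=> h; rewrite /P1; have -> : (minn Ne (i - N) = Ne)%N by nlia.
by have -> : (minn i N = N)%N by nlia.
Qed.
Let P1_step i : near_by B1 (P1 i) (P1 i.+1).
rewrite /P1; have [iN|iN] := boolP (i < N)%N.
 have -> : (minn Ne (i - N) = 0)%N by nlia.
 have -> : (minn Ne (i.+1 - N) = 0)%N by nlia.
 by rewrite ee0 !mulg1; apply: ll; nlia.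
have -> : (minn i N = N)%N by nlia.
have -> : (minn i.+1 N = N)%N by nlia.
by rewrite near_mull; apply: el; nlia.
Qed.
Let P2_step i : (i < m * N)%N -> near_by B1 (P2 i) (P2 i.+1).
move=> iM; rewrite /P2; have [iN|iN] := ltnP i (m * N - N).
 have -> : (i - (m * N - N) = 0)%N by nlia.
 have -> : (i.+1 - (m * N - N) = 0)%N by nlia.
 by rewrite k0 !mulg1 near_mull; apply: el; nlia.
have -> : (minn Ne (m * N - N - i) = 0)%N by nlia.
have -> : (minn Ne (m * N - N - i.+1) = 0)%N by nlia.
by rewrite near_mull; apply: kl; nlia.
Qed.
Let P10 : P1 0%N = 1%g. by rewrite /P1 min0n sub0n minn0 l0 ee0 mulg1. Qed.
Let P1N : P1 (m * N)%N = 1%g. by apply: P1one; move: Nm; nlia. Qed.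
Let P1_loop : loop_by B1 (m * N) P1.
by split=> [i _|]; [exact: P1_step|rewrite P10 P1N]. Qed.

Local Notation C := (wconst (r := r) B1 * (8 * c)%:R ^+ r + b + 2 * b ^+ 2).
Let W0 : 0 <= wconst (r := r) B1 := wconst_ge0 B10.
Let C0 : 0 <= C. by rewrite !addr_ge0 ?mulr_ge0. Qed.
Let c81 : 1 <= (8 * c)%:R :> R. by rewrite ler1n muln_gt0 c0. Qed.
(** The closing path is O(nu^2) long, so its coordinates have the homogeneous sizes of nu^2. The
    path in K has u and v of order N = nu^3 and centre of order nu^6 <= nu^(2r). These are the sizes
    for which [dil] may move at steps of nu^-(3(r-1)). *)
Let P2_size i : (i <= m * N)%N -> msize C nu%:R (P2 i).
move=> iM; have n1 : 1 <= nu%:R :> R by rewrite ler1n.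
have [A1 U1 V1 P1'] := coord1 (R := R) (r := r) (e := true).
have nn k' : 0 <= nu%:R ^+ k' :> R by rewrite exprn_ge0.
have [iN|iN] := leqP i (m * N - N).
 rewrite /P2; have -> : (i - (m * N - N) = 0)%N by nlia.
 rewrite k0 mulg1; set j := minn _ _; have jN : (j <= Ne)%N by rewrite /j; nlia.
 pose f q := (l N * ee (Ne - q))%g.
 have NN : 1 <= Ne%:R :> R by rewrite ler1n muln_gt0 muln_gt0 c0 expn_gt0 nu0.
 have f0 : f 0%N = 1%g by rewrite /f subn0.
 have fs q : (q < Ne)%N -> near_by B1 (f q) (f q.+1).
 by move=> qN; rewrite near_mull; apply: el; nlia.
 have := path_wsize r2 B10 NN (lexx _) f0 fs (leq_subr j Ne).
 rewrite /f subKn// => -[ha _ _ hp].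
 have NeE : Ne%:R = (8 * c)%:R * nu%:R ^+ 2 :> R by rewrite mulnA natrM natrX.
 have WC q : (q <= r)%N -> wconst (r := r) B1 * (8 * c)%:R ^+ q <= C.
 move=> qr; apply: (@le_trans _ _ (wconst (r := r) B1 * (8 * c)%:R ^+ r)); last first.
 by have := sqr_ge0 b; move: b0; lra.
 by rewrite ler_wpM2l// ler_weXn2l.
 have [u0 v0] : inL (l N * ee j)%g by exact: inL_mul.
 split=> [|||q].
 - apply: le_trans ha _; rewrite NeE mulrA ler_wpM2r//.
 by apply: (WC 1%N); nlia.
 - by rewrite u0 normr0 mulr_ge0.
 - by rewrite v0 normr0 mulr_ge0.
 apply: le_trans (hp q) _; rewrite NeE exprMn mulrA -exprM ler_wpM2r//.
 exact: WC.
have jN : (i - (m * N - N) <= N)%N by nlia.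
rewrite /P2; have -> : (minn Ne (m * N - N - i) = 0)%N by nlia.
move: jN; rewrite ee0 mulg1; move: (i - _)%N => j jN.
have E := LK_mul r2 (lL N) (kK j).
have NE : N%:R = nu%:R ^+ 3 :> R by rewrite natrX.
have bC : b <= C by rewrite addrAC; apply: ler_wpDl => //; rewrite addr_ge0 ?mulr_ge0.
have Ub z : `|z| <= b * j%:R -> `|z| <= C * nu%:R ^+ 3.
 move=> h; apply: le_trans h _; rewrite -NE; apply: ler_pM => //.
 by rewrite ler_nat.
split=> [|||q].
- by rewrite E cAD !cAmk gN A1 addr0 normr0 mulr_ge0.
- by rewrite E cUD !cUmk add0r; apply: Ub; apply: uB.
- by rewrite E cVD !cVmk add0r; apply: Ub; apply: vB.
rewrite E cPD [X in `|X|]mxE lP kP gN P1' sub0r.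
have [qr|qr] := eqVneq q.+1 r; last by rewrite !mul0r oppr0 addr0 normr0 mulr_ge0.
rewrite !mul1r; apply: normD_le; rewrite normrN.
apply: le_trans (lerD (arB (leqnn _)) (arB jN)) _.
apply: (@le_trans _ _ (2 * b ^+ 2 * nu%:R ^+ 6)).
 by rewrite NE -exprM; lra.
apply: ler_pM; rewrite ?mulr_ge0 ?exprn_ge0//.
 by apply: ler_wpDl => //; rewrite addr_ge0 ?mulr_ge0.
by rewrite ler_weXn2l// qr; nlia.
Qed.

Variable Dd : R.
Hypotheses (Dd0 : 0 <= Dd) (slow : forall n s t x, 1 <= n -> 0 <= s <= 1 -> 0 <= t <= 1 ->
 `|t - s| * n ^+ (3 * r.-1) <= 1 -> msize C n x -> near_by Dd (dil s x) (dil t x)).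
Local Notation T2 := (nu ^ (3 * r.-1))%N.
(** Where one of [P1], [P2] moves the other is 1. Hence [P2] can be dilated to 1 while [P1] stays,
    and the rows remain loops with bounded steps. *)
Let contract : grid (B1 + Dd) (m * N) T2 (fun i => P1 i * P2 i)%g P1.
have T0 : (0 < T2)%N by rewrite expn_gt0 nu0.
have T0' : 0 < T2%:R :> R by rewrite ltr0n.
have BD : B1 <= B1 + Dd by rewrite lerDl.
pose s t : R := (T2 - t)%:R / T2%:R.
have s01 t : 0 <= s t <= 1.
 by rewrite /s divr_ge0//= ler_pdivrMr// mul1r ler_nat leq_subr.
exists (fun t i => P1 i * dil (s t) (P2 i))%g; split.
- move=> t tT; split=> [i iM|]; last first.
 have -> : P2 0%N = 1%g by apply: P2one; move: Nm; nlia.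
 suff -> : P2 (m * N)%N = 1%g by rewrite P10 P1N.
 rewrite /P2 subKn; last by move: Nm; nlia.
 by rewrite (_ : minn Ne _ = 0)%N; [rewrite ee0 mulg1 -gE gN|nlia].
 apply: nearW BD _; have [h|h] := leqP i.+1 (N + Ne).
 by rewrite !P2one ?dil_1 ?mulg1; [exact: P1_step|move: Nm; nlia..].
 by rewrite !P1one ?mul1g; [apply: dil_near => //; apply: P2_step|nlia..].
- move=> t i tT iM; rewrite near_mull; apply: (@nearW _ _ _ Dd); first by rewrite lerDr.
 apply: (slow (n := nu%:R)) => //; [by rewrite ler1n| |exact: P2_size].
 rewrite distrC -natrX /s -mulrBl -natrB; last by nlia.
 have -> : (T2 - t - (T2 - t.+1) = 1)%N by nlia.
 by rewrite mul1r normfV normr_nat mulVf ?gt_eqF.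
- by move=> i iM; rewrite /s subn0 divff ?dil1 ?gt_eqF.
by move=> i iM; rewrite /s subnn mul0r dil0 ?mulg1//; nlia.
Qed.

Lemma split_loop : exists2 x : nat -> Q,
 [/\ forall i, inL (x i), loop_by B1 (m * N) x & x 0%N = 1%g] &
 grid (B2 + Dd) (m * N) (N + Ne + T2) (fun i => g (i %/ m)) x.
exists P1 => //.
have h1 : B2 <= B2 + Dd by rewrite lerDl.
apply: grid_trans; last by apply: gridW contract; rewrite lerD2r.
apply: grid_trans; [exact: gridW h1 separate|exact: gridW h1 insert].
Qed.

End Loop.

Lemma spiral_bound b : 0 <= b -> exists2 B : R, 0 <= B & forall M (x : nat -> Q),
 (0 < M)%N -> (forall i, inL (x i)) -> loop_by b M x -> x 0%N = 1%g ->
 grid B M (M + M ^ r.-1 + M + M ^ r.-1 + M) x (fun=> 1%g).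
move=> b0; suff [B h] : exists B : R, forall M (x : nat -> Q),
 (0 < M)%N -> (forall i, inL (x i)) -> loop_by b M x -> x 0%N = 1%g ->
 grid B M (M + M ^ r.-1 + M + M ^ r.-1 + M) x (fun=> 1%g).
 exists (Num.max B 0); first by rewrite le_max lexx orbT.
 by move=> M x M0 xL lx x0; apply: gridW (h M x M0 xL lx x0); rewrite le_max lexx.
by eexists => M x M0 xL lx x0; apply: (spiral_grid r2 b0 M0 xL lx x0).
Qed.

(** Lengths are cubes so that the defect of the splitting, at most b^2 nu^6 <= (c nu^2)^3, is
    spelled in L by 8 c nu^2 steps. In terms of the length n = nu^3, the grid has O(n^(r-1)) rows of
    m n cells. *)
Theorem loop_grid (b : R) : 0 <= b -> exists (B : R) (m C : nat),
 [/\ 0 <= B, (0 < m)%N & forall nu (g : nat -> Q), (0 < nu)%N ->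
 loop_by b (nu ^ 3) g -> g 0%N = 1%g -> exists2 T, (T <= C * nu ^ (3 * r.-1))%N &
 grid B (m * nu ^ 3) T (fun i => g (i %/ m)%N) (fun=> 1%g)].
move=> b0; pose c := (Num.trunc (b ^+ 2)).+1.
have bc : b ^+ 2 <= c%:R ^+ 3.
 apply: (@le_trans _ _ c%:R).
 by apply/ltW; have /andP[] := Num.Theory.trunc_itv (sqr_ge0 b).
 by rewrite ler_eXnr// ler1n.
set B1 := bmul (r := r) b + bmul (r := r) (1 : R).
have B10 : 0 <= B1.
 by rewrite addr_ge0// (le_trans _ (bmul_ge _)).
have CC0 : 0 <= wconst (r := r) B1 * (8 * c)%:R ^+ r + b + 2 * b ^+ 2.
 by rewrite !addr_ge0 ?mulr_ge0// wconst_ge0.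
have [Dd Dd0 slow] := dil_slow (e := true) r3 CC0.
have [B3 B30 hB3] := spiral_bound B10.
set m := (16 * c + 2)%N.
have bB1 : 0 <= bmul (r := r) B1 by apply: le_trans (bmul_ge B10).
exists (bmul (r := r) B1 + Dd + B3), m, (1 + 8 * c + 1 + 5 * m ^ r.-1)%N; split.
- by rewrite addr_ge0// addr_ge0.
- by rewrite /m addn2.
move=> nu g nu0 gl g0.
pose Ne := (8 * (c * nu ^ 2))%N.
have arB : `|\sum_(j < nu ^ 3) cU (g j) * (cV (g j.+1) - cV (g j))| <= (c * nu ^ 2)%:R ^+ 3 :> R.
 exact: (@split_area b c nu g).
have cn0 : (0 < c * nu ^ 2)%N by rewrite muln_gt0 expn_gt0 nu0.
have [ee [e0 eN eL es]] := reach_zt (D := @inL R r) r2 r3 cn0 (fun x h => h) arB.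
have [x [xL lx x0] gx] := split_loop b0 (isT : (0 < c)%N) bc nu0 gl g0 e0 eN eL es Dd0 slow.
have M0 : (0 < m * nu ^ 3)%N by rewrite muln_gt0 expn_gt0 nu0 /m addn2.
eexists; last first.
 apply: grid_trans; first by apply: gridW gx; rewrite lerDl.
 by apply: gridW (hB3 _ x M0 xL lx x0); rewrite lerDr addr_ge0.
have h1 : (nu ^ 3 <= nu ^ (3 * r.-1))%N by rewrite leq_pexp2l//; move: r3; nlia.
have h2 : (nu ^ 2 <= nu ^ (3 * r.-1))%N by rewrite leq_pexp2l//; move: r3; nlia.
have h3 : ((m * nu ^ 3) ^ r.-1 = m ^ r.-1 * nu ^ (3 * r.-1))%N by rewrite expnMn -expnM.
have h4 : (m * nu ^ 3 <= m ^ r.-1 * nu ^ (3 * r.-1))%N.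
 apply: leq_mul => //; rewrite -{1}(expn1 m) leq_pexp2l//.
 by move: r3; nlia.
rewrite h3; move: h1 h2 h4; rewrite /Ne; nia.
Qed.

End SplitLoop.

(** * The integer lattice and rounding *)

Section Lattice.
Context {R : realType} {r : nat} {e : bool}.
Local Notation Q := (filiprod R r e).
Local Notation L := (filiprod int r e).

Definition embed (z : L) : Q := map_mx (intr : int -> R) (z : 'rV[int]_(3 + r)).

Lemma cA_embed z : cA (embed z) = (cA z)%:~R. by rewrite /cA mxE. Qed.
Lemma cU_embed z : cU (embed z) = (cU z)%:~R. by rewrite /cU mxE. Qed.
Lemma cV_embed z : cV (embed z) = (cV z)%:~R. by rewrite /cV mxE. Qed.
Lemma cP_embed z k : cP (embed z) 0 k = (cP z 0 k)%:~R. by rewrite /cP !mxE. Qed.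

Lemma embedM x y : embed (x * y)%g = (embed x * embed y)%g.
apply: filiprodP => [|||k].
- by rewrite cA_mul !cA_embed cA_mul rmorphD.
- by rewrite cU_mul !cU_embed cU_mul rmorphD.
- by rewrite cV_mul !cV_embed cV_mul rmorphD.
rewrite [RHS]cP_mul !cP_embed cP_mul !rmorphD rmorph_sum/=; congr (_ + _ + _).
 apply: eq_bigr => j _.
 by rewrite !rmorphM /= rmorph_nat rmorphXn /= cA_embed cP_embed.
by rewrite cU_embed cV_embed; case: ifP => // _; rewrite !rmorphM /= rmorph_nat.
Qed.

Lemma embed1 : embed 1%g = 1%g.
by apply: (mulgI (embed 1%g)); rewrite -embedM !mulg1. Qed.
Lemma embedV x : embed x^-1%g = (embed x)^-1%g.
by apply: (mulgI (embed x)); rewrite -embedM !mulgV embed1. Qed.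

Lemma embed_inj : injective embed.
move=> x y xy; apply: filiprodP => [|||k]; apply: (@intr_inj R).
- by rewrite -!cA_embed xy.
- by rewrite -!cU_embed xy.
- by rewrite -!cV_embed xy.
by rewrite -!cP_embed xy.
Qed.
Let floors (x : Q) : L := mk (Num.floor (cA x)) (Num.floor (cU x)) (Num.floor (cV x)) 0.
Let floorP (y : Q) : L := mk 0 0 0 (\row_k Num.floor (cP y 0 k)).

(** The coordinates a, u, v are rounded first: dividing by the rounded element changes p, and it is
    p of the remainder that has to be rounded. *)
Definition rnd (x : Q) : L := (floors x * floorP ((embed (floors x))^-1 * x))%g.
Let frac (z : R) : `|z - (Num.floor z)%:~R| <= 1.
rewrite ger0_norm ?subr_ge0 ?floor_le_tmp ?ge_floor// lerBlDr addrC.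
by have := ltW (floorD1_gt z); rewrite intrD.
Qed.

Lemma rnd_near x : near_by 1 (embed (rnd x)) x.
rewrite /near_by /rnd embedM invgM -mulgA; set y := (_^-1 * x)%g.
have Y : [/\ `|cA y| <= 1, `|cU y| <= 1 & `|cV y| <= 1].
 by rewrite cA_div cU_div cV_div cA_embed cU_embed cV_embed cAmk cUmk cVmk; split; apply: frac.
have [ya yu yv] := Y; apply/bndP; split=> [|||k].
- by rewrite cA_div cA_embed cAmk subr0.
- by rewrite cU_div cU_embed cUmk subr0.
- by rewrite cV_div cV_embed cVmk subr0.
rewrite cP_div cA_embed cAmk cU_embed cUmk oppr0 pascal_sum0 mulr0 mul0r if_same subr0.
by rewrite cP_embed [cP (floorP y)]cPmk [X in _ - X%:~R]mxE; apply: frac.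
Qed.

Lemma rnd_embed z : rnd (embed z) = z.
rewrite /rnd; set w := floors _; have -> : ((embed w)^-1 * embed z)%g = embed (w^-1 * z)%g.
 by rewrite embedM embedV.
suff -> : floorP (embed (w^-1 * z)%g) = (w^-1 * z)%g by rewrite mulVKg.
apply: filiprodP => [|||k].
- by rewrite cA_div !cAmk cA_embed intrKfloor subrr.
- by rewrite cU_div !cUmk cU_embed intrKfloor subrr.
- by rewrite cV_div !cVmk cV_embed intrKfloor subrr.
by rewrite cPmk mxE cP_embed intrKfloor.
Qed.

Definition rstep (b : R) : nat := (Num.trunc (bmul (r := r) (bmul (r := r) (b + bmul (r := r) 1)))).+1.
Definition small (M : nat) (z : L) := bnd M%:R (embed z).

Lemma rnd_step b x y : 0 <= b -> near_by b x y -> small (rstep b) ((rnd x)^-1 * rnd y)%g.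
move=> b0 xy; have b1 := bmul_ge (r := r) (@ler01 R).
have b1' : 0 <= bmul (r := r) (1 : R) by apply: le_trans b1.
have bb : 0 <= b + bmul (r := r) 1 by rewrite addr_ge0.
have h1 : near_by (b + bmul (r := r) 1) (embed (rnd x)) x.
 by apply: nearW (rnd_near x); rewrite (le_trans b1)// lerDr.
have h2 : near_by (b + bmul (r := r) 1) x y by apply: nearW xy; rewrite lerDl.
have h3 := near_trans h1 h2.
have h4 : near_by (bmul (r := r) (b + bmul (r := r) 1)) y (embed (rnd y)).
 apply: nearW (near_sym (rnd_near y)); apply: le_trans (bmul_ge bb).
 by rewrite lerDr.
rewrite /small embedM embedV; apply: bndW (near_trans h3 h4).
have b2 : 0 <= bmul (r := r) (b + bmul (r := r) 1) by apply: le_trans (bmul_ge bb).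
have b3 : 0 <= bmul (r := r) (bmul (r := r) (b + bmul (r := r) 1)) by apply: le_trans (bmul_ge b2).
by apply/ltW; have /andP[] := Num.Theory.trunc_itv b3.
Qed.

Lemma smallE M (z : L) : small M z <-> forall i, `|(z : 'rV[int]_(3 + r)) 0 i| <= M%:Z.
have h i : (`|embed z 0 i| <= M%:R) = (`|(z : 'rV[int]_(3 + r)) 0 i| <= M%:Z).
 by rewrite mxE -intr_norm -[M%:R]/(M%:Z%:~R) ler_int.
by split=> sz i; [rewrite -h|rewrite h].
Qed.

(** Indexing a box by a finite type lets a maximum over it bound the areas and lengths of the
    finitely many words attached to its points. *)
Definition small_elt M (f : {ffun 'I_(3 + r) -> 'I_(M + M).+1}) : L :=
 \row_i ((f i)%:Z - M%:Z).

Lemma small_eltP M z : small M z <-> exists f, small_elt (M := M) f = z.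
split=> [/smallE sz|[f <-]].
 have lt i : (`|((z : 'rV[int]_(3 + r)) 0 i + M%:Z)%R|%N < (M + M).+1)%N by have := sz i; lia.
 exists [ffun i => Ordinal (lt i)]; apply/rowP => i; rewrite mxE ffunE /=.
 by have := sz i; lia.
by apply/smallE => i; rewrite mxE; have := ltn_ord (f i); lia.
Qed.

Lemma small_bounded (z : L) : exists M, small M z.
exists (\sum_i `|(z : 'rV[int]_(3 + r)) 0%R i|)%N; apply/smallE => i.
by rewrite -abszE lez_nat (bigD1 i)//= leq_addr.
Qed.

Lemma smallW M M' (z : L) : (M <= M')%N -> small M z -> small M' z.
by move=> MM; apply: bndW; rewrite ler_nat. Qed.
Lemma small1 M : small M 1%g.
by apply/smallE => i; rewrite oneE mxE. Qed.

(** Dilation orbits are Lipschitz in the parameter, uniformly on bounded sets. They join any point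
    to 1 by small steps, which serves to generate the lattice, to contract arbitrary loops and to
    refine bounded steps into unit ones. *)
Lemma dil_unif (m : R) : (0 < r)%N -> 0 <= m -> exists T0 : nat, forall (T : nat) s t (x : Q),
 bnd m x -> (T0 < T)%N ->
 0 <= s <= 1 -> 0 <= t <= 1 -> `|t - s| <= T%:R^-1 -> near_by 1 (dil s x) (dil t x).
move=> r0 m0.
pose K := 2 * r%:R * m + pbd (r := r) m * (2 * r%:R * m) + r%:R * m * m.
have P0 := pbd_ge0 (r := r) m0.
have r1 : 1 <= r%:R :> R by rewrite ler1n.
have K0 : 0 <= K by rewrite /K; nneg.
exists (Num.trunc K) => T s t x xm KT s01 t01 st.
have dT : `|t - s| * K <= 1.
 have T0 : 0 < T%:R :> R by rewrite ltr0n; apply: leq_ltn_trans KT.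
 apply: (@le_trans _ _ (T%:R^-1 * K)); first by rewrite ler_wpM2r.
 rewrite ler_pdivrMl// mulr1; have /andP[_ h] := Num.Theory.trunc_itv K0.
 by apply: le_trans (ltW h) _; rewrite ler_nat.
have d j (z : R) : (j <= 2 * r)%N -> `|z| <= m ->
 `|t ^+ j * z - s ^+ j * z| <= `|t - s| * (2 * r%:R * m).
 move=> jr zm; rewrite -mulrBl normrM.
 apply: le_trans (ler_pM _ _ (normr_subXX1 _ s01 t01) zm) _ => //.
 have -> : `|t - s| * (2 * r%:R * m) = (2 * r%:R) * `|t - s| * m by ring.
 by rewrite ler_wpM2r// ler_wpM2r// -natrM ler_nat.
have [xa xu xv xp] := (bndP _ _).1 xm.
have h1 : `|t - s| * (2 * r%:R * m) <= 1.
 apply: le_trans dT; rewrite ler_wpM2l// /K -addrA lerDl; nneg.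
apply/bndP; split=> [|||k].
- by rewrite cA_div !cA_dil; apply: le_trans h1; apply: d => //; nlia.
- by rewrite cU_div !cU_dil; apply: le_trans h1; apply: d => //; nlia.
- by rewrite cV_div !cV_dil; apply: le_trans h1; apply: d => //; nlia.
have a1 j (z : R) : `|z| <= m -> `|s ^+ j * z| <= m.
 case/andP: s01 => ? ? zm; apply: le_trans zm; rewrite normrM ler_piMl// ger0_norm ?exprn_ge0//.
 by rewrite exprn_ile1.
apply: le_trans dT; rewrite cP_div; apply: normB_le.
rewrite /K [leRHS]mulrDr lerD//.
 rewrite mulrDr; apply: ler_wpDl; first by nneg.
 rewrite mulrCA; apply: pascal_bound1 => //; first by nneg.
 by rewrite normrN cA_dil a1.
 by move=> j; rewrite !cP_dil; apply: d => //; rewrite leq_mul2l ltn_ord.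
case: eqP => [kr|_]; last by rewrite normr0; nneg.
rewrite !cU_dil !cV_dil -mulrBl -mulrA !normrM.
have -> : `|t - s| * (r%:R * m * m) = m * (r%:R * `|t - s| * m) by ring.
apply: (@le_trans _ _ (1 * (m * (r%:R * `|t - s| * m)))); last by rewrite mul1r.
apply: ler_pM; rewrite ?mulr_ge0//; first exact: e1.
rewrite -normrM; apply: ler_pM; rewrite ?mulr_ge0//; first exact: a1.
by apply: ler_pM => //; apply: normr_subXX1.
Qed.

Lemma dil_cont (x : Q) : (0 < r)%N -> exists T0 : nat, forall (T : nat) s t, (T0 < T)%N ->
 0 <= s <= 1 -> 0 <= t <= 1 -> `|t - s| <= T%:R^-1 -> near_by 1 (dil s x) (dil t x).
move=> r0; have [|T0 h] := @dil_unif (\sum_i `|x 0 i|) r0; first by rewrite sumr_ge0.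
by exists T0 => T s t; apply: h => i; rewrite (bigD1 i)//= lerDl sumr_ge0.
Qed.

End Lattice.
Arguments embed {R r e}.
Arguments rnd {R r e}.
Arguments small R {r e} M z.

(** * Words, areas and homotopies of words *)

Section FreeCalculus.
Context {m : nat}.
Implicit Types u v w : word m.

Lemma word_inv_cat u v : word_inv (u ++ v) = word_inv v ++ word_inv u.
by rewrite /word_inv map_cat rev_cat. Qed.

Lemma word_invK : involutive (@word_inv m).
move=> w; rewrite /word_inv map_rev revK -map_comp map_id_in// => -[i b] _.
by rewrite /letter_inv /= negbK.
Qed.

Lemma size_word_inv w : size (word_inv w) = size w.
by rewrite size_rev size_map. Qed.

Lemma free_cong u v v' w : free_eq v v' -> free_eq (u ++ v ++ w) (u ++ v' ++ w).
elim=> {v v'} [v v' a|v|v v' _|v1 v2 v3 _ h _]; last exact: free_trans.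
- by have := free_cancel (u ++ v) (v' ++ w) a; rewrite -!catA.
- exact: free_refl.
- exact: free_sym.
Qed.

Lemma free_cat u u' v v' : free_eq u u' -> free_eq v v' -> free_eq (u ++ v) (u' ++ v').
move=> h h'; apply: (@free_trans _ _ (u' ++ v)); first exact: (free_cong [::] v h).
by have := free_cong u' [::] h'; rewrite !cats0.
Qed.

Lemma free_invr u w v : free_eq (u ++ w ++ word_inv w ++ v) (u ++ v).
elim/last_ind: w u v => [|w a IH] u v; first exact: free_refl.
have -> : u ++ rcons w a ++ word_inv (rcons w a) ++ v =
 (u ++ w) ++ [:: a; letter_inv a] ++ (word_inv w ++ v).
 by rewrite -cats1 word_inv_cat -!catA.
by apply: free_trans (free_cancel _ _ _) _; rewrite -catA.
Qed.

Lemma free_invl u w v : free_eq (u ++ word_inv w ++ w ++ v) (u ++ v).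
by have := free_invr u (word_inv w) v; rewrite word_invK. Qed.

End FreeCalculus.

Section Eval.
Context {G : groupType} {m : nat} (s : 'I_m -> G).
Implicit Types u v w : word m.

Lemma evalM u v : word_eval s (u ++ v) = (word_eval s u * word_eval s v)%g.
by rewrite /word_eval big_cat. Qed.
Lemma word_eval0 : word_eval s [::] = 1%g. by rewrite /word_eval big_nil. Qed.
Lemma word_eval1 a : word_eval s [:: a] = if a.2 then (s a.1)^-1%g else s a.1.
by rewrite /word_eval big_seq1. Qed.

Lemma evalV w : word_eval s (word_inv w) = ((word_eval s w)^-1)%g.
elim: w => [|a w IH]; first by rewrite word_eval0 invg1.
rewrite -cat1s word_inv_cat !evalM IH invgM; congr (_ * _)%g.
by rewrite !word_eval1 /=; case: a.2; rewrite ?invgK.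
Qed.

Lemma free_eq_eval u v : free_eq u v -> word_eval s u = word_eval s v.
elim=> {u v} [u v a|//|//|u v w _ -> _ ->//].
rewrite !evalM -[[:: a; _]]cat1s evalM -[[:: letter_inv a]]/(word_inv [:: a]).
by rewrite evalV mulgV mul1g.
Qed.

End Eval.

Section Area.
Context {m : nat} (rels : seq (word m)).
Implicit Types u v w : word m.

Definition area (N : nat) w := exists2 us, filling rels w us & (size us <= N)%N.
Lemma area_free N u v : free_eq u v -> area N v -> area N u.
by move=> uv [us [h f] N_us]; exists us => //; split=> //; apply: free_trans f. Qed.
Lemma areaW N M w : (N <= M)%N -> area N w -> area M w.
by move=> NM [us f h]; exists us => //; apply: leq_trans NM. Qed.
Lemma area_nil N : area N [::].
by exists [::] => //; split=> //; apply: free_refl. Qed.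

Lemma area_rel w : w \in rels -> area 1 w.
move=> wr; exists [:: ([::], w)] => //; split; first by rewrite /= wr.
by rewrite /conjugates_prod /= !cats0; apply: free_refl.
Qed.

Lemma area_cat N M u v : area N u -> area M v -> area (N + M) (u ++ v).
move=> [us [h f] N_us] [vs [h' f'] M_vs]; exists (us ++ vs); last by rewrite size_cat leq_add.
split; first by rewrite all_cat h.
by rewrite /conjugates_prod map_cat flatten_cat; apply: free_cat.
Qed.

Lemma area_conj N u w : area N w -> area N (word_inv u ++ w ++ u).
move=> [us [h f] N_us]; exists [seq (p.1 ++ u, p.2) | p <- us]; last by rewrite size_map.
split; first by rewrite all_map.
apply: free_trans (free_cong _ _ f) _ => {f h N_us}.
elim: us => [|p us IH]; first by have := free_invl [::] u [::]; rewrite !cats0.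
rewrite /conjugates_prod /= word_inv_cat -!catA.
rewrite -/(conjugates_prod us) -/(conjugates_prod [seq (p.1 ++ u, p.2) | p <- us]).
have := free_invr (word_inv u ++ word_inv p.1 ++ p.2 ++ p.1) u (conjugates_prod us ++ u).
rewrite -!catA => h; apply: free_trans (free_sym h) _ => {h}.
have := free_cong (word_inv u ++ word_inv p.1 ++ p.2 ++ p.1 ++ u) [::] IH.
by rewrite !cats0 -!catA.
Qed.

Lemma area_inv N w : area N w -> area N (word_inv w).
move=> [us [h f] N_us]; exists (rev [seq (p.1, word_inv p.2) | p <- us]); last first.
 by rewrite size_rev size_map.
split.
 rewrite all_rev all_map; apply: sub_all h => p /=.
 by rewrite word_invK orbC.
have inv_cong u v : free_eq u v -> free_eq (word_inv u) (word_inv v).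
 elim=> {u v} [u v a|u|u v _|u v x _ h1 _ h2].
 - rewrite !word_inv_cat -catA.
 have -> : word_inv [:: a; letter_inv a] = [:: a; letter_inv a].
 by case: a => i b; rewrite /word_inv /letter_inv/= negbK.
 exact: free_cancel.
 - exact: free_refl.
 - exact: free_sym.
 exact: free_trans h1 h2.
apply: free_trans (inv_cong _ _ f) _ => {f h N_us}; elim: us => [|p us IH].
 exact: free_refl.
rewrite /conjugates_prod /= rev_cons map_rcons -cats1 flatten_cat /= cats0.
rewrite !word_inv_cat word_invK -catA; apply: free_cat => //.
exact: free_refl.
Qed.

Definition homot N u v := area N (u ++ word_inv v).

Lemma homot_refl u : homot 0 u u.
apply: area_free (area_nil 0).
by have := free_invr [::] u [::]; rewrite !cats0.
Qed.

Lemma homot_trans N M u v w : homot N u v -> homot M v w -> homot (N + M) u w.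
move=> h h'; apply: area_free (area_cat h h').
by apply: free_sym; have := free_invl u v (word_inv w); rewrite -!catA.
Qed.

Lemma homot_cat N u v a b : homot N u v -> homot N (a ++ u ++ b) (a ++ v ++ b).
move=> h; apply: area_free (area_conj (word_inv a) h); rewrite !word_inv_cat word_invK -!catA.
by have := free_invr (a ++ u) b (word_inv v ++ word_inv a); rewrite -!catA.
Qed.

Lemma homot_catl N u v a : homot N u v -> homot N (a ++ u) (a ++ v).
by move=> /(homot_cat a [::]); rewrite !cats0. Qed.
Lemma homot_catr N u v b : homot N u v -> homot N (u ++ b) (v ++ b).
exact: (homot_cat [::]). Qed.

Lemma homot_area N M u v : homot N u v -> area M v -> area (N + M) u.
move=> h h'; apply: area_free (area_cat h h').
by apply: free_sym; have := free_invl u v [::]; rewrite !cats0 -catA.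
Qed.

End Area.

(** * From grids of group elements to areas of words *)

Section Strips.
Context {G : groupType} {m : nat} (rels : seq (word m)).
Variables (F : set G) (W : G -> word m) (K : nat).
Hypotheses (W1 : area rels K (W 1%g)) (WK : forall z1 z2 z3 z4, F z1 -> F z2 -> F z3 -> F z4 ->
 (z1 * z2 = z3 * z4)%g -> homot rels K (W z1 ++ W z2) (W z3 ++ W z4)).
Implicit Types g : nat -> G.

Fixpoint path_word g n : word m :=
 if n is j.+1 then path_word g j ++ W ((g j)^-1 * g j.+1)%g else [::].

Lemma path_word_ext g g' n : (forall i, (i <= n)%N -> g i = g' i) ->
 path_word g n = path_word g' n.
elim: n => //= n IH h; rewrite IH ?h// => i iN; exact/h/leqW.
Qed.

Lemma path_word_cat g n p : path_word g (n + p) = path_word g n ++ path_word (fun i => g (n + i)%N) p.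
elim: p => [|p IH]; first by rewrite addn0 cats0.
by rewrite addnS /= IH -catA addnS.
Qed.

Lemma path_word_eval (s : 'I_m -> G) g n :
 (forall i, (i < n)%N -> word_eval s (W ((g i)^-1 * g i.+1)%g) = ((g i)^-1 * g i.+1)%g) ->
 word_eval s (path_word g n) = ((g 0%N)^-1 * g n)%g.
elim: n => [|n IH] h /=; first by rewrite word_eval0 mulVg.
rewrite evalM h// IH => [|i iN]; last exact/h/leqW.
by rewrite -mulgA mulVKg.
Qed.

Lemma strip_homot g g' n : (forall i, (i < n)%N -> F ((g i)^-1 * g i.+1)%g) ->
 (forall i, (i < n)%N -> F ((g' i)^-1 * g' i.+1)%g) ->
 (forall i, (i <= n)%N -> F ((g i)^-1 * g' i)%g) ->
 homot rels (n * K) (path_word g n ++ W ((g n)^-1 * g' n)%g)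
 (W ((g 0%N)^-1 * g' 0%N)%g ++ path_word g' n).
elim: n => [|n IH] h h' v /=; first by rewrite cats0; apply: homot_refl.
rewrite mulSn -catA; apply: (homot_trans (v := path_word g n ++ W ((g n)^-1 * g' n)%g ++
 W ((g' n)^-1 * g' n.+1)%g)).
 apply: homot_catl; apply: WK; [exact: h|exact: v|exact/v/ltnW|exact: h'|].
 by rewrite -!mulgA !mulVKg.
rewrite !catA; apply: homot_catr; apply: IH => i iN; by [apply/h/ltnW|apply/h'/ltnW|apply/v/ltnW].
Qed.

Lemma strip_area g g' n N : (forall i, (i < n)%N -> F ((g i)^-1 * g i.+1)%g) ->
 (forall i, (i < n)%N -> F ((g' i)^-1 * g' i.+1)%g) ->
 (forall i, (i <= n)%N -> F ((g i)^-1 * g' i)%g) -> g 0%N = g n -> g' 0%N = g' n ->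
 area rels N (path_word g' n) -> area rels (n * K + N) (path_word g n).
move=> h h' v c c' a; have := strip_homot h h' v; rewrite c c'.
set V := W _ => hs; have := area_conj (word_inv V) a; rewrite word_invK => a'.
apply: homot_area a'; apply: (homot_trans (N := 0) (v := path_word g n ++ V ++ word_inv V)).
 rewrite /homot; apply: area_free (area_nil _ 0); rewrite !word_inv_cat word_invK.
 apply: free_trans (free_sym (free_invr _ V _)) _; rewrite -catA.
 have := free_invr [::] (path_word g n ++ V ++ word_inv V) [::].
 by rewrite !cats0 !word_inv_cat word_invK -!catA.
by have := homot_catr (word_inv V) hs; rewrite -!catA.
Qed.

(** Each cell is a square relation between elements of [F], at cost K. Consecutive rows are
    conjugate up to the n cells between them, and the last row is n copies of the word of 1. *)
Lemma grid_area (g : nat -> nat -> G) T n :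
 (forall t i, (t <= T)%N -> (i < n)%N -> F ((g t i)^-1 * g t i.+1)%g) ->
 (forall t i, (t < T)%N -> (i <= n)%N -> F ((g t i)^-1 * g t.+1 i)%g) ->
 (forall t, (t <= T)%N -> g t 0%N = g t n) -> (forall i, (i <= n)%N -> g T i = 1%g) ->
 area rels (T.+1 * (n * K)) (path_word (g 0%N) n).
move=> h v c gT.
have aT : area rels (n * K) (path_word (g T) n).
 elim: n gT {h v c} => [|n IH] gT; first exact: area_nil.
 rewrite mulSn addnC /= !gT// mulVg; apply: area_cat => //.
 by apply: IH => i iN; apply/gT/ltnW.
suff a t : (t <= T)%N -> area rels (t.+1 * (n * K)) (path_word (g (T - t)%N) n).
 by have := a T (leqnn _); rewrite subnn.
elim: t => [_|t IH tT]; first by rewrite subn0 mul1n.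
rewrite mulSn; have E : (T - t = (T - t.+1).+1)%N by lia.
apply: strip_area (IH (ltnW tT)).
- by move=> i iN; apply: h => //; lia.
- by move=> i iN; apply: h => //; lia.
- by move=> i iN; rewrite E; apply: v => //; lia.
- by apply: c; lia.
- by apply: c; lia.
Qed.

End Strips.

Section WordPath.
Context {G : groupType} {m : nat} (s : 'I_m -> G) (rels : seq (word m)).
Variables (W : G -> word m) (K : nat).
Hypotheses (W1 : area rels K (W 1%g)).

(** A word is compared with the path of its prefixes, slowed down by p. An index where the prefix
    does not grow costs the area of the word of 1, the others that of replacing one letter. *)
Lemma path_word_homot (w : word m) p i : (0 < p)%N ->
 (forall a, a \in w -> homot rels K [:: a] (W (word_eval s [:: a]))) ->
 homot rels (i * K) (take (i %/ p) w) (path_word W (fun j => word_eval s (take (j %/ p) w)) i).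
move=> p0 hw; elim: i => [|i IH]; first by rewrite div0n take0; apply: homot_refl.
rewrite mulSn addnC /=.
have hq : (i.+1 %/ p = i %/ p \/ i.+1 %/ p = (i %/ p).+1)%N.
 have h1 : (i %/ p <= i.+1 %/ p)%N by rewrite leq_div2r.
 have h2 : (i.+1 %/ p <= (i %/ p).+1)%N.
 have := leq_div2r p (leq_add (leqnn i) p0).
 by rewrite addn1 divnDr// divnn p0 addn1.
 by lia.
have W1' : homot rels K [::] (W 1%g) by rewrite /homot; apply: area_inv.
have none : homot rels (i * K + K) (take (i %/ p) w)
 (path_word W (fun j => word_eval s (take (j %/ p) w)) i ++ W ((word_eval s (take (i %/ p) w))^-1 *
 word_eval s (take (i %/ p) w))%g).
 rewrite mulVg; apply: homot_trans IH _.
 set P := path_word _ _ _.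
 by rewrite -[X in homot _ _ X]cats0; apply: homot_catl.
case: hq => -> //; have [qw|qw] := ltnP (i %/ p) (size w); last first.
 have -> : take (i %/ p).+1 w = take (i %/ p) w by rewrite !take_oversize// leqW.
 exact: none.
have [a0 _] : {a | a \in w} by case: w qw {hw IH none} => // a w _; exists a; rewrite mem_head.
rewrite (take_nth a0 qw) -cats1 evalM mulKg.
apply: homot_trans (homot_catr _ IH) _; apply: homot_catl; apply: hw.
by rewrite mem_nth.
Qed.

End WordPath.

Lemma finite_area (G : groupType) m (s : 'I_m -> G) rels (I : finType) (f : I -> word m) :
 (forall w, word_eval s w = 1%g -> exists us, filling rels w us) ->
 (forall i, word_eval s (f i) = 1%g) -> exists K, forall i, area rels K (f i).
move=> P f1; have [n hn] : {n : I -> nat & forall i, area rels (n i) (f i)}.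
 apply: (@choice _ _ (fun i n => area rels n (f i))) => i.
 by have [us fu] := P _ (f1 i); exists (size us), us.
exists (\max_i n i) => i; apply: areaW (hn i); exact: leq_bigmax.
Qed.

Lemma filling_eval (G : groupType) m (s : 'I_m -> G) rels w us :
 (forall u, u \in rels -> word_eval s u = 1%g) -> filling rels w us -> word_eval s w = 1%g.
move=> h [hus /(free_eq_eval s) ->]; elim: us hus => [_|p us IH]; first exact: word_eval0.
move=> /= /andP[hp hus]; rewrite /conjugates_prod /= evalM (IH hus) mulg1.
rewrite !evalM evalV.
have -> : word_eval s p.2 = 1%g.
 case/orP: hp => /h //; rewrite evalV => /(congr1 (fun x => x^-1)%g).
 by rewrite invgK invg1.
by rewrite mul1g mulVg.
Qed.

Lemma cube_above n : exists nu, [/\ (0 < nu)%N, (n <= nu ^ 3)%N & (nu ^ 3 <= 8 * n.+1)%N].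
elim: n => [|n [nu [nu0 h1 h2]]]; first by exists 1%N.
have [h|h] := leqP n.+1 (nu ^ 3); first by exists nu; split=> //; nia.
by exists nu.+1; split=> //; move: h1 h2 h; rewrite !expnS expn0; nia.
Qed.

(** * Upper bound for the Dehn function of the lattice of H *)

Section DiscreteUpper.
Context {R : realType} {r : nat} (r3 : (2 < r)%N).
Local Notation L := (filiprod int r true).

(** The grid is made in the real group and rounded. Its edges then lie in the finite box [F], so
    that for any finite presentation the squares have a common bound on their areas. *)
Lemma dehn_upper (P : finite_presentation L) : exists C : nat, forall n,
 (dehn R P n <= ((C * n.+1 ^ r)%N%:R)%:E)%E.
pose s := @gens L P; pose rels := @pres_rels L P.
have [lb hlb] : {f : 'I_(gens_rank P) * bool -> nat &
 forall a, small R (f a) (word_eval s [:: a])}.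
 by apply: (@choice _ _ (fun a n => small R n (word_eval s [:: a]))) => a; apply: small_bounded.
pose M := \max_a lb a.
have lM a : small R M (word_eval s [:: a]) by apply: smallW (hlb a); apply: leq_bigmax.
have M0 : 0 <= M%:R :> R by [].
have [B [m [C [B0 m0 hC]]]] := loop_grid r3 M0.
pose N := rstep (r := r) B; pose F : set L := small R N.
have [W hW] : {W : L -> word _ & forall z, word_eval s (W z) = z}.
 by apply: (@choice _ _ (fun z w => word_eval s w = z)) => z; exact: gensP.
have hP w : word_eval s w = 1%g -> exists us, filling rels w us by exact: (presP w).1.
have [K1 hK1] := @finite_area L _ s rels unit (fun=> W 1%g) hP (fun=> hW 1%g).
have [|K2 hK2] := @finite_area L _ s rels _ (fun a => [:: a] ++ word_inv (W (word_eval s [:: a]))) hP.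
 by move=> a; rewrite evalM evalV hW mulgV.
pose el (f : {ffun 'I_(3 + r) -> 'I_(N + N).+1}) : L := small_elt f.
(* Three sides in the box determine a square, so finitely many squares occur; the fourth side is
   computed from them. *)
have [|K3 hK3] := @finite_area L _ s rels _ (fun p : _ * _ * _ =>
 (W (el p.1.1) ++ W (el p.1.2)) ++
 word_inv (W (el p.2) ++ W ((el p.2)^-1 * (el p.1.1 * el p.1.2))%g)) hP.
 by move=> p; rewrite evalM evalV !evalM !hW mulVKg mulgV.
pose K := (K1 + K2 + K3)%N.
have W1 : area rels K (W 1%g) by apply: areaW (hK1 tt); rewrite /K; lia.
have WK z1 z2 z3 z4 : F z1 -> F z2 -> F z3 -> F z4 -> (z1 * z2 = z3 * z4)%g ->
 homot rels K (W z1 ++ W z2) (W z3 ++ W z4).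
 move=> /small_eltP[f1 <-] /small_eltP[f2 <-] /small_eltP[f3 <-] _ E.
 apply: areaW (_ : area rels K3 _); first by rewrite /K; lia.
 by have := hK3 ((f1, f2), f3); rewrite /= E mulKg.
have hl a : homot rels K [:: a] (W (word_eval s [:: a])).
 by apply: areaW (hK2 a); rewrite /K; lia.
(* The T + 1 strips and the comparison of w with its path amount to at most (C + 2) nu^(3(r-1)) rows
   of m nu^3 cells of area K; the factor 8^r comes from nu^3 <= 8 (n + 1). *)
exists (C.+2 * m * K * 8 ^ r)%N => n.
apply: ub_ereal_sup => _ [w [wn w1] <-].
have [nu [nu0 h1 h2]] := cube_above n.
have wnu : (size w <= nu ^ 3)%N by apply: leq_trans h1.
pose g i := word_eval s (take i w).
have g0 : g 0%N = 1%g by rewrite /g take0 word_eval0.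
have step i : near_by M%:R (embed (g i) : filiprod R r true) (embed (g i.+1)).
 rewrite /near_by -embedV -embedM /g; have [iw|iw] := ltnP i (size w); last first.
 by rewrite !take_oversize ?mulVg//; [exact: small1|exact: leqW].
 have [a0 _] : {a | a \in w} by case: (w) iw => // a w' _; exists a; rewrite mem_head.
 rewrite (take_nth a0 iw) -cats1 evalM mulKg; exact: lM.
have lg : loop_by M%:R (nu ^ 3) (fun i => embed (g i) : filiprod R r true).
 by split=> [i _|]; [exact: step|rewrite g0 /g take_oversize// w1].
have [|T TC [G [Gh Gv G0 GT]]] := hC nu _ nu0 lg; first by rewrite /= g0 embed1.
pose ga t i : L := rnd (G t i).
have aG : area rels (T.+1 * (m * nu ^ 3 * K)) (path_word W (ga 0%N) (m * nu ^ 3)).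
 apply: (grid_area (F := F) W1 WK).
 - by move=> t i tT im; apply: rnd_step => //; apply: (Gh t tT).1.
 - by move=> t i tT im; apply: rnd_step => //; apply: Gv.
 - by move=> t tT; rewrite /ga (Gh t tT).2.
 by move=> i im; rewrite /ga GT// -embed1 rnd_embed.
have E : path_word W (ga 0%N) (m * nu ^ 3) = path_word W (fun i => g (i %/ m)%N) (m * nu ^ 3).
 by apply: path_word_ext => i im; rewrite /ga G0// rnd_embed.
rewrite E in aG; have := path_word_homot W1 (m * nu ^ 3) m0 (fun a _ => hl a).
move=> /(_ w); rewrite mulKn// take_oversize// => hw.
have [us fu su] := homot_area hw aG.
apply: le_trans (ereal_inf_lbound _) _; first by exists us; [exact: fu|].
rewrite lee_fin ler_nat; apply: leq_trans su _.
have -> : (m * nu ^ 3 * K + T.+1 * (m * nu ^ 3 * K) = T.+2 * (m * nu ^ 3 * K))%N by rewrite mulSn.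
have T2 : (T.+2 <= C.+2 * nu ^ (3 * r.-1))%N.
 by have : (0 < nu ^ (3 * r.-1))%N; [rewrite expn_gt0 nu0|move: TC; nia].
apply: (@leq_trans (C.+2 * nu ^ (3 * r.-1) * (m * nu ^ 3 * K))); first by rewrite leq_mul2r T2 orbT.
have -> : (C.+2 * nu ^ (3 * r.-1) * (m * nu ^ 3 * K) = C.+2 * m * K * (nu ^ 3) ^ r)%N.
 have -> : ((nu ^ 3) ^ r = nu ^ (3 * r.-1) * nu ^ 3)%N.
 by rewrite -expnM -expnD; congr (_ ^ _)%N; move: r3; clear; lia.
 by move: (nu ^ (3 * r.-1))%N (nu ^ 3)%N => x y; clear; nia.
rewrite -[leqRHS]mulnA leq_mul2l -expnMn leq_exp2r ?h2 ?orbT//; exact: ltnW (ltnW r3).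
Qed.

End DiscreteUpper.

(** * Finite presentability *)

Section Presentation.
Context (R : realType) (r : nat) (e : bool) (r1 : (1 < r)%N).
Local Notation L := (filiprod int r e).
Local Notation Q := (filiprod R r e).
Let r0 : (0 < r)%N. exact: ltnW. Qed.
Let N := rstep (R := R) (r := r) 1.
Let I := {ffun 'I_(3 + r) -> 'I_(N + N).+1}.
Let s (i : 'I_#|I|) : L := small_elt (enum_val i).
(** A single letter for the elements of the generating box, the empty word elsewhere: the length is
    at most 1 in all cases, while the value is z only inside the box. *)
Let W (z : L) : word #|I| := if pselect (exists i, s i = z) is left h then [:: (projT1 (cid h), false)] else [::].
Let WE z : small R N z -> word_eval s (W z) = z.
move=> /small_eltP[f fz]; rewrite /W; case: pselect => [h|[]]; last first.
 by exists (enum_rank f); rewrite /s enum_rankK.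
by rewrite word_eval1 /=; case: (cid h).
Qed.
Let sW z : (size (W z) <= 1)%N. by rewrite /W; case: pselect. Qed.
Let size_path g n : (size (path_word W g n) <= n)%N.
by elim: n => //= n IH; rewrite size_cat (leq_trans (leq_add IH (sW _)))// addn1. Qed.
Let fine (z : L) : exists T0, forall T, (T0 < T)%N -> forall j, (j < T)%N ->
 near_by 1 (dil (j%:R / T%:R) (embed z : Q)) (dil (j.+1%:R / T%:R) (embed z)).
have [T0 h] := dil_cont (embed z : Q) r0; exists T0 => T TT j jT.
have T1 : 0 < T%:R :> R by rewrite ltr0n (leq_trans _ jT).
apply: h TT _ _ _; rewrite ?divr_ge0 ?ler_pdivrMr ?mul1r ?ler_nat ?(ltnW jT)//=.
by rewrite -mulrBl -natrB// subSnn mul1r ger0_norm ?invr_ge0.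
Qed.
Let finegen : exists2 m, (0 < m)%N & forall (a : 'I_#|I| * bool) j, (j < m)%N ->
 near_by 1 (dil (j%:R / m%:R) (embed (word_eval s [:: a]) : Q))
 (dil (j.+1%:R / m%:R) (embed (word_eval s [:: a]))).
have [T hT] := choice (fun a => fine (word_eval s [:: a])).
exists (\max_a T a).+1 => // a j jm; apply: hT => //.
by rewrite ltnS; apply: leq_bigmax.
Qed.
Let gen (x : L) : exists w, word_eval s w = x.
have [T0 h] := fine x; pose T := T0.+1.
pose g j : L := rnd (dil (j%:R / T%:R) (embed x : Q)).
have T1 : T%:R != 0 :> R by rewrite pnatr_eq0.
exists (path_word W g T); rewrite path_word_eval => [|i iT].
 by rewrite /g mul0r dil0// mulfV// dil1 rnd_embed -(embed1 (R := R)) rnd_embed invg1 mul1g.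
by apply: WE; apply: rnd_step => //; apply: h.
Qed.

(** The relators are all trivial words up to a certain length. A trivial word is first refined, each
    letter being replaced by its dilation path in m steps, and then dilated to 1; the rounded rows
    form a grid. Cells are words of length 4, and a letter with its refinement has length m + 1,
    whence the bound m + 4. *)
Lemma filiprod_fp : finitely_presented L.
have [m m0 hm] := finegen.
pose X := FiniteGenset gen.
pose rels : seq (word #|I|) := [seq w <- flatten [seq [seq tval t | t <- enum {: n.-tuple ('I_#|I| * bool)}] |
 n <- iota 0 (m + 4).+1] | word_eval s w == 1%g].
have relsE w : word_eval s w = 1%g -> (size w <= m + 4)%N -> w \in rels.
 move=> w1 sw; rewrite mem_filter w1 eqxx andTb; apply/flatten_mapP.
 exists (size w); first by rewrite mem_iota.
 by apply/mapP; exists (in_tuple w) => //; rewrite mem_enum.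
have rels1 w : w \in rels -> word_eval s w = 1%g by rewrite mem_filter => /andP[/eqP].
suff P w : word_eval X w = 1%g <-> exists us, filling rels w us by exists; exact: (FinitePresentation P).
split=> [w1|[us]]; last exact: filling_eval.
pose F : set L := small R N.
have W1 : area rels 1 (W 1%g).
 apply/area_rel/relsE; first exact/WE/small1.
 by apply: leq_trans (sW _) _; rewrite addnS.
have WK z1 z2 z3 z4 : F z1 -> F z2 -> F z3 -> F z4 -> (z1 * z2 = z3 * z4)%g ->
 homot rels 1 (W z1 ++ W z2) (W z3 ++ W z4).
 move=> f1 f2 f3 f4 E; apply/area_rel/relsE.
 by rewrite evalM evalV !evalM !WE// E mulgV.
 rewrite size_cat size_word_inv !size_cat.
 have := sW z1; have := sW z2; have := sW z3; have := sW z4; lia.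
pose n := size w; pose g i := word_eval s (take i w).
have g0 : g 0%N = 1%g by rewrite /g take0 word_eval0.
have gn i : (n <= i)%N -> g i = 1%g by move=> ni; rewrite /g take_oversize.
pose z q := ((g q)^-1 * g q.+1)%g.
have zE q : (q < n)%N -> exists2 a, take q.+1 w = take q w ++ [:: a] & z q = word_eval s [:: a].
 move=> qn; have [a0 _] : {a | a \in w} by move: qn; rewrite /n; case: (w) => // a w' _; exists a; rewrite mem_head.
 exists (nth a0 w q); first by rewrite (take_nth a0 qn) cats1.
 by rewrite /z /g (take_nth a0 qn) -cats1 evalM mulKg.
(* The refined loop: the prefix of length i / m, followed by the next letter dilated by the fraction
   of the step already made. *)
pose x i : Q := (embed (g (i %/ m)%N) * dil ((i %% m)%:R / m%:R) (embed (z (i %/ m)%N)))%g.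
have mR : m%:R != 0 :> R by rewrite pnatr_eq0 -lt0n.
have xm q : x (q * m)%N = embed (g q).
 by rewrite /x mulnK// modnMl mul0r dil0// mulg1.
have xE q j : (j <= m)%N -> x (q * m + j)%N = (embed (g q) * dil (j%:R / m%:R) (embed (z q)))%g.
 rewrite leq_eqVlt => /orP[/eqP ->|jm].
 by rewrite -mulSnr xm mulfV// dil1 -embedM mulVKg.
 by rewrite /x divnMDl// divn_small// addn0 modnMDl modn_small.
have xs i : (i < n * m)%N -> near_by 1 (x i) (x i.+1).
 move=> inm; rewrite (divn_eq i m) -addnS !xE ?(ltn_pmod, ltnW (ltn_pmod _ _))//.
 rewrite near_mull; have [|a _ ->] := zE (i %/ m)%N; first by rewrite ltn_divLR.
 by apply: hm; rewrite ltn_pmod.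
have [T0 hT] := choice (fun i => dil_cont (x i) r0).
pose T := (\max_(i < (n * m).+1) T0 i).+1.
have TR : T%:R != 0 :> R by rewrite pnatr_eq0.
pose si t : R := (T - t)%:R / T%:R.
have s01 t : 0 <= si t <= 1.
 by rewrite /si divr_ge0//= ler_pdivrMr// mul1r ler_nat leq_subr.
pose ga t i : L := rnd (dil (si t) (x i)).
have si0 : si 0%N = 1 by rewrite /si subn0 mulfV.
have aG : area rels (T.+1 * (n * m * 1)) (path_word W (ga 0%N) (n * m)).
 apply: (grid_area (F := F) W1 WK).
 - by move=> t i tT im; apply: rnd_step => //; apply: dil_near => //; apply: xs.
 - move=> t i tT im; apply: rnd_step => //; apply: (hT i T) => //.
 rewrite /T ltnS; exact: (@leq_bigmax _ (fun i : 'I_(n * m).+1 => T0 i) (Ordinal (im : i < (n * m).+1)%N)).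
 rewrite /si distrC -mulrBl -natrB; last by lia.
 have -> : (T - t - (T - t.+1) = 1)%N by lia.
 by rewrite mul1r ger0_norm ?invr_ge0.
 - by move=> t tT; rewrite /ga xm gn// -[0%N](mul0n m) xm g0.
 by move=> i im; rewrite /ga /si subnn mul0r dil0// -(embed1 (R := R)) rnd_embed.
have hw q : (q <= n)%N -> homot rels q (take q w) (path_word W (ga 0%N) (q * m)).
 elim: q => [_|q IH qn]; first by rewrite take0; apply: homot_refl.
 have [a -> za] := zE q qn.
 rewrite mulSnr path_word_cat -[q.+1]addn1.
 apply: homot_trans (homot_catr _ (IH (ltnW qn))) _; apply: homot_catl.
 apply/area_rel/relsE; last first.
 by rewrite size_cat size_word_inv /= add1n addnS ltnS (leq_trans (size_path _ _))// leq_addr.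
 rewrite evalM evalV path_word_eval => [|j jm].
 rewrite addn0 /ga !si0 !dil1 -mulSnr !xm !rnd_embed -[(_^-1 * _)%g]/(z q) za mulgV//.
 rewrite addnS; apply: WE; apply: rnd_step => //; rewrite si0 !dil1.
 by apply: xs; nia.
have := homot_area (hw n (leqnn _)) aG.
by rewrite take_oversize// => -[us fu _]; exists us.
Qed.

End Presentation.

(** * Lower bound for the Dehn function of the lattice of G *)

Section AlternatingPowers.
Context {S : comNzRingType}.
Implicit Types f : nat -> S.

Definition altsum r f := \sum_(j < r.+1) (-1) ^+ j * 'C(r, j)%:R * f j.

Lemma altsumS r f : altsum r.+1 f = altsum r f - altsum r (fun j => f j.+1).
have E : altsum r f = \sum_(j < r.+2) (-1) ^+ j * 'C(r, j)%:R * f j.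
 by rewrite big_ord_recr/= bin_small// mulr0 mul0r addr0.
rewrite E /altsum [LHS]big_ord_recl [X in _ = X - _]big_ord_recl /= !bin0 -addrA; congr (_ + _).
rewrite -sumrB; apply: eq_bigr => j _; rewrite /bump /= add1n binS natrD exprS; ring.
Qed.

(** The r-th finite difference of a monomial: it annihilates degrees below r and takes the value r!
    in degree r, up to sign. *)
Lemma altsum_exp r k : (k <= r)%N ->
 altsum r (fun j => j%:R ^+ k) = if k == r then (-1) ^+ r * (r`!)%:R else 0.
elim: r k => [|r IH] k; first by rewrite leqn0 => /eqP ->; rewrite /altsum big_ord1 !mul1r.
move=> kr; have E j : (j.+1%:R : S) ^+ k = \sum_(i < k.+1) 'C(k, i)%:R * j%:R ^+ i.
 rewrite -natr1 addrC exprDn; apply: eq_bigr => i _.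
 by rewrite expr1n mul1r -mulr_natl.
have E2 : altsum r (fun j => j.+1%:R ^+ k) =
 \sum_(i < k.+1) 'C(k, i)%:R * altsum r (fun j => j%:R ^+ i).
 rewrite /altsum; under eq_bigr do rewrite E mulr_sumr.
 rewrite exchange_big; apply: eq_bigr => i _; rewrite mulr_sumr; apply: eq_bigr => j _.
 by ring.
rewrite altsumS E2 big_ord_recr/= binn mul1r opprD addrCA subrr addr0.
case: k kr {E E2} => [|k]; first by rewrite big_ord0 oppr0.
rewrite ltnS eqSS => kr; rewrite big_ord_recr/= big1 => [|i _]; last first.
 by rewrite IH ?ltn_eqF ?mulr0//; [exact: leq_trans kr|exact/ltnW/(leq_trans _ kr)].
rewrite add0r IH//; case: eqP => [->|_]; last by rewrite mulr0 oppr0.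
by rewrite factS natrM binSn exprS; ring.
Qed.

End AlternatingPowers.

Section CentralExtension.
Context {R : realType} {r : nat} (r1 : (0 < r)%N).
Local Notation Q0 := (filiprod R r false).
Local Notation Q1 := (filiprod R r.+1 false).
Implicit Types (x y : Q1).
Local Notation zt := (zt (R := R) (r := r.+1) (e := false)).

Definition forget x : Q0 := mk (cA x) (cU x) (cV x) (\row_k cP x 0 (widen_ord (leqnSn r) k)).
Definition top x : R := cP x 0 ord_max.
Lemma cP_forget x k : cP (forget x) 0 k = cP x 0 (widen_ord (leqnSn r) k).
by rewrite cPmk mxE. Qed.

Lemma forgetM x y : forget (x * y)%g = (forget x * forget y)%g.
apply: filiprodP => [|||k].
- by rewrite cA_mul !cAmk cA_mul.
- by rewrite cU_mul !cUmk cU_mul.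
- by rewrite cV_mul !cVmk cV_mul.
rewrite [RHS]cP_mul !cP_forget cP_mul !mul0r !if_same !addr0 big_ord_recr/= bin_small ?mul0r ?mulr0 ?addr0//.
by congr (_ + _); apply: eq_bigr => j _; rewrite cP_forget cAmk.
Qed.

Lemma forget1 : forget 1%g = 1%g.
by apply: (mulgI (forget 1%g)); rewrite -forgetM !mulg1. Qed.
Lemma cP_zt (A : R) (k : 'I_r.+1) : cP (zt A) 0 k = ((k : nat) == r)%:R * A.
by rewrite cPmk !mxE eqSS mulrC. Qed.

Lemma mul_zt x (A : R) k : cP (x * zt A)%g 0 k = cP x 0 k + ((k : nat) == r)%:R * A.
rewrite cP_mul !mul0r if_same addr0 pascal_sum_top ?cP_zt// => j.
by rewrite cP_zt eqSS => /negPf ->; rewrite mul0r.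
Qed.

Lemma zt_central x (A : R) : (zt A * x = x * zt A)%g.
apply: filiprodP => [|||k]; rewrite ?cA_mul ?cU_mul ?cV_mul ?cAmk ?cUmk ?cVmk ?addr0 ?add0r//.
rewrite mul_zt cP_mul cAmk pascal_sum0 !mul0r if_same addr0 cP_zt addrC//.
Qed.

Lemma ztD (A B : R) : zt (A + B) = (zt A * zt B)%g.
apply: filiprodP => [|||k]; rewrite ?cA_mul ?cU_mul ?cV_mul ?cAmk ?cUmk ?cVmk ?addr0//.
by rewrite mul_zt !cP_zt mulrDr.
Qed.

Lemma zt0 : zt 0 = 1%g.
by apply: (mulgI (zt 0)); rewrite -ztD addr0 mulg1. Qed.
Lemma ztN (A : R) : zt (- A) = (zt A)^-1%g.
by apply: (mulgI (zt A)); rewrite -ztD subrr mulgV zt0. Qed.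

Lemma ztX (A : R) n : (zt A ^+ n)%g = zt (n%:R * A).
elim: n => [|n IH]; first by rewrite expg0 mul0r zt0.
by rewrite expgS IH -ztD; congr zt; rewrite -[n.+1%:R]natr1; ring.
Qed.

Lemma zt_shuffle x y z (A B C : R) :
 (x * zt A * (y * zt B * (z * zt C)) = x * y * z * zt (A + (B + C)))%g.
rewrite !ztD !mulgA; congr (_ * _)%g; rewrite -!mulgA; congr (x * _)%g.
rewrite zt_central -!mulgA; congr (y * _)%g.
by rewrite zt_central -mulgA -ztD addrC ztD.
Qed.

Lemma top_zt (A : R) : top (zt A) = A.
by rewrite /top cP_zt eqxx mul1r. Qed.

Lemma forget_eq x y : forget x = forget y -> x = (y * zt (top x - top y))%g.
move=> xy; apply: filiprodP => [|||k].
- by rewrite cA_mul !cAmk addr0; have := congr1 cA xy; rewrite !cAmk.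
- by rewrite cU_mul !cUmk addr0; have := congr1 cU xy; rewrite !cUmk.
- by rewrite cV_mul !cVmk addr0; have := congr1 cV xy; rewrite !cVmk.
rewrite mul_zt; have [kr|kr] := eqVneq (k : nat) r.
 by have -> : k = ord_max by [apply/val_inj]; rewrite mul1r addrC subrK.
have kr' : (k < r)%N by have := ltn_ord k; rewrite ltnS leq_eqVlt (negPf kr).
have -> : k = widen_ord (leqnSn r) (Ordinal kr') by apply/val_inj.
by rewrite -!cP_forget xy mul0r addr0.
Qed.

Lemma forget_ker x : forget x = 1%g -> x = zt (top x).
move=> x1; have := @forget_eq x 1%g; rewrite forget1 mul1g => /(_ x1) {1}->.
have [_ _ _ p] := coord1 (R := R) (r := r.+1) (e := false).
by rewrite /top p subr0.
Qed.

(** A set-theoretic section over the lattice, with last coordinate 0. It is used on generators only,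
    and its failure to be a homomorphism stays in the centre. *)
Definition lift (z : filiprod int r false) : Q1 := mk (cA z)%:~R (cU z)%:~R (cV z)%:~R
 (\row_k (if insub (k : nat) is Some k' then (cP z 0 (k' : 'I_r))%:~R else 0)).

Lemma forget_lift z : forget (lift z) = embed z.
apply: filiprodP => [|||k]; rewrite ?cAmk ?cUmk ?cVmk ?cA_embed ?cU_embed ?cV_embed//.
by rewrite cP_forget cPmk mxE cP_embed /= (insubT (fun k => (k < r)%N) (ltn_ord k)) /=;
 congr (cP z 0 _)%:~R; apply/val_inj.
Qed.

Definition elX (a : R) : Q1 := mk a 0 0 0.
Definition elY (c : R) : Q1 := mk 0 0 0 (c *: delta_mx 0 0).

Lemma elXX (a : R) n : (elX a ^+ n)%g = elX (n%:R * a).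
have [a1 u1 v1 p1] := coord1 (R := R) (r := r.+1) (e := false).
elim: n => [|n IH].
 by rewrite expg0; apply: filiprodP => [|||k]; rewrite ?a1 ?u1 ?v1 ?p1 ?cAmk ?cUmk ?cVmk ?cPmk ?mul0r ?mxE.
rewrite expgS IH; apply: filiprodP => [|||k]; rewrite ?cA_mul ?cU_mul ?cV_mul ?cAmk ?cUmk ?cVmk ?addr0//.
 by rewrite -[n.+1%:R]natr1; ring.
by rewrite cP_mul !cPmk cUmk cVmk mulr0 if_same addr0 big1 ?addr0// => j _; rewrite mxE mul0r.
Qed.

Lemma mul_elX x (a : R) k : cP (x * elX a)%g 0 k = cP x 0 k.
rewrite cP_mul !mul0r if_same addr0 big1 ?addr0// => j _.
by rewrite cPmk mxE mul0r.
Qed.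

Lemma mul_elY x (c : R) k : cP (x * elY c)%g 0 k = cP x 0 k + c * cA x ^+ k.
rewrite cP_mul cPmk !mul0r if_same addr0 (bigD1 ord0)//= big1 => [|j /negPf j0].
 by rewrite bin0 subn0 !mxE !eqxx mul1r addr0 mulr1.
by rewrite !mxE j0 andbF mulr0 mul0r.
Qed.

Lemma elYX (c : R) n : (elY c ^+ n)%g = elY (n%:R * c).
have [a1 u1 v1 p1] := coord1 (R := R) (r := r.+1) (e := false).
elim: n => [|n IH].
 by rewrite expg0; apply: filiprodP => [|||k]; rewrite ?a1 ?u1 ?v1 ?p1 ?cAmk ?cUmk ?cVmk ?cPmk ?mul0r ?scale0r ?mxE.
rewrite expgSr IH; apply: filiprodP => [|||k]; rewrite ?cA_mul ?cU_mul ?cV_mul ?cAmk ?cUmk ?cVmk ?addr0//.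
rewrite mul_elY cAmk !cPmk !mxE /= -[n.+1%:R]natr1 mulrDl mul1r mulrDl; congr (_ + _).
by case: k => [[|k] lt] /=; rewrite ?expr0 ?exprS ?mul0r// mulr0.
Qed.

Section Presented.
Variable (P : finite_presentation (filiprod int r false)).
Let s := @gens _ P.
Let rels := @pres_rels _ P.
Let s' i : Q1 := lift (s i).
Let forget_eval w : forget (word_eval s' w) = embed (word_eval s w).
elim: w => [|a w IH]; first by rewrite !word_eval0 forget1 embed1.
rewrite -cat1s !evalM forgetM embedM IH; congr (_ * _)%g.
rewrite !word_eval1; case: a.2; last exact: forget_lift.
apply: (mulgI (forget (s' a.1))); rewrite -forgetM mulgV forget1 forget_lift -embedM mulgV embed1//.
Qed.
Let trivial_eval w : word_eval s w = 1%g -> word_eval s' w = zt (top (word_eval s' w)).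
by move=> w1; apply: forget_ker; rewrite forget_eval w1 embed1. Qed.
Let C : R := \sum_(u <- rels) `|top (word_eval s' u)| + 1.
Let C0 : 0 < C. by rewrite ltr_wpDl// sumr_ge0. Qed.
Let rels1 u : u \in rels -> word_eval s u = 1%g.
move=> ur; apply/(presP (f := P) u).2; exists [:: ([::], u)]; split; first by rewrite /= ur.
by rewrite /conjugates_prod /= !cats0; apply: free_refl.
Qed.
Let rels_top u : (u \in rels) || (word_inv u \in rels) ->
 exists2 A : R, word_eval s' u = zt A & `|A| <= C.
have h u' : u' \in rels -> `|top (word_eval s' u')| <= C.
 move=> ur; rewrite /C (perm_big _ (perm_to_rem ur))/= big_cons -addrA lerDl.
 by rewrite addr_ge0// sumr_ge0.
case/orP=> ur; first by exists (top (word_eval s' u)); [exact/trivial_eval/rels1|exact: h].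
exists (- top (word_eval s' (word_inv u))); last by rewrite normrN; apply: h.
by rewrite ztN -trivial_eval ?rels1// evalV invgK.
Qed.
(** Central values are unchanged by conjugation and add up in a product, so a filling by k relators
    bounds the last coordinate of the lift by k C. *)
Let filling_top w us : filling rels w us -> `|top (word_eval s' w)| <= (size us)%:R * C.
move=> [hus /(free_eq_eval s') ->].
suff [A -> AC] : exists2 A : R, word_eval s' (conjugates_prod us) = zt A & `|A| <= (size us)%:R * C.
 by rewrite top_zt.
elim: us hus => [_|p us IH /= /andP[hp hus]].
 by exists 0; [rewrite word_eval0 zt0|rewrite normr0 mul0r].
have [A EA AC] := IH hus; have [A' EA' AC'] := rels_top hp.
exists (A' + A); last first.
 apply: normD_le; apply: le_trans (lerD AC' AC) _.
 by rewrite -natr1 mulrDl mul1r addrC.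
rewrite /conjugates_prod /= evalM EA !evalM evalV EA'.
by rewrite zt_central mulKg -ztD.
Qed.
Let wpow n (w : word (gens_rank P)) := flatten (nseq n w).
Let wpowE n w : word_eval s' (wpow n w) = (word_eval s' w ^+ n)%g.
by elim: n => [|n IH]; rewrite ?word_eval0// /wpow /= evalM IH expgS. Qed.
Let size_wpow n w : size (wpow n w) = (n * size w)%N.
by elim: n => // n IH; rewrite /wpow /= size_cat IH mulSn. Qed.

(** Words representing x and y lift to the expected elements only up to central errors [al] and
    [be]. The word is balanced in x and in y, so the errors disappear and its lift has last
    coordinate n^(r+1) r! up to sign. *)
Lemma dehn_lower : exists (L D : nat), (0 < D)%N /\ forall n,
 (((n ^ r.+1)%:R / D%:R)%:E <= dehn R P (L * n))%E.
have [wx hx] := gensP P (mk 1 0 0 0); have [wy hy] := gensP P (mk 0 0 0 (delta_mx 0 (Ordinal r1))).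
have [al EX] : exists al : R, word_eval s' wx = (elX 1 * zt al)%g.
 eexists; apply: forget_eq; rewrite forget_eval [word_eval _ _]hx.
 by apply: filiprodP => [|||k]; rewrite ?cA_embed ?cU_embed ?cV_embed ?cAmk ?cUmk ?cVmk//
 cP_embed cP_forget !cPmk !mxE.
have [be EY] : exists be : R, word_eval s' wy = (elY 1 * zt be)%g.
 eexists; apply: forget_eq; rewrite forget_eval [word_eval _ _]hy.
 apply: filiprodP => [|||k]; rewrite ?cA_embed ?cU_embed ?cV_embed ?cAmk ?cUmk ?cVmk//.
 rewrite cP_embed cP_forget !cPmk !mxE /= mul1r -!val_eqE /=.
 by case: (k : nat).
pose c j : R := (-1) ^+ j * 'C(r, j)%:R.
pose Y n j := wpow (n * 'C(r, j)) (if odd j then word_inv wy else wy).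
pose W n i := flatten [seq Y n j ++ wpow n wx | j <- seq.iota 0 i].
have EXn n : word_eval s' (wpow n wx) = (elX n%:R * zt (n%:R * al))%g.
 by rewrite wpowE EX expgMn; [rewrite elXX mulr1 ztX|exact/esym/zt_central].
have EYn n j : word_eval s' (Y n j) = (elY (n%:R * c j) * zt (n%:R * c j * be))%g.
 rewrite /Y wpowE; have -> : word_eval s' (if odd j then word_inv wy else wy) =
 (elY ((-1) ^+ j) * zt ((-1) ^+ j * be))%g.
 rewrite -(signr_odd _ j); case: odd; rewrite ?expr0 ?expr1 ?mul1r ?EY//.
 rewrite evalV EY invgM -ztN mulN1r zt_central; congr (_ * _)%g.
 apply: (mulgI (elY 1)); rewrite mulgV.
 have [a1 u1 v1 p1] := coord1 (R := R) (r := r.+1) (e := false).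
 apply: filiprodP => [|||k]; rewrite ?cA_mul ?cU_mul ?cV_mul ?cAmk ?cUmk ?cVmk ?a1 ?u1 ?v1 ?addr0//.
 rewrite p1 mul_elY cAmk cPmk !mxE mul1r /=; case: k => [[|k] lt] /=; rewrite ?expr0 ?mulr1 ?subrr//.
 by rewrite exprS mul0r mulr0 addr0.
 rewrite expgMn; last exact/esym/zt_central.
 by rewrite elYX ztX /c natrM; congr (elY _ * zt _)%g; ring.
have EW n i : exists2 A : R, A = \sum_(j < i) (n%:R * c j * be + n%:R * al) &
 word_eval s' (W n i) = (mk (n%:R * i%:R) 0 0 (\row_k \sum_(j < i) n%:R * c j * (n%:R * j%:R) ^+ k) * zt A)%g.
 elim: i => [|i [A AE IH]].
 exists 0; first by rewrite big_ord0.
 have [a1 u1 v1 p1] := coord1 (R := R) (r := r.+1) (e := false).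
 by rewrite word_eval0 zt0 mulg1; apply: filiprodP => [|||k];
 rewrite ?a1 ?u1 ?v1 ?p1 ?cAmk ?cUmk ?cVmk ?cPmk ?mulr0// mxE big_ord0.
 exists (A + (n%:R * c i * be + n%:R * al)); first by rewrite big_ord_recr/= AE.
 rewrite /W -[i.+1]addn1 seq.iotaD map_cat flatten_cat /= cats0 add0n evalM -/(W n i) IH.
 rewrite evalM EXn EYn zt_shuffle; congr (_ * _)%g.
 apply: filiprodP => [|||k]; rewrite ?cA_mul ?cU_mul ?cV_mul ?cAmk ?cUmk ?cVmk ?addr0//.
 by rewrite natrD; ring.
 rewrite mul_elX mul_elY cAmk !cPmk !mxE addn1 big_ord_recr/=.
 by congr (_ + _); ring.
have altE n (k : 'I_r.+1) : \sum_(j < r.+1) n%:R * c j * (n%:R * j%:R) ^+ k =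
 n%:R ^+ k.+1 * altsum r (fun j => j%:R ^+ k) :> R.
 by rewrite /altsum mulr_sumr; apply: eq_bigr => j _; rewrite /c exprMn exprS; ring.
pose w n := W n r.+1 ++ wpow (n * r.+1) (word_inv wx).
have Ew n : word_eval s' (w n) =
 mk 0 0 0 (\row_k (n%:R ^+ k.+1 * altsum r (fun j => j%:R ^+ k))).
 have [A AE EA] := EW n r.+1; rewrite evalM {}EA wpowE evalV expVgn -wpowE EXn.
 (* The errors of y cancel because the coefficients c_j sum to 0, which is the finite difference of
    degree 0; those of x are undone by the final power of x^-1. *)
 have -> : A = (n * r.+1)%:R * al.
 rewrite AE big_split/= -mulr_suml -mulr_sumr sumr_const card_ord -[X in _ + X]mulr_natl.
 have -> : \sum_(j < r.+1) c j = altsum r (fun j => j%:R ^+ 0).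
 by apply: eq_bigr => j _; rewrite expr0 mulr1.
 by rewrite altsum_exp// eq_sym gtn_eqF// mulr0 mul0r add0r natrM; ring.
 have -> : mk (n%:R * r.+1%:R) 0 0 (\row_k \sum_(j < r.+1) n%:R * c j * (n%:R * j%:R) ^+ k) =
 ((mk 0 0 0 (\row_k (n%:R ^+ k.+1 * altsum r (fun j => j%:R ^+ k))) : Q1)%R * elX (n * r.+1)%:R)%g.
 apply: filiprodP => [|||k]; rewrite ?cA_mul ?cU_mul ?cV_mul ?cAmk ?cUmk ?cVmk ?addr0//.
 by rewrite natrM add0r.
 by rewrite mul_elX !cPmk !mxE altE.
 by rewrite -[(_ * elX _ * zt _)%g]mulgA mulgK.
have triv n : word_eval s (w n) = 1%g.
 apply: (@embed_inj R); rewrite -forget_eval Ew embed1.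
 have [a1 u1 v1 p1] := coord1 (R := R) (r := r) (e := false).
 apply: filiprodP => [|||k]; rewrite ?cAmk ?cUmk ?cVmk ?a1 ?u1 ?v1// cP_forget cPmk mxE p1.
 rewrite altsum_exp/=; last exact/ltnW/ltn_ord.
 by rewrite ltn_eqF ?mulr0.
pose L := (\sum_(j < r.+1) ('C(r, j) * size wy + size wx) + r.+1 * size wx)%N.
have sw n : size (w n) = (L * n)%N.
 rewrite size_cat size_wpow size_word_inv /L mulnDl; congr (_ + _)%N; last by lia.
 rewrite /W size_flatten /shape -map_comp sumnE big_map -(big_mkord xpredT (fun j => 'C(r, j) * size wy + size wx)%N).
 rewrite big_distrl/= /index_iota subn0; apply: eq_bigr => j _.
 by rewrite size_cat !size_wpow; case: odd; rewrite ?size_word_inv; lia.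
exists L, (Num.trunc C).+1; split=> // n.
apply: le_trans (ereal_sup_ubound _); last first.
 by exists (w n); [split; [rewrite sw|exact: triv]|].
apply: le_ereal_inf_tmp => _ [us fu <-]; rewrite lee_fin ler_pdivrMr ?ltr0n//.
have /andP[_ C1] := Num.Theory.trunc_itv (ltW C0).
apply: (@le_trans _ _ ((size us)%:R * C)); last by rewrite ler_wpM2l// ltW.
apply: le_trans (filling_top fu); rewrite Ew /top cPmk mxE altsum_exp ?eqxx//=.
rewrite normrM normrMsign normrX !normr_nat natrX ler_peMr// ?exprn_ge0// ler1n fact_gt0//.
Qed.

End Presented.
End CentralExtension.

Lemma leq_expl a b n : (a <= b)%N -> (a ^ n <= b ^ n)%N.
by move=> ab; elim: n => // n IH; rewrite !expnS leq_mul. Qed.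

(** With all constants collected in M, the two bounds at n = M + 1 would give (M + 1)^(r+1) <= M (M
    + 1)^r. *)
Lemma growth_gap (R : realType) (r L D C : nat) (f g : nat -> \bar R) : (0 < D)%N ->
 (forall n, (((n ^ r.+1)%:R / D%:R)%:E <= f (L * n)%N)%E) ->
 (forall n, (0 <= g n)%E) -> (forall n, (g n <= (C * n.+1 ^ r)%:R%:E)%E) -> ~ growth_le f g.
move=> D0 hf g0 hg [A hA].
pose K := (A * L + A + 1)%N; pose M := (D * (A * C * K ^ r + A))%N.
have M1 := hf M.+1; have := le_trans M1 (le_trans (lee_abs _) (hA _)).
have hgn := hg (A * (L * M.+1) + A)%N.
rewrite gee0_abs// => h.
have {h}h := le_trans h (leeD (lee_wpmul2l (lee0n A) hgn) (lexx _)).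
move: h; rewrite -EFinM -EFinD lee_fin -natrM -natrD ler_pdivrMr ?ltr0n// -natrM ler_nat.
have hK : ((A * (L * M.+1) + A).+1 <= K * M.+1)%N by rewrite /K; nia.
move=> h; have : (M.+1 ^ r.+1 <= M * M.+1 ^ r)%N.
 apply: leq_trans h _; rewrite /M -[leqRHS]mulnA [leqLHS]mulnC leq_mul2l; apply/orP; right.
 apply: (@leq_trans (A * (C * (K * M.+1) ^ r) + A)).
 by rewrite leq_add2r !leq_mul2l; rewrite leq_expl ?orbT.
 rewrite expnMn mulnDl; apply: leq_add; first by rewrite !mulnA.
 by rewrite leq_pmulr// expn_gt0.
by rewrite expnS leq_pmul2r ?expn_gt0// ltnn.
Qed.

Lemma dehn_ge0 (R : realType) (G : groupType) (P : finite_presentation G) n : (0 <= dehn R P n)%E.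
apply: le_trans (ereal_sup_ubound _); last first.
 by exists [::]; [split=> //; rewrite word_eval0|reflexivity].
by apply: le_ereal_inf_tmp => _ [us _ <-]; rewrite lee_fin.
Qed.

(** * Ultralimits and asymptotic cones up to sublinear errors *)

Section UltraLimits.
Context {R : realType} (F : set_system nat) (FU : UltraFilter F) (FN : nonprincipal F).
Implicit Types (u v : nat -> R).
Let FP : ProperFilter F := @ultra_proper _ _ FU.
Local Existing Instance FP.

Lemma ultra_bounded_cvg u (M : R) : (\forall n \near F, `|u n| <= M) -> cvg (u n @[n --> F]).
move=> uM; have FuP : ProperFilter (u n @[n --> F]) by exact: fmap_proper_filter.
have [|l [_ cl]] := @segment_compact R (- M) M _ FuP.
 by apply: filterS uM => n; rewrite /= in_itv/= ler_norml.
apply/cvg_ex; exists l => V Vl; have [//|hV] := in_ultra_setVsetC (u @^-1` V) FU.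
by have [z [/= zV]] := cl _ _ (hV : fmap u F (~` V)) Vl.
Qed.

Lemma ultra_ge (k : nat) : \forall n \near F, (k <= n)%N.
elim: k => [|k IH]; first by apply: filterE.
have [/FN//|h] := in_ultra_setVsetC [set k] FU.
by apply: filterS (filterI IH h) => n [/= kn nk]; rewrite ltn_neqAle kn andbT; apply/eqP => /esym.
Qed.

(** After division by n the error ep S(n) is at most ep CS and M is negligible; as ep is arbitrary,
    both vanish in the limit. *)
Lemma ultra_le (D D' S : nat -> R) (C CS : R) :
 (forall ep, 0 < ep -> exists M, forall n, D' n <= C * D n + ep * S n + M) ->
 (\forall n \near F, S n <= CS * n%:R) ->
 cvg (D n / n%:R @[n --> F]) -> cvg (D' n / n%:R @[n --> F]) ->
 lim (D' n / n%:R @[n --> F]) <= C * lim (D n / n%:R @[n --> F]).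
move=> h hS cD cD'; apply/ler_addgt0Pr => ep ep0.
pose ep' := ep / 2 / (`|CS| + 1).
have CS1 : 0 < `|CS| + 1 by rewrite ltr_wpDl.
have ep'0 : 0 < ep' by rewrite /ep' divr_gt0// divr_gt0.
have [M hM] := h _ ep'0.
pose k := (Num.trunc (`|M| / (ep / 2))).+1.
have cg : (C * (D n / n%:R) + ep) @[n --> F] --> C * lim (D n / n%:R @[n --> F]) + ep.
 by apply: cvgD; [apply: cvgM => //; exact: cvg_cst|exact: cvg_cst].
apply: ler_cvg_to cD' cg _.
near=> n.
have n0 : 0 < n%:R :> R by rewrite ltr0n; near: n; exact: ultra_ge.
rewrite ler_pdivrMr// mulrDl mulrA divfK ?gt_eqF//.
have Sn : S n <= CS * n%:R by near: n.
have e1 : ep' * S n <= ep / 2 * n%:R.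
 apply: (@le_trans _ _ (ep' * ((`|CS| + 1) * n%:R))); last by rewrite mulrA divfK ?gt_eqF.
 rewrite ler_wpM2l ?(ltW ep'0)//; apply: le_trans Sn _; rewrite ler_wpM2r ?(ltW n0)//.
 by apply: le_trans (ler_norm _) _; rewrite lerDl.
have e2 : M <= ep / 2 * n%:R.
 apply: le_trans (ler_norm _) _; rewrite mulrC -ler_pdivrMr ?divr_gt0//.
 have kn : k%:R <= n%:R :> R by rewrite ler_nat; near: n; exact: ultra_ge.
 apply: le_trans kn; apply/ltW.
 by have /andP[] := Num.Theory.trunc_itv (divr_ge0 (normr_ge0 M) (ltW (divr_gt0 ep0 (ltr0n _ 2)))).
apply: le_trans (hM n) _; rewrite -addrA lerD2l; apply: le_trans (lerD e1 e2) _.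
by rewrite -mulrDl -splitr.
Unshelve. all: by end_near.
Qed.

End UltraLimits.

Section CoarseCones.
Context {R : realType} {X : Type} (e : X).
Implicit Types d : X -> X -> R.

(** The axioms of a metric up to constants. They are stable under comparison with a count of steps,
    which yields them for word and Riemannian distances at once, and they suffice to control
    ultralimits. *)
Definition coarse_metric d := exists C : R, [/\ 0 <= C, forall x y, 0 <= d x y, forall x, d x x <= C,
 forall x y, d y x <= C * (d x y + 1) & forall x y z, d x z <= C * (d x y + d y z + 1)].

(* Comparability up to an error that is sublinear in the distance to e. *)
Definition dominated d d' := exists2 C : R, 0 <= C & forall ep, 0 < ep -> exists M,
 forall x y, d' x y <= C * d x y + ep * (d e x + d e y) + M.

Section Fixed.
Variables (F : set_system nat).
Hypotheses (FU : UltraFilter F) (FN : nonprincipal F).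
Let FP : ProperFilter F := @ultra_proper _ _ FU.
Local Existing Instance FP.

Lemma cone_cvg d x y : coarse_metric d -> cone_seq d e F x -> cone_seq d e F y ->
 cvg (d (x n) (y n) / n%:R @[n --> F]).
move=> [C [C0 d0 _ ds dt]] [Cx hx] [Cy hy].
apply: (@ultra_bounded_cvg _ F FU _ (C * (C * (`|Cx| + 1) + `|Cy| + 1))).
near=> n; have n1 : 1 <= n%:R :> R by rewrite ler1n; near: n; exact: (ultra_ge FU FN).
have n0 : 0 < n%:R :> R by apply: lt_le_trans n1.
rewrite ger0_norm ?divr_ge0 ?d0 ?(ltW n0)// ler_pdivrMr//.
apply: le_trans (dt _ e _) _; rewrite -mulrA ler_wpM2l//.
have hxn : d e (x n) <= Cx * n%:R by near: n.
have hyn : d e (y n) <= Cy * n%:R by near: n.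
rewrite !mulrDl mul1r; apply: lerD => //; apply: lerD.
 apply: le_trans (ds _ _) _; rewrite -mulrA ler_wpM2l// mulrDl mul1r lerD//.
 by apply: le_trans hxn _; rewrite ler_wpM2r ?(ltW n0)// ler_norm.
by apply: le_trans hyn _; rewrite ler_wpM2r ?(ltW n0)// ler_norm.
Unshelve. all: by end_near.
Qed.

Lemma cone_seq_dominated d d' x : coarse_metric d -> dominated d d' ->
 cone_seq d e F x -> cone_seq d' e F x.
move=> [C [C0 d0 dr _ _]] [K K0 h] [Cx hx]; have [M hM] := h 1 ltr01.
exists ((K + 1) * `|Cx| + `|C + M|); near=> n.
have n1 : 1 <= n%:R :> R by rewrite ler1n; near: n; exact: (ultra_ge FU FN).
have hxn : d e (x n) <= Cx * n%:R by near: n.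
have hxn' : d e (x n) <= `|Cx| * n%:R.
 by apply: le_trans hxn _; rewrite ler_wpM2r// ler_norm.
apply: le_trans (hM _ _) _; rewrite mul1r mulrDl -mulrA.
have : C + M <= `|C + M| * n%:R.
 by apply: le_trans (ler_norm _) _; rewrite ler_peMr.
have := dr e; have := ler_wpM2l K0 hxn'; rewrite mulrDl mul1r; move: hxn'; lra.
Unshelve. all: by end_near.
Qed.

Lemma ultradist_dominated d d' (C : R) x y : coarse_metric d -> coarse_metric d' ->
 (forall ep, 0 < ep -> exists M, forall x y, d' x y <= C * d x y + ep * (d e x + d e y) + M) ->
 cone_seq d e F x -> cone_seq d e F y -> cone_seq d' e F x -> cone_seq d' e F y ->
 ultradist d' F x y <= C * ultradist d F x y.
move=> cd cd' h hx hy hx' hy'; have [Cx hCx] := hx; have [Cy hCy] := hy.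
apply: (@ultra_le _ F FU FN _ _ (fun n => d e (x n) + d e (y n)) _ (Cx + Cy)).
- by move=> ep ep0; have [M hM] := h ep ep0; exists M => n.
- by apply: filterS2 hCx hCy => n h1 h2; rewrite mulrDl lerD.
- exact: cone_cvg.
exact: cone_cvg.
Qed.

Lemma ultradist_ge0 d x y : coarse_metric d -> cone_seq d e F x -> cone_seq d e F y ->
 0 <= ultradist d F x y.
move=> cd hx hy; have [C [_ d0 _ _ _]] := cd.
apply: limr_ge; first exact: cone_cvg.
by apply: filterE => n; rewrite divr_ge0.
Qed.

Lemma ultradist_triangle d : coarse_metric d -> exists2 C : R, 0 <= C &
 (forall x y, cone_seq d e F x -> cone_seq d e F y -> ultradist d F y x <= C * ultradist d F x y) /\
 (forall x y z, cone_seq d e F x -> cone_seq d e F y -> cone_seq d e F z ->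
 ultradist d F x z <= C * (ultradist d F x y + ultradist d F y z)) .
move=> cd; have [C [C0 d0 dr ds dt]] := cd; exists C => //; split=> [x y hx hy|x y z hx hy hz].
 apply: (@ultra_le _ F FU FN _ _ (fun=> 0) _ 0); [|by apply: filterE => n; rewrite mul0r|exact: cone_cvg..].
 by move=> ep ep0; exists C => n; rewrite mulr0 addr0; apply: le_trans (ds _ _) _; rewrite mulrDr mulr1.
have E : lim ((d (x n) (y n) + d (y n) (z n)) / n%:R @[n --> F]) =
 ultradist d F x y + ultradist d F y z.
 apply/cvg_lim; first exact: Rhausdorff.
 by under eq_fun do rewrite mulrDl; apply: cvgD; apply: cone_cvg.
rewrite -E; apply: (@ultra_le _ F FU FN _ _ (fun=> 0) _ 0); [|by apply: filterE => n; rewrite mul0r| |exact: cone_cvg].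
 by move=> ep ep0; exists C => n; rewrite mulr0 addr0; apply: le_trans (dt _ (y n) _) _; rewrite mulrDr mulr1.
apply/cvg_ex; exists (ultradist d F x y + ultradist d F y z).
by under eq_fun do rewrite mulrDl; apply: cvgD; apply: cone_cvg.
Qed.

Lemma ultradist_refl d x : coarse_metric d -> cone_seq d e F x -> ultradist d F x x = 0.
move=> cd hx; have [C [C0 d0 dr ds dt]] := cd.
apply: le_anti; rewrite ultradist_ge0// andbT -[leRHS](mul0r (ultradist d F x x)).
apply: (@ultra_le _ F FU FN _ _ (fun=> 0) _ 0); [|by apply: filterE => n; rewrite mul0r|exact: cone_cvg..].
by move=> ep ep0; exists C => n; rewrite mul0r mulr0 !add0r.
Qed.

Lemma cone_class_dominated d d' x : coarse_metric d -> coarse_metric d' ->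
 dominated d d' -> dominated d' d -> cone_seq d e F x -> cone_class d e F x `<=` cone_class d' e F x.
move=> cd cd' dd' d'd hx y [hy xy].
have hx' := cone_seq_dominated cd dd' hx; have hy' := cone_seq_dominated cd dd' hy.
split=> //; have [C C0 h] := dd'.
have := ultradist_dominated cd cd' h hx hy hx' hy'; rewrite xy mulr0 => le0.
by apply: le_anti; rewrite le0 ultradist_ge0.
Qed.

Lemma cone_is_cone d d' (A : set (nat -> X)) : coarse_metric d -> coarse_metric d' ->
 dominated d d' -> dominated d' d ->
 (exists2 x, cone_seq d e F x & A = cone_class d e F x) ->
 (exists2 x, cone_seq d' e F x & A = cone_class d' e F x).
move=> cd cd' dd' d'd [x hx ->]; exists x; first exact: cone_seq_dominated hx.
rewrite eqEsubset; split; first exact: cone_class_dominated.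
by apply: cone_class_dominated => //; exact: cone_seq_dominated hx.
Qed.

(** The representatives chosen in one class for the two distances may differ. Passing between them
    takes two triangle inequalities, hence the factor K^2. *)
Lemma cone_repr_dist d d' : coarse_metric d -> coarse_metric d' ->
 dominated d d' -> dominated d' d -> exists2 C : R, 0 <= C &
 forall (a b : cone d e F) (a' b' : cone d' e F), proj1_sig a = proj1_sig a' ->
 proj1_sig b = proj1_sig b' -> cone_dist a' b' <= C * cone_dist a b.
move=> cd cd' dd' d'd; have [C C0 h] := dd'.
have [K K0 [ks kt]] := ultradist_triangle cd.
exists (C * (K * K)); first by rewrite !mulr_ge0.
move=> a b a' b' aa' bb'; rewrite /cone_dist.
have rp (D : X -> X -> R) (c : cone D e F) : cone_seq D e F (cone_repr c) /\
 proj1_sig c = cone_class D e F (cone_repr c).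
 by rewrite /cone_repr; case: cid2.
have [ha Ea] := rp d a; have [hb Eb] := rp d b.
have [ha' Ea'] := rp d' a'; have [hb' Eb'] := rp d' b'.
have hA : cone_seq d e F (cone_repr a') by exact: cone_seq_dominated ha'.
have hB : cone_seq d e F (cone_repr b') by exact: cone_seq_dominated hb'.
have zA : ultradist d F (cone_repr a') (cone_repr a) = 0.
 have : cone_class d e F (cone_repr a') (cone_repr a).
 apply: (cone_class_dominated cd' cd) => //; rewrite -Ea' -aa' Ea; split=> //.
 exact: ultradist_refl.
 by case.
have zB : ultradist d F (cone_repr b) (cone_repr b') = 0.
 have [] : cone_class d e F (cone_repr b) (cone_repr b'); last by [].
 rewrite -Eb bb' Eb'; split=> //; exact: ultradist_refl.
apply: le_trans (ultradist_dominated cd cd' h hA hB ha' hb') _.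
rewrite -mulrA ler_wpM2l// -mulrA.
apply: le_trans (kt _ (cone_repr a) _ hA ha hB) _; rewrite zA add0r ler_wpM2l//.
by apply: le_trans (kt _ (cone_repr b) _ ha hb hB) _; rewrite zB addr0.
Qed.

End Fixed.

(** Mutually dominated distances define the same classes of sequences, so the two cones consist of
    the same sets and the homeomorphism is the identity on them. Exchanging the distances gives the
    inverse. *)
Lemma coarse_cones d d' : coarse_metric d -> coarse_metric d' ->
 dominated d d' -> dominated d' d -> bilipschitz_cones d e d' e.
move=> cd cd' dd' d'd F FU FN.
pose f (a : cone d e F) : cone d' e F := exist _ (proj1_sig a)
 (cone_is_cone FU FN cd cd' dd' d'd (proj2_sig a)).
pose g (a : cone d' e F) : cone d e F := exist _ (proj1_sig a)
 (cone_is_cone FU FN cd' cd d'd dd' (proj2_sig a)).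
exists f; split.
 by exists g => -[A hA]; rewrite /f /g /=; congr exist; apply: Prop_irrelevance.
have [C1 C10 h1] := cone_repr_dist FU FN cd cd' dd' d'd.
have [C2 C20 h2] := cone_repr_dist FU FN cd' cd d'd dd'.
have dist0 (D : X -> X -> R) (a b : cone D e F) : coarse_metric D -> 0 <= cone_dist a b.
 move=> cD; apply: ultradist_ge0 => //; by rewrite /cone_repr; case: cid2.
exists (C1 + C2 + 1); first by rewrite ltr_wpDl// addr_ge0.
move=> a b; have fa : proj1_sig a = proj1_sig (f a) by []; have fb : proj1_sig b = proj1_sig (f b) by [].
apply/andP; split; last first.
 apply: le_trans (h1 _ _ _ _ fa fb) _; rewrite ler_wpM2r ?dist0// -addrA lerDl addr_ge0//.
rewrite ler_pdivrMl; last by rewrite ltr_wpDl// addr_ge0.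
apply: le_trans (h2 _ _ _ _ (esym fa) (esym fb)) _; rewrite ler_wpM2r ?dist0//.
by rewrite [C1 + C2]addrC -addrA lerDl addr_ge0.
Qed.

End CoarseCones.

(** * Comparison of the metrics of G and H *)

Section Steps.
Context {R : realType} {r : nat} (r3 : (2 < r)%N).
Local Notation row := ('rV[R]_(3 + r)).
Local Notation Q e := (filiprod R r e).
Let r2 : (1 < r)%N. exact: ltnW. Qed.
Let r1 : (0 < r)%N. exact: ltnW. Qed.
(** Stated for rows and not for elements of a group, since the same rows are points of both
    groups. *)
Definition steps e n (x y : row) := @reach R r e setT 1 n x y.
Lemma steps_refl e x : steps e 0 x x.
by exists (fun=> x). Qed.
Lemma steps_trans e n m x y z : steps e n x y -> steps e m y z -> steps e (n + m) x z.
exact: reach_trans. Qed.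

Lemma steps_mull e n (z x y : Q e) : steps e n x y -> steps e n (z * x)%g (z * y)%g.
move=> [f [f0 fn _ hf]]; exists (fun i => z * f i)%g; split=> //; rewrite ?f0 ?fn//.
by move=> i iN; rewrite near_mull; apply: hf.
Qed.

Lemma step_refine e (B : R) : 0 <= B -> exists2 m, (0 < m)%N &
 forall x y : Q e, near_by B x y -> steps e m x y.
move=> B0; have [T0 hT] := @dil_unif R r e B r1 B0; exists T0.+1 => // x y xy.
pose m := T0.+1; have mR : m%:R != 0 :> R by rewrite pnatr_eq0.
have mR0 : 0 < m%:R :> R by rewrite ltr0n.
exists (fun j => x * dil (j%:R / m%:R) (x^-1 * y))%g; split=> //.
- by rewrite mul0r dil0// mulg1.
- by rewrite divff// dil1 mulVKg.
move=> j jm; rewrite near_mull; apply: (hT m) => //.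
- by rewrite divr_ge0//= ler_pdivrMr// mul1r ler_nat ltnW.
- by rewrite divr_ge0//= ler_pdivrMr// mul1r ler_nat.
by rewrite -mulrBl -natrB// subSnn mul1r ger0_norm ?invr_ge0.
Qed.

Lemma path_steps e (B : R) : 0 <= B -> exists2 m, (0 < m)%N &
 forall n (f : nat -> Q e), (forall i, (i < n)%N -> near_by B (f i) (f i.+1)) ->
 steps e (n * m) (f 0%N) (f n).
move=> B0; have [m m0 hm] := step_refine e B0; exists m => // n f.
elim: n => [|n IH] h; first exact: steps_refl.
rewrite mulSnr; apply: steps_trans (IH _) (hm _ _ (h n _)) => // i iN.
exact/h/leqW.
Qed.

Lemma steps_sym e : exists2 m, (0 < m)%N & forall n x y, steps e n x y -> steps e (n * m) y x.
have b1 : 0 <= bmul (r := r) (1 : R) by apply: le_trans (bmul_ge ler01).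
have [m m0 hm] := path_steps e b1; exists m => // n x y [f [<- <- _ hf]].
have := hm n (fun i => f (n - i)%N); rewrite subn0 subnn; apply=> i iN.
have -> : (n - i = (n - i.+1).+1)%N by lia.
by apply: near_sym; apply: hf; lia.
Qed.

Lemma steps_coord e n (x y : Q e) : steps e n x y -> `|cU y - cU x| <= n%:R.
move=> [f [<- <- _ hf]]; elim: n hf => [|n IH] hf; first by rewrite subrr normr0.
rewrite -(subrK (cU (f n)) (cU (f n.+1))) -addrA -[n.+1%:R]natr1 addrC.
apply: normD_le; apply: lerD; first by apply: IH => i iN; apply/hf/leqW.
by have [_ h _ _] := (bndP _ _).1 (hf n (ltnSn n)); rewrite cU_div in h.
Qed.

Lemma bool_dist (e e' : bool) : `|e'%:R - e%:R : R| <= 1.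
by case: e'; case: e; rewrite ?subrr ?subr0 ?sub0r ?normrN ?normr0 ?normr1. Qed.

(* The same steps performed in both groups lead to points that differ by a
 central element of size quadratic in the length. *)
Lemma steps_shadow e e' n N (x y : row) : steps e n x y -> `|cU x| <= N ->
 exists (c : R) (h : row), [/\ steps e' n x h, `|c| <= n%:R * (N + n%:R) &
 [/\ cA h = cA y, cU h = cU y, cV h = cV y &
 forall k, cP h 0 k = cP y 0 k + (k.+1 == r)%:R * c]].
move=> st xN; have N0 : 0 <= N by apply: le_trans xN.
elim: n y st => [|n IH] y [f [f0 fn _ hf]].
 exists 0, x; split; first exact: steps_refl.
 by rewrite normr0 mul0r.
 by rewrite -fn -f0; split=> // k; rewrite mulr0 addr0.
have st : steps e n x (f n) by exists f; split=> // i iN; apply/hf/leqW.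
have [c [h [sth cB [hA hU hV hP]]]] := IH _ st.
pose s : row := ((f n)^-1 * f n.+1)%g.
have sb : bnd 1 s by exact: hf.
have fE : f n.+1 = (f n * (s : Q e))%g by rewrite mulVKg.
clearbody s; pose h' : row := ((h : Q e') * (s : Q e'))%g.
exists (c + (e'%:R - e%:R) * cU (f n) * cV s), h'; split.
- rewrite -addn1; apply: steps_trans sth _.
 exists (fun i => if i == 0%N then h else h'); split=> // -[|//] _ /=.
 by rewrite /near_by /h' mulKg.
- apply: normD_le; rewrite -[n.+1%:R]natr1.
 have [_ _ sv _] := (bndP _ _).1 sb.
 have fu : `|cU (f n)| <= N + n%:R.
 rewrite -(subrK (cU x) (cU (f n))) addrC; apply: normD_le.
 by rewrite lerD// (steps_coord st).
 have : `|(e'%:R - e%:R) * cU (f n) * cV s| <= 1 * (N + n%:R) * 1.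
 by rewrite !normrM; apply: ler_pM; rewrite ?mulr_ge0//; apply: ler_pM => //; exact: bool_dist.
 have n0 : 0 <= n%:R :> R by [].
 by move: cB N0; nra.
rewrite -fn fE /h'; split=> [|||k]; rewrite ?cA_mul ?cU_mul ?cV_mul ?hA ?hU ?hV//.
rewrite !cP_mul hA hU hP.
by case: (k.+1 == r); rewrite ?mul1r ?mul0r ?addr0//; ring.
Qed.

(** A central element of size m^2 costs a number of steps proportional to nu, of order m^(2/3); this
    is the sublinearity on which the comparison of the cones rests. *)
Lemma cubic_root (ep : R) : 0 < ep -> exists M : R, forall m : R, 0 <= m ->
 exists nu, [/\ (0 < nu)%N, m ^+ 2 <= nu%:R ^+ 3 & nu%:R <= ep * m + M].
move=> ep0; pose M0 := (Num.trunc (ep ^+ 2)^-1).+1.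
have M1 : (ep ^+ 2)^-1 <= M0%:R.
 have i0 : 0 <= (ep ^+ 2)^-1 by rewrite invr_ge0 sqr_ge0.
 by apply/ltW; have /andP[] := Num.Theory.trunc_itv i0.
exists (1 + M0%:R) => m m0; have em : 0 <= ep * m by rewrite mulr_ge0// ltW.
have /andP[t1 t2] := Num.Theory.trunc_itv em.
(* The cube is at least (ep m)^2 times [M0], and [M0] is at least ep^-2. *)
exists (Num.trunc (ep * m) + 1 + M0)%N; split; first by rewrite addn1.
 have h1 : ep * m <= (Num.trunc (ep * m) + 1 + M0)%N%:R.
 by apply: le_trans (ltW t2) _; rewrite ler_nat addn1 leq_addr.
 have h2 : M0%:R <= (Num.trunc (ep * m) + 1 + M0)%N%:R :> R by rewrite ler_nat leq_addl.
 apply: (@le_trans _ _ ((ep * m) ^+ 2 * M0%:R)).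
 rewrite exprMn mulrAC ler_peMl ?sqr_ge0//.
 by rewrite -ler_pdivrMl ?mulr1// exprn_gt0.
 rewrite [leRHS]exprSr; apply: ler_pM => //; first exact: sqr_ge0.
 by rewrite lerXn2r ?nnegrE.
by rewrite !natrD -addrA lerD2r.
Qed.

(** The shadow of the path misses y by a central element of size at most (N + n)^2. It is supplied
    by 8 nu further steps; the factor 8 and the share of n are absorbed in the choice of [ep']. *)
Lemma steps_transfer e e' (ep : R) : 0 < ep -> exists M : R, forall n N (x y : row),
 steps e n x y -> `|cU x| <= N ->
 exists2 n', steps e' n' x y & n'%:R <= 2 * n%:R + ep * N + M.
move=> ep0; pose ep' := Num.min ep 1 / 8.
have mp : 0 < Num.min ep 1 by rewrite lt_min ep0 ltr01.
have m1 : Num.min ep 1 <= 1 by rewrite ge_min lexx orbT.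
have m2 : Num.min ep 1 <= ep by rewrite ge_min lexx.
have ep'0 : 0 < ep' by rewrite divr_gt0.
have [M hM] := cubic_root ep'0.
exists (8 * M) => n N x y st xN; have N0 : 0 <= N by apply: le_trans xN.
have [c [h [sth cB [hA hU hV hP]]]] := steps_shadow e' st xN.
have Nn : 0 <= N + n%:R by rewrite addr_ge0.
have [nu [nu0 nu2 nuM]] := hM _ Nn.
have cnu : `|- c| <= nu%:R ^+ 3.
 rewrite normrN; apply: le_trans cB _; apply: le_trans nu2; rewrite expr2.
 by rewrite ler_wpM2r// lerDr.
have := @reach_zt R r e' r2 setT nu (- c) r3 nu0 (fun x _ => I) cnu.
rewrite -/(steps e' _ _ _) => /(steps_mull (h : Q e')); rewrite mulg1.
have -> : ((h : Q e') * zt (- c))%g = y :> row.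
 apply: (@filiprodP _ _ e') => [|||k].
 - by rewrite cA_mul cAmk addr0.
 - by rewrite cU_mul cUmk addr0.
 - by rewrite cV_mul cVmk addr0.
 rewrite cP_mul cVmk mulr0 if_same addr0 hP.
 have zE (j : 'I_r) : cP (zt (- c) : Q e') 0 j = - (j.+1 == r)%:R * c.
 by rewrite cPmk !mxE mulrC mulrN mulNr.
 rewrite pascal_sum_top//; last by move=> j /negPf jr; rewrite zE jr oppr0 mul0r.
 by rewrite zE mulNr -addrA subrr addr0.
move=> st'; exists (n + 8 * nu)%N; first exact: steps_trans sth st'.
rewrite natrD natrM; have n0 : 0 <= n%:R :> R by [].
have e1 : 8 * (ep' * (N + n%:R)) <= ep * N + n%:R.
 rewrite /ep' mulrA mulrCA mulfV// mulr1 mulrDr; apply: lerD; first by rewrite ler_wpM2r.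
 by rewrite ler_piMl.
by lra.
Qed.

Section Comparable.
Context {X : Type} (pos : X -> row).
Implicit Types d : X -> X -> R.

(** Through [pos], distances on the lattice and on the Lie group are measured against the same count
    of unit steps in the real group. *)
Definition comparable e d := exists C : R, [/\ 0 <= C, forall x y, 0 <= d x y,
 forall n x y, steps e n (pos x) (pos y) -> d x y <= C * (n%:R + 1) &
 forall x y, exists2 n, steps e n (pos x) (pos y) & n%:R <= C * (d x y + 1)].

Lemma comparable_coarse e d : comparable e d -> coarse_metric d.
move=> [C [C0 d0 h1 h2]]; have [m m0 hm] := steps_sym e.
pose K := C + C * (2 * C * m%:R + 1).
have mR : 0 <= m%:R :> R by [].
have m1 : 1 <= m%:R :> R by rewrite ler1n.
have K1 : C <= K by rewrite lerDl; nneg.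
exists K; split=> //.
- by rewrite /K; nneg.
- move=> x; apply: le_trans (h1 0%N _ _ (steps_refl _ _)) _; rewrite add0r mulr1//.
- move=> x y; have [n st nC] := h2 x y; have dxy := d0 x y.
 apply: le_trans (h1 _ _ _ (hm _ _ _ st)) _; rewrite natrM.
 apply: (@le_trans _ _ (C * (C * m%:R + 1) * (d x y + 1))).
 rewrite -mulrA ler_wpM2l// mulrDl mul1r; apply: lerD; last by lra.
 by rewrite mulrAC ler_wpM2r.
 rewrite ler_wpM2r ?addr_ge0// /K.
 have : 0 <= C * (C * m%:R) by nneg.
 by lra.
move=> x y z; have [n st nC] := h2 x y; have [n' st' nC'] := h2 y z.
have dxy := d0 x y; have dyz := d0 y z.
apply: le_trans (h1 _ _ _ (steps_trans st st')) _; rewrite natrD.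
apply: (@le_trans _ _ (C * (C * (d x y + d y z + 2) + 1))).
 by rewrite ler_wpM2l//; nra.
have : 0 <= C * (C * (m%:R - 1) * (d x y + d y z + 1)).
 by rewrite !mulr_ge0 ?subr_ge0// !addr_ge0.
have : 0 <= C * (d x y + d y z) by rewrite mulr_ge0// addr_ge0.
have : 0 <= C * (C * (d x y + d y z)) by rewrite !mulr_ge0// addr_ge0.
by rewrite /K; lra.
Qed.

Lemma comparable_dominated e e' d d' z0 : pos z0 = 0 -> comparable e d -> comparable e' d' ->
 dominated z0 d d'.
move=> z00 [C [C0 d0 h1 h2]] [C' [C'0 d'0 h1' h2']].
exists (2 * C' * C) => [|ep ep0]; first by nneg.
pose ep' := ep / (C' * C + 1).
have cc0 : 0 <= C' * C by nneg.
have cc : 0 < C' * C + 1 by lra.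
have [M hM] := steps_transfer e e' (divr_gt0 ep0 cc).
exists (2 * C' * C + ep + C' * (`|M| + 1)) => x y.
have [n st nC] := h2 x y; have [N stN NC] := h2 z0 x.
have ux : `|cU (pos x)| <= N%:R.
 have := steps_coord stN; rewrite z00 (_ : cU (0 : row) = 0) ?subr0//.
 by rewrite /cU mxE.
have [n' st' nn'] := hM _ _ _ _ st ux.
apply: le_trans (h1' _ _ _ st') _.
have dx := d0 z0 x; have dy := d0 z0 y; have dxy := d0 x y.
have e1 : C' * (ep / (C' * C + 1) * N%:R) <= ep * (d z0 x + 1).
 apply: (@le_trans _ _ (C' * (ep / (C' * C + 1) * (C * (d z0 x + 1))))).
 by rewrite ler_wpM2l// ler_wpM2l// divr_ge0// ltW.
 have -> : C' * (ep / (C' * C + 1) * (C * (d z0 x + 1))) =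
 (ep * (d z0 x + 1)) * (C' * C / (C' * C + 1)) by ring.
 rewrite ler_piMr//; first by rewrite mulr_ge0 ?addr_ge0// ltW.
 by rewrite ler_pdivrMr// mul1r lerDl.
have e2 : C' * n%:R <= C' * (C * (d x y + 1)) by rewrite ler_wpM2l.
have e3 : C' * M <= C' * `|M| by rewrite ler_wpM2l// ler_norm.
have e4 : C' * n'%:R <= C' * (2 * n%:R + ep / (C' * C + 1) * N%:R + M) by rewrite ler_wpM2l.
have e5 : 0 <= ep * d z0 y by rewrite mulr_ge0// ltW.
by move: e1 e2 e3 e4 e5; lra.
Qed.

Lemma comparable_cones e e' d d' z0 : pos z0 = 0 -> comparable e d -> comparable e' d' ->
 bilipschitz_cones d z0 d' z0.
move=> z00 cd cd'; apply: coarse_cones.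
- exact: comparable_coarse cd.
- exact: comparable_coarse cd'.
- exact: comparable_dominated cd cd'.
exact: comparable_dominated cd' cd.
Qed.

End Comparable.

Section WordMetric.
Context {e : bool} (s : finite_genset (filiprod int r e)).
Local Notation L := (filiprod int r e).
Local Notation d := (word_dist R s).
Let lens (x y : L) : set R := [set (size w)%:R | w in [set w | word_eval s w = (x^-1 * y)%g]].
Let lens0 x y : lens x y !=set0.
by have [w hw] := gensP s (x^-1 * y)%g; exists (size w)%:R; exists w. Qed.
Let lens_inf x y : has_inf (lens x y).
by split; [exact: lens0|exists 0 => _ [w _ <-]]. Qed.
Lemma word_dist_le w x y : word_eval s w = (x^-1 * y)%g -> d x y <= (size w)%:R.
by move=> hw; apply: (inf_lbound (lens_inf x y).2); exists w. Qed.

Lemma word_dist_ge x y : exists2 w, word_eval s w = (x^-1 * y)%g & (size w)%:R <= d x y + 1.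
by have [_ [w hw <-] lt] := inf_adherent ltr01 (lens_inf x y); exists w => //; apply: ltW.
Qed.

(** Rounding a path of unit steps gives edges in a finite box, each spelled with a bounded number of
    letters; conversely a letter is a bounded step. *)
Lemma word_dist_comparable : comparable (fun z : L => embed z : row) e d.
have [lb hlb] : {f : 'I_(gens_rank s) * bool -> nat &
 forall a, small R (f a) (word_eval s [:: a])}.
 by apply: (@choice _ _ (fun a n => small R n (word_eval s [:: a]))) => a; apply: small_bounded.
pose M := \max_a lb a.
have lM a : small R M (word_eval s [:: a]) by apply: smallW (hlb a); apply: leq_bigmax.
pose N := rstep (R := R) (r := r) 1.
have [W hW] : {W : L -> word _ & forall z, word_eval s (W z) = z}.
 by apply: (@choice _ _ (fun z w => word_eval s w = z)) => z; exact: gensP.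
pose K := \max_(f : {ffun 'I_(3 + r) -> 'I_(N + N).+1}) size (W (small_elt f)).
have hK z : small R N z -> (size (W z) <= K)%N.
 by move=> /small_eltP[f <-]; apply: (leq_bigmax f).
have [m m0 hm] := path_steps e (ler0n R M).
exists (K%:R + m%:R); split.
- by rewrite addr_ge0.
- by move=> x y; apply: lb_le_inf (lens0 x y) _ => _ [w _ <-].
- move=> n x y [f [f0 fn _ hf]].
 pose g i : L := rnd (f i : Q e).
 have gs i : (i < n)%N -> small R N ((g i)^-1 * g i.+1)%g by move=> iN; apply: rnd_step => //; apply: hf.
 have hw : word_eval s (path_word W g n) = (x^-1 * y)%g.
 by rewrite path_word_eval => [|i _]; [rewrite /g f0 fn !rnd_embed|exact: hW].
 apply: le_trans (word_dist_le hw) _.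
 have sz : (size (path_word W g n) <= n * K)%N.
 elim: n gs {f0 fn hf hw} => // n IH gs; rewrite /= size_cat mulSnr leq_add//.
 by apply: IH => i iN; apply/gs/leqW.
 exact/hK/gs.
 apply: (@le_trans _ _ (n * K)%:R); first by rewrite ler_nat.
 by rewrite natrM mulrC; apply: ler_pM => //; rewrite lerDl.
move=> x y; have [w hw sw] := word_dist_ge x y.
pose f i : Q e := embed (x * word_eval s (take i w))%g.
exists (size w * m)%N; last first.
 rewrite natrM mulrC; apply: ler_pM => //; by rewrite lerDr.
have := hm (size w) f; rewrite /f take0 word_eval0 mulg1 take_size hw mulVKg; apply=> i iw.
rewrite !embedM near_mull.
have [a0 _] : {a | a \in w} by case: (w) iw => // a w' _; exists a; rewrite mem_head.
by rewrite (take_nth a0 iw) -cats1 evalM /near_by -embedV -embedM mulKg; apply: lM.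
Qed.

End WordMetric.

End Steps.

(** * The finitely generated pair *)

Theorem discrete_pair (R : realType) (r : nat) (hr : (3 <= r)%N) :
 exists G H : groupType,
 [/\ finitely_generated G /\ finitely_generated H,
 nilpotent_of_step G r /\ nilpotent_of_step H r,
 finitely_presented G /\ finitely_presented H,
 forall (s : finite_genset G) (t : finite_genset H),
 bilipschitz_cones (word_dist R s) 1%g (word_dist R t) 1%g &
 forall (P : finite_presentation G) (Q : finite_presentation H),
 ~ growth_eq (dehn R P) (dehn R Q)].
have r1 : (1 < r)%N := ltnW hr.
exists (filiprod int r false), (filiprod int r true); split.
- have [P] := filiprod_fp R false r1; have [P'] := filiprod_fp R true r1.
 by split; [exists; exact: P|exists; exact: P'].
- by split; apply: filiprod_step.
- by split; apply: filiprod_fp.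
- move=> s t; have cs := word_dist_comparable (R := R) hr s.
 have ct := word_dist_comparable (R := R) hr t.
 apply: (@comparable_cones R r hr _ _ false true _ _ (1%g : filiprod int r false) _ cs ct).
 exact: embed1.
move=> P Q [h _]; have [L [D [D0 hL]]] := dehn_lower (R := R) (ltnW r1) P.
have [C hC] := dehn_upper (R := R) hr Q.
by apply: (growth_gap D0 hL _ hC) h => n; apply: dehn_ge0.
Qed.

(** * Polynomial maps and the topology of row spaces *)

Section PolynomialMaps.
Context {R : realType} {V : normedModType R}.
Implicit Types (f g : V -> R).

(** Contains the coordinates and is closed under directional derivatives, so that smoothness of the
    group operations becomes an induction on the order. *)
Inductive polyfun : (V -> R) -> Prop :=
| polyfun_cst c : polyfun (fun=> c)
| polyfun_lin f : linear f -> continuous f -> polyfun f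
| polyfunD f g : polyfun f -> polyfun g -> polyfun (fun x => f x + g x)
| polyfunM f g : polyfun f -> polyfun g -> polyfun (fun x => f x * g x).

Lemma polyfun_diff f : polyfun f ->
 (forall x, differentiable f x) /\ forall v, polyfun (fun x => 'd f x v).
elim=> {f} [c|f lf cf|f g _ [df pf] _ [dg pg]|f g hf [df pf] hg [dg pg]].
- split=> [x|v]; first exact: differentiable_cst.
 have -> : (fun x => 'd (fun=> c) x v) = (fun=> 0); last exact: polyfun_cst.
 by apply: funext => x; rewrite (diff_cst (W := R) c x).
- pose F : {linear V -> R} := HB.pack f (GRing.isLinear.Build _ _ _ _ _ lf).
 split=> [x|v]; first exact: (@linear_differentiable _ _ _ F).
 have -> : (fun x => 'd f x v) = (fun=> f v); last exact: polyfun_cst.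
 by apply: funext => x; rewrite (@diff_lin _ _ _ F).
- split=> [x|v]; first exact: differentiableD.
 have -> : (fun x => 'd (fun y => f y + g y) x v) = (fun x => 'd f x v + 'd g x v).
 by apply: funext => x; rewrite (diffD (df x) (dg x)).
 exact: polyfunD.
split=> [x|v]; first exact: differentiableM.
have -> : (fun x => 'd (fun y => f y * g y) x v) = (fun x => f x * 'd g x v + g x * 'd f x v).
 by apply: funext => x; rewrite (diffM (df x) (dg x)).
by apply: polyfunD; apply: polyfunM.
Qed.

Lemma polyfunN f : polyfun f -> polyfun (fun x => - f x).
move=> pf; have -> : (fun x => - f x) = (fun x => -1 * f x) by apply: funext => x; rewrite mulN1r.
by apply: polyfunM => //; apply: polyfun_cst.
Qed.

Lemma polyfunX f n : polyfun f -> polyfun (fun x => f x ^+ n).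
move=> pf; elim: n => [|n IH]; first exact: polyfun_cst.
by under eq_fun do rewrite exprS; apply: polyfunM.
Qed.

Lemma polyfun_sum n (F : 'I_n -> V -> R) : (forall i, polyfun (F i)) ->
 polyfun (fun x => \sum_(i < n) F i x).
elim: n F => [|n IH] F hF.
 by under eq_fun do rewrite big_ord0; apply: polyfun_cst.
under eq_fun do rewrite big_ord_recr/=; apply: polyfunD => //.
by apply: IH => i.
Qed.

Lemma polyfun_ext f g : f =1 g -> polyfun f -> polyfun g.
by move=> /funext ->. Qed.

Context {n : nat}.
Implicit Types F : V -> 'rV[R]_n.

Lemma polymap_diff F : (forall i, polyfun (fun x => F x 0 i)) ->
 (forall x, differentiable F x) /\
 forall v i, polyfun (fun x => ('d F x v : 'rV[R]_n) 0 i).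
move=> pF; have FE : F = \sum_(i < n) (fun x => F x 0 i *: delta_mx 0 i).
 by apply: funext => x; rewrite fct_sumE [LHS]row_sum_delta.
have dF x : differentiable F x.
 by rewrite FE; apply: differentiable_sum => i; apply: differentiableZl; apply: (polyfun_diff (pF i)).1.
split=> // v i; apply: polyfun_ext ((polyfun_diff (pF i)).2 v) => x.
have lc : linear (fun N : 'rV[R]_n => N 0 i : R) by move=> a N N'; rewrite !mxE.
pose c : {linear 'rV[R]_n -> R} := HB.pack (fun N : 'rV[R]_n => N 0 i : R) (GRing.isLinear.Build _ _ _ _ _ lc).
have cc : continuous c by apply: coord_continuous.
have := diff_comp (dF x) (linear_differentiable (F x) cc).
by rewrite (diff_lin _ cc) => ->.
Qed.

Lemma polymap_smooth F (U : set V) : (forall i, polyfun (fun x => F x 0 i)) -> smooth_on U F.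
move=> pF k; elim: k F pF => [|k IH] F pF /=; have [dF pd] := polymap_diff pF.
 by move=> x _; apply: differentiable_continuous.
by split=> [x _|v]; [exact: dF|apply: IH; exact: pd].
Qed.

Lemma polymap_continuous F : (forall i, polyfun (fun x => F x 0 i)) -> continuous F.
by move=> /polymap_diff[dF _] x; apply: differentiable_continuous. Qed.

End PolynomialMaps.

Section RowSpace.
Context {R : realType} {n : nat}.

Lemma norm_bnd (x : 'rV[R]_n) (M : R) : 0 <= M -> (`|x| <= M) <-> (forall i, `|x 0 i| <= M).
move=> M0; have -> : `|x| = \big[Num.max/0]_ij `|x ij.1 ij.2| by exact: mx_normrE.
split=> [/bigmax_leP[_ h] i|h]; first exact: (h (0, i)).
by apply/bigmax_leP; split=> // -[i j] _ /=; rewrite (ord1 i).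
Qed.

Lemma row_second_countable : @second_countable 'rV[R]_n.
pose B (p : 'rV[rat]_n * nat) : set 'rV[R]_n :=
 @ball R 'rV[R]_n (map_mx ratr p.1) p.2.+1%:R^-1.
exists (range B).
 apply: (@card_le_trans _ _ _ (setT : set ('rV[rat]_n * nat))); first exact: card_image_le.
 exact: countableP.
split=> [_ [p _ <-]|x A /nbhs_ballP[e /= e0 eA]].
 exact: ball_open.
pose k := Num.trunc (2 / e).
have k0 : 0 < k.+1%:R^-1 :> R by rewrite invr_gt0.
have ke : k.+1%:R^-1 + k.+1%:R^-1 <= e.
 rewrite -mulr2n -[leLHS]mulr_natl -[leRHS]invrK.
 rewrite ler_pdivrMr ?ltr0n// mulrC -ler_pdivrMr ?invr_gt0// invrK.
 have /andP[_ h] := Num.Theory.trunc_itv (divr_ge0 (ler0n R 2) (ltW e0)).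
 exact: ltW.
have [q hq] : {q : 'I_n -> rat & forall i, `|ratr (q i) - x 0 i| < k.+1%:R^-1}.
 apply: (@choice _ _ (fun i q => `|ratr q - x 0 i| < k.+1%:R^-1)) => i.
 have : x 0 i - k.+1%:R^-1 < x 0 i + k.+1%:R^-1 by rewrite ltrD2l gtrN.
 move=> /rat_in_itvoo[q]; rewrite in_itv/= => /andP[h1 h2]; exists q.
 by rewrite ltr_distl h1 h2.
exists (B (\row_i q i, k)).
 split; first by exists (\row_i q i, k).
 by split=> // i j; rewrite ord1 !mxE /ball/=; apply: hq.
move=> y By; apply: eA; apply: le_ball ke _ _; apply: ball_triangle By.
apply: ball_sym; split=> // i j; rewrite ord1 !mxE /ball/=; exact: hq.
Qed.

End RowSpace.

Section Clamp.
Context {R : realType}.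

(** The retraction of the line onto [0, 1]. Composition with it turns continuity within the interval
    into continuity on the line. *)
Definition clamp (t : R) : R := Num.max 0 (Num.min 1 t).
Lemma clamp01 t : 0 <= clamp t <= 1.
by rewrite /clamp le_max lexx ge_max ler01 ge_min lexx. Qed.
Lemma clamp_id t : 0 <= t <= 1 -> clamp t = t.
by move=> /andP[t0 t1]; rewrite /clamp min_r// max_r. Qed.

Lemma clamp_continuous : continuous clamp.
move=> t; apply: (@continuous_max R R (fun=> 0) (Num.min 1)); first exact: cvg_cst.
by apply: (@continuous_min R R (fun=> 1) id); [exact: cvg_cst|exact: cvg_id].
Qed.

Lemma clamp_within (T : topologicalType) (c : R -> T) :
 {within `[0, 1], continuous c} -> continuous (c \o clamp).
move=> /subspace_continuousP h t V hV.
have t01 : `[0, 1]%classic (clamp t) by rewrite /= in_itv/= clamp01.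
have hh : \forall s \near t, `[0, 1]%classic (clamp s) -> V (c (clamp s)) :=
 @clamp_continuous t _ (h _ t01 V hV).
suff : \forall s \near t, V (c (clamp s)) by [].
by apply: filterS hh => s; apply; rewrite /= in_itv/= clamp01.
Qed.

Lemma within_eq (U T : topologicalType) (A : set U) (f g : U -> T) :
 continuous g -> {in A, f =1 g} -> {within A, continuous f}.
move=> cg fg; apply: (subspace_eq_continuous (f := g)) => [x xA|]; first exact/esym/fg.
exact: continuous_subspaceT.
Qed.

End Clamp.

(** * The Lie groups, with one global chart *)

Definition filiLie (R : realType) (r : nat) (e : bool) : Type := filiprod R r e.
HB.instance Definition _ (R : realType) r e := Group.on (filiLie R r e).
HB.instance Definition _ (R : realType) r e := Topological.copy (filiLie R r e) 'rV[R]_(3 + r).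

Section LieStructure.
Context (R : realType) (r : nat) (e : bool).
Local Notation M := (filiLie R r e).
Local Notation n := (3 + r)%N.
Let id_open : open (id @` [set: M]). by rewrite image_id; exact: openT. Qed.
Let id_cont (A : set M) : {within A, continuous (id : M -> M)}.
by apply: continuous_subspaceT => x; exact: cvg_id. Qed.

Definition id_chart : chart R n M := @Chart R n M setT id id openT id_open (fun _ _ => erefl)
 (@id_cont _) (@id_cont _).
Let poly_coord (V : normedModType R) (f : V -> 'rV[R]_n) i :
 linear f -> continuous f -> polyfun (fun p => f p 0 i).
move=> lf cf; apply: polyfun_lin; first by move=> a x y; rewrite lf !mxE.
by move=> x; exact: (continuous_comp (cf x) (@coord_continuous R 1 n 0 i (f x))).
Qed.
Let poly_mul i : polyfun (fun p : 'rV[R]_n * 'rV[R]_n => ((p.1 : M) * (p.2 : M))%g 0 i).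
have p1 j : polyfun (fun p : 'rV[R]_n * 'rV[R]_n => p.1 0 j).
 by apply: poly_coord => // x; apply: cvg_fst.
have p2 j : polyfun (fun p : 'rV[R]_n * 'rV[R]_n => p.2 0 j).
 by apply: poly_coord => // x; apply: cvg_snd.
move: i; apply: colP => [|||k].
- by apply: (polyfun_ext (f := fun p => cA p.1 + cA p.2)) => [p|]; [exact/esym/(cA_mul (e := e) (p.1 : M) (p.2 : M))|by apply: polyfunD; [exact: p1|exact: p2]].
- by apply: (polyfun_ext (f := fun p => cU p.1 + cU p.2)) => [p|]; [exact/esym/(cU_mul (e := e) (p.1 : M) (p.2 : M))|by apply: polyfunD; [exact: p1|exact: p2]].
- by apply: (polyfun_ext (f := fun p => cV p.1 + cV p.2)) => [p|]; [exact/esym/(cV_mul (e := e) (p.1 : M) (p.2 : M))|by apply: polyfunD; [exact: p1|exact: p2]].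
pose F (p : 'rV[R]_n * 'rV[R]_n) := cP p.1 0 k +
 \sum_(j < r) cP p.2 0 j * ('C(k, j)%:R * cA p.1 ^+ (k - j)) +
 (if k.+1 == r then e%:R * cU p.1 * cV p.2 else 0).
apply: (polyfun_ext (f := F)) => [p|].
 by rewrite /F -(cP_mul (e := e)) /cP mxE.
have pP1 j : polyfun (fun p : 'rV[R]_n * 'rV[R]_n => cP p.1 0 j).
 by apply: (polyfun_ext (f := fun p : 'rV[R]_n * 'rV[R]_n => p.1 0 (rshift 3 j))) => [p|]; [rewrite /cP mxE|exact: p1].
have pP2 j : polyfun (fun p : 'rV[R]_n * 'rV[R]_n => cP p.2 0 j).
 by apply: (polyfun_ext (f := fun p : 'rV[R]_n * 'rV[R]_n => p.2 0 (rshift 3 j))) => [p|]; [rewrite /cP mxE|exact: p2].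
apply: polyfunD.
 apply: polyfunD; first exact: pP1.
 apply: polyfun_sum => j; apply: polyfunM; first exact: pP2.
 apply: polyfunM; first exact: polyfun_cst.
 by apply: polyfunX; exact: p1.
case: (k.+1 == r); last exact: polyfun_cst.
apply: polyfunM; last exact: p2.
by apply: polyfunM; [exact: polyfun_cst|exact: p1].
Qed.
Let poly_inv i : polyfun (fun x : 'rV[R]_n => ((x : M)^-1)%g 0 i).
have p1 j : polyfun (fun p : 'rV[R]_n => p 0 j).
 by apply: (poly_coord (f := id)) => // x; exact: cvg_id.
move: i; have E (x : M) : (x^-1)%g = (x^-1 * 1)%g by rewrite mulg1.
apply: colP => [|||k].
- apply: (polyfun_ext (f := fun p : 'rV[R]_n => - cA p)) => [p|]; last exact/polyfunN/p1.
 by rewrite E -/(cA _) cA_div oneE /cA mxE sub0r.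
- apply: (polyfun_ext (f := fun p : 'rV[R]_n => - cU p)) => [p|]; last exact/polyfunN/p1.
 by rewrite E -/(cU _) cU_div oneE /cU mxE sub0r.
- apply: (polyfun_ext (f := fun p : 'rV[R]_n => - cV p)) => [p|]; last exact/polyfunN/p1.
 by rewrite E -/(cV _) cV_div oneE /cV mxE sub0r.
pose F (x : 'rV[R]_n) := \sum_(j < r) (- cP x 0 j) * ('C(k, j)%:R * (- cA x) ^+ (k - j)) +
 (if k.+1 == r then e%:R * cU x * cV x else 0).
apply: (polyfun_ext (f := F)) => [p|].
 have [a1 u1 v1 q1] := coord1 (R := R) (r := r) (e := e).
 transitivity (cP ((p : filiprod R r e)^-1 * 1)%g 0 k); last by rewrite mulg1 /cP mxE.
 rewrite cP_div v1 sub0r /F; congr (_ + _); last by case: ifP; rewrite ?oppr0// mulrN opprK.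
 by apply: eq_bigr => j _; rewrite q1 sub0r.
have pP1 j : polyfun (fun p : 'rV[R]_n => cP p 0 j).
 by apply: (polyfun_ext (f := fun p : 'rV[R]_n => p 0 (rshift 3 j))) => [p|]; [rewrite /cP mxE|exact: p1].
apply: polyfunD.
 apply: polyfun_sum => j; apply: polyfunM; first exact/polyfunN/pP1.
 apply: polyfunM; first exact: polyfun_cst.
 by apply/polyfunX/polyfunN; exact: p1.
case: (k.+1 == r); last exact: polyfun_cst.
apply: polyfunM; last exact: p1.
by apply: polyfunM; [exact: polyfun_cst|exact: p1].
Qed.

Program Definition filiLieG : lieGroup R n :=
 @LieGroup R n M _ _ [set id_chart] _ _ _ _ _ _.
Next Obligation. exact: (@norm_hausdorff R 'rV[R]_n). Qed.
Next Obligation. exact: row_second_countable. Qed.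
Next Obligation. by exists id_chart. Qed.
Next Obligation.
move=> a b -> ->; apply: polymap_smooth => i; by apply: (poly_coord (f := id)) => // x; exact: cvg_id.
Qed.
Next Obligation. exact: (polymap_continuous poly_mul). Qed.
Next Obligation. move=> a b c -> -> ->; exact: (polymap_smooth _ poly_mul). Qed.
Next Obligation. exact: (polymap_continuous poly_inv). Qed.
Next Obligation. move=> a b -> ->; exact: (polymap_smooth _ poly_inv). Qed.

Lemma filiLie_simply_connected : simply_connected R filiLieG.
split=> [x y|c cc c01].
 exists (fun t : R => ((x : 'rV[R]_n) + t *: ((y : 'rV[R]_n) - (x : 'rV[R]_n)))); split.
 - apply: continuous_subspaceT => t; apply: cvgD; first exact: cvg_cst.
 by apply: cvgZr_tmp; exact: cvg_id.
 - by rewrite scale0r addr0.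
 by rewrite scale1r addrC subrK.
exists (fun p : R * R => (c 0 : 'rV[R]_n) + (1 - p.1) *: ((c p.2 : 'rV[R]_n) - (c 0 : 'rV[R]_n))).
 apply: (within_eq (g := fun p : R * R => (c 0 : 'rV[R]_n) +
 (1 - p.1) *: (((c \o clamp) p.2 : 'rV[R]_n) - (c 0 : 'rV[R]_n)))).
 move=> p; apply: cvgD; first exact: cvg_cst.
 apply: cvgZ; first by apply: cvgB; [exact: cvg_cst|exact: cvg_fst].
 apply: cvgB; last exact: cvg_cst.
 apply: (@cvg_comp _ _ _ snd (c \o clamp) _ (nbhs p.2)); first exact: cvg_snd.
 exact: (clamp_within cc).
 by move=> p; rewrite inE => -[_ /= p2]; rewrite clamp_id//; move: p2; rewrite in_itv.
move=> t t01; split=> /=.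
- by rewrite subr0 scale1r addrC subrK.
- by rewrite subrr scale0r addr0.
- by rewrite subrr scaler0 addr0.
by rewrite -c01 subrr scaler0 addr0.
Qed.

End LieStructure.

(** * One-variable calculus for curves *)

Section Calculus.
Context {R : realType}.

Lemma is_derive_linear (U V W : normedModType R) (c : U -> V) (L : V -> W) (t v : U) (d : V) :
 linear L -> continuous L -> is_derive t v c d -> is_derive t v (fun s => L (c s)) (L d).
move=> lL cL [dc dE].
pose F : {linear V -> W} := HB.pack L (GRing.isLinear.Build _ _ _ _ _ lL).
have h : (fun h : R => h^-1 *: ((c \o shift t) (h *: v) - c t)) @ 0^' --> d by rewrite -dE.
have h' : (fun h : R => h^-1 *: (((fun s => L (c s)) \o shift t) (h *: v) - L (c t))) @ 0^' --> L d.
 have -> : (fun h : R => h^-1 *: (((fun s => L (c s)) \o shift t) (h *: v) - L (c t))) =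
 L \o (fun h : R => h^-1 *: ((c \o shift t) (h *: v) - c t)).
 have LZ : forall (a : R) x, L (a *: x) = a *: L x .
 by move=> a x; exact: (linearZZ F a x).
 have LB : forall x y, L (x - y) = L x - L y by move=> x y; exact: (linearB F x y).
 by apply: funext => s /=; rewrite LZ LB.
 exact: cvg_comp h (cL d).
apply: DeriveDef; last exact/cvg_lim.
by apply/cvg_ex; exists (L d).
Qed.

Lemma is_derive_within (V : normedModType R) (f df : R -> V) (a b : R) :
 (forall t : R, a <= t <= b -> is_derive t 1 f (df t)) -> {within `[a, b], continuous f}.
move=> h; apply: derivable_within_continuous => t; rewrite in_itv => /h; by case.
Qed.

(** The mean value inequality with an increasing primitive P in place of the variable. Lengths of
    curves are used below as increments of such a P. *)
Lemma derive_compare (f df P p : R -> R) (C s u : R) : s <= u ->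
 (forall t : R, s <= t <= u -> is_derive t 1 f (df t)) ->
 (forall t : R, s <= t <= u -> is_derive t 1 P (p t)) ->
 (forall t : R, s <= t <= u -> `|df t| <= C * p t) -> `|f u - f s| <= C * (P u - P s).
move=> su hf hP hb.
have g0 (h dh : R -> R) : (forall t : R, s <= t <= u -> is_derive t 1 h (dh t)) ->
 (forall t : R, s <= t <= u -> 0 <= dh t) -> h s <= h u.
 move=> hh hp; have [|//|c] := @MVT_segment R h dh s u su.
 - by move=> x; rewrite in_itv => /andP[/ltW x1 /ltW x2]; apply: hh; rewrite x1.
 - exact: is_derive_within hh.
 rewrite in_itv => /hp c0 E; rewrite -subr_ge0 E mulr_ge0// subr_ge0//.
rewrite ler_norml; apply/andP; split.
 have := g0 (fun t => C * P t + f t) (fun t => C * p t + df t).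
 have h1 (t : R) : s <= t <= u -> is_derive t 1 (fun t => C * P t + f t) (C * p t + df t).
 move=> st; have := hf t st; have := hP t st => ? ?.
 by apply: is_deriveD; apply: is_deriveZ.
 have h2 (t : R) : s <= t <= u -> 0 <= C * p t + df t.
 by move=> /hb; rewrite ler_norml => /andP[h _]; lra.
 by move=> /(_ h1 h2); lra.
have := g0 (fun t => C * P t - f t) (fun t => C * p t - df t).
have h1 (t : R) : s <= t <= u -> is_derive t 1 (fun t => C * P t - f t) (C * p t - df t).
 move=> st; have := hf t st; have := hP t st => ? ?.
 by apply: is_deriveB; apply: is_deriveZ.
have h2 (t : R) : s <= t <= u -> 0 <= C * p t - df t.
 by move=> /hb; rewrite ler_norml => /andP[_ h]; lra.
by move=> /(_ h1 h2); lra.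
Qed.

Lemma primitive01 (f : R -> R) : {within `[0, 1], continuous f} ->
 exists P : R -> R, forall t : R, 0 <= t <= 1 -> is_derive t 1 P (f t).
move=> cf; pose F := f \o clamp.
have cF : continuous F := clamp_within cf.
(* Integrating from -1 makes 0 an interior point, so that the derivative there is two-sided. *)
exists (fun x => \int[lebesgue_measure]_(t in `[-1, x]) F t) => t t01.
have [|||dP PE] := @continuous_FTC1_closed R F (-1) t 2 _ _ _ (cF t).
- by case/andP: t01 => _ t1; apply: le_lt_trans t1 _; rewrite ltr1n.
- apply: continuous_compact_integrable; first exact: segment_compact.
 exact: continuous_subspaceT.
- by case/andP: t01 => t0 _; apply: lt_le_trans t0; rewrite ltrN10.
apply: DeriveDef; first exact: dP.
by rewrite -derive1E PE /F /= clamp_id.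
Qed.

Lemma Rintegral_primitive (f P : R -> R) : {within `[0, 1], continuous f} ->
 (forall t : R, 0 <= t <= 1 -> is_derive t 1 P (f t)) ->
 \int[lebesgue_measure]_(t in `[0, 1]) f t = P 1 - P 0.
move=> cf hP; have h := @continuous_FTC2 R f P 0 1 ltr01 cf.
rewrite /Rintegral h//.
 have hc (t : R) : 0 <= t <= 1 -> {for t, continuous P}.
 by move=> t01; apply/differentiable_continuous/derivable1_diffP; have [] := hP t t01.
 split.
 - by move=> x; rewrite in_itv/= => /andP[/ltW x1 /ltW x2]; have [|] := hP x; rewrite ?x1.
 - by apply: cvg_at_right_filter; apply: hc; rewrite lexx ler01.
 by apply: cvg_at_left_filter; apply: hc; rewrite lexx ler01.
move=> x; rewrite in_itv/= => /andP[/ltW x1 /ltW x2].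
by rewrite derive1E; have [|_ ->] := hP x; rewrite ?x1.
Qed.

(* max(w, 0)^2 is C^1 and stops at w = 0; it is used to reparametrize curves
 before concatenating them. *)
Lemma is_derive_max0sqr (w : R) : is_derive w 1 (fun x : R => Num.max x 0 ^+ 2) (2 * Num.max w 0).
have sq (x : R) : is_derive x 1 (fun x : R => x ^+ 2) (2 * x) by apply: is_derive_eq; rewrite /= !scaler1 -mulr_natl; ring.
have [w0|w0|->] := ltgtP w 0.
- rewrite mulr0; apply: (near_eq_is_derive (f := cst (0 : R))).
 by near=> x; rewrite max_r ?expr0n//; apply/ltW; near: x; exact: lt_nbhsl.
- apply: (near_eq_is_derive (f := fun x : R => x ^+ 2)).
 by near=> x; rewrite max_l//; apply/ltW; near: x; exact: lt_nbhsr.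
rewrite mulr0.
have h : (fun h : R => h^-1 *: (((fun x : R => Num.max x 0 ^+ 2) \o shift 0) (h *: 1) -
 Num.max 0 0 ^+ 2)) @ 0^' --> (0 : R).
 apply/cvgrPdist_le => ep ep0; near=> h.
 have h0 : h != 0 by near: h; exact: nbhs_dnbhs_neq.
 rewrite sub0r normrN /= maxxx expr0n subr0 addr0 /GRing.scale/= mulr1 normrM normfV.
 apply: (@le_trans _ _ `|h|).
 rewrite ler_pdivrMl ?normr_gt0// -expr2 normrX lerXn2r ?nnegrE//.
 have [hh|hh] := leP h 0; rewrite ?normr0//.
 near: h; apply: dnbhs0_le; exact: ep0.
apply: DeriveDef; last exact/cvg_lim.
by apply/cvg_ex; exists 0.
Unshelve. all: by end_near.
Qed.

Lemma mulmxr_continuous n m (A : 'M[R]_(n, m)) : continuous (fun x : 'rV[R]_n => x *m A).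
apply: polymap_continuous => i.
apply: (polyfun_ext (f := fun x : 'rV[R]_n => \sum_j x 0 j * A j i)) => [x|]; first by rewrite mxE.
apply: polyfun_sum => j; apply: polyfunM; last exact: polyfun_cst.
by apply: polyfun_lin => [a x y|]; [rewrite !mxE|exact: coord_continuous].
Qed.

Lemma is_derive_mulmxr (V : normedModType R) n m (A : 'M[R]_(n, m)) (c : V -> 'rV[R]_n) (t v : V) d :
 is_derive t v c d -> is_derive t v (fun s => c s *m A) (d *m A).
apply: (is_derive_linear (L := fun x => x *m A)); last exact: mulmxr_continuous.
by move=> a x y; rewrite mulmxDl scalemxAl.
Qed.

Lemma is_derive_coord (V : normedModType R) n (c : V -> 'rV[R]_n) (t v : V) d i :
 is_derive t v c d -> is_derive t v (fun s => c s 0 i) (d 0 i).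
apply: (is_derive_linear (L := fun x : 'rV[R]_n => x 0 i)); last exact: coord_continuous.
by move=> a x y; rewrite !mxE.
Qed.

Lemma is_derive_row (V : normedModType R) n (c : V -> 'rV[R]_n) (t v : V) (d : 'rV[R]_n) :
 (forall i, is_derive t v (fun s => c s 0 i) (d 0 i)) -> is_derive t v c d.
move=> h; have dc : derivable c t v.
 by apply/derivable_mxP => i j; rewrite (ord1 i); have [] := h j.
apply: DeriveDef => //; apply/rowP => i.
have [_ <-] := h i; have := is_derive_coord i (DeriveDef dc erefl).
by case.
Qed.

Lemma is_derive_row_comp n (c : R -> 'rV[R]_n) (a : R -> R) (t da : R) dc :
 is_derive (a t) 1 c dc -> is_derive t 1 a da -> is_derive t 1 (fun s => c (a s)) (da *: dc).
move=> hc ha; apply: is_derive_row => i; rewrite mxE mulrC.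
by apply: (is_derive1_comp (f := fun s => c s 0 i)) => //; apply: is_derive_coord.
Qed.

End Calculus.

(** * Left-invariant Riemannian metrics in coordinates *)

Section Metric.
Context {R : realType} {r : nat} {e : bool}.
Local Notation Q := (filiprod R r e).
Local Notation row := 'rV[R]_(3 + r).
Variable g : leftinv_metric (filiLieG R r e).

Lemma li_chartE (x : row) : li_chart g x = x.
by have -> := (li_atlas g : li_chart g = _). Qed.

Lemma translateE (V : Type) (f : V -> row) p q :
 translate g f p q = (f q - f p) *m actxV (e := e) (f p).
by rewrite /translate li_chartE; exact: divE. Qed.

Lemma translate_derive (V : normedModType R) (f : V -> row) (p v : V) d :
 is_derive p v f d -> is_derive p v (translate g f p) (d *m actxV (e := e) (f p)).
move=> h; have -> : translate g f p = (fun q => f q *m actxV (e := e) (f p)) -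
 cst (f p *m actxV (e := e) (f p)).
 by apply: funext => q; rewrite translateE mulmxBl.
rewrite -[d *m _]subr0; apply: is_deriveB; first exact: is_derive_mulmxr.
Qed.

Lemma untranslate_derive (V : normedModType R) (f : V -> row) (p v : V) d :
 is_derive p v (translate g f p) d -> is_derive p v f (d *m actx (e := e) (f p)).
move=> h; have E : f = cst (f p) + (fun q => translate g f p q *m actx (e := e) (f p)).
 apply: funext => q; rewrite -[RHS]/(f p + _ *m _) translateE -mulmxA.
 by rewrite actxV_actx mulmx1 addrCA subrr addr0.
suff : is_derive p v (cst (f p) + (fun q => translate g f p q *m actx (e := e) (f p)))
 (d *m actx (e := e) (f p)) by rewrite -E.
by rewrite -[d *m _]add0r; apply: is_deriveD; exact: is_derive_mulmxr.
Qed.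

Lemma actxV_continuous (T : topologicalType) (f v : T -> row) : continuous f -> continuous v ->
 continuous (fun t => v t *m actxV (e := e) (f t)).
move=> cf cv t.
have -> : (fun t => v t *m actxV (e := e) (f t)) =
 fun t => ((f t : filiLieG R r e)^-1 * (f t + v t : row))%g.
 by apply: funext => s; rewrite [RHS]divE addrC addKr.
have h := @lie_mul_continuous R _ (filiLieG R r e).
have hi := @lie_inv_continuous R _ (filiLieG R r e).
pose F t : filiLieG R r e * filiLieG R r e :=
 ((f t : filiLieG R r e)^-1%g, (f t + v t : row)).
have cF : F @ t --> F t.
 have c1 : ((f s : filiLieG R r e)^-1)%g @[s --> t] --> ((f t : filiLieG R r e)^-1)%g.
 exact: cvg_comp (cf t) (hi _).
 have c2 : (f s + v s) @[s --> t] --> f t + v t.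
 by apply: (@cvgD R row); [exact: cf|exact: cv].
 exact: cvg_pair c1 c2.
exact: cvg_comp cF (h (F t)).
Qed.

Lemma actx_oppr (x : row) : actx (e := e) (- x) = actxV (e := e) x.
by rewrite /actx /actxV cAN cUN. Qed.

Lemma actx_continuous (T : topologicalType) (f v : T -> row) : continuous f -> continuous v ->
 continuous (fun t => v t *m actx (e := e) (f t)).
move=> cf cv; have -> : (fun t => v t *m actx (e := e) (f t)) =
 fun t => v t *m actxV (e := e) (- f t).
 by apply: funext => t; rewrite -actx_oppr opprK.
by apply: actxV_continuous => // t; apply: (@cvgN R row); exact: cf.
Qed.

Lemma bnd_actx (B c : R) (x v : row) : 0 <= B -> `|cA x| <= B -> `|cU x| <= B ->
 bnd c v -> bnd ((1 + pbd (r := r) B + B) * c) (v *m actx (e := e) x).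
move=> B0 xA xU vc; have c0 := bnd_ge0 vc.
have p0 := pbd_ge0 (r := r) B0.
have E : v *m actx (e := e) x = ((x : Q) * (v : Q))%g - x by rewrite mulE addrC addKr.
have [vA vU vV vP] := (bndP c v).1 vc.
have cc : c <= (1 + pbd (r := r) B + B) * c by rewrite !mulrDl mul1r -addrA lerDl; nneg.
apply/bndP; rewrite /actx cA_act cU_act cV_act; split; try exact: le_trans cc.
have cPB (a b : row) k : cP (a - b) 0 k = cP a 0 k - cP b 0 k by rewrite /cP !mxE.
move=> k; rewrite -/(actx x) E cPB cP_mul.
have -> (a b z : R) : a + b + z - a = b + z by ring.
apply: normD_le.
have h1 := pascal_bound1 (q := fun j => cP v 0 j) k B0 c0 xA vP.
have h2 : `|if k.+1 == r then e%:R * cU x * cV v else 0| <= B * c.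
 case: ifP => _; last by rewrite normr0; nneg.
 rewrite -mulrA normrM normr_nat; apply: le_trans (_ : `|cU x * cV v| <= _).
 by case: e; rewrite ?mul1r ?mul0r.
 by rewrite normrM; apply: ler_pM.
by apply: le_trans (lerD h1 h2) _; rewrite !mulrDl mul1r; lra.
Qed.

Definition bn (v : row) : R := Num.sqrt (bform (li_form g) v v).
Lemma bn_ge0 v : 0 <= bn v. exact: sqrtr_ge0. Qed.

Lemma bform_ge0 v : 0 <= bform (li_form g) v v.
have [->|v0] := eqVneq v 0; first by rewrite /bform !mul0mx mxE.
by have [_ /(_ v v0) /ltW] := li_posdef g.
Qed.

Lemma bnZ a v : bn (a *: v) = `|a| * bn v.
rewrite /bn /bform linearZ/= -scalemxAl -scalemxAl -scalemxAr mxE.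
rewrite [(_ *: (_ *m _)) 0 0]mxE mulrA -expr2 sqrtrM ?sqr_ge0// sqrtr_sqr//.
Qed.

Lemma bn_continuous : continuous bn.
have h : continuous (fun v : row => bform (li_form g) v v).
 suff p : polyfun (fun v : row => bform (li_form g) v v).
 by move=> x; apply: differentiable_continuous; have [h _] := polyfun_diff p; exact: h.
 have lc j : polyfun (fun x : row => x 0 j).
 by apply: polyfun_lin => [a x y|]; [rewrite !mxE|exact: coord_continuous].
 apply: (polyfun_ext (f := fun v : row => \sum_j (\sum_i v 0 i * li_form g i j) * v 0 j)).
 by move=> v; rewrite /bform mxE; apply: eq_bigr => j _; rewrite !mxE.
 apply: polyfun_sum => j; apply: polyfunM => //; apply: polyfun_sum => i.
 by apply: polyfunM => //; exact: polyfun_cst.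
move=> x; apply: (continuous_comp (h x)); exact: sqrt_continuous.
Qed.

Lemma bn_equiv : exists k1 k2 : R, [/\ 0 < k1, 0 < k2 & forall v, k1 * `|v| <= bn v <= k2 * `|v|].
pose S := [set v : row | `|v| = 1].
have S0 : S !=set0.
 exists (const_mx 1); apply/eqP; rewrite eq_le; apply/andP; split.
 by apply/norm_bnd => // i; rewrite mxE normr1.
 have := (norm_bnd (const_mx 1 : row) (normr_ge0 (const_mx 1 : row))).1 (lexx _) 0.
 by rewrite mxE normr1.
have cS : compact S.
 apply: bounded_closed_compact.
 by exists 1; split=> // M M1 v /= ->; exact: ltW.
 have -> : S = (fun v : row => `|v|) @^-1` [set 1] by [].
 by apply: preimage_closed (@closed_eq R 1) => v _; exact: norm_continuous.
have cb : {within S, continuous bn} := continuous_subspaceT bn_continuous.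
have [v1 + h1] := compact_EVT_min S0 cS cb.
have [v2 _ h2] := compact_EVT_max S0 cS cb.
rewrite inE /S/= => v11.
have b1 : 0 < bn v1.
 rewrite sqrtr_gt0; have [_] := li_posdef g; apply.
 by rewrite -normr_gt0 v11.
exists (bn v1), (bn v2 + 1); split=> //; first by have := bn_ge0 v2; lra.
move=> v; have [->|v0] := eqVneq v 0.
 by rewrite -(scale0r (0 : row)) bnZ scale0r !normr0 !mulr0 mul0r lexx.
have nv : 0 < `|v| by rewrite normr_gt0.
have Sv : (`|v|^-1 *: v) \in S.
 by rewrite inE /S/= normrZ normfV normr_id mulVf// gt_eqF.
have := h1 _ Sv; have := h2 _ Sv; rewrite bnZ normfV normr_id.
rewrite ler_pdivlMl// ler_pdivrMl// mulrC => a b; rewrite [bn v1 * _]mulrC b/=.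
by apply: le_trans a _; rewrite mulrDl mul1r lerDl ltW.
Qed.

Lemma C1P (c v : R -> row) : continuous c ->
 (forall t : R, 0 <= t <= 1 -> is_derive t 1 c (v t *m actx (e := e) (c t))) ->
 {within `[0, 1], continuous v} ->
 C1_curve g c /\ forall t : R, 0 <= t <= 1 -> velocity g c t = v t.
move=> cc hc cv.
have h (t : R) : 0 <= t <= 1 -> is_derive t 1 (translate g c t) (v t).
 by move=> /hc /translate_derive; rewrite -mulmxA actx_actxV mulmx1.
have vE (t : R) : 0 <= t <= 1 -> velocity g c t = v t by move=> /h [].
split=> //; split=> //; first by move=> t /h [].
by apply: subspace_eq_continuous cv => t; rewrite inE/= in_itv/= => /vE /esym.
Qed.

Lemma C1_velocity (c : R -> row) : C1_curve g c -> [/\ continuous c,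
 forall t : R, 0 <= t <= 1 -> is_derive t 1 c (velocity g c t *m actx (e := e) (c t)) &
 {within `[0, 1], continuous (velocity g c)}].
move=> [cc dc cv]; split=> // t t01; apply: untranslate_derive.
by apply: DeriveDef => //; exact: dc.
Qed.

End Metric.

Lemma continuous_rowZ (R : realType) n (f : R -> R) (v : R -> 'rV[R]_n) :
 continuous f -> continuous v -> continuous (fun t => f t *: v t).
by move=> cf cv t; apply: cvgZ; [exact: cf|exact: cv]. Qed.

Lemma continuous_rowD (R : realType) n (u v : R -> 'rV[R]_n) :
 continuous u -> continuous v -> continuous (fun t => u t + v t).
by move=> cu cv t; apply: cvgD; [exact: cu|exact: cv]. Qed.

Section RiemannianDistance.
Context {R : realType} {r : nat} {e : bool}.
Local Notation Q := (filiprod R r e).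
Local Notation row := 'rV[R]_(3 + r).
Variable g : leftinv_metric (filiLieG R r e).
Local Notation dist := (@riem_dist R (3 + r) (filiLieG R r e) g).
Local Notation len := (@smooth_length R (3 + r) (filiLieG R r e) g).
Local Notation C1 := (@C1_curve R (3 + r) (filiLieG R r e) g).
Local Notation vel := (@velocity R (3 + r) (filiLieG R r e) g).

Lemma length_primitive c : C1 c -> exists2 P : R -> R,
 (forall t : R, 0 <= t <= 1 -> is_derive t 1 P (bn g (vel c t))) & len c = P 1 - P 0.
move=> /C1_velocity[_ _ cv].
have cb : {within `[0, 1], continuous (fun t => bn g (vel c t))}.
 by move=> x; apply: continuous_comp (cv x) (@bn_continuous _ _ _ g _).
have [P hP] := primitive01 cb; exists P => //.
exact: Rintegral_primitive cb hP.
Qed.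

Lemma length_ge0 c : 0 <= len c.
by apply: Rintegral_ge0 => t _; exact: sqrtr_ge0. Qed.

Lemma C1_mull (z : Q) (c : R -> Q) : C1 c ->
 [/\ C1 (fun t => z * c t)%g, vel (fun t => z * c t)%g = vel c & len (fun t => z * c t)%g = len c].
move=> [cc dc cv].
have E t : translate g (fun t => z * c t)%g t = translate g c t.
 by apply: funext => s; rewrite /translate invgM -mulgA mulKg.
have vE : vel (fun t => z * c t)%g = vel c by apply: funext => t; rewrite /velocity E.
split; [|exact: vE|by rewrite /smooth_length vE].
split; [|by move=> t; rewrite E; exact: dc|by rewrite vE].
have -> : (fun t => z * c t)%g = (fun t => (z : row) + (c t : row) *m actx (e := e) z).
 by apply: funext => t; rewrite -mulE.
move=> t; apply: (@cvgD R row); first exact: cvg_cst.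
by apply: (actx_continuous (T := R)) => // s; exact: cvg_cst.
Qed.

Lemma norm_actx (B : R) (x v : row) : 0 <= B -> `|cA x| <= B -> `|cU x| <= B ->
 `|v *m actx (e := e) x| <= (1 + pbd (r := r) B + B) * `|v|.
move=> B0 xA xU; have p0 := pbd_ge0 (r := r) B0; apply/norm_bnd; first by nneg.
by apply: bnd_actx => //; apply/norm_bnd.
Qed.

Lemma C1_ray (z : row) : let c := (fun t : R => t *: z) in
 C1 c /\ forall t : R, 0 <= t <= 1 -> vel c t = z *m actxV (e := e) (t *: z).
have cc : continuous (fun t : R => t *: z) by move=> t; exact: scalel_continuous.
apply: C1P => // [t _|].
 rewrite -mulmxA actxV_actx mulmx1.
 apply: is_derive_row => i; rewrite -[z 0 i]mul1r.
 have -> : (fun s : R => (s *: z) 0 i) = (fun s => s * z 0 i) by apply: funext => s; rewrite mxE.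
 have -> : 1 * z 0 i = z 0 i *: (1 : R) by rewrite mulrC.
 have -> : (fun s : R => s * z 0 i) = (fun s => z 0 i *: s) by apply: funext => s; rewrite mulrC.
 exact: is_deriveZ.
apply: continuous_subspaceT; apply: actxV_continuous => // t; exact: cvg_cst.
Qed.

Lemma dist_le_length c : C1 c -> dist (c 0) (c 1) <= len c.
move=> cc; apply: ge_inf; last by exists c.
by exists 0 => _ [c' _ <-]; exact: length_ge0.
Qed.

(** The segment from 1 to z in coordinates is a competitor: its left-translated velocity is the
    image of z under the inverse action of the points t z, which is bounded on bounded sets. *)
Lemma ray_dist (M : R) : 0 <= M -> exists2 C : R, 0 <= C & forall x y : Q,
 bnd M (x^-1 * y)%g -> dist x y <= C * `|(x^-1 * y)%g : row|.
move=> M0; have [k1 [k2 [k10 k20 hk]]] := bn_equiv g.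
have p0 := pbd_ge0 (r := r) M0.
exists (k2 * (1 + pbd (r := r) M + M)) => [|x y hz]; first by nneg; apply: ltW.
pose z : row := (x^-1 * y)%g; rewrite -/z; have hz' : bnd M z := hz.
have [cz vz] := C1_ray z.
have [cx vx lx] := C1_mull (x : Q) cz.
have := dist_le_length cx; rewrite /= scale0r scale1r.
rewrite -[(x * 0)%g]/(x * 1)%g mulg1 /z mulVKg lx -/z => h; apply: le_trans h _.
have [P hP ->] := length_primitive cz.
have h := @derive_compare R P _ id (fun=> 1) (k2 * (1 + pbd (r := r) M + M) * `|z|) 0 1 ler01 hP.
apply: le_trans (ler_norm _) _; rewrite subr0 mulr1 in h; apply: h.
move=> t t01; rewrite (ger0_norm (bn_ge0 g _)) (vz t t01).
have /andP[_ h] := hk (z *m actxV (e := e) (t *: z)); apply: le_trans h _.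
rewrite -(mulrA k2); apply: ler_wpM2l; first exact: ltW.
rewrite -actx_oppr.
have tz : bnd M (- (t *: z)).
 have t1 : `|t| <= 1 by case/andP: t01 => ? ?; rewrite ger0_norm.
 move=> i; rewrite !mxE normrN normrM; apply: le_trans (hz' i).
 by rewrite -[leRHS]mul1r; apply: ler_wpM2r.
have [tA tU _ _] := (bndP _ _).1 tz.
exact: norm_actx M0 tA tU.
Qed.

Lemma C1_exists (x y : Q) : exists c, [/\ C1 c, c 0 = x & c 1 = y].
have [cz _] := C1_ray (x^-1 * y)%g; have [cx _ _] := C1_mull (x : Q) cz.
eexists; split; first exact: cx.
 by rewrite /= scale0r; exact: mulg1.
by rewrite /= scale1r mulVKg.
Qed.

Lemma dist_ge0 (x y : Q) : 0 <= dist x y.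
apply: lb_le_inf; last by move=> _ [c _ <-]; exact: length_ge0.
by have [c hc] := C1_exists x y; exists (len c), c.
Qed.

Lemma dist_mull (z x y : Q) : dist (z * x)%g (z * y)%g = dist x y.
have le (z' x' y' : Q) : dist (z' * x')%g (z' * y')%g <= dist x' y'.
 apply: lb_le_inf; first by have [c hc] := C1_exists x' y'; exists (len c), c.
 move=> _ [c [cc <- <-] <-]; have [cz _ <-] := C1_mull z' cc.
 exact: dist_le_length cz.
by apply/eqP; rewrite eq_le le/= -{1}(mulKg z x) -{1}(mulKg z y) le.
Qed.

Lemma distxx (x : Q) : dist x x = 0.
have [C C0 hC] := ray_dist (ler01 : 0 <= 1 :> R).
apply/eqP; rewrite eq_le dist_ge0 andbT.
have /hC : bnd 1 ((x^-1 * x)%g : row) by rewrite mulVg; exact: bnd0.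
by rewrite mulVg oneE normr0 mulr0.
Qed.

Lemma dist_approx (x y : Q) (ep : R) : 0 < ep ->
 exists c, [/\ C1 c, c 0 = x, c 1 = y & len c < dist x y + ep].
move=> ep0; have [|_ [c [cc c0 c1] <-] h] := inf_adherent ep0 (E := [set len c | c in
 [set c | [/\ C1 c, c 0 = x & c 1 = y]]]).
 split; first by have [c hc] := C1_exists x y; exists (len c), c.
 by exists 0 => _ [c' _ <-]; exact: length_ge0.
by exists c.
Qed.

Lemma bn_comb0l (x y : row) (b : R) : 0 <= b -> bn g (0 *: x + b *: y) = bn g x * 0 + bn g y * b.
by move=> b0; rewrite scale0r add0r bnZ mulr0 add0r ger0_norm// mulrC. Qed.
Lemma bn_comb0r (x y : row) (b : R) : 0 <= b -> bn g (b *: x + 0 *: y) = bn g x * b + bn g y * 0.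
by move=> b0; rewrite addrC bn_comb0l// addrC. Qed.

(** The two pieces are run through with speeds vanishing at time 1/2. Writing the curve as c1(a) +
    c2(b) - c2(0), with b = 0 on the first half and a = 1 on the second, makes it differentiable at
    the junction without a separate argument. *)
Lemma C1_concat (c1 c2 : R -> row) : C1 c1 -> C1 c2 -> c1 1 = c2 0 ->
 exists c, [/\ C1 c, c 0 = c1 0, c 1 = c2 1 & len c = len c1 + len c2].
have n1 (t : R) : 0 <= t -> 1 - 2 * t <= 1 by move=> ?; lra.
have n2 (t : R) : t <= 1 -> 2 * t - 1 <= 1 by move=> ?; lra.
have n3 (t : R) : t <= 2^-1 -> 2 * t - 1 <= 0 by move=> ?; lra.
have n4 (t : R) : 2^-1 <= t -> 1 - 2 * t <= 0 by move=> ?; lra.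
have n5 : 2^-1 <= 1 :> R by lra.
move=> C11 C12 c12.
have [P1 hP1 l1] := length_primitive C11; have [P2 hP2 l2] := length_primitive C12.
have [cc1 dc1 cv1] := C1_velocity C11; have [cc2 dc2 cv2] := C1_velocity C12.
pose m (x : R) := Num.max x 0.
have mc : continuous m.
 by move=> x; apply: (@continuous_max R R id (fun=> 0)); [exact: cvg_id|exact: cvg_cst].
pose w1 (t : R) := 1 - 2 * t; pose w2 (t : R) := 2 * t - 1.
have dw1 (t : R) : is_derive t 1 w1 (- 2).
 have -> : - 2 = 0 - 2 *: 1 :> R by rewrite sub0r /GRing.scale/= mulr1.
 by apply: is_deriveB; try (exact: is_deriveZ).
have dw2 (t : R) : is_derive t 1 w2 2.
 have -> : 2 = 2 *: 1 - 0 :> R by rewrite subr0 /GRing.scale/= mulr1.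
 by apply: is_deriveB; try (exact: is_deriveZ).
pose a t := 1 - m (w1 t) ^+ 2; pose b t := m (w2 t) ^+ 2.
pose a' t := 4 * m (w1 t); pose b' t := 4 * m (w2 t).
have da (t : R) : is_derive t 1 a (a' t).
 have -> : a' t = 0 - 2 * m (w1 t) * - 2 by rewrite /a'; ring.
 apply: is_deriveB.
 by apply: (is_derive1_comp (f := fun x => m x ^+ 2)); exact: is_derive_max0sqr.
have db (t : R) : is_derive t 1 b (b' t).
 have -> : b' t = 2 * m (w2 t) * 2 by rewrite /b'; ring.
 by apply: (is_derive1_comp (f := fun x => m x ^+ 2)); exact: is_derive_max0sqr.
have cont (f f' : R -> R) : (forall t : R, is_derive t 1 f (f' t)) -> continuous f.
 by move=> h t; apply/differentiable_continuous/derivable1_diffP; have [] := h t.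
have ca := cont _ _ da; have cb := cont _ _ db.
have cm (f f' : R -> R) : (forall t : R, is_derive t 1 f (f' t)) -> continuous (fun t => 4 * m (f t)).
 move=> /cont cf t; apply: cvgMr; apply: continuous_comp (cf t) (mc _).
have ca' := cm _ _ dw1; have cb' := cm _ _ dw2.
have m0 x : 0 <= m x by rewrite /m le_max lexx orbT.
have m1 x : x <= 1 -> m x ^+ 2 <= 1 by move=> x1; rewrite expr_le1// /m ge_max x1/=.
have a01 (t : R) : 0 <= t <= 1 -> 0 <= a t <= 1.
 move=> /andP[t0 t1]; by rewrite /a subr_ge0 m1 ?n1//= gerBl exprn_ge0.
have b01 (t : R) : 0 <= t <= 1 -> 0 <= b t <= 1.
 by move=> /andP[t0 t1]; rewrite /b exprn_ge0//= m1// n2.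
have lo t : t <= 2^-1 -> b t = 0 /\ b' t = 0.
 by move=> th; rewrite /b /b' /m max_r ?expr0n ?mulr0// n3.
have hi t : 2^-1 <= t -> a t = 1 /\ a' t = 0.
 by move=> th; rewrite /a /a' /m max_r ?expr0n/= ?mulr0 ?subr0// n4.
have a'0 t : 0 <= a' t by rewrite /a' mulr_ge0.
have b'0 t : 0 <= b' t by rewrite /b' mulr_ge0.
pose c t : row := c1 (a t) + (c2 (b t) - c2 0).
pose v t : row := a' t *: vel c1 (a t) + b' t *: vel c2 (b t).
have cc : continuous c.
 move=> t; apply: (@cvgD R row); first exact: continuous_comp (ca t) (cc1 _).
 by apply: (@cvgB R row); [exact: continuous_comp (cb t) (cc2 _)|exact: cvg_cst].
have dc (t : R) : 0 <= t <= 1 -> is_derive t 1 c (v t *m actx (e := e) (c t)).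
 move=> t01.
 have -> : v t *m actx (e := e) (c t) = a' t *: (vel c1 (a t) *m actx (e := e) (c1 (a t))) +
 (b' t *: (vel c2 (b t) *m actx (e := e) (c2 (b t))) - 0).
 rewrite subr0 /v /c mulmxDl -!scalemxAl; have [th|/ltW th] := leP t 2^-1.
 by have [-> ->] := lo _ th; rewrite !scale0r !addr0 subrr addr0.
 by have [-> ->] := hi _ th; rewrite !scale0r !add0r c12 addrCA subrr addr0.
 apply: is_deriveD; first by apply: is_derive_row_comp => //; exact/dc1/a01.
 apply: is_deriveB; first by apply: is_derive_row_comp => //; exact/dc2/b01.
have cw1 := clamp_within cv1; have cw2 := clamp_within cv2.
have cv : {within `[0, 1], continuous v}.
 apply: (within_eq (g := fun t => a' t *: (vel c1 \o clamp) (a t) + b' t *: (vel c2 \o clamp) (b t))).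
 apply: continuous_rowD.
 by apply: continuous_rowZ ca' _ => t; exact: continuous_comp (ca t) (cw1 _).
 by apply: continuous_rowZ cb' _ => t; exact: continuous_comp (cb t) (cw2 _).
 by move=> t; rewrite inE/= in_itv/= => t01; rewrite !clamp_id ?a01 ?b01.
have [C1c vE] := C1P g cc dc cv.
have [b0 _] : b 0 = 0 /\ b' 0 = 0 by apply: lo; rewrite invr_ge0.
have a0 : a 0 = 0 by rewrite /a /w1 mulr0 subr0 /m max_l// expr1n subrr.
have [a1 _] : a 1 = 1 /\ a' 1 = 0 by apply: hi.
have b1 : b 1 = 1.
 by rewrite /b /w2 mulr1 -[2 - 1]/(1 + 1 - 1) addrK /m max_l// expr1n.
exists c; split=> //.
- by rewrite /c a0 b0 subrr addr0.
- by rewrite /c a1 b1 c12 addrCA subrr addr0.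
have cb1 : {within `[0, 1], continuous (fun t => bn g (vel c t))}.
 have [_ _ cvc] := C1_velocity C1c.
 by move=> x; apply: continuous_comp (cvc x) (@bn_continuous _ _ _ g _).
have dP (t : R) : 0 <= t <= 1 -> is_derive t 1 (fun t => P1 (a t) + P2 (b t)) (bn g (vel c t)).
 move=> t01.
 have -> : bn g (vel c t) = bn g (vel c1 (a t)) * a' t + bn g (vel c2 (b t)) * b' t.
 rewrite (vE t t01) /v; have [th|/ltW th] := leP t 2^-1.
 by have [_ ->] := lo _ th; rewrite bn_comb0r.
 by have [_ ->] := hi _ th; rewrite bn_comb0l.
 apply: is_deriveD; apply: is_derive1_comp => //; [exact/hP1/a01|exact/hP2/b01].
have lc : len c = P1 (a 1) + P2 (b 1) - (P1 (a 0) + P2 (b 0)) := Rintegral_primitive cb1 dP.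
by rewrite lc a0 b0 a1 b1 l1 l2 opprD addrACA.
Qed.

Lemma dist_triangle (x y z : Q) : dist x z <= dist x y + dist y z.
have E (a b u v ep : R) : u < a + ep / 2 -> v < b + ep / 2 -> u + v <= a + b + ep by move=> *; lra.
apply/ler_addgt0Pr => ep ep0; have ep2 : 0 < ep / 2 by rewrite divr_gt0.
have [c1 [C11 c10 c11 l1]] := dist_approx x y ep2.
have [c2 [C12 c20 c21 l2]] := dist_approx y z ep2.
have [|c [cc c0 c1' l]] := C1_concat C11 C12; first by rewrite c11.
have := dist_le_length cc; rewrite c0 c1' c10 c21 l => h.
exact: le_trans h (E _ _ _ _ _ l1 l2).
Qed.

(** The curve is translated so as to start at 1. The action does not touch the components a and u of
    the velocity, so these two coordinates are bounded by the length directly; the action, which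
    depends on them alone, is then bounded, and so are the other coordinates. *)
Lemma curve_increment (L : R) : 0 <= L -> exists2 C : R, 0 <= C &
 forall (c : R -> Q) (P p : R -> R) (s u : R), C1 c -> 0 <= s -> s <= u -> u <= 1 ->
 (forall t : R, s <= t <= u -> is_derive t 1 P (p t)) ->
 (forall t : R, s <= t <= u -> bn g (vel c t) <= p t) -> P u - P s <= L ->
 `|((c s)^-1 * c u)%g : row| <= C * (P u - P s).
move=> L0; have [k1 [k2 [k10 k20 hk]]] := bn_equiv g.
have k1V : 0 <= k1^-1 by rewrite invr_ge0 ltW.
pose M := k1^-1 * L; have M0 : 0 <= M by rewrite mulr_ge0.
have p0 := pbd_ge0 (r := r) M0.
pose K := 1 + pbd (r := r) M + M; have K0 : 0 <= K by rewrite /K; nneg.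
exists (K * k1^-1) => [|c P p s u cc s0 su u1 hP hp PL]; first exact: mulr_ge0.
have [cz vz _] := C1_mull (c s)^-1%g cc.
have [_ dz _] := C1_velocity cz; rewrite vz in dz.
set z := (fun t => (c s)^-1 * c t)%g in dz *.
have zs : z s = 0 :> row by rewrite /z mulVg.
have in01 (t : R) : s <= t <= u -> 0 <= t <= 1 by move=> /andP[a b]; lra2.
have vp (t : R) : s <= t <= u -> `|vel c t| <= k1^-1 * p t.
 by move=> st; rewrite ler_pdivlMl//; have /andP[h _] := hk (vel c t); exact: le_trans h (hp t st).
have mono (t : R) : s <= t <= u -> 0 <= P u - P t.
 move=> /andP[st tu]; have h : `|cst 0 u - cst 0 t : R| <= 1 * (P u - P t).
 apply: (derive_compare (df := cst 0) (p := p) tu) => x /andP[tx xu].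
 by apply: hP; rewrite (le_trans st tx).
 rewrite normr0 mul1r; apply: le_trans (bn_ge0 g _) (hp _ _).
 by rewrite (le_trans st tx).
 by move: h; rewrite subrr normr0 mul1r.
have coord i t : s <= t <= u -> is_derive t 1 (fun t => (z t : row) 0 i)
 ((vel c t *m actx (e := e) (z t)) 0 i).
 by move=> /in01 /dz; exact: is_derive_coord.
have small i : (forall t, (vel c t *m actx (e := e) (z t)) 0 i = vel c t 0 i) ->
 forall t : R, s <= t <= u -> `|(z t : row) 0 i| <= M.
 move=> hi t /andP[st tu].
 have sub x : s <= x <= t -> s <= x <= u by move=> /andP[a b]; rewrite a (le_trans b).
 have := derive_compare (C := k1^-1) st (fun x hx => coord i x (sub x hx)) (fun x hx => hP x (sub x hx)).
 rewrite zs mxE subr0 => h; apply: le_trans (h _) _; last first.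
 by rewrite ler_wpM2l//; have := mono t; rewrite st tu => /(_ isT); lra.
 move=> x /andP[a b]; rewrite hi; apply: le_trans (vp x _); last by rewrite a (le_trans b).
 exact: (norm_bnd (vel c x) (normr_ge0 _)).1.
have sA := small _ (fun t => cA_act (cA (z t)) (cU (z t)) (vel c t)).
have sU := small _ (fun t => cU_act (cA (z t)) (cU (z t)) (vel c t)).
have su0 : 0 <= P u - P s by apply: mono; rewrite lexx.
apply/norm_bnd => [|i]; first by rewrite mulr_ge0// mulr_ge0.
have := derive_compare su (coord i) hP (C := K * k1^-1); rewrite zs mxE subr0; apply=> t st.
have := bnd_actx (e := e) M0 (sA t st) (sU t st) ((norm_bnd (vel c t) (normr_ge0 _)).1 (lexx _)) i.
move=> h; apply: le_trans h _; rewrite -mulrA; apply: ler_wpM2l => //; exact: vp.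
Qed.

Lemma dist_local (L : R) : 0 <= L -> exists2 C : R, 0 <= C & forall x y : Q,
 dist x y <= L -> `|(x^-1 * y)%g : row| <= C * dist x y.
move=> L0; have [C C0 hC] := curve_increment (addr_ge0 L0 ler01); exists C => // x y xy.
apply/ler_addgt0Pr => ep ep0.
pose d := Num.min 1 (ep / (C + 1)).
have C1' : 0 < C + 1 by lra.
have d0 : 0 < d by rewrite lt_min ltr01 divr_gt0.
have d1 : d <= 1 by rewrite ge_min lexx.
have d2 : d <= ep / (C + 1) by rewrite ge_min lexx orbT.
have [c [cc c0 c1 lc]] := dist_approx x y d0.
have [P hP lP] := length_primitive cc.
have := hC c P _ 0 1 cc (lexx _) ler01 (lexx _) hP (fun t _ => lexx _).
rewrite -lP c0 c1 => h; apply: le_trans (h _) _; first by lra.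
apply: (@le_trans _ _ (C * (dist x y + d))); first by rewrite ler_wpM2l// ltW.
rewrite mulrDr lerD2l; apply: (@le_trans _ _ ((C + 1) * d)); first by rewrite ler_wpM2r ?(ltW d0)// lerDl.
by rewrite -ler_pdivlMl// mulrC.
Qed.

Hypothesis r3 : (2 < r)%N.

Lemma dist_steps : exists2 C : R, 0 <= C & forall x y : Q,
 exists2 n, steps e n x y & n%:R <= C * (dist x y + 1).
have [B B0 hB] := curve_increment (ler01 : 0 <= 1 :> R).
have [m m0 hm] := path_steps r3 e B0.
exists (3 * m%:R) => [|x y]; first by nneg.
have [c [cc c0 c1 lc]] := dist_approx x y ltr01.
have [P hP lP] := length_primitive cc.
(* Adding t makes the length function strictly increasing, so that the points that cut the curve
   into n pieces, given by the intermediate value theorem, come in order. *)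
pose A t := P t + t.
have hA (t : R) : 0 <= t <= 1 -> is_derive t 1 A (bn g (vel c t) + 1).
 by move=> t01; have h := hP t t01; apply: is_deriveD; exact: is_derive_id.
have strict (s t : R) : 0 <= s -> s <= t -> t <= 1 -> t - s <= A t - A s.
 move=> s0 st t1; have := @derive_compare R id (fun=> 1) A (fun t => bn g (vel c t) + 1) 1 s t st.
 rewrite mul1r => h; apply: le_trans (ler_norm _) (h _ _ _) => z /andP[sz zt].
 by apply: hA; lra2.
 by rewrite mul1r ger0_norm// lerDr bn_ge0.
have cA : {within `[0, 1], continuous A} by exact: is_derive_within hA.
have l0 := length_ge0 c.
have AE : A 1 - A 0 = len c + 1 by rewrite lP /A; lra.
have L0 : 0 <= len c + 1 by lra.
have /andP[n1 n2] := Num.Theory.trunc_itv L0.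
set n := (Num.trunc (len c + 1)).+1 in n2.
have nR : 0 < n%:R :> R by rewrite ltr0n.
have nu : n%:R != 0 :> R by rewrite gt_eqF.
have tex i : exists t : R, (i <= n)%N -> 0 <= t <= 1 /\ A t = A 0 + i%:R * ((len c + 1) / n%:R).
 have [iN|] := boolP (i <= n)%N; last by exists 0.
 have q0 : 0 <= i%:R * ((len c + 1) / n%:R) by rewrite mulr_ge0// divr_ge0// ltW.
 have q1 : i%:R * ((len c + 1) / n%:R) <= len c + 1.
 rewrite mulrCA ler_piMr// ler_pdivrMr// mul1r ler_nat//.
 have [|t] := @IVT R A 0 1 (A 0 + i%:R * ((len c + 1) / n%:R)) ler01 cA.
 by rewrite min_l ?max_r; [apply/andP; split|..]; lra.
 by rewrite in_itv/= => t01 E; exists t.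
have [t ht] := choice tex.
have t0 : t 0%N = 0.
 have [/andP[a b] E] := ht 0%N isT; have := strict 0 _ (lexx _) a b.
 by rewrite E mul0r addr0 subrr; lra.
have tn : t n = 1.
 have [/andP[a b] E] := ht n (leqnn n); have := strict _ 1 a b (lexx _).
 by rewrite E mulrCA divff// mulr1; lra.
have := hm n (fun i => c (t i)); rewrite t0 tn c0 c1 => h.
exists (n * m)%N; first (apply: h => i iN).
 have [/andP[a b] E] := ht i (ltnW iN); have [/andP[a' b'] E'] := ht _ iN.
 have q0 : 0 <= (len c + 1) / n%:R by rewrite divr_ge0// ltW.
 have q1 : (len c + 1) / n%:R <= 1 by rewrite ler_pdivrMr// mul1r ltW.
 have EE : A (t i.+1) - A (t i) = (len c + 1) / n%:R by rewrite E E' -[i.+1%:R]natr1; ring.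
 have [tt|/ltW tt] := leP (t i) (t i.+1); last first.
 have tE : t i = t i.+1 by have := strict _ _ a' tt b; lra.
 by rewrite tE; apply: near_refl.
 have in01 (z : R) : t i <= z <= t i.+1 -> 0 <= z <= 1 by move=> /andP[zt tz]; lra2.
 have := hB c A (fun t => bn g (vel c t) + 1) _ _ cc a tt b' (fun z hz => hA z (in01 z hz)).
 rewrite EE => /(_ _ q1) h'; apply/norm_bnd => //.
 apply: le_trans (h' _) _; first by move=> z _; rewrite lerDl.
 by rewrite ler_piMr.
rewrite natrM mulrAC ler_wpM2r//; have d0 := dist_ge0 x y.
apply: le_trans (_ : (len c + 1) + 1 <= _); last by lra.
by rewrite /n -natr1 lerD2r.
Qed.

Lemma riem_comparable : @comparable R r row id e dist.
have [C1' C10 h1] := dist_steps; have [C2 C20 h2] := ray_dist (ler01 : 0 <= 1 :> R).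
exists (C1' + C2); split=> [|x y|n x y|x y].
- by nneg.
- exact: dist_ge0.
- move=> [f [<- <- _ hf]]; apply: (@le_trans _ _ (C2 * n%:R)); last first.
 by rewrite ler_pM//; lra.
 elim: n hf => [|n IH] hf; first by rewrite distxx mulr0.
 apply: le_trans (dist_triangle _ (f n) _) _; rewrite -[n.+1%:R]natr1 mulrDr mulr1.
 apply: lerD; first by apply: IH => i iN; apply/hf/leqW.
 apply: le_trans (h2 _ _ (hf n (ltnSn n))) _; rewrite ler_piMr//.
 by apply/norm_bnd => //; exact: (hf n (ltnSn n)).
have [n st nC] := h1 x y; exists n => //; apply: le_trans nC _.
by rewrite ler_wpM2r ?lerDl//; have := dist_ge0 x y; lra.
Qed.

End RiemannianDistance.

(** * Arclength parametrization of rectifiable loops *)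

Section Arclength.
Context {R : realType} {X : Type} (d : X -> X -> R).
Hypothesis dxx : forall x, d x x = 0.
Hypothesis d0 : forall x y, 0 <= d x y.
Hypothesis dtri : forall x y z, d x z <= d x y + d y z.
Variable c : R -> X.

(* The chord sums of c along the subdivisions of [a, b], repetitions allowed. *)
Inductive chain : R -> R -> R -> Prop :=
| chain0 a : chain a a 0
| chainS a b t s : a <= b -> chain b t s -> chain a t (d (c a) (c b) + s).

Lemma chain_le a b s : chain a b s -> a <= b.
by elim=> // {a s} a t b' s at_ _; exact: le_trans. Qed.

Lemma chain_cat a b t s s' : chain a b s -> chain b t s' -> chain a t (s + s').
move=> h; elim: h => [a'|a' b' t' s1 ab _ IH] h'; first by rewrite add0r.
by rewrite -addrA; apply: chainS => //; exact: IH.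
Qed.

Lemma chain1 a b : a <= b -> chain a b (d (c a) (c b)).
by move=> ab; rewrite -[d _ _]addr0; apply: chainS => //; exact: chain0. Qed.

Lemma chain_insert a b s t : chain a b s -> a <= t -> t <= b ->
 exists s1 s2, [/\ chain a t s1, chain t b s2 & s <= s1 + s2].
move=> h; elim: h t => [a'|a' b' t' s1 ab h IH] t at_ tb.
 have -> : t = a' by apply/eqP; rewrite eq_le at_ tb.
 by exists 0, 0; split; [exact: chain0|exact: chain0|rewrite addr0].
have [bt|/ltW tb'] := leP b' t.
 have [u1 [u2 [h1 h2 h3]]] := IH t bt tb.
 by exists (d (c a') (c b') + u1), u2; split=> //; [exact: chainS|rewrite -addrA lerD2l].
exists (d (c a') (c t)), (d (c t) (c b') + s1); split; [exact: chain1|exact: chainS|].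
by rewrite addrA lerD2r.
Qed.

Lemma chain_first a b s : chain a b s -> a < b ->
 exists a' s', [/\ a < a', a' <= b, chain a' b s' & s = d (c a) (c a') + s'].
move=> h; elim: h => [a'|a' b' t' s1 ab h IH] at_; first by rewrite ltxx in at_.
have [bb|ba] := ltP a' b'; first by exists b', s1; split=> //; exact: chain_le h.
have E : a' = b' by apply/eqP; rewrite eq_le ab.
by rewrite E dxx add0r; apply: IH; rewrite -E.
Qed.

Lemma chain_last a b s : chain a b s -> a < b ->
 exists b' s', [/\ b' < b, a <= b', chain a b' s' & s = s' + d (c b') (c b)].
move=> h; elim: h => [a'|a' b' t' s1 ab h IH] at_; first by rewrite ltxx in at_.
have [bt|tb] := ltP b' t'.
 have [b2 [s2 [h1 h2 h3 ->]]] := IH bt; exists b2, (d (c a') (c b') + s2).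
 by split=> //; [exact: le_trans h2|exact: chainS|rewrite addrA].
have E : b' = t' by apply/eqP; rewrite eq_le tb (chain_le h).
move: h; rewrite -E => h; exists a', 0; split=> //; [by rewrite E|exact: chain0|].
have -> : s1 = 0.
 have : b' <= b' by [].
 have : forall x y z, chain x y z -> x = y -> z = 0.
 move=> x y z; elim=> // x1 x2 x3 z1 x12 hz IHz E3.
 have E2 : x2 = x3 by apply/eqP; rewrite eq_le (chain_le hz) -E3 x12.
 by rewrite (IHz E2) E3 -E2 dxx addr0.
 by move=> /(_ _ _ _ h erefl).
by rewrite addr0 add0r.
Qed.

Variable l : R.
Hypothesis lP : forall s, chain 0 1 s -> s <= l.
Hypothesis cc : forall t0 : R, 0 <= t0 <= 1 -> forall ep : R, 0 < ep ->
 exists2 del : R, 0 < del & forall t : R, 0 <= t <= 1 -> `|t - t0| < del ->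
 d (c t) (c t0) < ep /\ d (c t0) (c t) < ep.

Definition arclen a b : R := sup [set s | chain a b s].

Lemma chain_bound a b s : 0 <= a -> b <= 1 -> chain a b s -> s <= l.
move=> a0 b1 h.
have := lP (chain_cat (chain_cat (chain1 a0) h) (chain1 b1)).
by have := d0 (c 0) (c a); have := d0 (c b) (c 1); lra.
Qed.

Lemma chain_sup a b : 0 <= a -> a <= b -> b <= 1 -> has_sup [set s | chain a b s].
move=> a0 ab b1; split; first by exists (d (c a) (c b)); exact: chain1.
by exists l => s; exact: chain_bound.
Qed.

Lemma arclen_ub a b s : 0 <= a -> b <= 1 -> chain a b s -> s <= arclen a b.
by move=> a0 b1 h; have [_ hs] := chain_sup a0 (chain_le h) b1; exact: ub_le_sup.
Qed.

Lemma arclen_approx a b ep : 0 <= a -> a <= b -> b <= 1 -> 0 < ep ->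
 exists2 s, chain a b s & arclen a b - ep < s.
by move=> a0 ab b1 ep0; exact: sup_adherent ep0 (chain_sup a0 ab b1). Qed.

Lemma arclen_add a b t : 0 <= a -> a <= b -> b <= t -> t <= 1 ->
 arclen a t = arclen a b + arclen b t.
move=> a0 ab bt t1; have b0 := le_trans a0 ab; have b1 := le_trans bt t1.
apply/eqP; rewrite eq_le; apply/andP; split.
 apply: ge_sup; first by case: (chain_sup a0 (le_trans ab bt) t1).
 move=> s h; have [s1 [s2 [h1 h2 h3]]] := chain_insert h ab bt.
 by apply: le_trans h3 _; apply: lerD; apply: arclen_ub.
apply/ler_addgt0Pr => ep ep0; have ep2 : 0 < ep / 2 by rewrite divr_gt0.
have [s1 h1 e1] := arclen_approx a0 ab b1 ep2; have [s2 h2 e2] := arclen_approx b0 bt t1 ep2.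
by have := arclen_ub a0 t1 (chain_cat h1 h2); lra.
Qed.

Lemma arclen_chord a b : 0 <= a -> a <= b -> b <= 1 -> d (c a) (c b) <= arclen a b.
by move=> a0 ab b1; apply: arclen_ub => //; exact: chain1. Qed.

Lemma arclenxx a : 0 <= a <= 1 -> arclen a a = 0.
by move=> /andP[a0 a1]; have := arclen_add a0 (lexx a) (lexx a) a1; lra.
Qed.

Lemma arclen_ge0 a b : 0 <= a -> a <= b -> b <= 1 -> 0 <= arclen a b.
by move=> a0 ab b1; exact: le_trans (d0 _ _) (arclen_chord a0 ab b1). Qed.

(** A nearly optimal chain on [0, t0] has a last vertex b < t0. For t in between, the length of
    [t, t0] exceeds the chord by no more than the defect of the chain, and the chord is small
    because c is continuous. The right side is symmetric. *)
Lemma arclen_continuous : {within `[0, 1], continuous (arclen 0)}.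
apply/subspace_continuousP => t0 /=; rewrite in_itv/= => t01.
have /andP[t00 t11] := t01.
apply/cvgrPdist_lt => ep ep0; have ep2 : 0 < ep / 2 by rewrite divr_gt0.
have [del del0 hdel] := cc t01 ep2.
have [dl dl0 hl] : exists2 dl : R, 0 < dl & forall t, 0 <= t -> t <= t0 -> t0 - dl < t ->
 arclen t t0 < ep.
 have [t0E|] := eqVneq t0 0.
 exists 1 => // t t_0 tt _; have -> : t = t0 by lra.
 by rewrite arclenxx.
 rewrite neq_lt ltNge t00/= => tp.
 have [s hs es] := arclen_approx (lexx 0) t00 t11 ep2.
 have [b [s' [bt b0 hs' E]]] := chain_last hs tp.
 exists (Num.min del (t0 - b)) => [|t t_0 tt]; first by rewrite lt_min del0 subr_gt0.
 move=> td; have td1 : t0 - t < del.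
 by apply: lt_le_trans (_ : Num.min del (t0 - b) <= _); [lra|rewrite ge_min lexx].
 have td2 : b < t.
 suff : t0 - t < t0 - b by lra.
 by apply: lt_le_trans (_ : Num.min del (t0 - b) <= _); [lra|rewrite ge_min lexx orbT].
 have [||h1 _] := hdel t; [by rewrite t_0 (le_trans tt)|by rewrite distrC ger0_norm; lra|].
 have h2 := arclen_ub (lexx 0) (le_trans tt t11) (chain_cat hs' (chain1 (ltW td2))).
 have h3 := dtri (c b) (c t) (c t0).
 by have := arclen_add (lexx 0) t_0 tt t11; lra.
have [dr dr0 hr] : exists2 dr : R, 0 < dr & forall t, t0 <= t -> t <= 1 -> t < t0 + dr ->
 arclen t0 t < ep.
 have [t0E|] := eqVneq t0 1.
 exists 1 => // t tt t_1 _; have -> : t = t0 by lra.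
 by rewrite arclenxx.
 rewrite neq_lt [1 < _]ltNge t11 orbF => tp.
 have [s hs es] := arclen_approx t00 t11 (lexx 1) ep2.
 have [b [s' [bt b1 hs' E]]] := chain_first hs tp.
 exists (Num.min del (b - t0)) => [|t tt t_1]; first by rewrite lt_min del0 subr_gt0.
 move=> td; have td1 : t - t0 < del.
 by apply: lt_le_trans (_ : Num.min del (b - t0) <= _); [lra|rewrite ge_min lexx].
 have td2 : t < b.
 suff : t - t0 < b - t0 by lra.
 by apply: lt_le_trans (_ : Num.min del (b - t0) <= _); [lra|rewrite ge_min lexx orbT].
 have [||_ h1] := hdel t; [by rewrite t_1 (le_trans t00)|by rewrite ger0_norm; lra|].
 have h2 := arclen_ub (le_trans t00 tt) (lexx 1) (chainS (ltW td2) hs').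
 have h3 := dtri (c t0) (c t) (c b).
 by have := arclen_add t00 tt t_1 (lexx 1); lra.
rewrite near_withinE; near=> t => /=; rewrite in_itv/= => /andP[t_0 t_1].
have tn : `|t - t0| < Num.min dl dr.
 near: t; apply/nbhs_ballP; exists (Num.min dl dr); first by rewrite /= lt_min dl0.
 by move=> t; rewrite -ball_normE/= distrC.
rewrite lt_min in tn; case/andP: tn => tl tr.
rewrite -[X in X < _]/(`|arclen 0 t0 - arclen 0 t|).
have [tt|/ltW tt] := leP t t0.
 have h := hl t t_0 tt; rewrite (arclen_add (lexx 0) t_0 tt t11) addrAC subrr add0r ger0_norm ?arclen_ge0//.
 by apply: h; move: tl; rewrite distrC ger0_norm; lra.
have h := hr t tt t_1; rewrite (arclen_add (lexx 0) t00 tt t_1) opprD addrA subrr add0r normrN ger0_norm ?arclen_ge0//.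
by apply: h; move: tr; rewrite ger0_norm; lra.
Unshelve. all: by end_near.
Qed.

(** The new parameter is proportional to t plus the arclength, which is strictly increasing and so
    invertible even where c stands still. The summand t accounts for the 1 in the Lipschitz constant
    1 + l. *)
Lemma arclen_reparam : exists (sg : R -> R) (c' : R -> X),
 [/\ {within `[0, 1], continuous sg}, {in `[0, 1] &, {homo sg : x y / x <= y}},
 sg 0 = 0 /\ sg 1 = 1, forall t, 0 <= t <= 1 -> c t = c' (sg t) &
 forall x y : R, 0 <= x -> x <= y -> y <= 1 -> d (c' x) (c' y) <= (1 + l) * (y - x)].
pose T := arclen 0 1; have T0 : 0 <= T by apply: arclen_ge0.
have Tl : T <= l by apply: ge_sup; [case: (chain_sup (lexx 0) ler01 (lexx 1))|move=> s; exact: lP].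
have T1 : 0 < 1 + T by lra.
pose sg t := (t + arclen 0 t) / (1 + T).
have sgB x y : 0 <= x -> x <= y -> y <= 1 -> sg y - sg x = (y - x + arclen x y) / (1 + T).
 by move=> x0 xy y1; rewrite /sg (arclen_add (lexx 0) x0 xy y1); ring.
have csg : {within `[0, 1], continuous sg}.
 move=> x; apply: (@cvgMl R _ _ _ (fun x => x + arclen 0 x)).
 apply: cvgD; last exact: arclen_continuous.
 by have := @continuous_subspaceT R R `[0, 1]%classic id (fun x => @cvg_id _ (nbhs x)); apply.
have sg0 : sg 0 = 0 by rewrite /sg arclenxx ?lexx ?ler01// addr0 mul0r.
have sg1 : sg 1 = 1 by rewrite /sg divff// gt_eqF.
have hT (th : R) : exists t : R, 0 <= th <= 1 -> 0 <= t <= 1 /\ sg t = th.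
 have [th01|] := boolP (0 <= th <= 1); last by exists 0.
 have [|t] := @IVT R sg 0 1 th ler01 csg.
 by rewrite sg0 sg1 min_l ?max_r.
 by rewrite in_itv/= => t01 E; exists t.
have [tau htau] := choice hT.
have strict x y : 0 <= x <= 1 -> 0 <= y <= 1 -> sg x <= sg y -> x <= y.
 move=> /andP[x0 x1] /andP[y0 y1] h; rewrite leNgt; apply/negP => yx.
 have := sgB y x y0 (ltW yx) x1.
 have : 0 < (x - y + arclen y x) / (1 + T).
 by rewrite divr_gt0//; have := arclen_ge0 y0 (ltW yx) x1; lra.
 lra.
exists sg, (c \o tau); split=> //.
- move=> x y; rewrite !in_itv/= => /andP[x0 x1] /andP[y0 y1] xy.
 by rewrite -subr_ge0 sgB// divr_ge0 ?(ltW T1)// addr_ge0 ?arclen_ge0// subr_ge0.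
- move=> t t01 /=.
 have st : 0 <= sg t <= 1.
 have /andP[t0 t1] := t01.
 have := sgB _ _ (lexx 0) t0 t1; have := sgB _ _ t0 t1 (lexx 1); rewrite sg0 sg1 => h1 h2.
 have p1 : 0 <= (t - 0 + arclen 0 t) / (1 + T) by rewrite divr_ge0 ?(ltW T1)// addr_ge0 ?arclen_ge0// subr0.
 have p2 : 0 <= (1 - t + arclen t 1) / (1 + T) by rewrite divr_ge0 ?(ltW T1)// addr_ge0 ?arclen_ge0// subr_ge0.
 by lra2.
 have [u01 uE] := htau _ st; congr c.
 have h1 : t <= tau (sg t) by apply: (strict _ _ t01 u01); rewrite uE lexx.
 have h2 : tau (sg t) <= t by apply: (strict _ _ u01 t01); rewrite uE lexx.
 by apply/eqP; rewrite eq_le h1 h2.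
move=> x y x0 xy y1 /=.
have x01 : 0 <= x <= 1 by rewrite x0 (le_trans xy).
have y01 : 0 <= y <= 1 by rewrite y1 (le_trans x0).
have [u01 uE] := htau _ x01; have [v01 vE] := htau _ y01.
have uv : tau x <= tau y by apply: strict => //; rewrite uE vE.
have /andP[u0 u1] := u01; have /andP[v0 v1] := v01.
apply: le_trans (arclen_chord u0 uv v1) _.
have := sgB _ _ u0 uv v1; rewrite uE vE => E.
apply: (@le_trans _ _ ((1 + T) * (y - x))); last by rewrite ler_wpM2r ?subr_ge0//; lra.
by rewrite E mulrC divfK ?gt_eqF// lerDr subr_ge0.
Qed.

End Arclength.

Section RectifiableLoops.
Context {R : realType} {r : nat} {e : bool}.
Local Notation Q := (filiprod R r e).
Local Notation row := 'rV[R]_(3 + r).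
Variable g : leftinv_metric (filiLieG R r e).
Local Notation dist := (@riem_dist R (3 + r) (filiLieG R r e) g).
Local Notation len := (@smooth_length R (3 + r) (filiLieG R r e) g).
Local Notation C1 := (@C1_curve R (3 + r) (filiLieG R r e) g).

Lemma dist_sym (x y : Q) : dist x y = dist y x.
have le (x' y' : Q) : dist x' y' <= dist y' x'.
 apply/ler_addgt0Pr => ep ep0.
 have [c [cc c0 c1 lc]] := dist_approx g y' x' ep0.
 have [P hP lP] := length_primitive cc.
 have [ct dc cv] := C1_velocity cc.
 pose v (t : R) : row := - velocity g c (1 - t).
 have flip (t : R) : 0 <= t <= 1 -> 0 <= 1 - t <= 1 by move=> /andP[a b]; lra2.
 have df (t : R) : is_derive t 1 (fun t : R => 1 - t) (-1).
 by rewrite -[-1]sub0r; apply: is_deriveB.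
 have cf : continuous (fun t : R => 1 - t).
 by move=> t; apply/differentiable_continuous/derivable1_diffP; have [] := df t.
 have cw := clamp_within cv.
 have [C1v vE] : C1 (fun t => c (1 - t)) /\ forall t : R, 0 <= t <= 1 -> velocity g (fun t => c (1 - t)) t = v t.
 apply: C1P.
 - by move=> t; exact: continuous_comp (cf t) (ct _).
 - move=> t t01; rewrite /v mulNmx -scaleN1r.
 by apply: is_derive_row_comp => //; exact/dc/flip.
 apply: (@within_eq R row _ v (fun t : R => - (velocity g c \o clamp) (1 - t))).
 by move=> t; apply: (@cvgN R row); exact: continuous_comp (cf t) (cw _).
 by move=> t; rewrite inE/= in_itv/= => /flip t01; rewrite /= clamp_id.
 have := dist_le_length C1v; rewrite /= subr0 subrr c0 c1 => h.
 apply: le_trans h _; apply: ltW; apply: le_lt_trans lc.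
 have bE (t : R) : 0 <= t <= 1 -> bn g (velocity g (fun t => c (1 - t)) t) = bn g (velocity g c (1 - t)).
 by move=> /vE ->; rewrite /v -scaleN1r bnZ normrN1 mul1r.
 have cb1 : {within `[0, 1], continuous (fun t => bn g (velocity g (fun t => c (1 - t)) t))}.
 have [_ _ cvc] := C1_velocity C1v.
 by move=> x1; apply: continuous_comp (cvc x1) (@bn_continuous _ _ _ g _).
 have dP (t : R) : 0 <= t <= 1 -> is_derive t 1 (fun t => - P (1 - t))
 (bn g (velocity g (fun t => c (1 - t)) t)).
 move=> t01; rewrite (bE t t01) -[bn _ _]opprK -[- bn _ _]mulrN1.
 by apply: is_deriveN; apply: is_derive1_comp => //; exact/hP/flip.
 have -> : smooth_length g (fun t => c (1 - t)) = - P (1 - 1) - - P (1 - 0) := Rintegral_primitive cb1 dP.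
 by rewrite lP subrr subr0 opprK addrC.
by apply/eqP; rewrite eq_le !le.
Qed.

Lemma dist_cont (c : R -> Q) (t0 : R) : is_path (c : R -> filiLieG R r e) -> 0 <= t0 <= 1 ->
 forall ep : R, 0 < ep -> exists2 del : R, 0 < del & forall t : R, 0 <= t <= 1 -> `|t - t0| < del ->
 dist (c t) (c t0) < ep.
move=> pc t01 ep ep0; have [C C0 hC] := ray_dist g (ler01 : 0 <= 1 :> R).
have cp := clamp_within pc.
have ch : continuous (fun t => ((c t0 : row) - c (clamp t)) *m actxV (e := e) (c (clamp t))).
 apply: actxV_continuous; first exact: cp.
 by move=> t; apply: (@cvgB R row); [exact: cvg_cst|exact: cp].
have C1' : 0 < C + 1 by lra.
pose d := Num.min 1 (ep / (C + 1)).
have dd0 : 0 < d by rewrite lt_min ltr01 divr_gt0.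
have := ch t0; rewrite /= /continuous_at clamp_id// subrr mul0mx => /cvgrPdist_lt /(_ _ dd0).
rewrite nearE => /nbhs_ballP[del /= del0 hdel]; exists del => // t tt td.
have := hdel t; rewrite -ball_normE/= distrC => /(_ td); rewrite clamp_id// sub0r normrN.
have <- : ((c t)^-1 * c t0)%g = (((c t0 : row) - c t) *m actxV (e := e) (c t)) :> row := divE _ _.
rewrite lt_min => /andP[h1 h2].
apply: le_lt_trans (hC _ _ _) _; first by apply/norm_bnd => //; exact: ltW.
apply: (@le_lt_trans _ _ ((C + 1) * `|((c t)^-1 * c t0)%g : row|)).
 by rewrite ler_wpM2r// lerDl.
by rewrite -ltr_pdivlMl// mulrC.
Qed.

Lemma chain_partition (c : R -> Q) (a b s : R) : chain dist c a b s -> exists2 u,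
 itv_partition a b u & s = \sum_(p <- zip (a :: u) u) dist (c p.1) (c p.2).
elim=> {a b s} [a|a b t s ab _ [u [pu lu] ->]].
 by exists [::]; [split=> /=|rewrite big_nil].
move: ab; rewrite le_eqVlt => /orP[/eqP ->|ab].
 exists u; first by split.
 by rewrite distxx add0r.
by exists (b :: u); rewrite ?big_cons// /itv_partition/= ab.
Qed.

Lemma loop_reparam (c : R -> Q) (l : R) : loop_of_length_le g (c : R -> filiLieG R r e) l ->
 exists (sg : R -> R) (c' : R -> Q),
 [/\ {within `[0, 1], continuous sg}, {in `[0, 1] &, {homo sg : x y / x <= y}},
 sg 0 = 0 /\ sg 1 = 1, (forall t, 0 <= t <= 1 -> c t = c' (sg t)) /\ c' 0 = c' 1 &
 forall x y : R, 0 <= x <= 1 -> 0 <= y <= 1 -> dist (c' x) (c' y) <= (1 + l) * `|y - x|].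
move=> [pc c01 cl].
have lP s : chain dist c 0 1 s -> s <= l.
 move=> /chain_partition[u pu ->]; rewrite -lee_fin; apply: le_trans cl.
 by apply: ereal_sup_ubound; exists u.
have cc (t0 : R) : 0 <= t0 <= 1 -> forall ep : R, 0 < ep ->
 exists2 del : R, 0 < del & forall t : R, 0 <= t <= 1 -> `|t - t0| < del ->
 dist (c t) (c t0) < ep /\ dist (c t0) (c t) < ep.
 move=> t01 ep ep0; have [del del0 h] := dist_cont pc t01 ep0; exists del => // t tt td.
 by rewrite (dist_sym (c t0)); split; exact: h.
have [sg [c' [h1 h2 [s0 s1] h4 h5]]] := arclen_reparam (distxx g) (dist_ge0 g)
 (dist_triangle g) lP cc.
exists sg, c'; split=> //.
 by split=> //; rewrite -s0 -s1 -!h4 ?lexx ?ler01.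
move=> x y /andP[x0 x1] /andP[y0 y1]; have [xy|/ltW yx] := leP x y.
 by rewrite ger0_norm ?subr_ge0// h5.
by rewrite dist_sym distrC ger0_norm ?subr_ge0// h5.
Qed.

End RectifiableLoops.

(** * From grids of points to Lipschitz strips *)

Section Interpolation.
Context {R : realType} {r : nat} {e : bool}.
Local Notation Q := (filiprod R r e).
Local Notation row := 'rV[R]_(3 + r).
Variable g : leftinv_metric (filiLieG R r e).
Local Notation dist := (@riem_dist R (3 + r) (filiLieG R r e) g).

Definition lerp (x y : row) (s : R) : row := x + s *: (y - x).

Lemma lerp0 x y : lerp x y 0 = x. by rewrite /lerp scale0r addr0. Qed.
Lemma lerp1 x y : lerp x y 1 = y. by rewrite /lerp scale1r addrC subrK. Qed.
Lemma lerpxx x s : lerp x x s = x. by rewrite /lerp subrr scaler0 addr0. Qed.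

(** Left translations are affine, so interpolation of coordinates is a left-invariant operation. *)
Lemma lerp_mull (z x y : Q) s : (z * (lerp x y s : Q))%g = lerp (z * x)%g (z * y)%g s :> row.
rewrite /lerp !mulE mulmxDl -scalemxAl mulmxBl addrA; congr (_ + _ *: _).
by rewrite opprD addrACA subrr add0r.
Qed.

Lemma norm_rowD3 (a b c : row) (A B C : R) : `|a| <= A -> `|b| <= B -> `|c| <= C ->
 `|a + b + c| <= A + B + C.
move=> ha hb hc; apply: le_trans (ler_normD _ _) (lerD _ hc).
by apply: le_trans (ler_normD _ _) (lerD ha hb).
Qed.

Lemma lerp_diff (D A D' : row) (s s' : R) :
 lerp A D' s' - lerp 0 D s = (1 - s') *: A + s' *: (D' - D) + (s' - s) *: D.
rewrite /lerp add0r subr0; apply/rowP => i; rewrite !mxE; ring.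
Qed.

Lemma norm_scale1 (v : row) (s B : R) : 0 <= s <= 1 -> `|v| <= B -> `|s *: v| <= B.
move=> /andP[s0 s1] vB; rewrite normrZ ger0_norm//; apply: le_trans vB.
by rewrite -[leRHS]mul1r ler_wpM2r.
Qed.

(** Translating by x^-1 brings all four corners to bounded coordinates, where the Riemannian
    distance and the norm of the difference control each other. Separating [del] from the
    interpolation parameter lets one estimate serve along rows and across them. *)
Lemma dist_lerp (K : R) : 0 <= K -> exists2 K' : R, 0 <= K' &
 forall (x y x' y' : Q) (s s' del : R), 0 <= del <= 1 -> 0 <= s <= 1 -> 0 <= s' <= 1 ->
 dist x x' <= K * del -> dist y y' <= K * del -> dist x y <= K ->
 dist (lerp x y s) (lerp x' y' s') <= K' * (`|s' - s| + del).
move=> K0; have [C C0 hC] := dist_local g K0.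
pose B := C * K; have B0 : 0 <= B by rewrite mulr_ge0.
pose k := 1 + pbd (r := r) B + B.
have k0 : 0 <= k by have p0 := pbd_ge0 (r := r) B0; rewrite /k; nneg.
pose K2 := B + k * B; have K20 : 0 <= K2 by rewrite /K2; nneg.
pose M := k * K2 * 2; have M0 : 0 <= M by rewrite /M; nneg.
have [C' C'0 hC'] := ray_dist g M0.
exists (C' * (k * K2)) => [|x y x' y' s s' del /andP[del0 del1] s01 s'01 xx' yy' xy]; first by rewrite /K2; nneg.
have Kd : K * del <= K by rewrite ler_piMr.
pose A : Q := (x^-1 * x')%g; pose D : Q := (x^-1 * y)%g; pose D' : Q := (x^-1 * y')%g.
have hA : `|A : row| <= B * del.
 apply: le_trans (hC _ _ (le_trans xx' Kd)) _; rewrite /B -mulrA; exact: ler_wpM2l.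
have hD : `|D : row| <= B by apply: le_trans (hC _ _ xy) _; exact: ler_wpM2l.
have bD := (norm_bnd (D : row) B0).1 hD.
have [DA DU _ _] := (bndP B (D : row)).1 bD.
have hDD : `|(D' : row) - D| <= k * (B * del).
 have <- : ((D^-1 * D')%g : row) *m actx (e := e) D = (D' : row) - D.
 by rewrite divE -mulmxA actxV_actx mulmx1.
 apply: le_trans (norm_actx _ B0 DA DU) _; apply: ler_wpM2l => //.
 have -> : (D^-1 * D')%g = (y^-1 * y')%g by rewrite /D /D' invgM invgK -mulgA mulVKg.
 by apply: le_trans (hC _ _ (le_trans yy' Kd)) _; rewrite /B -mulrA; exact: ler_wpM2l.
have <- := dist_mull g (x^-1)%g.
rewrite !lerp_mull mulVg -/A -/D -/D'.
set f := lerp _ D s; set f' := lerp A D' s'.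
have hf : `|f' - f : row| <= K2 * (`|s' - s| + del).
 have -> : f' - f = (1 - s') *: (A : row) + s' *: ((D' : row) - D) + (s' - s) *: (D : row).
 exact: lerp_diff.
 apply: le_trans (norm_rowD3 (A := B * del) (B := k * (B * del)) (C := B * `|s' - s|) _ _ _) _.
 - by apply: norm_scale1 hA; case/andP: s'01 => a b; lra2.
 - exact: norm_scale1 hDD.
 - by rewrite normrZ mulrC; apply: ler_wpM2r.
 have kB : 0 <= k * B * `|s' - s| by nneg.
 have -> : K2 * (`|s' - s| + del) = B * del + k * (B * del) + B * `|s' - s| + k * B * `|s' - s|.
 by rewrite /K2; ring.
 by rewrite lerDl.
have fB : `|- f : row| <= B.
 by rewrite normrN /f /lerp add0r subr0; exact: norm_scale1.
have [fA fU _ _] := (bndP B (- f : row)).1 ((norm_bnd (- f : row) B0).1 fB).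
have hz : `|(((f : Q)^-1 * (f' : Q))%g : row)| <= k * K2 * (`|s' - s| + del).
 rewrite (divE (f : Q) (f' : Q)) -actx_oppr -mulrA.
 by apply: le_trans (norm_actx _ B0 fA fU) _; apply: ler_wpM2l.
have ss : `|s' - s| <= 1 by case/andP: s01 => ? ?; case/andP: s'01 => ? ?; rewrite ler_norml; lra2.
apply: le_trans (hC' (f : Q) (f' : Q) _) _; last by rewrite -mulrA; exact: ler_wpM2l.
apply/norm_bnd => //; apply: le_trans hz _; rewrite /M; apply: ler_wpM2l; first by nneg.
lra.
Qed.

(** Points at distance at most 1 lie in the same or in adjacent unit intervals, so one triangle
    inequality at the common endpoint suffices and the constant is not lost. *)
Lemma lipschitz_glue (f : R -> Q) (K : R) (M : nat) :
 (forall (i : nat) (x y : R), (i < M)%N -> i%:R <= x <= i.+1%:R -> i%:R <= y <= i.+1%:R ->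
 dist (f x) (f y) <= K * `|y - x|) ->
 forall x y : R, 0 <= x <= M%:R -> 0 <= y <= M%:R -> `|y - x| <= 1 ->
 dist (f x) (f y) <= K * `|y - x|.
move=> h.
have wl (x y : R) : 0 <= x -> x <= y -> y <= M%:R -> y <= x + 1 -> dist (f x) (f y) <= K * `|y - x|.
 move=> x0 xy yM yx; have /andP[i1 i2] := Num.Theory.trunc_itv x0.
 set i := Num.trunc x in i1 i2.
 have [iM|Mi] := ltnP i M; last first.
 have Mi' : M%:R <= i%:R :> R by rewrite ler_nat.
 have -> : y = x by lra.
 by rewrite distxx subrr normr0 mulr0.
 have [yi|iy] := leP y i.+1%:R.
 by apply: h iM _ _; lra2.
 have i2' : i.+1%:R <= i.+2%:R :> R by rewrite ler_nat.
 have iE : i.+2%:R = i.+1%:R + 1 :> R by rewrite -natr1.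
 have iM2 : (i.+1 < M)%N by rewrite -(ltr_nat R); lra.
 have h1 := h i x i.+1%:R iM; have h2 := h i.+1 i.+1%:R y iM2.
 apply: le_trans (dist_triangle g _ (f i.+1%:R) _) _.
 apply: le_trans (lerD (h1 _ _) (h2 _ _)) _.
 - by lra2.
 - by apply/andP; split; [rewrite ler_nat|].
 - by apply/andP; split; [|rewrite ler_nat].
 - by rewrite (ltW iy)/= iE; lra.
 rewrite [`|y - x|]ger0_norm ?[`|_ - x|]ger0_norm ?[`|y - _%:R|]ger0_norm ?subr_ge0 ?(ltW i2) ?(ltW iy)//.
 by rewrite -mulrDr; have -> : i.+1%:R - x + (y - i.+1%:R) = y - x by ring.
move=> x y /andP[x0 xM] /andP[y0 yM] xy; have [le|/ltW le] := leP x y.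
 by apply: wl => //; move: xy; rewrite ger0_norm ?subr_ge0//; lra.
rewrite dist_sym distrC; apply: wl => //.
by move: xy; rewrite distrC ger0_norm ?subr_ge0//; lra.
Qed.

Definition polygon (G : nat -> row) (x : R) : row :=
 lerp (G (Num.trunc x)) (G (Num.trunc x).+1) (x - (Num.trunc x)%:R).

Lemma polygonE G (i : nat) (x : R) : i%:R <= x <= i.+1%:R -> polygon G x = lerp (G i) (G i.+1) (x - i%:R).
move=> /andP[ix xi]; have x0 : 0 <= x by apply: le_trans ix.
have /andP[i1 i2] := Num.Theory.trunc_itv x0.
have := xi; rewrite le_eqVlt => /orP[/eqP E|xi'].
 by rewrite /polygon E natrK subrr lerp0 -natr1 addrAC subrr add0r lerp1.
have E : Num.trunc x = i.
 apply/eqP; rewrite eqn_leq -ltnS -(ltr_nat R) -[X in _ && X]ltnS -(ltr_nat R).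
 by apply/andP; split; [exact: le_lt_trans i1 xi'|exact: le_lt_trans ix i2].
by rewrite /polygon E.
Qed.

Lemma polygon_nat G i : polygon G i%:R = G i.
by rewrite (@polygonE G i); [rewrite subrr lerp0|rewrite lexx ler_nat/=]. Qed.

Lemma dist_polygon (B : R) : 0 <= B -> exists2 K : R, 0 <= K & forall (G : nat -> Q) (M : nat),
 (forall i, (i < M)%N -> near_by B (G i) (G i.+1)) ->
 forall x y : R, 0 <= x <= M%:R -> 0 <= y <= M%:R -> `|y - x| <= 1 ->
 dist (polygon G x) (polygon G y) <= K * `|y - x|.
move=> B0; have [C C0 hC] := ray_dist g B0.
have [K K0 hK] := dist_lerp (mulr_ge0 C0 B0).
exists K => // G M hG; apply: lipschitz_glue => i x y iM hx hy.
rewrite (polygonE G hx) (polygonE G hy).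
have sub (z : R) : i%:R <= z <= i.+1%:R -> 0 <= z - i%:R <= 1.
 by rewrite -natr1 => /andP[a b]; lra2.
have := hK (G i) (G i.+1) (G i) (G i.+1) (x - i%:R) (y - i%:R) 0.
rewrite !distxx !mulr0 addr0 lexx ler01 => h.
have -> : y - x = y - i%:R - (x - i%:R) by ring.
apply: h => //; [exact: sub|exact: sub|].
apply: le_trans (hC _ _ (hG i iM)) _; apply: ler_wpM2l => //.
by apply/norm_bnd => //; exact: hG.
Qed.

Definition strip (rho : nat -> R -> row) (tau x : R) : row :=
 polygon (fun j => rho j x) tau.

Lemma dist_strip (K : R) : 0 <= K -> exists2 K' : R, 0 <= K' & forall (rho : nat -> R -> Q) (M : R),
 (forall j (x y : R), 0 <= x <= M -> 0 <= y <= M -> `|y - x| <= 1 ->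
 dist (rho j x) (rho j y) <= K * `|y - x|) ->
 (forall j (x : R), 0 <= x <= M -> dist (rho j x) (rho j.+1 x) <= K) ->
 forall x y tau tau' : R, 0 <= x <= M -> 0 <= y <= M -> `|y - x| <= 1 -> 0 <= tau -> 0 <= tau' ->
 `|tau' - tau| <= 1 -> dist (strip rho tau x) (strip rho tau' y) <= K' * (`|tau' - tau| + `|y - x|).
move=> K0; have [K' K'0 hK'] := dist_lerp K0; exists K' => // rho M h1 h2.
have cell (j : nat) (x y t t' : R) : 0 <= x <= M -> 0 <= y <= M -> `|y - x| <= 1 ->
 j%:R <= t <= j.+1%:R -> j%:R <= t' <= j.+1%:R ->
 dist (strip rho t x) (strip rho t' y) <= K' * (`|t' - t| + `|y - x|).
 move=> hx hy xy ht ht'; rewrite /strip (polygonE _ ht) (polygonE _ ht').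
 have sub (z : R) : j%:R <= z <= j.+1%:R -> 0 <= z - j%:R <= 1.
 by rewrite -natr1 => /andP[a b]; lra2.
 have -> : t' - t = t' - j%:R - (t - j%:R) by ring.
 by apply: hK'; rewrite ?normr_ge0 ?sub// ?h1 ?h2.
have wl (x y t t' : R) : 0 <= x <= M -> 0 <= y <= M -> `|y - x| <= 1 -> 0 <= t -> t <= t' -> t' <= t + 1 ->
 dist (strip rho t x) (strip rho t' y) <= K' * (`|t' - t| + `|y - x|).
 move=> hx hy xy t0 tt t't; have /andP[i1 i2] := Num.Theory.trunc_itv t0.
 set i := Num.trunc t in i1 i2.
 have [yi|iy] := leP t' i.+1%:R.
 by apply: (cell i) => //; lra2.
 have iE : i.+2%:R = i.+1%:R + 1 :> R by rewrite -natr1.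
 apply: le_trans (dist_triangle g _ (strip rho i.+1%:R x) _) _.
 have xx : `|x - x| <= 1 by rewrite subrr normr0.
 apply: le_trans (lerD (cell i x x t i.+1%:R hx hx xx _ _) (cell i.+1 x y i.+1%:R t' hx hy xy _ _)) _.
 - by lra2.
 - by apply/andP; split; [rewrite ler_nat|].
 - by apply/andP; split; [|rewrite ler_nat].
 - by rewrite (ltW iy)/= iE; lra.
 rewrite subrr normr0 addr0 -mulrDr addrA.
 rewrite [`|t' - t|]ger0_norm ?[`|_ - t|]ger0_norm ?[`|t' - _%:R|]ger0_norm ?subr_ge0 ?(ltW i2) ?(ltW iy)//.
 by have -> : i.+1%:R - t + (t' - i.+1%:R) = t' - t by ring.
move=> x y t t' hx hy xy t0 t'0 tt; have [le|/ltW le] := leP t t'.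
 by apply: wl => //; move: tt; rewrite ger0_norm ?subr_ge0//; lra.
rewrite dist_sym distrC [`|y - x|]distrC; apply: wl => //; first by rewrite distrC.
by move: tt; rewrite distrC ger0_norm ?subr_ge0//; lra.
Qed.

End Interpolation.

Lemma cube_near (l : nat) : exists2 nu, (0 < nu)%N & (l.+1 <= nu ^ 3 <= 8 * l.+1)%N.
have ex : exists nu, (l.+1 <= nu ^ 3)%N.
 by exists l.+1; rewrite -[leqLHS]expn1 leq_pexp2l.
case: (ex_minnP ex) => [[|k] h1 h2]; first by rewrite exp0n in h1.
exists k.+1; rewrite // h1/=; case: k h1 h2 => [|k] h1 h2; first by rewrite exp1n.
have : (k.+1 ^ 3 < l.+1)%N by rewrite ltnNge; apply/negP => /h2; rewrite ltnn.
have : (k.+2 ^ 3 <= 8 * k.+1 ^ 3)%N.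
 by rewrite (_ : 8 = 2 ^ 3)%N// -expnMn leq_exp2r//; lia.
move: (k.+2 ^ 3)%N (k.+1 ^ 3)%N; clear; lia.
Qed.

Section LoopStrip.
Context {R : realType} {r : nat} (r3 : (2 < r)%N).
Local Notation Q := (filiprod R r true).
Local Notation row := 'rV[R]_(3 + r).
Variable g : leftinv_metric (filiLieG R r true).
Local Notation dist := (@riem_dist R (3 + r) (filiLieG R r true) g).

(** Row 0 is the rectifiable loop in its Lipschitz parametrization, row t + 1 the polygon through
    row t of the grid; from row T + 1 on the strip is constant. In the coordinates tau and M th each
    unit cell has a bounded Lipschitz constant. *)
Theorem loop_strip : exists (K : R) (C : nat), 0 <= K /\
 forall (l : nat) (c : R -> Q), loop_of_length_le g (c : R -> filiLieG R r true) l%:R ->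
 exists (sg : R -> R) (c' : R -> Q) (F : R -> R -> Q) (M T : nat) (x0 : Q),
 [/\ {within `[0, 1], continuous sg}, {in `[0, 1] &, {homo sg : x y / x <= y}},
 sg 0 = 0 /\ sg 1 = 1 & forall t, 0 <= t <= 1 -> c t = c' (sg t)] /\
 [/\ (0 < M <= C * l.+1)%N /\ (T <= C * M ^ r.-1)%N,
 forall th, 0 <= th <= 1 -> F 0 th = c' th,
 forall tau, 0 <= tau -> F tau 0 = F tau 1,
 forall tau th, T.+1%:R <= tau -> 0 <= th <= 1 -> F tau th = x0 &
 forall th th' tau tau', 0 <= th <= 1 -> 0 <= th' <= 1 -> 0 <= tau -> 0 <= tau' ->
 `|tau' - tau| <= 1 -> M%:R * `|th' - th| <= 1 ->
 dist (F tau th) (F tau' th') <= K * (`|tau' - tau| + M%:R * `|th' - th|)].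
have [b b0 hb] := dist_local g (ler01 : 0 <= 1 :> R).
have [B [m [C [B0 m0 hgrid]]]] := loop_grid r3 b0.
have [K1 K10 hpoly] := dist_polygon g B0.
have [CB CB0 hCB] := ray_dist g B0.
pose K0 := 2 * K1 + CB * B + 1.
have K00 : 0 <= K0 by rewrite /K0; nneg.
have [K Kge0 hK] := dist_strip g K00.
exists K, (8 * m + C)%N; split=> // l c /loop_reparam[sg [c' [h1 h2 h3 [h4 h5] h6]]].
have [nu nu0 /andP[nu1 nu2]] := cube_near l.
pose N := (nu ^ 3)%N; have N0 : (0 < N)%N by rewrite expn_gt0 nu0.
have NR : 0 < N%:R :> R by rewrite ltr0n.
have lN : 1 + l%:R <= N%:R :> R by rewrite nat1r ler_nat.
pose x0 : Q := c' 0.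
pose gg (i : nat) : Q := (x0^-1 * c' (i%:R / N%:R)%R)%g.
have q01 i : (i <= N)%N -> 0 <= (i%:R / N%:R : R) <= 1.
 by move=> iN; rewrite divr_ge0//= ler_pdivrMr// mul1r ler_nat.
have c'N i j : (i <= N)%N -> (j <= N)%N -> (i <= j <= i.+1)%N -> dist (c' (i%:R / N%:R)) (c' (j%:R / N%:R)) <= 1.
 move=> iN jN ij; apply: le_trans (h6 _ _ (q01 i iN) (q01 j jN)) _.
 rewrite -mulrBl normrM normfV [`|N%:R|]ger0_norm// -natrB; last by case/andP: ij.
 rewrite normr_nat mulrA ler_pdivrMr// mul1r; apply: le_trans lN.
 by rewrite ler_piMr// lern1; case/andP: ij; lia.
have lg : loop_by b N gg.
 split=> [i iN|]; last by rewrite /gg mul0r divff ?gt_eqF// h5.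
 have d1 := c'N i i.+1 (ltnW iN) iN; rewrite leqnSn leqnn in d1; have {}d1 := d1 isT.
 apply/norm_bnd => //; rewrite /gg invgM invgK -mulgA mulVKg.
 apply: le_trans (hb _ _ d1) _; rewrite ler_piMr//.
have g0 : gg 0%N = 1%g by rewrite /gg mul0r mulVg.
have [T TC [G [G1 G2 G3 G4]]] := hgrid nu gg nu0 lg g0.
pose M := (m * N)%N; have M0 : (0 < M)%N by rewrite muln_gt0 m0.
have MR : 0 < M%:R :> R by rewrite ltr0n.
(* The grid is based at 1 and is translated to the base point of the loop; truncating at T repeats
   the last row for all later indices. *)
pose GG t i : Q := (x0 * G (minn t T) i)%g.
pose rho (j : nat) (x : R) : Q := if j is t.+1 then polygon (GG t) x else c' (x / M%:R).
have GGl t : forall i, (i < M)%N -> near_by B (GG t i) (GG t i.+1).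
 by move=> i iM; rewrite /GG near_mull; have [h _] := G1 (minn t T) (geq_minr _ _); exact: h.
have vert t i (x : R) : (i <= M)%N -> i%:R <= x < i.+1%:R -> x <= M%:R ->
 dist (GG t i) (polygon (GG t) x) <= K1.
 move=> iM /andP[ix xi] xM; rewrite -[GG t i](polygon_nat (GG t)).
 have xi' : `|x - i%:R| <= 1.
 by rewrite ger0_norm ?subr_ge0// lerBlDr nat1r ltW.
 apply: le_trans (hpoly (GG t) M (GGl t) i%:R x _ _ xi') _.
 - by rewrite ler0n ler_nat.
 - by rewrite xM (le_trans _ ix).
 by rewrite ler_piMr.
have rho1 j (x y : R) : 0 <= x <= M%:R -> 0 <= y <= M%:R -> `|y - x| <= 1 ->
 dist (rho j x) (rho j y) <= K0 * `|y - x|.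
 move=> hx hy xy; case: j => [|t] /=.
 have h01 (z : R) : 0 <= z <= M%:R -> 0 <= z / M%:R <= 1.
 by move=> /andP[z0 zM]; rewrite divr_ge0//= ler_pdivrMr// mul1r.
 apply: le_trans (h6 _ _ (h01 _ hx) (h01 _ hy)) _.
 rewrite -mulrBl normrM normfV [`|M%:R|]ger0_norm// mulrCA mulrC; apply: ler_wpM2r => //.
 rewrite ler_pdivrMr//; apply: le_trans lN _; apply: (@le_trans _ _ M%:R).
 by rewrite ler_nat leq_pmull.
 by rewrite ler_peMl// /K0 lerDr; nneg.
 apply: le_trans (hpoly (GG t) M (GGl t) x y hx hy xy) _; apply: ler_wpM2r => //.
 have : 0 <= CB * B by nneg.
 by rewrite /K0; move: (CB * B) => z; lra.
have rho2 j (x : R) : 0 <= x <= M%:R -> dist (rho j x) (rho j.+1 x) <= K0.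
 move=> /andP[x0' xM]; have /andP[i1 i2] := Num.Theory.trunc_itv x0'.
 set i := Num.trunc x in i1 i2.
 have iM : (i <= M)%N by rewrite -(ler_nat R); apply: le_trans xM.
 have ixi : i%:R <= x < i.+1%:R by rewrite i1.
 have CBB : 0 <= CB * B by nneg.
 case: j => [|t] /=.
 have v1 := vert 0%N i x iM ixi xM.
 apply: le_trans (dist_triangle g _ (GG 0%N i) _) _.
 have E : GG 0%N i = c' ((i %/ m)%:R / N%:R) by rewrite /GG min0n G3// /gg mulVKg.
 have imN : (i %/ m <= N)%N.
 by apply: leq_trans (leq_div2r m iM) _; rewrite mulKn.
 have d1 : dist (c' (x / M%:R)) (GG 0%N i) <= 1.
 rewrite E dist_sym; apply: le_trans (h6 _ _ (q01 _ imN) _) _.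
 by rewrite divr_ge0//= ler_pdivrMr// mul1r.
 have -> : x / M%:R - (i %/ m)%:R / N%:R = (x - (m * (i %/ m))%:R) / M%:R.
 have mR : m%:R != 0 :> R by rewrite pnatr_eq0 -lt0n.
 by rewrite [RHS]mulrBl; congr (_ - _); rewrite /M (natrM _ m N) (natrM _ m (i %/ m)) invfM mulrACA divff// mul1r.
 have a1 : (m * (i %/ m))%:R <= x by apply: le_trans i1; rewrite ler_nat mulnC leq_divM.
 have a2 : x - (m * (i %/ m))%:R <= m%:R.
 rewrite lerBlDr; apply: le_trans (ltW i2) _; rewrite -natrD ler_nat.
 by have := ltn_ceil i m0; rewrite mulSn [(i %/ m * m)%N]mulnC.
 rewrite ger0_norm; last by rewrite divr_ge0// subr_ge0.
 rewrite mulrA ler_pdivrMr// mul1r /M (natrM _ m N) mulrC.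
 by apply: ler_pM => //; rewrite ?subr_ge0// addr_ge0.
 by apply: le_trans (lerD d1 v1) _; rewrite /K0; lra.
 have v1 := vert t i x iM ixi xM; have v2 := vert t.+1 i x iM ixi xM.
 apply: le_trans (dist_triangle g _ (GG t i) _) _.
 apply: le_trans (lerD (lexx _) (dist_triangle g _ (GG t.+1 i) _)) _.
 rewrite dist_sym.
 have d1 : dist (GG t i) (GG t.+1 i) <= CB * B.
 have nb : near_by B (GG t i) (GG t.+1 i).
 rewrite /GG near_mull; have [tT|Tt] := boolP (t < T)%N.
 by rewrite (minn_idPl (ltnW tT)) (minn_idPl tT); exact: G2.
 rewrite -leqNgt in Tt; rewrite (minn_idPr Tt) (minn_idPr (leqW Tt)); exact: near_refl.
 apply: le_trans (hCB _ _ nb) _; apply: ler_wpM2l => //; exact/norm_bnd.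
 by apply: le_trans (lerD v1 (lerD d1 v2)) _; rewrite /K0; lra.
exists sg, c', (fun tau th => strip rho tau (th * M%:R)), M, T, x0; split=> //.
have th01 (th : R) : 0 <= th <= 1 -> 0 <= th * M%:R <= M%:R.
 by move=> /andP[a a']; rewrite mulr_ge0//= ler_piMl.
have closed j : rho j 0 = rho j M%:R.
 case: j => [|t] /=; first by rewrite mul0r divff ?gt_eqF.
 rewrite polygon_nat -[X in polygon _ X]/(0%:R) polygon_nat /GG.
 by have [_ ->] := G1 (minn t T) (geq_minr _ _).
split.
- split; first rewrite M0/=.
 rewrite /M; apply: leq_trans (leq_mul (leqnn m) nu2) _.
 by rewrite mulnCA mulnA mulnDl leq_addr.
 apply: leq_trans TC _; apply: leq_trans (_ : C * M ^ r.-1 <= _)%N; last first.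
 by rewrite leq_mul2r leq_addl orbT.
 rewrite leq_mul2l expnM leq_exp2r; last by lia.
 by rewrite leq_pmull// orbT.
- by move=> th h; rewrite /strip -[X in polygon _ X]/(0%:R) polygon_nat /= mulfK ?gt_eqF.
- by move=> tau _; rewrite mul0r mul1r /strip; congr polygon; apply: funext => j; exact: closed.
- move=> tau th hT /th01 hth; rewrite /strip.
 have tau0 : 0 <= tau by apply: le_trans hT.
 have rT j (x : R) : (T < j)%N -> 0 <= x <= M%:R -> rho j x = x0.
 case: j => // t Tt /andP[a a'] /=.
 have /andP[i1 i2] := Num.Theory.trunc_itv a; set i := Num.trunc x in i1 i2.
 have iM : (i <= M)%N by rewrite -(ler_nat R); apply: le_trans a'.
 have gT k : (k <= M)%N -> GG t k = x0.
 by move=> kM; rewrite /GG (minn_idPr (Tt : (T <= t)%N)) G4// mulg1.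
 rewrite /polygon -/i gT//; have [iM'|Mi] := ltnP i M; first by rewrite gT// lerpxx.
 have -> : x - i%:R = 0.
 have : M%:R <= i%:R :> R by rewrite ler_nat.
 by move=> ?; lra.
 by rewrite lerp0.
 have /andP[i1 i2] := Num.Theory.trunc_itv tau0.
 have iT : (T < Num.trunc tau)%N.
 by rewrite -ltnS -(ltr_nat R); exact: le_lt_trans hT i2.
 have -> : polygon (fun j => rho j (th * M%:R)) tau = lerp (rho (Num.trunc tau) (th * M%:R))
 (rho (Num.trunc tau).+1 (th * M%:R)) (tau - (Num.trunc tau)%:R) by [].
 by rewrite (rT _ _ iT hth) (rT _ _ (leqW iT) hth) lerpxx.
move=> th th' tau tau' hth hth' t0 t'0 tt thth.
have E : `|th' * M%:R - th * M%:R| = M%:R * `|th' - th|.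
 by rewrite -mulrBl normrM normr_nat mulrC.
rewrite -E; apply: (hK rho M%:R rho1 rho2) => //; rewrite ?th01// E//.
Qed.

End LoopStrip.

(** * Polar coordinates in the plane *)

Section PlanarAngle.
Context {R : realType}.

Lemma sin_ge_half (y : R) : 0 <= y <= pi / 2 -> y / 2 <= sin y.
move=> /andP[y0 y1].
have pi0 := pi_gt0 R.
have h (x : R) : 0 <= x <= pi / 4 -> x / Num.sqrt 2 <= sin x /\ (Num.sqrt 2)^-1 <= cos x.
 have c (z : R) : 0 <= z <= pi / 4 -> (Num.sqrt 2)^-1 <= cos z.
 move=> /andP[z0 z1].
 have cz : 0 <= cos z by apply: cos_ge0_pihalf; lra2.
 have c2 : 0 <= cos (z + z) by apply: cos_ge0_pihalf; lra2.
 rewrite cosD -!expr2 in c2; have := cos2Dsin2 z => cs.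
 have h2 : 2^-1 <= cos z ^+ 2 by lra.
 rewrite -(ler_pXn2r (n := 2)) ?nnegrE ?invr_ge0 ?sqrtr_ge0//.
 by rewrite exprVn sqr_sqrtr.
 move=> /andP[x0 x1]; split; last by apply: c; rewrite x0.
 have [|z] := @MVT_segment R sin cos 0 x x0.
 by apply: continuous_subspaceT => t; exact: continuous_sin.
 rewrite in_itv/= sin0 !subr0 => /andP[z0 zx] ->.
 by rewrite mulrC ler_wpM2r// c// z0 (le_trans zx).
have y4 : 0 <= y / 2 <= pi / 4 by lra2.
have [h1 h2] := h _ y4.
have -> : y = y / 2 + y / 2 by rewrite -splitr.
rewrite sinD -splitr.
have s0 : 0 <= sin (y / 2) by apply: le_trans h1; rewrite divr_ge0// divr_ge0.
have h3 : y / 2 / Num.sqrt 2 * (Num.sqrt 2)^-1 <= sin (y / 2) * cos (y / 2).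
 by apply: ler_pM => //; rewrite ?divr_ge0 ?invr_ge0 ?sqrtr_ge0.
have h4 : y / 2 / Num.sqrt 2 * (Num.sqrt 2)^-1 = y / 4.
 rewrite -mulrA -invfM -expr2 sqr_sqrtr//; lra.
rewrite [cos _ * _]mulrC; lra.
Qed.

Definition euclid (p : R * R) : R := Num.sqrt (p.1 ^+ 2 + p.2 ^+ 2).
Lemma euclid_ge0 p : 0 <= euclid p. exact: sqrtr_ge0. Qed.
Lemma euclid_sqr p : euclid p ^+ 2 = p.1 ^+ 2 + p.2 ^+ 2.
by rewrite sqr_sqrtr// addr_ge0// sqr_ge0. Qed.

Lemma euclid_eq0 p : (euclid p == 0) = (p == 0).
rewrite -sqrf_eq0 euclid_sqr paddr_eq0 ?sqr_ge0// !sqrf_eq0.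
by case: p.
Qed.

Lemma polar (p : R * R) : exists a : R, 0 <= a <= 1 /\
 p = (euclid p * cos (2 * pi * a), euclid p * sin (2 * pi * a)).
have pi0 := pi_gt0 R; have pin : 2 * pi != 0 :> R by rewrite mulf_neq0// gt_eqF.
have [->|p0] := eqVneq p 0.
 exists 0; rewrite lexx ler01; split=> //.
 have -> : euclid 0 = 0 by apply/eqP; rewrite euclid_eq0.
 by rewrite !mul0r.
have e0 : euclid p != 0 by rewrite euclid_eq0.
have ep : 0 < euclid p by rewrite lt_neqAle eq_sym e0 euclid_ge0.
pose x := p.1 / euclid p; pose y := p.2 / euclid p.
have xy : x ^+ 2 + y ^+ 2 = 1.
 by rewrite /x /y !exprMn -mulrDl -euclid_sqr -exprMn divff// expr1n.
have x1 : -1 <= x <= 1.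
 rewrite -ler_norml -(ler_pXn2r (n := 2)) ?nnegrE// expr1n -normrX ger0_norm ?sqr_ge0//.
 by rewrite -xy lerDl sqr_ge0.
pose t := acos x.
have ct : cos t = x by rewrite /t acosK// in_itv.
have st : sin t = `|y|.
 by rewrite /t sin_acos// -xy addrAC subrr add0r sqrtr_sqr.
have t0 : 0 <= t := acos_ge0 x1; have t1 : t <= pi := acos_lepi x1.
have pE : p = (euclid p * x, euclid p * y).
 by rewrite /x /y ![euclid p * _]mulrC !divfK//; case: (p).
have t01 : 0 <= t / (2 * pi) <= 1.
 apply/andP; split; first by apply: divr_ge0 => //; lra.
 by rewrite ler_pdivrMr; lra.
have [y0|y0] := leP 0 y.
 exists (t / (2 * pi)); split=> //.
 rewrite [2 * pi * _]mulrC divfK// ct st ger0_norm//.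
exists (1 - t / (2 * pi)); split; first by case/andP: t01 => a b; lra2.
have -> : 2 * pi * (1 - t / (2 * pi)) = - t + pi *+ 2.
 by rewrite mulrBr mulr1 [2 * pi * (_ / _)]mulrC divfK// -[pi *+ 2]mulr_natl addrC.
by rewrite cosD2pi sinD2pi cosN sinN ct st ltr0_norm// opprK.
Qed.

Lemma norm_pair (p : R * R) : `|p| = Num.max `|p.1| `|p.2|. by []. Qed.

(** The law of cosines, with the half-angle formula; the factor 2 compares the Euclidean norm with
    the sup norm. *)
Lemma polar_dist (a a' rho rho' : R) (p q : R * R) : 0 <= rho -> 0 <= rho' ->
 p = (rho * cos (2 * pi * a), rho * sin (2 * pi * a)) ->
 q = (rho' * cos (2 * pi * a'), rho' * sin (2 * pi * a')) ->
 (rho' - rho) ^+ 2 + 4 * rho * rho' * sin (pi * (a' - a)) ^+ 2 <= 2 * `|q - p| ^+ 2.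
move=> r0 r'0 pE qE.
have h1 : (q.1 - p.1) ^+ 2 <= `|q - p| ^+ 2.
 by rewrite -[leLHS]ger0_norm ?sqr_ge0// normrX lerXn2r ?nnegrE// norm_pair le_max lexx.
have h2 : (q.2 - p.2) ^+ 2 <= `|q - p| ^+ 2.
 by rewrite -[leLHS]ger0_norm ?sqr_ge0// normrX lerXn2r ?nnegrE// norm_pair le_max lexx orbT.
have E : cos (2 * pi * a') * cos (2 * pi * a) + sin (2 * pi * a') * sin (2 * pi * a) =
 1 - 2 * sin (pi * (a' - a)) ^+ 2.
 rewrite -cosB; have -> : 2 * pi * a' - 2 * pi * a = pi * (a' - a) + pi * (a' - a) by ring.
 by rewrite cosD -!expr2; have := cos2Dsin2 (pi * (a' - a)); lra.
have c1 := cos2Dsin2 (2 * pi * a); have c2 := cos2Dsin2 (2 * pi * a').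
move: h1 h2; rewrite pE qE /=; move: `|_ - _| => D.
move: (cos (2 * pi * a)) (sin (2 * pi * a)) (cos (2 * pi * a')) (sin (2 * pi * a')) (sin (pi * (a' - a))) c1 c2 E.
move=> x y x' y' S c1 c2 E h1 h2.
have -> : (rho' - rho) ^+ 2 + 4 * rho * rho' * S ^+ 2 =
 (rho' * x' - rho * x) ^+ 2 + (rho' * y' - rho * y) ^+ 2.
 have -> : (rho' * x' - rho * x) ^+ 2 + (rho' * y' - rho * y) ^+ 2 = rho' ^+ 2 * (x' ^+ 2 + y' ^+ 2) +
 rho ^+ 2 * (x ^+ 2 + y ^+ 2) - 2 * rho * rho' * (x' * x + y' * y) by ring.
 by rewrite c1 c2 E; ring.
lra.
Qed.

Lemma sin_pi_ge (x : R) : 0 <= x <= 1 -> Num.min x (1 - x) <= sin (pi * x).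
have pi2 : 2 <= pi :> R := pi_ge2 R.
have h (z : R) : 0 <= z <= 2^-1 -> z <= sin (pi * z).
 move=> /andP[z0 z1]; have h1 : 2 * z <= pi * z by apply: ler_wpM2r.
 have h2 : pi * z <= pi * 2^-1 by apply: ler_wpM2l => //; lra.
 apply: le_trans (sin_ge_half _); first by lra.
 by lra2.
move=> /andP[x0 x1]; rewrite ge_min; have [xh|xh] := leP x 2^-1.
 by rewrite h// x0.
apply/orP; right; have -> : sin (pi * x) = sin (pi * (1 - x)).
 by rewrite mulrBr mulr1 -[RHS]opprK -sinN opprB -[pi * x - pi]addrC addrC -sinDpi subrK.
by apply: h; lra2.
Qed.

(** The minimum is the distance of the angles on the circle R/Z. If rho' >= rho / 2, the angular
    term of [polar_dist] bounds it; otherwise the radial term already has the size of rho, and the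
    left side is bounded. *)
Lemma angle_dist (a a' rho rho' : R) (p q : R * R) : 0 < rho -> 0 <= rho' -> 0 <= a <= 1 -> 0 <= a' <= 1 ->
 p = (rho * cos (2 * pi * a), rho * sin (2 * pi * a)) ->
 q = (rho' * cos (2 * pi * a'), rho' * sin (2 * pi * a')) ->
 Num.min `|a' - a| (1 - `|a' - a|) <= 3 * `|q - p| / rho.
move=> r0 r'0 /andP[a0 a1] /andP[a'0 a'1] pE qE.
have := polar_dist (ltW r0) r'0 pE qE; set D := `|q - p|.
have D0 : 0 <= D by exact: normr_ge0.
have : sin (pi * (a' - a)) ^+ 2 = sin (pi * `|a' - a|) ^+ 2.
 have [h|h] := leP 0 (a' - a); first by rewrite ger0_norm.
 by rewrite ltr0_norm// mulrN sinN sqrrN.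
have d01 : 0 <= `|a' - a| <= 1 by rewrite normr_ge0 ler_norml; lra2.
move=> ->; have := sin_pi_ge d01; have := sin_le1 (pi * `|a' - a|).
have m0 : 0 <= Num.min `|a' - a| (1 - `|a' - a|).
 by rewrite le_min normr_ge0/= subr_ge0; case/andP: d01.
move: (sin _) (Num.min _ _) m0 => S m m0 S1 mS h.
have S0 : 0 <= S by apply: le_trans mS.
apply: le_trans mS _; rewrite ler_pdivlMr// mulrC.
rewrite -(ler_pXn2r (n := 2)) ?nnegrE ?mulr_ge0 ?(ltW r0)// !exprMn.
have S2 : S ^+ 2 <= 1 by rewrite expr_le1.
have S20 : 0 <= S ^+ 2 by rewrite sqr_ge0.
have rS : rho ^+ 2 * S ^+ 2 <= rho ^+ 2 by rewrite ler_piMr// sqr_ge0.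
have [hr|hr] := leP (rho / 2) rho'.
 have : rho * (rho / 2) * S ^+ 2 <= rho * rho' * S ^+ 2.
 by apply: ler_wpM2r => //; apply: ler_wpM2l => //; exact: ltW.
 have := sqr_ge0 (rho' - rho); have := sqr_ge0 D; rewrite !expr2 in h rS S20 *; lra.
have : (rho / 2) ^+ 2 <= (rho' - rho) ^+ 2.
 rewrite -[(rho' - rho) ^+ 2]sqrrN opprB lerXn2r ?nnegrE; lra.
have : 0 <= rho * rho' * S ^+ 2 by rewrite !mulr_ge0 ?(ltW r0).
have := sqr_ge0 D; rewrite !expr2 in h rS S20 *; lra.
Qed.

Lemma euclid_dist (p q : R * R) : `|euclid q - euclid p| <= 2 * `|q - p|.
have [a [_ pE]] := polar p; have [a' [_ qE]] := polar q.
have h := polar_dist (euclid_ge0 p) (euclid_ge0 q) pE qE.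
rewrite -(ler_pXn2r (n := 2)) ?nnegrE ?mulr_ge0// -normrX ger0_norm ?sqr_ge0//.
have : 0 <= 4 * euclid p * euclid q * sin (pi * (a' - a)) ^+ 2.
 exact: mulr_ge0 (mulr_ge0 (mulr_ge0 (ler0n _ 4) (euclid_ge0 p)) (euclid_ge0 q)) (sqr_ge0 _).
have := sqr_ge0 `|q - p|; rewrite [(2 * _) ^+ 2]exprMn; lra.
Qed.

Lemma ln_dist (x y : R) : 0 < x -> x / 2 <= y -> `|ln y - ln x| <= 2 * `|y - x| / x.
move=> x0 xy; have y0 : 0 < y by lra.
have lnq (u v : R) : 0 < u -> 0 < v -> ln u - ln v <= (u - v) / v.
 move=> u0 v0; have -> : ln u - ln v = ln (1 + (u - v) / v).
 by rewrite -ln_div ?posrE//; congr ln; field; rewrite gt_eqF.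
 apply: le_ln1Dx; have : 0 < u / v by rewrite divr_gt0.
 by rewrite mulrBl divff ?gt_eqF//; lra.
have b (z : R) : 0 < z -> x / 2 <= z -> `|y - x| / z <= 2 * `|y - x| / x.
 move=> z0 xz; rewrite ler_pdivrMr// mulrAC ler_pdivlMr// mulrC.
 have -> : 2 * `|y - x| * z = 2 * z * `|y - x| by ring.
 by apply: ler_wpM2r => //; lra.
have h1 := lnq y x y0 x0; have h2 := lnq x y x0 y0.
rewrite ler_norml; apply/andP; split.
 suff : ln x - ln y <= 2 * `|y - x| / x by lra.
 apply: le_trans h2 _; apply: le_trans (b y y0 xy); apply: ler_wpM2r; first by rewrite invr_ge0 ltW.
 by rewrite distrC ler_norm.
apply: le_trans h1 _; apply: le_trans (b x x0 _); last by lra.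
by apply: ler_wpM2r; [rewrite invr_ge0 ltW|exact: ler_norm].
Qed.

End PlanarAngle.

Section DerivativeBound.
Context {R : realType} {V : normedModType R} {n : nat}.

Lemma point_row : (point : 'rV[R]_n) = 0.
by apply/rowP => i; rewrite !mxE. Qed.

(** Where the derivative does not exist, its value is the default point, which is 0, so the bound
    persists there. *)
Lemma derive_norm_le (f : V -> 'rV[R]_n) (p v : V) (B : R) : 0 <= B ->
 (\forall h \near (0 : R)^', `|h^-1 *: (f (h *: v + p) - f p)| <= B) -> `|'D_v f p| <= B.
move=> B0 h; have [d|d] := pselect (derivable f p v); last first.
 have -> : 'D_v f p = 0 by rewrite -point_row; exact: dvgP.
 by rewrite normr0.
have c : (fun h => `|h^-1 *: ((f \o shift p) (h *: v) - f p)|) @ (0 : R)^' --> `|'D_v f p|.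
 by apply: cvg_norm; exact: d.
have <- : lim ((fun h => `|h^-1 *: ((f \o shift p) (h *: v) - f p)|) @ (0 : R)^') = `|'D_v f p|.
 exact/cvg_lim.
apply: limr_le; last exact: h.
by apply/cvg_ex; eexists; exact: c.
Qed.

End DerivativeBound.

Section IntegralBound.
Context {R : realType}.
Local Notation mu2 := (@lebesgue_measure R \x @lebesgue_measure R)%E.

(* No measurability of f is needed: the integral of a nonnegative function is a
 supremum over the simple functions below it. *)
Lemma integral_le_dominated (f h : R * R -> R) (D : set (R * R)) : (forall p, 0 <= h p) ->
 (forall p, D p -> 0 <= f p <= h p) ->
 (\int[mu2]_(p in D) (f p)%:E <= \int[mu2]_p (h p)%:E)%E.
move=> h0 fh; rewrite !ge0_integralE; first last.
- by move=> p /fh /andP[f0 _]; rewrite lee_fin.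
- by move=> p _; rewrite lee_fin.
apply: le_ereal_sup => _ [s hs <-]; exists s => // p; rewrite patch_setT.
apply: le_trans (hs p) _; rewrite /patch; case: ifPn => [|_]; last by rewrite lee_fin.
by rewrite inE => /fh /andP[_ fp]; rewrite lee_fin.
Qed.

Lemma square_integral (a c : R) : 0 <= a -> 0 <= c ->
 (\int[mu2]_p (c * \1_(`[- a, a] `*` `[- a, a]) p)%:E = (c * (2 * a) ^+ 2)%:E)%E.
move=> a0 c0; under eq_integral do rewrite EFinM.
have mS : measurable (`[- a, a]%classic `*` `[- a, a]%classic : set (R * R)) by exact: measurableX.
rewrite ge0_integralZl//; last 1 first.
- by apply/measurable_realfun.measurable_EFinP; exact: measurable_indic.
pose I : set R := `[- a, a]%classic.
have -> : (\int[mu2]_p (\1_(I `*` I) p)%:E = lebesgue_measure I * lebesgue_measure I)%E.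
 have mI : measurable I := measurable_itv _.
 by rewrite integral_indic// setIT; exact: (product_measure1E lebesgue_measure lebesgue_measure mI mI).
rewrite /I lebesgue_measure_itv/= lte_fin.
case: ifPn => [_|]; first by rewrite -EFinB -!EFinM; congr (_%:E); ring.
rewrite -leNgt => aa; have -> : a = 0 by lra.
by rewrite !mule0 mulr0 expr0n/= mulr0.
Qed.

End IntegralBound.

(** * Upper bound for the Dehn function of the Lie group H *)

Section UpperBound.
Context {R : realType} {r : nat} (r3 : (2 < r)%N).
Local Notation Q := (filiprod R r true).
Local Notation row := 'rV[R]_(3 + r).
Variable g : leftinv_metric (filiLieG R r true).
Local Notation dist := (@riem_dist R (3 + r) (filiLieG R r true) g).

Lemma gram_le v1 v2 : Num.sqrt (bform (li_form g) v1 v1 * bform (li_form g) v2 v2 -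
 bform (li_form g) v1 v2 ^+ 2) <= bn g v1 * bn g v2.
by rewrite /bn -sqrtrM ?bform_ge0// ler_wsqrtr// gerBl sqr_ge0.
Qed.

Section Disc.
Variables (K : R) (M T : nat) (F : R -> R -> Q) (x0 : Q).
Hypotheses (K0 : 0 <= K) (M0 : (0 < M)%N).
Hypothesis F2 : forall tau, 0 <= tau -> F tau 0 = F tau 1.
Hypothesis F3 : forall tau th, T.+1%:R <= tau -> 0 <= th <= 1 -> F tau th = x0.
Hypothesis F4 : forall th th' tau tau', 0 <= th <= 1 -> 0 <= th' <= 1 -> 0 <= tau -> 0 <= tau' ->
 `|tau' - tau| <= 1 -> M%:R * `|th' - th| <= 1 ->
 dist (F tau th) (F tau' th') <= K * (`|tau' - tau| + M%:R * `|th' - th|).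
Let MR : 0 < M%:R :> R. by rewrite ltr0n. Qed.

(** The chosen angle of a point jumps across the ray of angle 0. Closeness is therefore measured on
    the circle, and a pair on both sides of the seam is joined through th = 0 and th = 1, where the
    strip agrees. *)
Lemma strip_closed th th' tau tau' : 0 <= th <= 1 -> 0 <= th' <= 1 -> 0 <= tau -> 0 <= tau' ->
 `|tau' - tau| <= 1 -> M%:R * Num.min `|th' - th| (1 - `|th' - th|) <= 1 ->
 dist (F tau th) (F tau' th') <=
 K * (`|tau' - tau| + M%:R * Num.min `|th' - th| (1 - `|th' - th|)).
have wl t t' s s' : 0 <= t -> t <= t' -> t' <= 1 -> 0 <= s -> 0 <= s' ->
 `|s' - s| <= 1 -> M%:R * (1 - (t' - t)) <= 1 ->
 dist (F s t) (F s' t') <= K * (`|s' - s| + M%:R * (1 - (t' - t))).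
 move=> t0 tt t'1 s0 s'0 ss h; have t01 : 0 <= t <= 1 by rewrite t0 (le_trans tt).
 have t'01 : 0 <= t' <= 1 by rewrite t'1 (le_trans t0).
 have e0 : 0 <= (0 : R) <= 1 by rewrite lexx ler01.
 have e1 : 0 <= (1 : R) <= 1 by rewrite lexx ler01.
 apply: le_trans (dist_triangle g _ (F s 0) _) _; rewrite {2}(F2 s0).
 have Mt : M%:R * t <= M%:R * (1 - (t' - t)) by rewrite ler_pM2l//; lra.
 have Mt' : M%:R * (1 - t') <= M%:R * (1 - (t' - t)) by rewrite ler_pM2l//; lra.
 have h1 := F4 t01 e0 s0 s0; have h2 := F4 e1 t'01 s0 s'0 ss.
 rewrite subrr normr0 sub0r normrN add0r ger0_norm// in h1.
 rewrite distrC ger0_norm ?subr_ge0// in h2.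
 apply: le_trans (lerD (h1 ler01 (le_trans Mt h)) (h2 (le_trans Mt' h))) _.
 rewrite -mulrDr; apply: ler_wpM2l => //; rewrite addrCA; rewrite lerD2l -mulrDr ler_pM2l//; lra.
move=> hth hth' t0 t'0 tt; rewrite minEle; case: ifP => [_ h|_ h]; first exact: F4.
have [le|/ltW le] := leP th th'.
 have E : `|th' - th| = th' - th by rewrite ger0_norm ?subr_ge0.
 by case/andP: hth hth' => ? ? /andP[? ?]; rewrite E; apply: wl => //; rewrite -E.
have E : `|th' - th| = th - th' by rewrite distrC ger0_norm ?subr_ge0.
case/andP: hth hth' => ? ? /andP[? ?]; rewrite E dist_sym [`|tau' - _|]distrC.
by apply: wl => //; rewrite ?[`|tau - _|]distrC// -E.
Qed.
Let ang := projT1 (choice (@polar R)).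
Let angP : forall p : R * R, 0 <= ang p <= 1 /\
 p = (euclid p * cos (2 * pi * ang p), euclid p * sin (2 * pi * ang p)) := projT2 (choice (@polar R)).

(* Polar coordinates turn the strip into the disc; the radius is logarithmic to
 make the map conformal. *)
Definition disc_map (p : R * R) : Q :=
 if p == 0 then x0 else F (M%:R * - ln (euclid p)) (ang p).
(** Inside this radius the logarithmic coordinate exceeds T + 1, where the strip is constant. *)
Let rho0 : R := expR (- (T.+1%:R / M%:R)).
Lemma euclid_gt0 (p : R * R) : p != 0 -> 0 < euclid p.
by move=> p0; rewrite lt_neqAle euclid_ge0 eq_sym euclid_eq0 p0. Qed.

Lemma disc_tau (p : R * R) : p != 0 -> euclid p <= 1 -> 0 <= M%:R * - ln (euclid p).
by move=> p0 p1; have e0 := euclid_gt0 p0; rewrite mulr_ge0// oppr_ge0 -(ln1 R) ler_ln ?posrE.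
Qed.

Lemma disc_map_const p : euclid p <= rho0 -> disc_map p = x0.
rewrite /disc_map; case: eqVneq => // p0 h; apply: F3; last by case: (angP p).
have e0 := euclid_gt0 p0.
have : ln (euclid p) <= - (T.+1%:R / M%:R).
 by rewrite -[leRHS](@expRK R) ler_ln ?posrE// expR_gt0.
by rewrite lerNr => h'; rewrite mulrC -ler_pdivrMr.
Qed.

(** The local Lipschitz constant is inversely proportional to the radius. The factor 7 is 4 for the
    logarithm of the radius, 2 from [ln_dist] times 2 from [euclid_dist], plus 3 for the angle. *)
Lemma disc_map_local p q : p != 0 -> euclid p <= 1 -> euclid q <= 1 ->
 4 * M%:R * `|q - p| <= euclid p ->
 dist (disc_map p) (disc_map q) <= 7 * K * M%:R * `|q - p| / euclid p.
move=> p0 p1 q1; set D := `|q - p| => h; have e0 := euclid_gt0 p0.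
have D0 : 0 <= D by exact: normr_ge0.
have M1 : 1 <= M%:R :> R by rewrite ler1n.
have hD : 4 * D <= euclid p.
 apply: le_trans h; rewrite -[leLHS]mul1r mulrA [4 * M%:R]mulrC -mulrA -[leRHS]mulrA.
 by rewrite mul1r ler_peMl// mulr_ge0.
have ed := euclid_dist p q; rewrite -/D in ed.
have eq2 : euclid p / 2 <= euclid q by move: ed; rewrite ler_norml => /andP[? _]; lra.
have q0 : q != 0 by rewrite -euclid_eq0 gt_eqF//; lra.
have [ha pE] := angP p; have [ha' qE] := angP q.
rewrite /disc_map (negbTE p0) (negbTE q0).
set x := D / euclid p.
have x0' : 0 <= x by rewrite divr_ge0// ltW.
have hx : 4 * M%:R * x <= 1 by rewrite /x mulrA ler_pdivrMr// mul1r.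
have tt : `|M%:R * - ln (euclid q) - M%:R * - ln (euclid p)| <= 4 * M%:R * x.
 rewrite -mulrBr opprK addrC -opprB mulrN normrN normrM normr_nat -mulrA mulrCA; apply: ler_wpM2l => //.
 apply: le_trans (ln_dist e0 eq2) _; rewrite /x mulrA; apply: ler_wpM2r; first by rewrite invr_ge0 ltW.
 by lra.
have aa := angle_dist e0 (euclid_ge0 q) ha ha' pE qE; rewrite -/D -[leRHS]mulrA -/x in aa.
have Ma : M%:R * Num.min `|ang q - ang p| (1 - `|ang q - ang p|) <= 3 * M%:R * x.
 by rewrite [3 * M%:R]mulrC -mulrA; apply: ler_wpM2l.
have Mx : 0 <= M%:R * x by rewrite mulr_ge0.
apply: le_trans (strip_closed ha ha' (disc_tau p0 p1) (disc_tau q0 q1) _ _) _.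
- exact: le_trans tt hx.
- by apply: le_trans Ma _; apply: le_trans hx; rewrite -!mulrA; lra.
have -> : 7 * K * M%:R * D / euclid p = K * (4 * M%:R * x + 3 * M%:R * x) by rewrite /x; ring.
by apply: ler_wpM2l => //; exact: lerD.
Qed.

Lemma disc_map_bounded p : euclid p <= 1 -> dist (disc_map p) x0 <= K * T.+1%:R.
move=> p1; rewrite /disc_map; case: eqVneq => [_|p0]; first by rewrite distxx mulr_ge0.
have [ha _] := angP p; have := disc_tau p0 p1; move: (_ * - _) => t t0.
have h n : dist (F t (ang p)) (F (t + n%:R) (ang p)) <= K * n%:R.
 elim: n => [|n IH]; first by rewrite addr0 distxx mulr0.
 apply: le_trans (dist_triangle g _ (F (t + n%:R) (ang p)) _) _.
 rewrite -[n.+1%:R]natr1 mulrDr; apply: lerD => //.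
 have E : t + (n%:R + 1) - (t + n%:R) = 1 by ring.
 have := F4 (tau := t + n%:R) (tau' := t + (n%:R + 1)) ha ha.
 rewrite E subrr normr0 mulr0 addr0 normr1.
 have n0 : 0 <= n%:R :> R by []; apply; rewrite ?ler01 ?addr_ge0//.
have hT : T.+1%:R <= t + T.+1%:R by rewrite lerDr.
by have := h T.+1; rewrite (F3 hT ha).
Qed.

Lemma disc_map_lipschitz : lipschitz_disc g (disc_map : R * R -> filiLieG R r true).
have r0 : 0 < rho0 := expR_gt0 _.
pose L := 7 * K * M%:R / rho0 + 2 * (K * T.+1%:R) * (4 * M%:R / rho0).
have L1 : 0 <= 7 * K * M%:R / rho0 by rewrite divr_ge0 ?(ltW r0)// !mulr_ge0.
have L2 : 0 <= 2 * (K * T.+1%:R) * (4 * M%:R / rho0) by rewrite mulr_ge0 ?divr_ge0 ?(ltW r0)// !mulr_ge0.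
have cd (p : R * R) : closed_disc p -> euclid p <= 1.
 by rewrite /closed_disc/= => h; rewrite -(sqrtr1 R) ler_wsqrtr.
have wl p q : closed_disc p -> closed_disc q -> rho0 < euclid p ->
 dist (disc_map p) (disc_map q) <= L * `|q - p|.
 move=> /cd p1 /cd q1 rp; have p0 : p != 0 by rewrite -euclid_eq0 gt_eqF// (lt_trans r0).
 have [h|h] := leP (4 * M%:R * `|q - p|) rho0.
 apply: le_trans (disc_map_local p0 p1 q1 (le_trans h (ltW rp))) _.
 apply: (@le_trans _ _ (7 * K * M%:R / rho0 * `|q - p|)); last by apply: ler_wpM2r => //; rewrite lerDl.
 rewrite mulrAC; apply: ler_wpM2r => //; apply: ler_wpM2l; first by rewrite !mulr_ge0.
 by rewrite lef_pV2 ?posrE ?(lt_trans r0 rp) ?(ltW rp).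
 apply: (@le_trans _ _ (2 * (K * T.+1%:R))).
 apply: le_trans (dist_triangle g _ x0 _) _; rewrite [dist x0 _]dist_sym.
 by apply: le_trans (lerD (disc_map_bounded p1) (disc_map_bounded q1)) _; lra.
 apply: (@le_trans _ _ (2 * (K * T.+1%:R) * (4 * M%:R / rho0) * `|q - p|)); last by apply: ler_wpM2r => //; rewrite lerDr.
 rewrite -mulrA ler_peMr ?mulr_ge0// mulrAC ler_pdivlMr// mul1r; exact: ltW.
exists L => p q hp hq.
have [rp|rp] := leP (euclid p) rho0; last by rewrite distrC; exact: wl.
have [rq|rq] := leP (euclid q) rho0; last by rewrite dist_sym; exact: wl.
by rewrite !disc_map_const// distxx mulr_ge0// addr_ge0.
Qed.

Variables (C k2 : R).
Hypotheses (C0 : 0 <= C) (k20 : 0 <= k2).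
Hypothesis hC : forall x y : Q, dist x y <= 2 * K -> `|(x^-1 * y)%g : row| <= C * dist x y.
Hypothesis hk2 : forall v, bn g v <= k2 * `|v|.

Lemma open_disc_near (p v : R * R) : open_disc p ->
 \forall h \near (0 : R), euclid (h *: v + p) <= 1.
move=> hp; have p1 : euclid p < 1.
 by rewrite -(sqrtr1 R) ltr_sqrt//.
have d0 : 0 < (1 - euclid p) / (2 * (`|v| + 1)).
 by rewrite divr_gt0 ?subr_gt0// mulr_gt0// ltr_wpDl.
apply/nbhs_ballP; exists ((1 - euclid p) / (2 * (`|v| + 1))) => // h.
rewrite -ball_normE/= sub0r normrN => hh.
have := euclid_dist p (h *: v + p); rewrite addrK normrZ ler_norml => /andP[_].
have : `|h| * (2 * (`|v| + 1)) < 1 - euclid p by rewrite -ltr_pdivlMr// mulr_gt0// ltr_wpDl.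
have := normr_ge0 h; rewrite mulrCA; move: `|h| `|v| (euclid _) (euclid _) => a b c d; rewrite mulrDr mulr1; lra.
Qed.

Lemma disc_derive_local p v : open_disc p -> p != 0 -> `|v| <= 1 ->
 `|'D_v (translate g (disc_map : R * R -> filiLieG R r true) p) p| <= C * (7 * K * M%:R / euclid p).
move=> hp p0 v1; have e0 := euclid_gt0 p0.
have p1 : euclid p <= 1 by rewrite -(sqrtr1 R) ler_wsqrtr// ltW.
have B0 : 0 <= 7 * K * M%:R / euclid p by rewrite divr_ge0 ?(ltW e0)// !mulr_ge0.
apply: derive_norm_le; first by rewrite mulr_ge0.
have d0 : 0 < euclid p / (4 * M%:R) by rewrite divr_gt0// mulr_gt0.
near=> h.
have h0 : h != 0 by near: h; exact: nbhs_dnbhs_neq.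
have q1 : euclid (h *: v + p) <= 1.
 by near: h; apply: nbhs_dnbhs; exact: open_disc_near.
have hd : `|h| <= euclid p / (4 * M%:R) by near: h; exact: dnbhs0_le.
set q := h *: v + p in q1 *.
have qp : `|q - p| <= `|h| by rewrite /q addrK normrZ ler_piMr.
have qp4 : 4 * M%:R * `|q - p| <= euclid p.
 rewrite mulrC -ler_pdivlMr ?mulr_gt0//; exact: le_trans qp hd.
have dl := disc_map_local p0 p1 q1 qp4.
have dB : dist (disc_map p) (disc_map q) <= 7 * K * M%:R / euclid p * `|h|.
 by apply: le_trans dl _; rewrite mulrAC; apply: ler_wpM2l.
have d2 : dist (disc_map p) (disc_map q) <= 2 * K.
 apply: le_trans dl _; rewrite ler_pdivrMr//.
 have : K * (4 * M%:R * `|q - p|) <= K * euclid p by apply: ler_wpM2l.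
 have : 0 <= K * euclid p by rewrite mulr_ge0// ltW.
 have -> : 7 * K * M%:R * `|q - p| = 7 / 4 * (K * (4 * M%:R * `|q - p|)) by field.
 have -> : 2 * K * euclid p = 2 * (K * euclid p) by ring.
 by move: (K * (4 * M%:R * `|q - p|)) (K * euclid p) => a b; lra.
have -> : translate g (disc_map : R * R -> filiLieG R r true) p q -
 translate g (disc_map : R * R -> filiLieG R r true) p p = ((disc_map p)^-1 * disc_map q)%g :> row.
 rewrite !translateE subrr mul0mx subr0; exact/esym/divE.
rewrite normrZ normfV mulrC ler_pdivrMr ?normr_gt0// -[leRHS]mulrA.
apply: le_trans (hC d2) _; exact: ler_wpM2l.
Unshelve. all: by end_near.
Qed.

Lemma disc_derive_const p v : euclid p < rho0 ->
 'D_v (translate g (disc_map : R * R -> filiLieG R r true) p) p = 0.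
move=> pr; apply/eqP; rewrite -normr_le0; apply: derive_norm_le => //.
have d0 : 0 < (rho0 - euclid p) / (2 * (`|v| + 1)).
 by rewrite divr_gt0 ?subr_gt0// mulr_gt0// ltr_wpDl.
near=> h.
have hh : `|h| < (rho0 - euclid p) / (2 * (`|v| + 1)).
 by near: h; exact: dnbhs0_lt.
have q1 : euclid (h *: v + p) <= rho0.
 have := euclid_dist p (h *: v + p); rewrite addrK normrZ ler_norml => /andP[_].
 have : `|h| * (2 * (`|v| + 1)) < rho0 - euclid p by rewrite -ltr_pdivlMr// mulr_gt0// ltr_wpDl.
 have := normr_ge0 h; rewrite mulrCA; move: `|h| `|v| (euclid _) (euclid _) => a b c d; rewrite mulrDr mulr1; lra.
rewrite !translateE !disc_map_const ?(ltW pr)// !subrr scaler0 normr0//.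
Unshelve. all: by end_near.
Qed.
Let J := (T.+1 %/ M).+1.
Let c0 : R := (k2 * (C * (7 * K * M%:R))) ^+ 2.
(** The density is at most a constant times M^2 / |p|^2. It is majorized on the exponential shell k
    by a constant on a square of side 2 exp(-k), and all shells have the same integral. With about T
    / M shells, the area is of order M T, the number of cells of the strip. *)
Let shell (k : nat) (p : R * R) : R :=
 c0 * expR k.+1%:R ^+ 2 * \1_(`[- expR (- k%:R), expR (- k%:R)] `*` `[- expR (- k%:R), expR (- k%:R)]) p.
Let shell_ge0 k p : 0 <= shell k p.
by rewrite /shell !mulr_ge0 ?sqr_ge0 ?exprn_ge0 ?expR_ge0// indicE. Qed.

Lemma density_bound p : open_disc p ->
 0 <= area_density g (disc_map : R * R -> filiLieG R r true) p <= \sum_(k < J) shell k p.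
move=> hp; rewrite /area_density sqrtr_ge0/=; set v1 := 'D_(_) _ _; set v2 := 'D_(_) _ _.
apply: le_trans (gram_le v1 v2) _.
have S0 : 0 <= \sum_(k < J) shell k p by apply: sumr_ge0.
have bn0 : bn g 0 = 0 by rewrite -(scale0r 0) bnZ normr0 mul0r.
have [pr|pr] := ltP (euclid p) rho0.
 by rewrite /v1 disc_derive_const// bn0 mul0r.
have r0 : 0 < rho0 := expR_gt0 _.
have e0 : 0 < euclid p by apply: lt_le_trans pr.
have p0 : p != 0 by rewrite -euclid_eq0 gt_eqF.
have p1 : euclid p < 1 by rewrite -(sqrtr1 R) ltr_sqrt.
have lp0 : 0 <= - ln (euclid p) by rewrite oppr_ge0 -(ln1 R) ler_ln ?posrE// ltW.
have /andP[k1 k2'] := Num.Theory.trunc_itv lp0; set k := Num.trunc _ in k1 k2'.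
have lrho : - ln (euclid p) <= T.+1%:R / M%:R.
 by rewrite lerNl -[leLHS](@expRK R) ler_ln ?posrE.
have kJ : (k < J)%N.
 rewrite /J ltnS leq_divRL// -(ler_nat R) natrM -ler_pdivlMr//; exact: le_trans lrho.
rewrite (bigD1 (Ordinal kJ))//=; apply: le_trans (_ : shell k p <= _); last first.
 by rewrite lerDl; apply: sumr_ge0.
have ek : euclid p <= expR (- k%:R).
 by rewrite -[leLHS]lnK ?posrE// ler_expR lerNr.
have ek1 : expR (- k.+1%:R) <= euclid p.
 by rewrite -[leRHS]lnK ?posrE// ler_expR lerNl ltW.
have pS : p \in (`[- expR (- k%:R), expR (- k%:R)] `*` `[- expR (- k%:R), expR (- k%:R)])%classic.
 have le1 : `|p.1| <= euclid p.
 by rewrite -sqrtr_sqr ler_wsqrtr// lerDl sqr_ge0.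
 have le2 : `|p.2| <= euclid p.
 by rewrite -sqrtr_sqr ler_wsqrtr// lerDr sqr_ge0.
 by rewrite inE; split=> /=; rewrite in_itv/= -ler_norml (le_trans _ ek).
rewrite /shell indicE pS mulr1.
have n1 : `|(1, 0) : R * R| <= 1 by rewrite norm_pair/= normr1 normr0 max_l.
have n2 : `|(0, 1) : R * R| <= 1 by rewrite norm_pair/= normr1 normr0 max_r.
have b (v : R * R) : `|v| <= 1 -> bn g ('D_v (translate g (disc_map : R * R -> filiLieG R r true) p) p) <=
 k2 * (C * (7 * K * M%:R)) * expR k.+1%:R.
 move=> v1'; apply: le_trans (hk2 _) _; rewrite -mulrA; apply: ler_wpM2l => //.
 apply: le_trans (disc_derive_local hp p0 v1') _; rewrite -[leRHS]mulrA; apply: ler_wpM2l => //.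
 apply: ler_wpM2l; first by rewrite !mulr_ge0.
 rewrite -[expR k.+1%:R]invrK -expRN lef_pV2 ?posrE ?expR_gt0//.
rewrite /c0 -exprMn expr2; apply: ler_pM; rewrite ?bn_ge0//; exact: b.
Qed.

Lemma disc_map_area : (disc_area g (disc_map : R * R -> filiLieG R r true) <=
 (c0 * (4 * expR 1 ^+ 2) * J%:R)%:E)%E.
apply: le_trans (integral_le_dominated (h := fun p => \sum_(k < J) shell k p) _ density_bound) _.
 by move=> p; apply: sumr_ge0.
under eq_integral do rewrite -sumEFin.
have c00 : 0 <= c0 by rewrite sqr_ge0.
rewrite ge0_integral_sum//; first last.
- by move=> k p _; rewrite lee_fin.
- move=> k; apply/measurable_realfun.measurable_EFinP; apply: measurable_funM; first exact: measurable_cst.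
 by apply: measurable_indic; exact: measurableX.
have E (k : 'I_J) : (\int[(@lebesgue_measure R \x @lebesgue_measure R)%E]_p (shell k p)%:E =
 (c0 * (4 * expR 1 ^+ 2))%:E)%E.
 rewrite /shell square_integral ?expR_ge0 ?mulr_ge0 ?exprn_ge0 ?expR_ge0//.
 congr (_%:E); rewrite -!mulrA -[k.+1%:R]natr1 expRD expRN; field.
 by rewrite gt_eqF ?expR_gt0.
under eq_bigr do rewrite E.
by rewrite sumEFin lee_fin sumr_const card_ord -[leLHS]mulr_natr.
Qed.

Lemma disc_map_circle (c' : R -> Q) (s : R) : (forall th, 0 <= th <= 1 -> F 0 th = c' th) ->
 0 <= s <= 1 -> disc_map (cos (2 * pi * s), sin (2 * pi * s)) = c' s.
move=> F1 s01; set p := (_, _).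
have e1 : euclid p = 1 by rewrite /euclid /= cos2Dsin2 sqrtr1.
have p0 : p != 0 by rewrite -euclid_eq0 e1 oner_eq0.
have [ha pE] := angP p; rewrite e1 in pE.
have pE' : p = (1 * cos (2 * pi * s), 1 * sin (2 * pi * s)) by rewrite !mul1r.
have := angle_dist ltr01 ler01 ha s01 pE pE'; rewrite subrr normr0 mulr0 mul0r => h.
rewrite /disc_map (negbTE p0) e1 ln1 oppr0 mulr0 F1//.
move: h; rewrite minEle; case: ifP => _.
 by rewrite normr_le0 subr_eq0 => /eqP ->.
have c'01 : c' 0 = c' 1 by rewrite -!F1 ?lexx ?ler01// F2.
rewrite subr_le0; move: ha s01 => /andP[a0 a1] /andP[s0 s1].
have [h|h] := leP 0 (s - ang p); [rewrite ger0_norm//|rewrite ltr0_norm//] => h'.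
 have [-> ->] : ang p = 0 /\ s = 1 by split; lra.
 exact: c'01.
have [-> ->] : ang p = 1 /\ s = 0 by split; lra.
exact/esym.
Qed.

End Disc.

(** The area is a constant times M^2 (T / M + 1), which is O(M^r) for T = O(M^(r-1)), and M is at
    most C (n + 1). *)
Theorem lie_dehn_upper : exists C : nat, forall n : nat,
 (lie_dehn g n%:R <= (C * n.+1 ^ r)%:R%:E)%E.
have [K [C [K0 hK]]] := loop_strip r3 g.
have [k1 [k2 [_ k20 hk]]] := bn_equiv g.
have hk2 v : bn g v <= k2 * `|v| by case/andP: (hk v).
have [|C1 C10 hC1] := dist_local g (_ : 0 <= 2 * K); first by rewrite mulr_ge0.
pose A : R := (k2 * (C1 * (7 * K))) ^+ 2 * (4 * expR 1 ^+ 2).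
have A0 : 0 <= A by rewrite mulr_ge0 ?sqr_ge0// mulr_ge0// sqr_ge0.
have /andP[_ Alt] := Num.Theory.trunc_itv A0; set a := (Num.trunc A).+1 in Alt.
exists (a * ((C + 3) * C ^ r))%N => n; apply: ereal_inf_lbound.
exists (a * ((C + 3) * C ^ r) * n.+1 ^ r)%:R => // c hc.
have [sg [c' [F [M [T [x0 [[h1 h2 [s0 s1] h4] [[/andP[M0 MC] TC] F1 F2 F3 F4]]]]]]]] := hK n c hc.
exists (disc_map M F x0); split.
- exact: (disc_map_lipschitz K0 M0 F2 F3 F4).
- exists sg; split=> // t t01; rewrite h4//; apply/esym.
 apply: disc_map_circle => //.
 have := h2 0 t; have := h2 t 1; rewrite !in_itv/= !lexx !ler01 t01 s0 s1.
 by case/andP: t01 => t0 t1 /(_ isT isT t1) -> /(_ isT isT t0) ->.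
apply: le_trans (disc_map_area K0 M0 F2 F3 F4 C10 (ltW k20) hC1 hk2) _; rewrite lee_fin.
have -> : (k2 * (C1 * (7 * K * M%:R))) ^+ 2 * (4 * expR 1 ^+ 2) * (T.+1 %/ M).+1%:R =
 A * (M ^ 2 * (T.+1 %/ M).+1)%:R.
 by rewrite natrM natrX /A; ring.
rewrite -mulnA [leRHS]natrM; apply: ler_pM => //; first exact: ltW.
rewrite ler_nat.
have Mr : (M ^ r <= C ^ r * n.+1 ^ r)%N by rewrite -expnMn leq_exp2r//; lia.
apply: (@leq_trans ((C + 3) * M ^ r)); last by rewrite -mulnA leq_mul2l Mr orbT.
have TM : (T.+1 %/ M * M <= T.+1)%N by exact: leq_divM.
have rE : r = r.-1.+1 by lia.
have M2 : (M ^ 2 <= M ^ r)%N by apply: leq_pexp2l => //; lia.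
have M1 : (M <= M ^ r)%N by rewrite -[leqLHS]expn1; apply: leq_pexp2l => //; lia.
have TMM : (T * M <= C * M ^ r)%N.
 by rewrite rE expnSr mulnA; apply: leq_mul.
have -> : (M ^ 2 * (T.+1 %/ M).+1 = (T.+1 %/ M * M) * M + M ^ 2)%N by rewrite mulnS expnS expn1; ring.
have : (T.+1 %/ M * M * M <= T.+1 * M)%N by rewrite leq_mul2r TM orbT.
rewrite mulnDl mulSn => h; apply: leq_trans (leq_add h M2) _.
move: M1 TMM M2; move: (M ^ r)%N (T * M)%N (C * _)%N; clear; lia.
Qed.

End UpperBound.

(** * Almost everywhere differentiability of Lipschitz maps *)

Section LipschitzDerivable.
Context {R : realType}.
Local Notation mu := (@lebesgue_measure R).

Lemma ae_mono d (T : measurableType d) (m : {measure set T -> \bar R}) (P P' : T -> Prop) :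
 {ae m, forall x, P x} -> (forall x, P x -> P' x) -> {ae m, forall x, P' x}.
move=> [N [mN N0 PN]] PP'; exists N; split=> // x /= nx; apply: PN => /= px; exact/nx/PP'.
Qed.

Section Monotone.
Variables (f : R -> R) (K : R).
Hypothesis K0 : 0 < K.
Hypothesis fmono : nondecreasing f.
Hypothesis flip : forall x y, x <= y -> f y - f x <= K * (y - x).
Let f_rc : right_continuous f.
move=> x; apply: cvg_at_right_filter; apply/cvgrPdist_le => ep ep0.
near=> y.
have yx : `|x - y| <= ep / K.
 near: y; apply: cvgr_dist_le; [exact: cvg_id|exact: divr_gt0].
have -> : `|f x - f y| <= ep = true => //.
rewrite ler_pdivlMr// mulrC in yx; apply: le_trans yx.
have [xy|/ltW xy] := leP x y.
 have := flip xy; rewrite distrC [`|x - y|]distrC !ger0_norm ?subr_ge0//; exact: fmono.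
have := flip xy; rewrite !ger0_norm ?subr_ge0//; exact: fmono.
Unshelve. all: by end_near.
Qed.

HB.instance Definition _ := isCumulative.Build R _ R f fmono f_rc.
Let nu : {measure set (measurableTypeR R) -> \bar R} := lebesgue_stieltjes_measure f.
Let wlength_lip (A : set (ocitv_type R)) : measurable A ->
 (wlength f A <= K%:E * wlength (idfun : R -> R) A)%E.
move=> [[x y] xy <-]; rewrite !wlength_itv/= !lte_fin; case: ifPn => [xy'|_]; last by rewrite mule0.
by rewrite -!EFinD -EFinM lee_fin; apply/flip/ltW.
Qed.
Let nu_le (A : set R) : (nu A <= K%:E * mu A)%E.
rewrite -lee_pdivrMl//; apply: le_ereal_inf_tmp => _ [F [mF AF] <-].
rewrite lee_pdivrMl//; rewrite -nneseriesZl//.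
apply: le_trans (_ : \sum_(k <oo) wlength f (F k) <= _)%E.
 by apply: ereal_inf_lbound; exists F.
by apply: lee_nneseries => i *; [exact: wlength_ge0|exact: (wlength_lip (mF i))].
Qed.

(** The Stieltjes measure of f is at most K times Lebesgue measure, hence absolutely continuous. So
    f is, up to a constant, the integral of a Radon-Nikodym density, to which Lebesgue
    differentiation applies. *)
Lemma monotone_lipschitz_derivable (n : R) : 0 < n ->
 {ae mu, forall x, - n < x < n -> derivable f x 1}.
move=> n0.
pose D : set (measurableTypeR R) := `]- n, n]%classic.
have mD : measurable D by exact: measurable_itv.
have nuD (x : R) : - n <= x -> nu `]- n, x]%classic = (f x - f (- n))%:E.
 move=> nx; rewrite -[LHS]/(mu_ext (wlength f) `]- n, x]%classic) measurable_mu_extE/=; last first.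
 by exists (- n, x).
 by rewrite wlength_itv_bnd.
have Doo : (nu D < +oo)%E by rewrite nuD ?ltry//; lra.
pose nuD' : {finite_measure set (measurableTypeR R) -> \bar R} := @mfrestr _ (measurableTypeR R) R D nu mD Doo.
have dom : nuD' `<< mu.
 apply/null_content_dominatesP => A mA A0.
 apply/eqP; rewrite eq_le measure_ge0 andbT /nuD' /mfrestr /mrestr.
 apply: le_trans (nu_le _) _.
 have -> : mu (A `&` D) = 0%E.
 by apply/eqP; rewrite eq_le measure_ge0 andbT -A0 le_measure ?inE//; exact: measurableI.
 by rewrite mule0.
have gint := Radon_Nikodym_SigmaFinite.f_integrable dom.
have gE := Radon_Nikodym_SigmaFinite.f_integral dom.
have gfin := Radon_Nikodym_SigmaFinite.f_fin_num dom.
set g := Radon_Nikodym_SigmaFinite.f _ _ in gint gE gfin.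
pose h x := fine (g x).
have gh : EFin \o h = g by apply: funext => x; rewrite /= fineK.
have hint : mu.-integrable [set: R] (EFin \o h) by rewrite gh.
have hloc : locally_integrable [set: R] h.
 by have := integrable_locally measurableT hint; rewrite patch_setT.
have := @FTC1 R h (BRight (- n)) _ hloc; have hI y : mu.-integrable [set` Interval (BRight (- n)) (BRight y)] (EFin \o h).
 by apply: integrableS hint => //; exact: measurable_itv.
move=> /(_ hI) haux; apply: ae_mono haux _ => x hx /andP[nx xn].
have [dF _] := hx nx.
have Fx : \forall y \near x, \int[mu]_(t in [set` Interval (BRight (- n)) (BRight y)]) h t + f (- n) = f y.
 near=> y.
 have yn : - n < y by near: y; exact: lt_nbhsr.
 have yn' : y < n by near: y; exact: lt_nbhsl.
 have := gE `]- n, y]%classic (measurable_itv _); rewrite -[nuD' _]/(nu (`]- n, y]%classic `&` D)).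
 have -> : `]- n, y]%classic `&` D = `]- n, y]%classic :> set R.
 apply/seteqP; split=> z; rewrite /D /= !in_itv/=; first by case.
 by move=> /andP[z1 z2]; rewrite z1 z2/= (le_trans z2 (ltW yn')).
 rewrite nuD ?(ltW yn)// -gh => E.
 by rewrite /Rintegral -E /= subrK.
have dF' : derivable (fun y => \int[mu]_(t in [set` Interval (BRight (- n)) (BRight y)]) h t + f (- n)) x 1.
 exact: derivableD.
by have [] := near_eq_is_derive Fx (DeriveDef dF' erefl).
Unshelve. all: by end_near.
Qed.

End Monotone.

(** Adding a large multiple of x makes f nondecreasing and keeps it Lipschitz. *)
Lemma lipschitz_derivable_ae (f : R -> R) (K : R) :
 (forall x y, `|f y - f x| <= K * `|y - x|) -> {ae mu, forall x, derivable f x 1}.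
move=> flip; pose K' := `|K| + 1; have K'0 : 0 < K' by rewrite ltr_wpDl.
have fl x y : x <= y -> `|f y - f x| <= K' * (y - x).
 move=> xy; apply: le_trans (flip x y) _; rewrite ger0_norm ?subr_ge0//.
 by apply: ler_wpM2r; [rewrite subr_ge0|rewrite /K'; have := ler_norm K; lra].
pose h x := f x + K' * x.
have hmono : nondecreasing h.
 by move=> x y xy; have := fl x y xy; rewrite ler_norml /h => /andP[h1 _]; lra.
have hlip x y : x <= y -> h y - h x <= 2 * K' * (y - x).
 by move=> xy; have := fl x y xy; rewrite ler_norml /h => /andP[_ h1]; lra.
have K2 : 0 < 2 * K' by lra.
have ae n : {ae mu, forall x, - n.+1%:R < x < n.+1%:R -> derivable h x 1}.
 exact: (monotone_lipschitz_derivable K2 hmono hlip).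
apply: ae_mono (ae_foralln ae) _ => x hx; have /andP[_ t] := Num.Theory.trunc_itv (normr_ge0 x).
have dh : derivable h x 1.
 by apply: (hx (Num.trunc `|x|)); rewrite -ltr_norml.
have -> : f = h - (fun x => K' *: x).
 by apply: funext => y; rewrite /h -[RHS]/(f y + K' * y - K' *: y) /GRing.scale/= addrK.
apply: derivableB => //; apply: derivableZ; exact: derivable_id.
Qed.

End LipschitzDerivable.

(** * Lebesgue measure in the plane and existence of partial derivatives *)

Section PlaneMeasure.
Context {R : realType}.
Local Notation mu := (@lebesgue_measure R).
Local Notation mu2 := (mu \x mu)%E.
Implicit Types (U : set (R * R)) (f : R * R -> \bar R).

Lemma open_measurable2 U : open U -> measurable U.
move=> oU.
pose box (a b : rat) (k : nat) : set (R * R) :=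
 `](ratr a - k.+1%:R^-1), (ratr a + k.+1%:R^-1)[%classic `*`
 `](ratr b - k.+1%:R^-1), (ratr b + k.+1%:R^-1)[%classic.
pose B a b k := if pselect (box a b k `<=` U) is left _ then box a b k else set0.
have -> : U = \bigcup_a \bigcup_b \bigcup_k B a b k.
 apply/seteqP; split=> [p Up|p [a _ [b _ [k _]]]]; last first.
 by rewrite /B; case: pselect => // h; exact: h.
 have [e /= e0 he] := (nbhs_ballP p U).1 (open_nbhs_nbhs (conj oU Up)).
 have e2 : 0 < (e / 2)^-1 by rewrite invr_gt0 divr_gt0.
 have /andP[_ kt] := Num.Theory.trunc_itv (ltW e2).
 set k := Num.trunc _ in kt; set d : R := k.+1%:R^-1.
 have d0 : 0 < d by rewrite invr_gt0.
 have de : d < e / 2 by rewrite -[e / 2]invrK ltf_pV2 ?posrE.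
 have near (x : R) : exists a : rat, x - d < ratr a < x + d.
 by have [|a] := @rat_in_itvoo R (x - d) (x + d); [lra|rewrite in_itv/= => h; exists a].
 have [a /andP[a1 a2]] := near p.1; have [b /andP[b1 b2]] := near p.2.
 exists a => //; exists b => //; exists k => //.
 have pb : box a b k p.
 by split; rewrite /= in_itv/= -/d; lra2.
 rewrite /B; case: pselect => //; case=> q [/= qa qb]; apply: he.
 rewrite /= !in_itv/= -/d in qa qb.
 split; rewrite /ball/= ltr_norml; apply/andP; split; case/andP: qa => ? ?; case/andP: qb => ? ?; lra.
do 2!apply: bigcupT_measurable_rat => ?; apply: bigcupT_measurable => k.
rewrite /B; case: pselect => // _; exact: measurableX.
Qed.

Lemma closed_measurable2 U : closed U -> measurable U.
move=> cU; rewrite -[U]setCK; apply: measurableC; apply: open_measurable2; exact: closed_openC.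
Qed.

Lemma continuous_measurable2 (f : R * R -> R) : continuous f -> measurable_fun setT f.
move=> /continuousP cf; apply: (measurability _ (RGenOpens.measurableE R)).
move=> _ [_ [a [b ->] <-]]; rewrite setTI; apply: open_measurable2.
exact/cf/interval_open.
Qed.

Lemma shift_measurable (h : R) : measurable_fun setT (fun x : R => x + h).
by apply: continuous_measurable_fun => x; apply: cvgD; [exact: cvg_id|exact: cvg_cst]. Qed.

Lemma integral_shift (g : R -> \bar R) (h : R) : measurable_fun setT g -> (forall x, 0 <= g x)%E ->
 (\int[mu]_x g (x + h)%R = \int[mu]_x g x)%E.
move=> mg g0; have mh := shift_measurable h.
pose nu : {measure set (measurableTypeR R) -> \bar R} :=
 pushforward mu (fun x : measurableTypeR R => (x + h : measurableTypeR R)).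
have E : forall A, measurable A -> mu A = nu mh A.
 apply: lebesgue_measure_unique => _ [[a b] _ <-].
 rewrite -[RHS]/(mu ((fun x : R => x + h) @^-1` `]a, b]%classic)).
 have -> : (fun x : R => x + h) @^-1` `]a, b]%classic = `](a - h), (b - h)]%classic :> set R.
 by apply/seteqP; split=> x /=; rewrite !in_itv/= ltrBlDr lerBrDr.
 rewrite !lebesgue_measure_itv/= !lte_fin ltrD2r; case: ifP => // _.
 by rewrite -!EFinB; congr (_%:E); ring.
have -> : (\int[mu]_x g x = \int[nu mh]_x g x)%E.
 by apply: eq_measure_integral => A mA _; exact: E.
by rewrite /nu ge0_integral_pushforward// preimage_setT.
Qed.

Lemma integral_shift2 f (v : R * R) : measurable_fun setT f -> (forall p, 0 <= f p)%E ->
 (\int[mu2]_p f (p + v)%R = \int[mu2]_p f p)%E.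
move=> mf f0.
have mv : measurable_fun setT (fun p : R * R => p + v).
 apply: measurable_fun_pair.
 - exact: measurableT_comp (shift_measurable v.1) (@measurable_fst _ _ _ _).
 - exact: measurableT_comp (shift_measurable v.2) (@measurable_snd _ _ _ _).
rewrite !fubini_tonelli1//; last exact: measurableT_comp mf mv.
rewrite -[RHS](integral_shift v.1); last 2 first.
- exact: measurable_fun_fubini_tonelli_F.
- by move=> x; apply: integral_ge0.
apply: eq_integral => x _; rewrite /fubini_F -[RHS](integral_shift v.2)//.
exact: measurableT_comp mf (measurable_pair1 _).
Qed.

End PlaneMeasure.

Section GoodSet.
Context {R : realType} {n : nat}.
Local Notation mu := (@lebesgue_measure R).
Local Notation mu2 := (mu \x mu)%E.
Variables (E : R * R -> 'rV[R]_n) (L : R).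
Hypothesis ELip : forall p q, `|E q - E p| <= L * `|q - p|.

Lemma lipschitz_continuous : continuous E.
move=> p; apply/cvgrPdist_le => ep ep0.
have L1 : 0 < `|L| + 1 by rewrite ltr_wpDl.
near=> q; rewrite distrC; apply: le_trans (ELip p q) _.
apply: (@le_trans _ _ ((`|L| + 1) * `|q - p|)).
 by apply: ler_wpM2r => //; have := ler_norm L; lra.
rewrite -ler_pdivlMl// mulrC distrC; near: q; apply: cvgr_dist_le; [exact: cvg_id|exact: divr_gt0].
Unshelve. all: by end_near.
Qed.

Definition quotient (v : R * R) (h : R) (p : R * R) : 'rV[R]_n := h^-1 *: (E (h *: v + p) - E p).

Lemma quotient_continuous v h : continuous (quotient v h).
move=> p; apply: (@cvgZr _ 'rV[R]_n); apply: (@cvgB R 'rV[R]_n); last exact: lipschitz_continuous.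
apply: (@cvg_comp _ _ _ (fun p => h *: v + p) E _ (nbhs (h *: v + p))); last exact: lipschitz_continuous.
by apply: (@cvgD R (R * R)%type); [exact: cvg_cst|exact: cvg_id].
Qed.

Definition cauchy_at v (j k : nat) : set (R * R) := [set p | forall h h' : R,
 0 < `|h| < k.+1%:R^-1 -> 0 < `|h'| < k.+1%:R^-1 ->
 `|quotient v h p - quotient v h' p| <= j.+1%:R^-1].

(* The set where the derivative along v exists, as a countable combination of closed sets. *)
Definition good v : set (R * R) := \bigcap_j \bigcup_k cauchy_at v j k.

Lemma good_measurable v : measurable (good v).
apply: bigcapT_measurable => j; apply: bigcupT_measurable => k; apply: closed_measurable2.
have -> : cauchy_at v j k = \bigcap_(hh in [set hh : R * R | 0 < `|hh.1| < k.+1%:R^-1 /\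
 0 < `|hh.2| < k.+1%:R^-1]) [set p | `|quotient v hh.1 p - quotient v hh.2 p| <= j.+1%:R^-1].
 apply/seteqP; split=> [p hp [h h'] /= [? ?]|p hp h h' ? ?]; first exact: hp.
 exact: (hp (h, h')).
apply: closed_bigI => -[h h'] _ /=.
have -> : [set p | `|quotient v h p - quotient v h' p| <= j.+1%:R^-1] =
 (fun p => `|quotient v h p - quotient v h' p|) @^-1` [set x | x <= j.+1%:R^-1] by [].
apply: preimage_closed; last exact: closed_le.
move=> p _; apply: cvg_norm; apply: (@cvgB R 'rV[R]_n); exact: quotient_continuous.
Qed.

Lemma inv_lt (ep : R) : 0 < ep -> exists k : nat, k.+1%:R^-1 < ep.
move=> ep0; have e1 : 0 < ep^-1 by rewrite invr_gt0.
have /andP[_ kt] := Num.Theory.trunc_itv (ltW e1).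
by exists (Num.trunc ep^-1); rewrite -[X in _ < X]invrK ltf_pV2 ?posrE ?invr_gt0.
Qed.

Lemma good_derivable v p : good v p -> derivable E p v.
move=> gp; apply/cauchy_cvgP; apply: cauchy_exP => ep ep0.
have [j hj] := inv_lt ep0; have [k _ hk] := gp j I.
have k0 : 0 < k.+1%:R^-1 :> R by rewrite invr_gt0.
have kk : k.+2%:R^-1 < k.+1%:R^-1 :> R by rewrite ltf_pV2 ?posrE// ltr_nat.
exists (quotient v k.+2%:R^-1 p).
suff : \forall h \near (0 : R)^', ball (quotient v k.+2%:R^-1 p) ep (quotient v h p) by [].
near=> h; rewrite -ball_normE/=.
apply: le_lt_trans hj; apply: hk.
 by rewrite ger0_norm ?invr_ge0 ?ler0n// kk andbT invr_gt0 ltr0n.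
apply/andP; split; first by rewrite normr_gt0; near: h; exact: nbhs_dnbhs_neq.
near: h; exact: dnbhs0_lt.
Unshelve. all: by end_near.
Qed.

Lemma derivable_good v p : derivable E p v -> good v p.
move=> dE j _; have dc : quotient v h p @[h --> 0^'] --> 'D_v E p := dE.
have e0 : 0 < j.+1%:R^-1 / 2 :> R by rewrite divr_gt0 ?invr_gt0.
move/cvgrPdist_le: dc => /(_ _ e0); rewrite nearE => /nbhs_ballP[d /= d0 hd].
have [k hk] := inv_lt d0.
exists k => // h h' /andP[h0 hk1] /andP[h'0 hk2].
have b (x : R) : 0 < `|x| -> `|x| < k.+1%:R^-1 -> `|'D_v E p - quotient v x p| <= j.+1%:R^-1 / 2.
 move=> x0 xk; apply: hd; last by rewrite -normr_gt0.
 by rewrite -ball_normE/= sub0r normrN (lt_trans xk).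
have -> : quotient v h p - quotient v h' p = ('D_v E p - quotient v h' p) - ('D_v E p - quotient v h p).
 by rewrite opprB [RHS]addrC addrA subrK.
rewrite [leRHS]splitr; apply: normB_le.
by apply: lerD; exact: b.
Qed.
Let line_derivable (f : R -> 'rV[R]_n) : (forall x y, `|f y - f x| <= L * `|y - x|) ->
 {ae mu, forall x, derivable f x 1}.
move=> hf.
have hi (i : 'I_n) : {ae mu, forall x, derivable (fun x => f x 0 i) x 1}.
 apply: (lipschitz_derivable_ae (K := L)) => x y; apply: le_trans (hf x y).
 have := (norm_bnd (f y - f x) (normr_ge0 _)).1 (lexx _) i; by rewrite !mxE.
have : {ae mu, forall x, forall i : 'I_n, derivable (fun x => f x 0 i) x 1}.
 pose P (k : nat) x := if insub k is Some i then derivable (fun x => f x 0 (i : 'I_n)) x 1 else True.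
 have : {ae mu, forall x, forall k, P k x}.
 apply/ae_foralln => k; rewrite /P; case: insub => [i|]; first exact: hi.
 by exists set0; split=> // x /=; exact.
 move=> h; apply: ae_mono h _ => x h i; by have := h i; rewrite /P valK.
move=> h; apply: ae_mono h _ => x h; apply/derivable_mxP => i j; rewrite (ord1 i); exact: h.
Qed.
Let null_section (A : set R) (P : R -> Prop) : measurable A -> {ae mu, forall x, P x} ->
 (forall x, P x -> ~ A x) -> (\int[mu]_x (\1_A x)%:E = 0)%E.
move=> mA [N [mN N0 PN]] PA; rewrite integral_indic// setIT.
apply: (subset_measure0 (mu := mu) mA mN _ N0) => x Ax; apply: PN => /= Px; exact: (PA x Px).
Qed.

(** On each line parallel to v the restriction of [E] is Lipschitz, so the bad set meets the line in
    a null set; Tonelli concludes. *)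
Lemma good_full v : v = (1, 0) \/ v = (0, 1) -> mu2 (~` good v) = 0%E.
move=> hv; have mC : measurable (~` good v) by apply: measurableC; exact: good_measurable.
have m1 : measurable_fun setT (fun p : R * R => (\1_(~` good v) p)%:E : \bar R).
 by apply/measurable_EFinP; exact: measurable_indic.
have -> : mu2 (~` good v) = (\int[mu2]_p (\1_(~` good v) p)%:E)%E by rewrite integral_indic// setIT.
have i0 (p : R * R) : (0 <= (\1_(~` good v) p)%:E :> \bar R)%E by rewrite lee_fin indicE.
case: hv => vE.
- rewrite fubini_tonelli2//; apply: integral0_eq => y _; rewrite /fubini_G.
 have h := @line_derivable (fun x => E (x, y)) _.
 have -> : (fun x => (\1_(~` good v) (x, y))%:E : \bar R) =
 (fun x => (\1_(ysection (~` good v) y) x)%:E).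
 by apply: funext => x; rewrite !indicE mem_ysection.
 apply: null_section (h _) _.
 + exact: measurable_ysection.
 + move=> x x'; apply: le_trans (ELip _ _) _.
 have -> : `|(x', y) - (x, y)| = `|x' - x| by rewrite norm_pair/= subrr normr0 max_l.
 by [].
 move=> x dx; rewrite /ysection/= inE => /(_ _)/=; apply; apply: derivable_good.
 rewrite vE /derivable; move: dx; rewrite /derivable/=.
 set f := (fun h => _); set f' := (fun h => _) => dx.
 suff -> : f' = f by [].
 apply: funext => h'; rewrite /f /f' /=; congr (_ *: (E _ - _)).
 by rewrite -[LHS]/(h' *: 1 + x, h' *: 0 + y) scaler0 add0r.
rewrite fubini_tonelli1//; apply: integral0_eq => x _; rewrite /fubini_F.
have h := @line_derivable (fun y => E (x, y)) _.
have -> : (fun y => (\1_(~` good v) (x, y))%:E : \bar R) =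
 (fun y => (\1_(xsection (~` good v) x) y)%:E).
 by apply: funext => y; rewrite !indicE mem_xsection.
apply: null_section (h _) _.
+ exact: measurable_xsection.
+ move=> y y'; apply: le_trans (ELip _ _) _.
 have -> : `|(x, y') - (x, y)| = `|y' - y| by rewrite norm_pair/= subrr normr0 max_r.
 by [].
move=> y dy; rewrite /xsection/= inE => /(_ _)/=; apply; apply: derivable_good.
rewrite vE /derivable; move: dy; rewrite /derivable/=.
set f := (fun h => _); set f' := (fun h => _) => dy.
suff -> : f' = f by [].
apply: funext => h'; rewrite /f /f' /=; congr (_ *: (E _ - _)).
by rewrite -[LHS]/(h' *: 0 + x, h' *: 1 + y) scaler0 add0r.
Qed.

End GoodSet.

(** * Green's formula for Lipschitz maps *)

Section Green.
Context {R : realType} {m : nat}.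
Local Notation mu := (@lebesgue_measure R).
Local Notation mu2 := (mu \x mu)%E.
Variables (U W : R * R -> 'rV[R]_m) (L : R).
Hypothesis L0 : 0 <= L.
Hypothesis ULip : forall p q, `|U q - U p| <= L * `|q - p|.
Hypothesis WLip : forall p q, `|W q - W p| <= L * `|q - p|.

(** The trapezoidal value on a segment of the integral of the sum of U_j dW_j; it changes sign with
    the orientation. *)
Definition edge (p q : R * R) : R := \sum_j (U p 0 j + U q 0 j) / 2 * (W q 0 j - W p 0 j).

Definition detq (h : R) (p : R * R) : R := \sum_j
 ((U (p + (h, 0)) 0 j - U p 0 j) * (W (p + (0, h)) 0 j - W p 0 j) -
 (U (p + (0, h)) 0 j - U p 0 j) * (W (p + (h, 0)) 0 j - W p 0 j)).

Definition tile (h : R) (p : R * R) : R :=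
 edge p (p + (h, 0)) + edge (p + (h, 0)) (p + (h, h)) -
 edge (p + (0, h)) (p + (h, h)) - edge p (p + (0, h)).

(** An exact identity, and the reason for the trapezoidal rule: the circulation around a square is
    the mean of the Jacobian increments at two opposite corners, taken with steps h and -h. *)
Lemma tileE h p : tile h p = (detq h p + detq (- h) (p + (h, h))) / 2.
have e1 : p + (h, h) + (- h, 0) = p + (0, h) by case: (p) => x y; congr pair; rewrite /= ?addr0 ?addrK.
have e2 : p + (h, h) + (0, - h) = p + (h, 0) by case: (p) => x y; congr pair; rewrite /= ?addr0 ?addrK.
rewrite /tile /detq e1 e2 /edge -!big_split/= -!sumrB mulr_suml.
by apply: eq_bigr => j _; field.
Qed.

Lemma coord_lip (V : R * R -> 'rV[R]_m) : (forall p q, `|V q - V p| <= L * `|q - p|) ->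
 forall p v j, `|V (p + v) 0 j - V p 0 j| <= L * `|v|.
move=> hV p v j; have := hV p (p + v); rewrite [p + v - p]addrC addKr; apply: le_trans.
by have := (norm_bnd (V (p + v) - V p) (normr_ge0 _)).1 (lexx _) j; rewrite !mxE.
Qed.

Lemma norm_h1 (h : R) : `|(h, 0) : R * R| = `|h|. by rewrite norm_pair/= normr0 max_l. Qed.
Lemma norm_h2 (h : R) : `|(0, h) : R * R| = `|h|. by rewrite norm_pair/= normr0 max_r. Qed.

Lemma detq_bound h p : `|detq h p| <= 2 * m%:R * L ^+ 2 * h ^+ 2.
apply: le_trans (ler_norm_sum _ _ _) _.
apply: le_trans (ler_sum _ (G := fun _ => 2 * L ^+ 2 * h ^+ 2) _) _; last first.
 have -> : 2 * m%:R * L ^+ 2 * h ^+ 2 = m%:R * (2 * L ^+ 2 * h ^+ 2) by ring.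
 by rewrite sumr_const card_ord -[leLHS]mulr_natl.
move=> j _; have u1 := coord_lip ULip p (h, 0) j; have u2 := coord_lip ULip p (0, h) j.
have w1 := coord_lip WLip p (h, 0) j; have w2 := coord_lip WLip p (0, h) j.
rewrite norm_h1 in u1 w1; rewrite norm_h2 in u2 w2.
have E : L * `|h| * (L * `|h|) = L ^+ 2 * h ^+ 2 by rewrite mulrACA -!expr2 -normrX ger0_norm// sqr_ge0.
apply: normB_le; rewrite !normrM.
apply: (@le_trans _ _ (L ^+ 2 * h ^+ 2 + L ^+ 2 * h ^+ 2)); last by rewrite -mulrA; lra.
by apply: lerD; rewrite -E; apply: ler_pM.
Qed.

Lemma coord_continuous2 (V : R * R -> 'rV[R]_m) (v : R * R) j : (forall p q, `|V q - V p| <= L * `|q - p|) ->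
 continuous (fun p : R * R => V (p + v) 0 j).
move=> hV p; apply: (@cvg_comp _ _ _ (fun p => V (p + v)) (fun x : 'rV[R]_m => x 0 j) _ (nbhs (V (p + v)))); last exact: coord_continuous.
apply: (@cvg_comp _ _ _ (fun p : R * R => p + v) V _ (nbhs (p + v))); last exact: lipschitz_continuous hV _.
by apply: (@cvgD R (R * R)%type); [exact: cvg_id|exact: cvg_cst].
Qed.

Lemma sum_continuous (F : 'I_m -> R * R -> R) : (forall j, continuous (F j)) ->
 continuous (fun p => \sum_j F j p).
move=> cF; have -> : (fun p => \sum_j F j p) = \sum_j F j by apply: funext => p; rewrite fct_sumE.
apply: (big_ind (fun f : R * R -> R => continuous f)) => [x|f f' cf cf' x|j _]; [exact: cvg_cst| |exact: cF].
by apply: cvgD; [exact: cf|exact: cf'].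
Qed.

Lemma detq_continuous h : continuous (detq h).
apply: sum_continuous => j p.
have c0 (V : R * R -> 'rV[R]_m) : (forall p q, `|V q - V p| <= L * `|q - p|) -> forall v,
 (V (q + v) 0 j - V q 0 j) @[q --> p] --> V (p + v) 0 j - V p 0 j.
 move=> hV v; apply: cvgB; first exact: coord_continuous2.
 apply: (@cvg_comp _ _ _ V (fun x : 'rV[R]_m => x 0 j) _ (nbhs (V p))); last exact: coord_continuous.
 exact: lipschitz_continuous hV _.
by apply: cvgB; apply: cvgM; apply: c0.
Qed.

Variables (J : R * R -> R) (Gd : set (R * R)).
Hypothesis mG : measurable Gd.
Hypothesis G0 : mu2 (~` Gd) = 0%E.
Hypothesis JP : forall p, Gd p -> (detq h p / h ^+ 2) @[h --> 0^'] --> J p.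
Let Sq (a : R) : set (R * R) := `[- a, a]%classic `*` `[- a, a]%classic.
Let mSq a : measurable (Sq a). exact: measurableX. Qed.
Let step (N : nat) : R := 4 / N.+1%:R.
Let step_gt0 N : 0 < step N. by rewrite divr_gt0. Qed.
Let step_cvg : step @ \oo --> 0.
rewrite -(mulr0 4); apply: cvgMr.
have := @cvg_harmonic R; apply: cvg_trans; apply: near_eq_cvg.
by near=> n.
Unshelve. all: by end_near.
Qed.
Let G (h : R) (p : R * R) : R := `|detq h p| / h ^+ 2 * \1_(Sq 3) p.
Let G_ge0 h p : 0 <= G h p.
by rewrite /G mulr_ge0 ?divr_ge0 ?sqr_ge0// indicE. Qed.
Let G_measurable h : measurable_fun setT (G h).
apply: measurable_funM; last exact: measurable_indic.
apply: continuous_measurable2 => p; apply: cvgMl; apply: cvg_norm; exact: detq_continuous.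
Qed.
Let lim_f (p : R * R) : R := `|J p| * \1_(Sq 3 `&` Gd) p.
Let cvg_G (s : R) : s = 1 \/ s = -1 -> forall p, Gd p -> (G (s * step n) p) @[n --> \oo] --> lim_f p.
move=> hs p Gp.
have E (n : nat) : G (s * step n) p = `|detq (s * step n) p / (s * step n) ^+ 2| * \1_(Sq 3 `&` Gd) p.
 rewrite /G normrM normfV [`|_ ^+ 2|]ger0_norm ?sqr_ge0// !indicE; congr (_ * (_ : bool)%:R).
 by rewrite in_setI [p \in Gd]mem_set// andbT.
under eq_fun do rewrite E; apply: cvgMl; apply: cvg_norm.
apply: (@cvg_comp _ _ _ (fun n => s * step n) (fun h => detq h p / h ^+ 2) _ 0^'); last exact: JP.
move=> A [d /= d0 hA]; have := step_cvg => /cvgrPdist_lt/(_ _ d0); apply: filterS => n.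
rewrite sub0r normrN => hn; apply: hA.
 suff : `|0 - s * step n| < d by []; rewrite sub0r normrN normrM.
 by case: hs => ->; rewrite ?normrN normr1 mul1r.
by case: hs => ->; rewrite ?mul1r ?mulN1r ?oppr_eq0 gt_eqF.
Qed.
Let f_measurable : measurable_fun setT (fun p => (lim_f p)%:E).
apply: (emeasurable_fun_cvg (fun n p => (G (1 * step n) p * \1_Gd p)%:E)).
 move=> n; apply/measurable_EFinP; apply: measurable_funM; [exact: G_measurable|exact: measurable_indic].
move=> p _; apply: cvg_EFin; first by near=> n.
suff h : (G (1 * step n) p * \1_Gd p) @[n --> \oo] --> lim_f p by exact: h.
have [Gp|nGp] := pselect (Gd p).
 have -> : (fun n => G (1 * step n) p * \1_Gd p) = (fun n => G (1 * step n) p).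
 by apply: funext => n; rewrite indicE mem_set// mulr1.
 by apply: cvg_G => //; left.
have z : \1_Gd p = 0 :> R by rewrite indicE memNset.
have -> : lim_f p = 0 by rewrite /lim_f indicE memNset ?mulr0// => -[].
under eq_fun do rewrite z mulr0; exact: cvg_cst.
Unshelve. all: by end_near.
Qed.
Let dct (s : R) : s = 1 \/ s = -1 ->
 (\int[mu2]_p (G (s * step n) p)%:E @[n --> \oo] --> \int[mu2]_p (lim_f p)%:E)%E.
move=> hs; pose B := 2 * m%:R * L ^+ 2.
have B0 : 0 <= B by rewrite !mulr_ge0 ?exprn_ge0.
have := @dominated_convergence _ _ _ mu2 setT measurableT
 (fun n p => (G (s * step n) p)%:E) (fun p => (lim_f p)%:E) (fun p => (B * \1_(Sq 3) p)%:E).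
case.
- by move=> n; apply/measurable_EFinP; exact: G_measurable.
- exact: f_measurable.
- exists (~` Gd); split; [exact: measurableC|exact: G0|].
 move=> p /= np Gp; apply: np => _; apply: cvg_EFin; [by near=> n|exact: (cvg_G hs Gp)].
- apply/integrableP; split.
 have mB : measurable_fun setT (fun p : R * R => B * \1_(Sq 3) p).
 apply: measurable_funM; first exact: measurable_cst.
 exact: (measurable_indic (mSq 3)).
 by apply/measurable_EFinP; exact: mB.
 have I0 p : 0 <= \1_(Sq 3) p :> R by rewrite indicE ler0n.
 have E p : `|(B * \1_(Sq 3) p)%:E|%E = (B * \1_(Sq 3) p)%:E.
 by rewrite abse_EFin ger0_norm// mulr_ge0.
 under eq_integral do rewrite E.
 by rewrite square_integral// ltry.
- apply: aeW => p n _.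
 rewrite abse_EFin lee_fin ger0_norm ?G_ge0// /G; apply: ler_wpM2r; first by rewrite indicE.
 rewrite ler_pdivrMr ?detq_bound// exprn_even_gt0//=.
 by case: hs => ->; rewrite ?mul1r ?mulN1r ?oppr_eq0 gt_eqF.
by move=> _ _.
Unshelve. all: by end_near.
Qed.

Definition node (s : R * R) (h : R) (i k : nat) : R * R := (s.1 - 2 + i%:R * h, s.2 - 2 + k%:R * h).
Lemma node_right s h i k : node s h i k + (h, 0) = node s h i.+1 k.
by congr pair; rewrite /= ?addr0// -[i.+1%:R]natr1 mulrDl mul1r addrA. Qed.
Lemma node_up s h i k : node s h i k + (0, h) = node s h i k.+1.
by congr pair; rewrite /= ?addr0// -[k.+1%:R]natr1 mulrDl mul1r addrA. Qed.
Lemma node_diag s h i k : node s h i k + (h, h) = node s h i.+1 k.+1.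
by congr pair; rewrite /= -?[i.+1%:R]natr1 -?[k.+1%:R]natr1 mulrDl mul1r addrA. Qed.

Lemma sum_tiles s h N : \sum_(i < N) \sum_(k < N) tile h (node s h i k) =
 \sum_(i < N) (edge (node s h i 0) (node s h i.+1 0) - edge (node s h i N) (node s h i.+1 N)) +
 \sum_(k < N) (edge (node s h N k) (node s h N k.+1) - edge (node s h 0 k) (node s h 0 k.+1)).
have E (i k : nat) : tile h (node s h i k) =
 (edge (node s h i k) (node s h i.+1 k) - edge (node s h i k.+1) (node s h i.+1 k.+1)) +
 (edge (node s h i.+1 k) (node s h i.+1 k.+1) - edge (node s h i k) (node s h i k.+1)).
 by rewrite /tile node_right node_up node_diag; ring.
have tel (F : nat -> R) : \sum_(k < N) (F k - F k.+1) = F 0%N - F N.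
 elim: N => [|M IH]; first by rewrite big_ord0 subrr.
 by rewrite big_ord_recr/= IH addrA subrK.
under eq_bigr do (under eq_bigr do rewrite E); under eq_bigr do rewrite big_split/=.
rewrite big_split/=; congr (_ + _).
 by apply: eq_bigr => i _; rewrite (tel (fun k => edge (node s h i k) (node s h i.+1 k))).
rewrite exchange_big/=; apply: eq_bigr => k _.
rewrite -[LHS]opprK -sumrN; under eq_bigr do rewrite opprB.
by rewrite (tel (fun i => edge (node s h i k) (node s h i k.+1))) opprB.
Qed.

Variables (kappa C : R).
(** The bound is uniform in the offset s of the grid, because the grid sums will be averaged over
    all offsets in one cell. *)
Hypothesis bdry : forall N s, step N <= 1 -> 0 <= s.1 < step N -> 0 <= s.2 < step N ->
 kappa - C * step N <= `|\sum_(i < N.+1) \sum_(k < N.+1) tile (step N) (node s (step N) i k)|.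
Let cell (h : R) : set (R * R) := `[0, h[%classic `*` `[0, h[%classic.
Let cellE (h : R) p : 0 < h -> \1_(cell h) p =
 ((0 <= p.1)%R%:R - (h <= p.1)%R%:R) * ((0 <= p.2)%R%:R - (h <= p.2)%R%:R) :> R.
move=> h0; rewrite indicE.
have -> : (p \in cell h) = (0 <= p.1 < h) && (0 <= p.2 < h).
 by apply/idP/idP; rewrite inE /cell/= !in_itv/= => /andP.
have b (x : R) : (0 <= x)%R%:R - (h <= x)%R%:R = (0 <= x < h)%R%:R :> R.
 have [hx|xh] := leP h x; first by rewrite (le_trans (ltW h0) hx) subrr.
 by case: (0 <= x); rewrite subr0.
by rewrite !b -natrM mulnb.
Qed.
(** Translates of a half-open cell by the nodes of the grid are disjoint and fill a square.
    Indicators are written as differences of step functions, so that the sum telescopes in each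
    variable. *)
Let sum_cells (h : R) N (p : R * R) : 0 < h ->
 \sum_(i < N) \sum_(k < N) (\1_(cell h) (p - (i%:R * h - 2, k%:R * h - 2)) : R) <=
 \1_(`[- 2, (N%:R * h - 2)]%classic `*` `[- 2, (N%:R * h - 2)]%classic) p.
move=> h0; pose F (x : R) (i : nat) : R := (i%:R * h <= x + 2)%R%:R.
have E (x : R) i : (0 <= x - (i%:R * h - 2))%R%:R - (h <= x - (i%:R * h - 2))%R%:R = F x i - F x i.+1.
 rewrite /F -[i.+1%:R]natr1 mulrDl mul1r; congr ((_ : bool)%:R - (_ : bool)%:R).
 by rewrite subr_ge0 lerBlDr.
 by rewrite -subr_ge0 -[RHS]subr_ge0; congr (0 <= _); ring.
under eq_bigr do (under eq_bigr do rewrite (cellE _ h0) /= !E).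
under eq_bigr do rewrite -mulr_sumr; rewrite -mulr_suml.
have tel x : \sum_(i < N) (F x i - F x i.+1) = F x 0%N - F x N.
 elim: N => [|M IH]; first by rewrite big_ord0 subrr.
 by rewrite big_ord_recr/= IH addrA subrK.
rewrite !tel.
have b (x : R) : F x 0%N - F x N = (0 <= x + 2 < N%:R * h)%R%:R.
 rewrite /F mul0r; have [hx|xh] := leP (N%:R * h) (x + 2).
 by rewrite (le_trans _ hx) ?subrr// mulr_ge0// ltW.
 by case: (0 <= x + 2); rewrite subr0.
rewrite !b -natrM mulnb indicE ler_nat; case: (boolP (_ && _)) => // /andP[/andP[a b'] /andP[a2 b2]].
by rewrite mem_set// /= !in_itv/=; split; lra2.
Qed.
Let cell_measure (h : R) : 0 < h -> mu2 (cell h) = (h ^+ 2)%:E.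
move=> h0; pose I : set R := `[0, h[%classic.
have mI : measurable I := measurable_itv _.
have -> : mu2 (cell h) = (mu I * mu I)%E by exact: (product_measure1E mu mu mI mI).
by rewrite /I lebesgue_measure_itv/= lte_fin h0 oppr0 adde0 -EFinM.
Qed.
Let tile_continuous h : continuous (tile h).
have -> : tile h = fun p => (detq h p + detq (- h) (p + (h, h))) / 2 by apply: funext => p; exact: tileE.
move=> p; apply: cvgMl; apply: cvgD; first exact: detq_continuous.
apply: (@cvg_comp _ _ _ (fun p : R * R => p + (h, h)) (detq (- h)) _ (nbhs (p + (h, h)))); last exact: detq_continuous.
by apply: (@cvgD R (R * R)%type); [exact: cvg_id|exact: cvg_cst].
Qed.
Let measurable_shift2 (v : R * R) : measurable_fun setT (fun p : R * R => p + v).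
apply: measurable_fun_pair.
- exact: measurableT_comp (shift_measurable v.1) (@measurable_fst _ _ _ _).
- exact: measurableT_comp (shift_measurable v.2) (@measurable_snd _ _ _ _).
Qed.
(** The Jacobian increments converge only almost everywhere, so the sum over a single grid cannot be
    controlled. Averaged over the offset, it becomes an integral over the plane, by translation
    invariance and because the shifted cells fill the square. *)
Let tiles_le N : step N <= 1 -> ((2 * (kappa - C * step N))%:E <=
 \int[mu2]_p (G (1 * step N) p)%:E + \int[mu2]_p (G (-1 * step N) p)%:E)%E.
move=> h1; set h := step N in h1 *; have h0 : 0 < h := step_gt0 N; have h20 : 0 < h ^+ 2 by rewrite exprn_gt0.
pose c (i k : nat) : R * R := (i%:R * h - 2, k%:R * h - 2).
have mF : measurable_fun setT (fun p : R * R => `|tile h p|).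
 by apply: continuous_measurable2 => p; apply: cvg_norm; exact: tile_continuous.
have mcell : measurable (cell h) by exact: measurableX.
have mc : measurable_fun setT (\1_(cell h) : R * R -> R) by exact: measurable_indic.
have s1 : (((kappa - C * h) * h ^+ 2)%:E <=
 \int[mu2]_s (\sum_(i < N.+1) \sum_(k < N.+1) \1_(cell h) s * `|tile h (s + c i k)|)%:E)%E.
 have [neg|pos] := leP (kappa - C * h) 0.
 apply: (@le_trans _ _ 0%E); first by rewrite lee_fin mulr_le0_ge0// ltW.
 apply: integral_ge0 => s _; rewrite lee_fin; apply: sumr_ge0 => i _; apply: sumr_ge0 => k _.
 by rewrite mulr_ge0// indicE.
 have -> : ((kappa - C * h) * h ^+ 2)%:E = (\int[mu2]_s ((kappa - C * h) * \1_(cell h) s)%:E)%E.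
 under eq_integral do rewrite EFinM.
 rewrite ge0_integralZl//.
 - rewrite integral_indic// setIT EFinM; congr (_ * _)%E; exact/esym/cell_measure.
 - by apply/measurable_EFinP.
 - by rewrite lee_fin ltW.
 apply: ge0_le_integral => //.
 - by move=> s _; rewrite lee_fin mulr_ge0 ?indicE// ltW.
 - by apply/measurable_EFinP; apply: measurable_funM.
 - apply/measurable_EFinP; apply: measurable_sum => i; apply: measurable_sum => k.
 by apply: measurable_funM => //; exact: measurableT_comp mF (measurable_shift2 _).
 move=> s _; rewrite lee_fin; under eq_bigr do rewrite -mulr_sumr; rewrite -mulr_sumr mulrC indicE.
 case: (boolP (s \in cell h)) => [|_]; last by rewrite !mul0r.
 rewrite inE /cell/= !in_itv/= => -[a1 a2]; rewrite !mul1r.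
 apply: le_trans (bdry (N := N) h1 a1 a2) _; apply: le_trans (ler_norm_sum _ _ _) _.
 apply: ler_sum => i _; apply: le_trans (ler_norm_sum _ _ _) _; apply: ler_sum => k _.
 have -> : node s (step N) i k = s + c i k.
 by case: (s) => x y; congr pair; rewrite /= -/h; ring.
 exact: lexx.
have s2 : (\int[mu2]_s (\sum_(i < N.+1) \sum_(k < N.+1) \1_(cell h) s * `|tile h (s + c i k)|)%:E =
 \int[mu2]_p (\sum_(i < N.+1) \sum_(k < N.+1) \1_(cell h) (p - c i k) * `|tile h p|)%:E)%E.
 have mt (i k : nat) : measurable_fun setT (fun s : R * R => (\1_(cell h) s * `|tile h (s + c i k)|)%:E).
 apply/measurable_EFinP; apply: measurable_funM => //.
 exact: measurableT_comp mF (measurable_shift2 _).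
 have mt' (i k : nat) : measurable_fun setT (fun p : R * R => (\1_(cell h) (p - c i k) * `|tile h p|)%:E).
 apply/measurable_EFinP; apply: measurable_funM => //.
 exact: measurableT_comp mc (measurable_shift2 _).
 have t0 (i k : nat) s : (0 <= (\1_(cell h) s * `|tile h (s + c i k)|)%:E)%E.
 by rewrite lee_fin mulr_ge0// indicE.
 have t'0 (i k : nat) s : (0 <= (\1_(cell h) (s - c i k) * `|tile h s|)%:E)%E.
 by rewrite lee_fin mulr_ge0// indicE.
 have sumE (f : nat -> nat -> R * R -> R) s : (\sum_(i < N.+1) \sum_(k < N.+1) f i k s)%:E =
 (\sum_(i < N.+1) \sum_(k < N.+1) (f i k s)%:E)%E.
 by rewrite -sumEFin; apply: eq_bigr => i _; rewrite -sumEFin.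
 under eq_integral do rewrite (sumE (fun i k s => \1_(cell h) s * `|tile h (s + c i k)|)).
 under [RHS]eq_integral do rewrite (sumE (fun i k s => \1_(cell h) (s - c i k) * `|tile h s|)).
 have out (f : nat -> nat -> R * R -> \bar R) : (forall i k, measurable_fun setT (f i k)) ->
 (forall i k s, 0 <= f i k s)%E ->
 (\int[mu2]_s (\sum_(i < N.+1) \sum_(k < N.+1) f i k s) =
 \sum_(i < N.+1) \sum_(k < N.+1) \int[mu2]_s (f i k s))%E.
 move=> mf f0; rewrite ge0_integral_sum.
 - by apply: eq_bigr => i _; rewrite ge0_integral_sum// => k; exact: mf.
 - exact: measurableT.
 - by move=> i; apply: emeasurable_sum => k; exact: mf.
 by move=> i s _; apply: sume_ge0 => k _; exact: f0.
 rewrite (out (fun i k s => (\1_(cell h) s * `|tile h (s + c i k)|)%:E))//.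
 rewrite (out (fun i k s => (\1_(cell h) (s - c i k) * `|tile h s|)%:E))//.
 apply: eq_bigr => i _; apply: eq_bigr => k _.
 rewrite -[LHS](integral_shift2 (- c i k))//.
 by apply: eq_integral => s _; rewrite subrK.
have hN : N.+1%:R * h = 4 by rewrite /h /step mulrC divfK.
have s3 : (\int[mu2]_p (\sum_(i < N.+1) \sum_(k < N.+1) \1_(cell h) (p - c i k) * `|tile h p|)%:E <=
 \int[mu2]_p (2^-1 * h ^+ 2 * G (1 * h) p + 2^-1 * h ^+ 2 * G (-1 * h) (p + (h, h)))%:E)%E.
 apply: ge0_le_integral => //.
 - move=> p _; rewrite lee_fin; apply: sumr_ge0 => i _; apply: sumr_ge0 => k _.
 by rewrite mulr_ge0// indicE.
 - apply/measurable_EFinP; apply: measurable_sum => i; apply: measurable_sum => k.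
 by apply: measurable_funM => //; exact: measurableT_comp mc (measurable_shift2 _).
 - apply/measurable_EFinP; apply: measurable_funD; apply: measurable_funM.
 + exact: measurable_cst.
 + exact: (G_measurable (1 * h)).
 + exact: measurable_cst.
 exact: (measurableT_comp (G_measurable (-1 * h)) (measurable_shift2 (h, h))).
 move=> p _; rewrite lee_fin; under eq_bigr do rewrite -mulr_suml; rewrite -mulr_suml.
 apply: le_trans (ler_wpM2r (normr_ge0 _) (sum_cells N.+1 p h0)) _; rewrite hN.
 have -> : 4 - 2 = 2 :> R by ring.
 rewrite indicE; case: (boolP (p \in _)) => [|_]; last first.
 by rewrite mul0r addr_ge0// mulr_ge0 ?G_ge0// mulr_ge0// ltW.
 rewrite inE /= !in_itv/= => -[/andP[p1 p1'] /andP[p2 p2']]; rewrite mul1r.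
 have hA : `|detq h p| = h ^+ 2 * G (1 * h) p.
 rewrite /G mul1r indicE mem_set; last by rewrite /Sq/= !in_itv/=; split; lra2.
 by rewrite mulr1 mulrC divfK ?gt_eqF.
 have hB : `|detq (- h) (p + (h, h))| = h ^+ 2 * G (-1 * h) (p + (h, h)).
 rewrite /G mulN1r indicE mem_set; last by rewrite /Sq/= !in_itv/=; split; lra2.
 by rewrite mulr1 sqrrN mulrC divfK ?gt_eqF.
 rewrite mul1r tileE normrM.
 have -> : `|2^-1| = 2^-1 :> R by rewrite ger0_norm ?invr_ge0.
 rewrite -!(mulrA 2^-1) -mulrDr mulrC; apply: ler_wpM2l; first by rewrite invr_ge0.
 by apply: normD_le; rewrite hA hB mul1r.
have mG1 (s : R) : measurable_fun setT (fun p : R * R => (G (s * h) p)%:E).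
 by apply/measurable_EFinP; exact: G_measurable.
have mG2 : measurable_fun setT (fun p : R * R => (G (-1 * h) (p + (h, h)))%:E).
 apply/measurable_EFinP; exact: (measurableT_comp (G_measurable (-1 * h)) (measurable_shift2 (h, h))).
have c0 : (0 <= (2^-1 * h ^+ 2)%:E)%E by rewrite lee_fin mulr_ge0 ?invr_ge0// ltW.
have s4 : (\int[mu2]_p (2^-1 * h ^+ 2 * G (1 * h) p + 2^-1 * h ^+ 2 * G (-1 * h) (p + (h, h)))%:E =
 (2^-1 * h ^+ 2)%:E * (\int[mu2]_p (G (1 * h) p)%:E + \int[mu2]_p (G (-1 * h) p)%:E))%E.
 have sG : (\int[mu2]_p (G (-1 * h) (p + (h, h)))%:E = \int[mu2]_p (G (-1 * h) p)%:E)%E.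
 by apply: (integral_shift2 (f := fun p => (G (-1 * h) p)%:E)) => // p; rewrite lee_fin G_ge0.
 have pG (s : R) (p : R * R) : (0 <= (G (s * h) p)%:E)%E by rewrite lee_fin G_ge0.
 rewrite -sG -(@ge0_integralD _ _ _ mu2 setT measurableT _ _ (fun p _ => pG 1 p) (mG1 1) (fun p _ => pG (-1) _) mG2).
 rewrite -(@ge0_integralZl _ _ _ mu2 setT measurableT _ (emeasurable_funD (mG1 1) mG2) _ (fun p _ => adde_ge0 (pG 1 p) (pG (-1) _)) c0).
 by apply: eq_integral => p _; rewrite -EFinD -EFinM mulrDr.
have := le_trans (le_trans s1 (eq_ind_r (fun z => (z <= _)%E) s3 s2)) (eq_ind_r (fun z => (z <= _)%E) (lexx _) s4).
have -> : ((kappa - C * h) * h ^+ 2)%:E = ((2^-1 * h ^+ 2)%:E * (2 * (kappa - C * h))%:E)%E.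
 by rewrite -EFinM; congr (_%:E); field.
by rewrite lee_pmul2l// lte_fin mulr_gt0// invr_gt0.
Qed.

(** As the mesh tends to 0, both integrals of [tiles_le] converge, by dominated convergence, to the
    integral on the right. This accounts for the factor 2 on the two sides. *)
Theorem green : (kappa%:E <= \int[mu2]_p (`|J p| * \1_(`[- 3, 3]%classic `*` `[- 3, 3]%classic `&` Gd) p)%:E)%E.
set I := integral _ _ _.
have I0 : (0 <= I)%E by apply: integral_ge0 => p _; rewrite lee_fin mulr_ge0// indicE.
have [->|/eqP If] := eqVneq I +oo%E; first exact: leey.
have If' : I \is a fin_num by rewrite ge0_fin_numE// ltey; apply/eqP.
have cI (s : R) : s = 1 \/ s = -1 -> (\int[mu2]_p (G (s * step n) p)%:E @[n --> \oo] --> I)%E.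
 exact: dct.
have c2 : ((\int[mu2]_p (G (1 * step n) p)%:E + \int[mu2]_p (G (-1 * step n) p)%:E)%E @[n --> \oo] --> (I + I)%E).
 apply: cvgeD; [by rewrite fin_num_adde_defl|by apply: cI; left|by apply: cI; right].
have c1 : (2 * (kappa - C * step n))%:E @[n --> \oo] --> (2 * (kappa - C * 0))%:E.
 apply: cvg_EFin; first by near=> n.
 suff h : 2 * (kappa - C * step n) @[n --> \oo] --> 2 * (kappa - C * 0) by exact: h.
 apply: cvgMr; apply: cvgB; [exact: cvg_cst|exact: cvgMr step_cvg].
have : (lim ((2 * (kappa - C * step n))%:E @[n --> \oo]) <=
 lim ((\int[mu2]_p (G (1 * step n) p)%:E + \int[mu2]_p (G (-1 * step n) p)%:E)%E @[n --> \oo]))%E.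
 apply: lee_lim; [by apply/cvg_ex; eexists; exact: c1|by apply/cvg_ex; eexists; exact: c2|].
 near=> n; apply: tiles_le; rewrite /step; have : `|0 - step n| < 1 by near: n; have /cvgrPdist_lt := step_cvg; exact.
 by rewrite sub0r normrN gtr0_norm// => /ltW.
rewrite (cvg_lim _ c1)// (cvg_lim _ c2)// mulr0 subr0 -(fineK If') -EFinD !lee_fin; lra.
Unshelve. all: by end_near.
Qed.

End Green.

(** * Extension of a filling disc to the plane *)

Section Retraction.
Context {R : realType}.
Local Notation mu := (@lebesgue_measure R).
Local Notation mu2 := (mu \x mu)%E.
Implicit Types p q : R * R.

(** The radial retraction onto the closed disc. It extends a filling to a Lipschitz map of the
    plane, so that a square grid larger than the disc sees the boundary loop along its sides. *)
Definition ret p : R * R := (Num.max 1 (euclid p))^-1 *: p.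

Lemma euclidZ (a : R) p : euclid (a *: p) = `|a| * euclid p.
rewrite /euclid; have -> : (a *: p).1 = a * p.1 by []; have -> : (a *: p).2 = a * p.2 by [].
by rewrite !exprMn -mulrDr sqrtrM ?sqr_ge0// sqrtr_sqr.
Qed.

Lemma norm_le_euclid p : `|p| <= euclid p.
rewrite norm_pair ge_max /euclid -!sqrtr_sqr; apply/andP; split; apply: ler_wsqrtr.
- by rewrite lerDl sqr_ge0.
- by rewrite lerDr sqr_ge0.
Qed.

Lemma ret_euclid p : euclid (ret p) <= 1.
have m0 : 0 < Num.max 1 (euclid p) by rewrite lt_max ltr01.
rewrite euclidZ ger0_norm ?invr_ge0 ?(ltW m0)// mulrC ler_pdivrMr// mul1r.
by rewrite le_max lexx orbT.
Qed.

Lemma ret_disc p : closed_disc (ret p).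
suff : (ret p).1 ^+ 2 + (ret p).2 ^+ 2 <= 1 by [].
by rewrite -euclid_sqr expr_le1 ?euclid_ge0// ret_euclid.
Qed.

Lemma ret_in p : euclid p <= 1 -> ret p = p.
by move=> h; rewrite /ret max_l// invr1 scale1r. Qed.
Lemma ret_out p : 1 <= euclid p -> ret p = (euclid p)^-1 *: p.
by move=> h; rewrite /ret max_r. Qed.

Lemma ret_scale (a : R) p : 0 < a -> 1 <= euclid p -> 1 <= euclid (a *: p) -> ret (a *: p) = ret p.
move=> a0 h1 h2; rewrite !ret_out// euclidZ gtr0_norm// scalerA invfM -mulrA mulrC -mulrA divff ?gt_eqF//.
by rewrite mulr1.
Qed.

Lemma ret_lip p q : `|ret q - ret p| <= 3 * `|q - p|.
rewrite /ret; set m := Num.max 1 (euclid p); set m' := Num.max 1 (euclid q).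
have m1 : 1 <= m by rewrite le_max lexx.
have m1' : 1 <= m' by rewrite le_max lexx.
have m0 : 0 < m by apply: lt_le_trans m1.
have m0' : 0 < m' by apply: lt_le_trans m1'.
have pm : `|p| <= m by rewrite le_max norm_le_euclid orbT.
have mm : `|m - m'| <= 2 * `|q - p|.
 have := euclid_dist p q; rewrite /m /m'; move: (euclid p) (euclid q) `|q - p| => x y d.
 by rewrite !ler_norml => /andP[? ?]; case: (leP 1 x); case: (leP 1 y) => *; lra2.
have -> : m'^-1 *: q - m^-1 *: p = m'^-1 *: (q - p) + ((m - m') / m') *: (m^-1 *: p).
 rewrite scalerA scalerBr -addrA -[in RHS]scaleNr -scalerDl; congr (_ + _).
 by rewrite -scaleNr; congr (_ *: _); field; rewrite !gt_eqF.
apply: normD_le; rewrite !normrZ.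
have i1 : `|m'^-1| <= 1 by rewrite ger0_norm ?invr_ge0 ?(ltW m0')// invf_le1.
have h1 : `|m'^-1| * `|q - p| <= `|q - p| by rewrite -[leRHS]mul1r ler_wpM2r.
have h2 : `|m^-1| * `|p| <= 1.
 by rewrite ger0_norm ?invr_ge0 ?(ltW m0)// mulrC ler_pdivrMr// mul1r.
have h3 : `|(m - m') / m'| <= 2 * `|q - p|.
 by rewrite normrM -[leRHS]mulr1; apply: ler_pM.
have h4 : `|(m - m') / m'| * (`|m^-1| * `|p|) <= 2 * `|q - p|.
 by rewrite -[leRHS]mulr1; apply: ler_pM => //; rewrite mulr_ge0.
rewrite normrM in h4; have -> : 3 * `|q - p| = `|q - p| + 2 * `|q - p| by ring.
exact: lerD.
Qed.

Lemma circle_lip (x y : R) : `|(cos y, sin y) - (cos x, sin x) : R * R| <= `|y - x|.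
wlog xy : x y / x <= y.
 by move=> h; case: (leP x y) => [/h//|/ltW/h]; rewrite distrC [leRHS]distrC.
rewrite norm_pair/= ge_max; apply/andP; split.
- have [|z _ ->] := @MVT_segment R cos (- sin) x y xy.
 by apply: continuous_subspaceT => t; exact: continuous_cos.
 by rewrite normrM -[leRHS]mul1r ler_wpM2r// normrN ler_norml sin_geN1 sin_le1.
- have [|z _ ->] := @MVT_segment R sin cos x y xy.
 by apply: continuous_subspaceT => t; exact: continuous_sin.
 by rewrite normrM -[leRHS]mul1r ler_wpM2r// ler_norml cos_geN1 cos_le1.
Qed.

Lemma euclid_continuous : continuous (euclid : R * R -> R).
move=> p; apply/cvgrPdist_le => e e0; near=> q.
rewrite distrC; apply: le_trans (euclid_dist p q) _.
rewrite -ler_pdivlMl// mulrC distrC; near: q; apply: cvgr_dist_le; [exact: cvg_id|exact: divr_gt0].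
Unshelve. all: by end_near.
Qed.

Definition circle : set (R * R) := [set p | euclid p = 1].

Lemma circle_measurable : measurable circle.
apply: closed_measurable2; have -> : circle = euclid @^-1` [set 1] by [].
by apply: preimage_closed => [p _|]; [exact: euclid_continuous|exact: closed_eq].
Qed.

Lemma circle_null : mu2 circle = 0%E.
have -> : mu2 circle = (\int[mu2]_p (\1_circle p)%:E)%E.
 by rewrite integral_indic ?setIT//; exact: circle_measurable.
have m1 : measurable_fun setT (fun p : R * R => (\1_circle p)%:E : \bar R).
 by apply/measurable_EFinP; apply: measurable_indic; exact: circle_measurable.
have i0 (p : R * R) : (0 <= (\1_circle p)%:E :> \bar R)%E by rewrite lee_fin indicE.
rewrite fubini_tonelli1//.
apply: integral0_eq => x _; rewrite /fubini_F.
have -> : (fun y => (\1_circle (x, y))%:E : \bar R) = (fun y => (\1_(xsection circle x) y)%:E).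
 by apply: funext => y; rewrite !indicE mem_xsection.
have mx : measurable (xsection circle x) by apply: measurable_xsection; exact: circle_measurable.
rewrite integral_indic// setIT; apply: countable_lebesgue_measure0.
apply: (@sub_countable _ _ _ [set Num.sqrt (1 - x ^+ 2); - Num.sqrt (1 - x ^+ 2)]); last first.
 exact/finite_set_countable/finite_set2.
apply: subset_card_le => y; rewrite /xsection/= inE /circle/= => /(congr1 (fun z => z ^+ 2)).
rewrite euclid_sqr expr1n /= => h.
have -> : 1 - x ^+ 2 = y ^+ 2 by lra.
by rewrite sqrtr_sqr; case: (ger0P y) => _; [left|right; rewrite opprK].
Qed.

End Retraction.

Section LineDerivatives.
Context {R : realType}.

Lemma is_derive_affine (V W : normedModType R) (E : V -> W) (f : R -> W) (p v : V) (t : R) d :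
 (forall h, f (h + t) = E (h *: v + p)) -> is_derive p v E d -> is_derive t 1 f d.
move=> fE [dE Ed].
have q : (fun h => h^-1 *: ((f \o shift t) (h *: 1) - f t)) =
 (fun h => h^-1 *: ((E \o shift p) (h *: v) - E p)).
 apply: funext => h; congr (_ *: (_ - _)); first by rewrite /= -fE [h *: 1]mulr1.
 by have := fE 0; rewrite add0r scale0r add0r.
by apply: DeriveDef; [rewrite /derivable q|rewrite /derive q].
Qed.

Lemma is_derive_quot (V : normedModType R) (f : V -> R) (p v : V) d :
 is_derive p v f d -> (f (p + h *: v) - f p) / h @[h --> 0^'] --> d.
move=> [df <-]; have : (fun h => h^-1 *: ((f \o shift p) (h *: v) - f p)) @ (0 : R)^' --> 'D_v f p := df.
suff -> : (fun h => h^-1 *: ((f \o shift p) (h *: v) - f p)) = (fun h => (f (p + h *: v) - f p) / h) by [].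
by apply: funext => h; rewrite /= [h *: v + p]addrC [LHS]mulrC.
Qed.

Lemma cvg_bigsum (T : Type) (F : set_system T) (FF : Filter F) m (f : 'I_m -> T -> R) l :
 (forall j, f j x @[x --> F] --> l j) -> \sum_j f j x @[x --> F] --> \sum_j l j.
move=> h; have -> : (fun x => \sum_j f j x) = \sum_j f j by apply: funext => x; rewrite fct_sumE.
apply: (big_ind2 (fun (u : T -> R) (v : R) => u @ F --> v)) => [|u u' v v' hu hv|j _].
- exact: cvg_cst.
- exact: cvgD.
exact: h.
Qed.

End LineDerivatives.

(** * The invariant 2-form and its comparison with area *)

Section GramMinor.
Context {R : realType} {r : nat} {e : bool}.
Local Notation row := 'rV[R]_(3 + r).
Local Notation Q := (filiprod R r e).
Variable g : leftinv_metric (filiLieG R r e).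
Local Notation B := (bform (li_form g)).

Definition minor (k : 'I_r) (u v : row) : R := cA (u : Q) * cP (v : Q) 0 k - cA (v : Q) * cP (u : Q) 0 k.

Lemma bformC (u v : row) : B u v = B v u.
have [Qs _] := li_posdef g.
have -> : B u v = (v *m li_form g *m u^T)^T 0 0 by rewrite !trmx_mul trmxK Qs mulmxA.
by rewrite mxE.
Qed.

Lemma bform_combC (u v : row) (t : R) :
 B (v - t *: u) (v - t *: u) = B v v - 2 * t * B v u + t ^+ 2 * B u u.
have -> : B (v - t *: u) (v - t *: u) = B v v - t * B v u - t * B u v + t * (t * B u u).
 have hl (a b w : row) : B (a - t *: b) w = B a w - t * B b w.
 by rewrite /bform !mulmxBl -!scalemxAl mxE; congr (_ + _); rewrite !mxE.
 have hr (a b w : row) : B w (a - t *: b) = B w a - t * B w b.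
 by rewrite /bform linearB linearZ/= mulmxBr -scalemxAr mxE; congr (_ + _); rewrite !mxE.
 by rewrite !hl !hr; ring.
by rewrite [B u v]bformC; ring.
Qed.

(** Subtracting from v its projection on u changes neither the minor nor the Gram determinant. For
    orthogonal vectors the determinant is the product of the squared lengths, while the minor is at
    most 2 |u| |w|. *)
Lemma gram_minor (k1 : R) (k : 'I_r) (u v : row) : 0 < k1 -> (forall w, k1 * `|w| <= bn g w) ->
 k1 ^+ 2 / 2 * `|minor k u v| <= Num.sqrt (B u u * B v v - B u v ^+ 2).
move=> k10 hk.
have cAn (w : row) : `|cA (w : Q)| <= `|w| by apply: (norm_bnd w (normr_ge0 _)).1.
have cPn (w : row) : `|cP (w : Q) 0 k| <= `|w|.
 by rewrite mxE; apply: (norm_bnd w (normr_ge0 _)).1.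
have [u0|u0] := eqVneq u 0.
 have -> : minor k u v = 0 by rewrite u0 /minor /cA /cP !mxE !(mul0r, mulr0) subrr.
 by rewrite normr0 mulr0 sqrtr_ge0.
have Bu : 0 < B u u by have [_ /(_ u u0)] := li_posdef g.
pose t := B v u / B u u; pose w := v - t *: u.
have E : B u u * B v v - B u v ^+ 2 = B u u * B w w.
 by rewrite bform_combC [B u v]bformC /t; field; rewrite gt_eqF.
have mE : minor k u v = minor k u w.
 by rewrite /minor /w /cA /cP !mxE; ring.
rewrite E sqrtrM ?bform_ge0// -/(bn g u) -/(bn g w) mE.
have h1 : `|minor k u w| <= 2 * (`|u| * `|w|).
 apply: normB_le; rewrite !normrM.
 have a1 : `|cA (u : Q)| * `|cP (w : Q) 0 k| <= `|u| * `|w| by apply: ler_pM.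
 have a2 : `|cA (w : Q)| * `|cP (u : Q) 0 k| <= `|u| * `|w| by rewrite mulrC; apply: ler_pM.
 by rewrite mulr_natl mulr2n; apply: lerD.
apply: (@le_trans _ _ (k1 ^+ 2 / 2 * (2 * (`|u| * `|w|)))).
 by apply: ler_wpM2l => //; rewrite divr_ge0// sqr_ge0.
have -> : k1 ^+ 2 / 2 * (2 * (`|u| * `|w|)) = (k1 * `|u|) * (k1 * `|w|) by field.
by apply: ler_pM; rewrite ?mulr_ge0// ltW.
Qed.

End GramMinor.

Section DiscExtension.
Context {R : realType} {r : nat}.
Local Notation Q := (filiprod R r false).
Local Notation row := 'rV[R]_(3 + r).
Variable g : leftinv_metric (filiLieG R r false).
Local Notation dist := (@riem_dist R (3 + r) (filiLieG R r false) g).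
Variable lam : R.

(* The primitive of the invariant 2-form: its restriction to segments along
 the generators is exact. *)
Definition coef (j : 'I_r) (a : R) : R := lam * (- 'C(r, j)%:R * (- a) ^+ (r - j)).

Lemma coef_lip (B : R) : 0 <= B -> exists2 L : R, 0 <= L & forall (j : 'I_r) (a a' : R),
 `|a| <= B -> `|a'| <= B -> `|coef j a' - coef j a| <= L * `|a' - a|.
move=> B0; have B1 : 1 <= 1 + B by rewrite lerDl.
exists (`|lam| * (2 ^+ r * (r%:R * (1 + B) ^+ r))).
 by rewrite !mulr_ge0// exprn_ge0// addr_ge0.
move=> j a a' ha ha'.
have -> : coef j a' - coef j a = lam * (- 'C(r, j)%:R * ((- a') ^+ (r - j) - (- a) ^+ (r - j))).
 by rewrite /coef; ring.
rewrite !normrM normrN -!mulrA; apply: ler_wpM2l => //; apply: ler_pM => //.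
 by rewrite normr_nat -natrX ler_nat bin_leq_exp2.
have h (x : R) : `|x| <= B -> `|- x| <= 1 + B by rewrite normrN; lra.
apply: le_trans (normr_subXX _ (h _ ha') (h _ ha)) _.
have -> : - a' - - a = - (a' - a) by ring.
rewrite normrN -!mulrA [_ * (1 + B) ^+ _]mulrC; apply: ler_pM => //.
- by rewrite mulr_ge0// exprn_ge0// addr_ge0.
- by rewrite ler_nat leq_subr.
by apply: ler_wpM2r => //; apply: ler_weXn2l => //; rewrite -ltnS; apply: leq_ltn_trans (leq_pred _) _; rewrite ltnS leq_subr.
Qed.

Variable phi : R * R -> Q.
Hypothesis hphi : lipschitz_disc g (phi : R * R -> filiLieG R r false).

Definition ext (p : R * R) : row := phi (ret p).

Lemma ext_ret p : ext (ret p) = ext p.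
by rewrite /ext (ret_in (ret_euclid p)). Qed.
Let ret_norm (p : R * R) : `|ret p| <= 1.
exact: le_trans (norm_le_euclid _) (ret_euclid _). Qed.

(** The disc is Lipschitz for the Riemannian distance. Its image is bounded, hence lies in a set
    where quotients and differences of coordinates are comparable. *)
Lemma ext_lip : exists2 L : R, 0 <= L & forall p q, `|ext q - ext p| <= L * `|q - p|.
have [K hK] := hphi.
have hd p q : dist (phi (ret p)) (phi (ret q)) <= `|K| * `|ret p - ret q|.
 apply: le_trans (hK _ _ (ret_disc p) (ret_disc q)) _.
 by apply: ler_wpM2r => //; exact: ler_norm.
have L0 : 0 <= `|K| * 2 by rewrite mulr_ge0.
have hd2 p q : dist (phi (ret p)) (phi (ret q)) <= `|K| * 2.
 apply: le_trans (hd p q) _; apply: ler_wpM2l => //; apply: normB_le.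
 by rewrite -[2]/(1 + 1); apply: lerD.
have [C C0 hC] := dist_local g L0.
have step p q : `|((ext p : Q)^-1 * ext q)%g : row| <= C * (`|K| * `|ret p - ret q|).
 by apply: le_trans (hC _ _ (hd2 p q)) _; apply: ler_wpM2l => //; exact: hd.
pose M := Num.max `|ext 0| (C * (`|K| * 2)).
have M0 : 0 <= M by rewrite le_max normr_ge0.
have bM q : bnd (bmul (r := r) M) (ext q : Q).
 have -> : ext q = ((ext 0 : Q) * ((ext 0 : Q)^-1 * ext q))%g by rewrite mulVKg.
 apply: bnd_mul; apply/norm_bnd => //; first by rewrite /M le_max lexx.
 rewrite /M le_max; apply/orP; right; apply: le_trans (hC _ _ (hd2 0 q)) _.
 by apply: ler_wpM2l => //; exact: hd2.
set B := bmul M in bM; have B0 : 0 <= B := bnd_ge0 (bM 0).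
have A0 : 0 <= 1 + pbd (r := r) B + B by rewrite addr_ge0// addr_ge0// pbd_ge0.
exists ((1 + pbd (r := r) B + B) * (C * (`|K| * 3))); first by rewrite !mulr_ge0.
move=> p q; have -> : ext q - ext p = ((ext p : Q)^-1 * ext q)%g *m actx (e := false) (ext p : Q) :> row.
 by rewrite divE -mulmxA actxV_actx mulmx1.
have [xA xU _ _] := (bndP _ _).1 (bM p).
apply: le_trans (norm_actx _ B0 xA xU) _; rewrite -[leRHS]mulrA; apply: ler_wpM2l => //.
apply: le_trans (step p q) _; rewrite -!mulrA; apply: ler_wpM2l => //; apply: ler_wpM2l => //.
by rewrite distrC; exact: ret_lip.
Qed.

Lemma ext_bounded : exists2 B : R, 0 <= B & forall p, `|ext p| <= B.
have [L L0 hL] := ext_lip; exists (`|ext 0| + L); first by rewrite addr_ge0.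
move=> p; have -> : ext p = ext 0 + (ext (ret p) - ext 0) by rewrite ext_ret addrC subrK.
apply: normD_le; apply: lerD => //; apply: le_trans (hL _ _) _.
by rewrite subr0 -[leRHS]mulr1; apply: ler_wpM2l.
Qed.

Definition extU (p : R * R) : 'rV[R]_r := \row_j coef j (cA (ext p : Q)).
Definition extW (p : R * R) : 'rV[R]_r := cP (ext p : Q).
Lemma cA_norm (x : row) : `|cA (x : Q)| <= `|x|.
exact: (norm_bnd x (normr_ge0 _)).1. Qed.
Lemma cP_norm (x : row) : `|cP (x : Q)| <= `|x|.
by apply/norm_bnd => // i; rewrite mxE; exact: (norm_bnd x (normr_ge0 _)).1. Qed.

Lemma extUW_lip : exists2 L : R, 0 <= L & (forall p q, `|extU q - extU p| <= L * `|q - p|) /\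
 (forall p q, `|extW q - extW p| <= L * `|q - p|).
have [L L0 hL] := ext_lip; have [B B0 hB] := ext_bounded; have [K K0 hK] := coef_lip B0.
have sA (x y : row) : cA (x : Q) - cA (y : Q) = cA (x - y : Q) by rewrite /cA !mxE.
exists ((K + 1) * L); first by rewrite mulr_ge0// addr_ge0.
split=> p q.
 apply/norm_bnd => [|j]; first by rewrite !mulr_ge0// addr_ge0.
 rewrite !mxE; apply: le_trans (hK j _ _ (le_trans (cA_norm _) (hB p)) (le_trans (cA_norm _) (hB q))) _.
 rewrite sA -[leRHS]mulrA; apply: ler_pM => //; first by rewrite lerDl.
 exact: le_trans (cA_norm _) (hL p q).
rewrite /extW -linearB/=; apply: le_trans (cP_norm _) _; apply: le_trans (hL p q) _.
by apply: ler_wpM2r => //; rewrite -[leLHS]mul1r; apply: ler_wpM2r => //; rewrite lerDr.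
Qed.

Definition extV (v p : R * R) : row := 'D_v ext p *m actxV (e := false) (ext p : Q).
Definition extJ (k : 'I_r) (p : R * R) : R :=
 lam * r%:R * minor (e := false) k (extV (1, 0) p) (extV (0, 1) p).

Lemma extU_derive v p j d : is_derive p v ext d -> is_derive p v (fun q => extU q 0 j)
 (lam * ('C(r, j)%:R * ((r - j)%:R * (- cA (ext p : Q)) ^+ (r - j).-1)) * cA (d : Q)).
move=> hd; have ha : is_derive p v (fun q => - cA (ext q : Q)) (- cA (d : Q)).
 by apply: is_deriveN; exact: (is_derive_coord (lshift r 0) hd).
have hX := is_deriveX (r - j) ha.
have := is_deriveZ (lam * - 'C(r, j)%:R) hX.
set f := _ \*: _; set df := _ *: _.
have -> : f = fun q => extU q 0 j.
 by apply: funext => q; rewrite /f mxE /coef mulrA; congr (_ * _); rewrite exprfctE.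
suff -> : df = lam * ('C(r, j)%:R * ((r - j)%:R * (- cA (ext p : Q)) ^+ (r - j).-1)) * cA (d : Q) by [].
by rewrite /df -[LHS]/(_ * (_ * _)); ring.
Qed.

(** The limit is the Jacobian of the sum of coef_j(a) dp_j, that is, the sum of coef_j'(a) da dp_j.
    The identity (r - j) C(r, j) = r C(r - 1, j) turns the derivatives of the coefficients into the
    last column of the left translation, so the form is lam r times the invariant form da
    dp_(r-1). *)
Lemma extJ_limit (k : 'I_r) p : k = r.-1 :> nat -> derivable ext p (1, 0) -> derivable ext p (0, 1) ->
 (detq extU extW h p / h ^+ 2) @[h --> 0^'] --> extJ k p.
move=> kr d1 d2; pose e1 := 'D_(1, 0) ext p; pose e2 := 'D_(0, 1) ext p.
have i1 : is_derive p (1, 0) ext e1 by apply: DeriveDef.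
have i2 : is_derive p (0, 1) ext e2 by apply: DeriveDef.
pose c (j : 'I_r) := lam * ('C(r, j)%:R * ((r - j)%:R * (- cA (ext p : Q)) ^+ (r - j).-1)).
have w (v : R * R) d j : is_derive p v ext d -> is_derive p v (fun q => extW q 0 j) (cP (d : Q) 0 j).
 move=> h; rewrite mxE; have -> : (fun q => extW q 0 j) = (fun q => ext q 0 (rshift 3 j)).
 by apply: funext => q; rewrite mxE.
 exact: is_derive_coord.
have JE : extJ k p = \sum_j (c j * cA (e1 : Q) * cP (e2 : Q) 0 j - c j * cA (e2 : Q) * cP (e1 : Q) 0 j).
 have cPk (d : row) : cP (d *m actxV (e := false) (ext p : Q) : Q) 0 k =
 \sum_j cP (d : Q) 0 j * ('C(k, j)%:R * (- cA (ext p : Q)) ^+ (k - j)).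
 rewrite /actxV cP_act mxE lsub_heis !mul0r if_same add0r mxE; apply: eq_bigr => j _.
 by rewrite [pascal _ _ _ _]mxE.
 have cc j : c j = lam * r%:R * ('C(k, j)%:R * (- cA (ext p : Q)) ^+ (k - j)).
 rewrite /c kr; have := mul_bin_down r j; move/(congr1 (fun n => n%:R : R)).
 rewrite !natrM => h; have -> : (r - j).-1 = (r.-1 - j)%N by have := ltn_ord j; lia.
 by rewrite !mulrA -[lam * _ * (r - j)%:R]mulrA [_ * (r - j)%:R]mulrC -h !mulrA.
 have key (f1 f2 : row) : lam * r%:R * minor (e := false) k (f1 *m actxV (e := false) (ext p : Q))
 (f2 *m actxV (e := false) (ext p : Q)) =
 \sum_j (c j * cA (f1 : Q) * cP (f2 : Q) 0 j - c j * cA (f2 : Q) * cP (f1 : Q) 0 j).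
 rewrite /minor (cPk f1) (cPk f2) /actxV !cA_act !mulr_sumr -sumrB mulr_sumr.
 by apply: eq_bigr => j _; rewrite cc; ring.
 exact: key.
rewrite JE; have sE : (fun h => detq extU extW h p / h ^+ 2) = (fun h => \sum_j
 ((extU (p + h *: (1, 0)) 0 j - extU p 0 j) / h * ((extW (p + h *: (0, 1)) 0 j - extW p 0 j) / h) -
 (extU (p + h *: (0, 1)) 0 j - extU p 0 j) / h * ((extW (p + h *: (1, 0)) 0 j - extW p 0 j) / h))).
 apply: funext => h; rewrite /detq mulr_suml; apply: eq_bigr => j _.
 have -> : h *: (1, 0) = (h, 0) :> R * R by rewrite -[LHS]/(h * 1, h * 0) mulr1 mulr0.
 have -> : h *: (0, 1) = (0, h) :> R * R by rewrite -[LHS]/(h * 0, h * 1) mulr1 mulr0.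
 by rewrite expr2 invfM; ring.
rewrite sE; apply: cvg_bigsum => j; apply: cvgB; apply: cvgM.
- exact: is_derive_quot (extU_derive j i1).
- exact: is_derive_quot (w _ _ j i2).
- exact: is_derive_quot (extU_derive j i2).
- exact: is_derive_quot (w _ _ j i1).
Qed.

Lemma ext_density (k1 : R) (k : 'I_r) p : 0 < k1 -> (forall w, k1 * `|w| <= bn g w) ->
 lam * r%:R = k1 ^+ 2 / 2 -> euclid p < 1 -> derivable ext p (1, 0) -> derivable ext p (0, 1) ->
 `|extJ k p| <= area_density g (phi : R * R -> filiLieG R r false) p.
move=> k10 hk lr p1 d1 d2.
have E v : derivable ext p v -> 'D_v (translate g (phi : R * R -> filiLieG R r false) p) p = extV v p.
 move=> dv; have i : is_derive p v (phi : R * R -> row) ('D_v ext p).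
 have near : \near p, ext p = phi p.
 near=> q; rewrite /ext ret_in//; apply: ltW; near: q.
 exact: (cvgr_lt _ (euclid_continuous (x := p)) _ p1).
 by apply: near_eq_is_derive near _; apply: DeriveDef.
 have [_ ->] := translate_derive g i.
 by rewrite /extV /ext ret_in ?ltW.
rewrite /area_density (E _ d1) (E _ d2) /extJ normrM lr.
have -> : `|k1 ^+ 2 / 2| = k1 ^+ 2 / 2 by rewrite ger0_norm// divr_ge0// sqr_ge0.
exact: (gram_minor k (extV (1, 0) p) (extV (0, 1) p) k10 hk).
Unshelve. all: by end_near.
Qed.

(** Outside the disc the extension is constant along rays, so its two partial derivatives are
    proportional, or the first one vanishes on the axis y = 0. *)
Lemma extJ_out (k : 'I_r) p : 1 < euclid p -> derivable ext p (1, 0) -> derivable ext p (0, 1) ->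
 extJ k p = 0.
case: p => x y p1 d1 d2; pose e1 := 'D_(1, 0) ext (x, y); pose e2 := 'D_(0, 1) ext (x, y).
have i1 : is_derive (x, y) (1, 0) ext e1 by apply: DeriveDef.
have i2 : is_derive (x, y) (0, 1) ext e2 by apply: DeriveDef.
pose c (u : R) : row := ext (u, y).
have ic : is_derive x 1 c e1.
 apply: (is_derive_affine _ i1) => h; rewrite /c; congr (ext _).
 by rewrite -[RHS]/(h * 1 + x, h * 0 + y) mulr1 mulr0 add0r.
have euc (f : R -> R * R) (t : R) : {for t, continuous f} -> 1 < euclid (f t) -> \near t, 1 <= euclid (f t).
 move=> cf h; near=> s; apply: ltW; near: s.
 apply: (cvgr_gt (euclid (f t))) => //.
 by apply: (@cvg_comp _ _ _ f (euclid : R * R -> R) _ (nbhs (f t))); [exact: cf|exact: euclid_continuous].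
have pairC (f1 f2 : R -> R) (t : R) : f1 s @[s --> t] --> f1 t -> f2 s @[s --> t] --> f2 t ->
 {for t, continuous (fun s => (f1 s, f2 s))}.
 move=> h1 h2; exact: (cvg_pair (F := nbhs t) (G := nbhs (f1 t)) (H := nbhs (f2 t)) h1 h2).
suff [a ea] : exists a : R, e1 = 0 \/ e2 = a *: e1.
 rewrite /extJ /extV -/e1 -/e2; case: ea => ->; rewrite /minor ?mul0mx -?scalemxAl /cA /cP !mxE; ring.
have [y0|y0] := eqVneq y 0.
 exists 0; left; have x0 : x != 0.
 by apply: contraTneq p1 => x0; rewrite /euclid x0 y0/= !expr0n/= addr0 sqrtr0 ltr10.
 have near : \forall u \near x, cst (c x) u = c u.
 near=> u; have ux : 0 < u / x.
 near: u; apply: (cvgr_gt (x / x)); last by rewrite divff.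
 by apply: cvgMl; exact: cvg_id.
 have u1 : 1 <= euclid (u, y).
 near: u; apply: (euc (fun u => (u, y))) => //.
 by apply: (pairC id (fun=> y)); [exact: cvg_id|exact: cvg_cst].
 rewrite /cst /c /ext.
 have <- : (u / x) *: (x, y) = (u, y) by rewrite -[LHS]/(u / x * x, u / x * y) divfK// y0 mulr0.
 rewrite ret_scale// ?(ltW p1)//; by have -> : (u / x) *: (x, y) = (u, y) by rewrite -[LHS]/(u / x * x, u / x * y) divfK// y0 mulr0.
 have [_ <-] := ic; have [_ ->] := near_eq_is_derive near (is_derive_cst (c x) x 1).
 by [].
exists (- (x / y)); right.
(* The abscissa for which (a t, y) lies on the ray through (x, y + t). *)
pose a (t : R) : R := x * (y * (y + t)^-1).
have a0 : a 0 = x by rewrite /a addr0 divff// mulr1.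
have ia : is_derive (0 : R) 1 a (- (x / y)).
 have hy : is_derive (0 : R) 1 (fun t => y + t) (1 : R).
 by rewrite -[X in is_derive _ _ _ X]add0r; apply: is_deriveD.
 have := is_deriveV (f := fun t : R => y + t) _ hy; rewrite addr0 => /(_ y0) hV.
 have := is_deriveZ (x * y) hV.
 set f := _ \*: _; set df := _ *: _.
 have -> : f = a by apply: funext => t; rewrite /a mulrA.
 suff -> : df = - (x / y) by [].
 by rewrite /df -[LHS]/((x * y) * (- y ^- 2 * 1)); field.
have ir : is_derive (0 : R) 1 (fun t => c (a t)) (- (x / y) *: e1).
 have ic' : is_derive (a 0) 1 c e1 by rewrite a0.
 exact: (is_derive_row_comp ic' ia).
have iy : is_derive (0 : R) 1 (fun t => ext (x, y + t)) e2.
 apply: (is_derive_affine _ i2) => h; congr (ext _).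
 by rewrite -[RHS]/(h * 0 + x, h * 1 + y) mulr1 mulr0 add0r addr0 addrC.
have near : \forall t \near (0 : R), c (a t) = ext (x, y + t).
 have cy : y + t @[t --> (0 : R)] --> y.
 by rewrite -[X in _ --> X]addr0; apply: cvgD; [exact: cvg_cst|exact: cvg_id].
 have ca : y * (y + t)^-1 @[t --> (0 : R)] --> (1 : R).
 by rewrite -(divff y0); apply: cvgMr; apply: cvgV.
 near=> t.
 have l0 : 0 < y * (y + t)^-1 by near: t; exact: (cvgr_gt 1).
 have q1 : 1 <= euclid (x, y + t).
 near: t; apply: (euc (fun t => (x, y + t))); last by rewrite addr0.
 by apply: (pairC (fun=> x) (fun t => y + t)); [exact: cvg_cst|rewrite addr0].
 have q2 : 1 <= euclid (a t, y).
 near: t; apply: (euc (fun t => (a t, y))); last by rewrite a0.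
 apply: (pairC a (fun=> y)); last exact: cvg_cst.
 by rewrite a0 -[X in _ --> X]mulr1; apply: cvgMr.
 have yt : y + t != 0 by apply: contraTneq l0 => ->; rewrite invr0 mulr0 ltxx.
 have lE : (y * (y + t)^-1) *: (x, y + t) = (a t, y).
 rewrite -[LHS]/(y * (y + t)^-1 * x, y * (y + t)^-1 * (y + t)).
 by rewrite mulrC -(mulrA y) mulVf ?mulr1.
 by rewrite /c /ext -lE ret_scale// lE.
by have [_ <-] := iy; have [_ ->] := near_eq_is_derive near ir.
Unshelve. all: by end_near.
Qed.

End DiscExtension.

Section Segments.
Context {R : realType}.

Lemma segment_ind (Pr : R -> R -> Prop) (M : nat) : (0 < M)%N ->
 (forall (i : nat) x y, (i < M)%N -> i%:R <= x -> x <= y -> y <= i.+1%:R -> Pr x y) ->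
 (forall x y w, 0 <= x -> x <= y -> y <= w -> w <= M%:R -> Pr x y -> Pr y w -> Pr x w) ->
 forall x y, 0 <= x -> x <= y -> y <= M%:R -> Pr x y.
move=> M0 hs ht x y x0 xy yM.
suff h (d i : nat) x' y' : i%:R <= x' -> x' <= y' -> y' <= (i + d).+1%:R -> (i + d < M)%N -> Pr x' y'.
 by apply: (h M.-1 0%N) => //; rewrite add0n prednK.
elim: d x' y' => [|d IH] x' y' h1 h2 h3 h4; first by apply: (hs i); rewrite ?addn0 in h3 h4.
have h4' : (i + d < M)%N by lia.
have [h5|h5] := leP y' (i + d).+1%:R; first exact: IH.
rewrite addnS in h3 h4; have [h6|h6] := leP (i + d).+1%:R x'; first exact: (hs (i + d).+1).
have i0 : 0 <= i%:R :> R := ler0n _ _.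
apply: (ht x' (i + d).+1%:R y'); try exact: ltW.
- exact: le_trans h1.
- by apply: le_trans h3 _; rewrite ler_nat.
- by apply: IH => //; exact: ltW.
by apply: (hs (i + d).+1) => //; exact: ltW.
Qed.

End Segments.

(** * The test loop, its height and its length *)

Section WordLoop.
Context {R : realType} {r : nat} (r0 : (0 < r)%N).
Local Notation Q := (filiprod R r false).
Local Notation row := 'rV[R]_(3 + r).
Variables (lam : R) (n : nat).

Definition wcoef (j : nat) : R := n%:R * ((-1) ^+ j * 'C(r, j)%:R).

(* The vertices of the word y^(n c_0) x^n y^(n c_1) ... x^n y^(n c_r) x^(-rn). *)
Definition wpoint (k : nat) : row :=
 mk (if k == r.+1.*2 then 0 else (k./2)%:R * n%:R) 0 0
 (\row_(l < r) \sum_(j < uphalf k) wcoef j * (j%:R * n%:R) ^+ l) : Q.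

(** lam times the last coordinate of the lift of the word to the filiform group of class r + 1: a
    potential at the vertices for the 1-form with coefficients [coef]. *)
Definition wpot (k : nat) : R := lam * \sum_(j < uphalf k) wcoef j * (j%:R * n%:R) ^+ r.

Lemma wsum l : (l <= r)%N -> \sum_(j < r.+1) wcoef j * (j%:R * n%:R) ^+ l =
 if l == r then n%:R ^+ r.+1 * ((-1) ^+ r * (r`!)%:R) else 0.
move=> lr; have -> : \sum_(j < r.+1) wcoef j * (j%:R * n%:R) ^+ l =
 n%:R ^+ l.+1 * altsum r (fun j => j%:R ^+ l : R).
 rewrite /altsum mulr_sumr; apply: eq_bigr => j _; rewrite /wcoef exprMn exprS; ring.
by rewrite altsum_exp//; case: eqP => [->//|_]; rewrite mulr0.
Qed.

Lemma wpoint0 : wpoint 0 = 0.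
apply: (@filiprodP R r false _ (1%g : Q)); rewrite /wpoint ?cAmk ?cUmk ?cVmk ?mul0r//; try by rewrite /cA /cU /cV mxE.
by move=> k; rewrite cPmk !mxE big_ord0.
Qed.

Lemma wpoint_end : wpoint r.+1.*2 = 0.
apply: (@filiprodP R r false _ (1%g : Q)); rewrite /wpoint ?cAmk ?cUmk ?cVmk ?eqxx//; try by rewrite /cA /cU /cV mxE.
move=> k; rewrite cPmk !mxE uphalf_double wsum; last exact/ltnW/ltn_ord.
by rewrite ltn_eqF.
Qed.

Lemma wpot0 : wpot 0 = 0. by rewrite /wpot big_ord0 mulr0. Qed.
Lemma wpot_end : wpot r.+1.*2 = lam * (n%:R ^+ r.+1 * ((-1) ^+ r * (r`!)%:R)).
by rewrite /wpot uphalf_double wsum// eqxx. Qed.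

Lemma wstep k : (k < r.+1.*2)%N ->
 (exists da : R, `|da| <= n%:R * 2 ^+ r /\ wpoint k.+1 - wpoint k = (mk da 0 0 0 : Q) /\ wpot k.+1 = wpot k) \/
 (exists (i : nat), [/\ `|wcoef i| <= n%:R * 2 ^+ r, cA (wpoint k : Q) = i%:R * n%:R,
 wpoint k.+1 - wpoint k = (mk 0 0 0 (wcoef i *: \row_l (i%:R * n%:R) ^+ l) : Q) &
 wpot k.+1 = wpot k + lam * (wcoef i * (i%:R * n%:R) ^+ r)]).
move=> kM; have kE := odd_double_half k.
set i := k./2 in kE; have ir : (i <= r)%N by move: kM; rewrite -{1}kE !doubleS; case: (odd k) => /=; lia.
have u2 : uphalf i.*2.+1 = i.+1 by rewrite uphalfE -doubleS half_double.
have h1 : (i.*2.+1)./2 = i by rewrite -uphalfE uphalf_double.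
have n1 : (i.*2.+1 == r.+1.*2) = false by apply/negbTE; lia.
case ok : (odd k) kE => kE; rewrite /= ?add1n ?add0n in kE; rewrite -kE.
 left; exists ((if i == r then 0 else i.+1%:R * n%:R) - i%:R * n%:R).
 have e1 : (i.*2.+2 == r.+1.*2) = (i == r) by rewrite -doubleS; apply/eqP/eqP; lia.
 have u3 : uphalf i.*2.+2 = i.+1 by rewrite -doubleS uphalf_double.
 have h2 : (i.*2.+2)./2 = i.+1 by rewrite -doubleS half_double.
 split; last split.
 - case: eqP => [->|_].
 rewrite sub0r normrN -natrM normr_nat -natrX -natrM ler_nat mulnC leq_mul2l.
 by rewrite (ltnW (ltn_expl _ _)) ?orbT.
 rewrite -mulrBl -natrB ?leqnSn// subSnn mul1r normr_nat -[leLHS]mulr1.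
 by apply: ler_wpM2l => //; apply: exprn_ege1; rewrite ler1n.
 - apply: (@filiprodP R r false); rewrite /wpoint ?cAD ?cUD ?cVD ?cAN ?cUN ?cVN ?cAmk ?cUmk ?cVmk ?subrr//.
 by rewrite n1 e1 h1 h2.
 by move=> l; rewrite cPD cPN !cPmk u2 u3 subrr.
 by rewrite /wpot u2 u3.
right; exists i; have n2 : (i.*2 == r.+1.*2) = false by apply/negbTE; lia.
split.
- rewrite /wcoef !normrM normrX normrN normr1 expr1n mul1r !normr_nat.
 by apply: ler_wpM2l => //; rewrite -natrX ler_nat bin_leq_exp2.
- by rewrite /wpoint cAmk n2 half_double.
- apply: (@filiprodP R r false); rewrite /wpoint ?cAD ?cUD ?cVD ?cAN ?cUN ?cVN ?cAmk ?cUmk ?cVmk ?subrr//.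
 by rewrite n1 n2 h1 half_double subrr.
 move=> l; rewrite cPD cPN !cPmk u2 uphalf_double !mxE big_ord_recr/= addrC addKr//.
by rewrite /wpot u2 uphalf_double big_ord_recr/= mulrDr.
Qed.

Definition wedge (x y : row) : R := \sum_j (coef lam j (cA (x : Q)) + coef lam j (cA (y : Q))) / 2 *
 (cP (y : Q) 0 j - cP (x : Q) 0 j).

Lemma wedge_triangle (x y w : row) : wedge x w = wedge x y + wedge y w -
 2^-1 * \sum_j ((coef lam j (cA (y : Q)) - coef lam j (cA (w : Q))) * (cP (y : Q) 0 j - cP (x : Q) 0 j) +
 (coef lam j (cA (y : Q)) - coef lam j (cA (x : Q))) * (cP (w : Q) 0 j - cP (y : Q) 0 j)).
by rewrite /wedge mulr_sumr -big_split/= -sumrB; apply: eq_bigr => j _; field.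
Qed.

(** The trapezoidal form fails to be additive by products of an increment of a coefficient and an
    increment of p, which are quadratic in the diameter. *)
Lemma wedge_corner (B : R) : 0 <= B -> exists2 C : R, 0 <= C & forall (x y w : row) D,
 `|x| <= B -> `|y| <= B -> `|w| <= B -> `|y - x| <= D -> `|w - y| <= D ->
 `|wedge x w - (wedge x y + wedge y w)| <= C * D ^+ 2.
move=> B0; have [L L0 hL] := coef_lip (r := r) lam B0.
have cAd (x y : row) D : `|x - y| <= D -> `|cA (x : Q) - cA (y : Q)| <= D.
 by apply: le_trans; have := cA_norm (x - y); rewrite /cA !mxE.
have cPd (x y : row) j D : `|x - y| <= D -> `|cP (x : Q) 0 j - cP (y : Q) 0 j| <= D.
 apply: le_trans; have := (norm_bnd (cP (x - y : Q)) (normr_ge0 _)).1 (cP_norm _) j.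
 by rewrite /cP !mxE.
have cAb (x : row) : `|x| <= B -> `|cA (x : Q)| <= B := le_trans (cA_norm x).
exists (r%:R * L) => [|x y w D xB yB wB h1 h2]; first exact: mulr_ge0.
have D0 : 0 <= D := le_trans (normr_ge0 _) h1.
rewrite (wedge_triangle _ y) [X in `|X|]addrC addKr normrN normrM.
have -> : `|2^-1| = 2^-1 :> R by rewrite ger0_norm ?invr_ge0.
have -> : r%:R * L * D ^+ 2 = 2^-1 * \sum_(j < r) (L * D * D + L * D * D).
 by rewrite sumr_const card_ord -[X in _ = _ * X]mulr_natl; field.
apply: ler_wpM2l; first by rewrite invr_ge0.
apply: le_trans (ler_norm_sum _ _ _) _; apply: ler_sum => j _.
apply: normD_le; rewrite !normrM; apply: lerD; apply: ler_pM => //; try exact: cPd.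
- apply: le_trans (hL j _ _ (cAb _ wB) (cAb _ yB)) _; apply: ler_wpM2l => //.
 by apply: cAd; rewrite distrC.
- by apply: le_trans (hL j _ _ (cAb _ xB) (cAb _ yB)) _; apply: ler_wpM2l => //; exact: cAd.
Qed.

Lemma wedge_opp (x y : row) : wedge y x = - wedge x y.
by rewrite /wedge -sumrN; apply: eq_bigr => j _; ring. Qed.
Lemma cA_lerp (x y : row) s : cA (lerp x y s : Q) = cA (x : Q) + s * cA (y - x : Q).
by rewrite /lerp /cA !mxE. Qed.
Lemma cP_lerp (x y : row) s j : cP (lerp x y s : Q) 0 j = cP (x : Q) 0 j + s * cP (y - x : Q) 0 j.
by rewrite /lerp /cP !mxE. Qed.

(** Along x the coordinates p do not move. Along y the coordinate a is constant, and the sum of -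
    C(r, j) (-a)^(r-j) a^j over j < r equals a^r, because the full binomial sum is (a - a)^r = 0. *)
Lemma wedge_segment k s t : (k < r.+1.*2)%N ->
 wedge (lerp (wpoint k) (wpoint k.+1) s) (lerp (wpoint k) (wpoint k.+1) t) = (t - s) * (wpot k.+1 - wpot k).
move=> /wstep [[da [_ [dE ->]]]|[i [_ aE dE ->]]].
 rewrite subrr mulr0 /wedge big1// => j _; by rewrite !cP_lerp dE cPmk !mxE !mulr0 subrr mulr0.
rewrite [X in _ = _ * X]addrAC subrr add0r /wedge; set al := i%:R * n%:R in aE dE *.
have aL u : cA (lerp (wpoint k) (wpoint k.+1) u : Q) = al by rewrite cA_lerp dE aE cAmk mulr0 addr0.
under eq_bigr do rewrite !cP_lerp !aL dE cPmk !mxE.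
have -> : (t - s) * (lam * (wcoef i * al ^+ r)) = - (t - s) * lam * wcoef i *
 \sum_(j < r) (- al) ^+ (r - j) * al ^+ j *+ 'C(r, j).
 have := exprDn (- al) al r; rewrite addNr expr0n gtn_eqF// big_ord_recr/= binn subnn mulr1n expr0 mul1r.
 move/esym/eqP; rewrite addr_eq0 => /eqP ->; ring.
rewrite mulr_sumr; by apply: eq_bigr => j _; rewrite /coef -[_ *+ 'C(_, _)]mulr_natr; field.
Qed.

Definition wcurve (x : R) : row := polygon wpoint x.
Definition wheight (x : R) : R := cA (polygon (fun k => mk (wpot k) 0 0 0 : Q) x : Q).
Lemma wheight_nat k : wheight k%:R = wpot k.
by rewrite /wheight polygon_nat cAmk. Qed.
Lemma wcurve_nat k : wcurve k%:R = wpoint k.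
by rewrite /wcurve polygon_nat. Qed.

Lemma wedge_exact (i : nat) x y : (i < r.+1.*2)%N -> i%:R <= x <= i.+1%:R -> i%:R <= y <= i.+1%:R ->
 wedge (wcurve x) (wcurve y) = wheight y - wheight x.
move=> iM hx hy; rewrite /wcurve /wheight !(polygonE _ hx) !(polygonE _ hy) wedge_segment// !cA_lerp.
by rewrite cAD cAN !cAmk; ring.
Qed.

Lemma wcurve_lip : exists2 K : R, 0 <= K & forall x y, 0 <= x -> x <= y -> y <= r.+1.*2%:R ->
 `|wcurve y - wcurve x| <= K * (y - x).
exists (\sum_(k < r.+1.*2) `|wpoint k.+1 - wpoint k|); first exact: sumr_ge0.
apply: segment_ind => [//|i x y iM h1 h2 h3|x y w x0 xy yw wM h1 h2]; last first.
 have -> : wcurve w - wcurve x = (wcurve w - wcurve y) + (wcurve y - wcurve x) by rewrite addrA subrK.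
 apply: normD_le.
 have -> : w - x = (w - y) + (y - x) by ring.
 by rewrite mulrDr; exact: lerD.
have hx : i%:R <= x <= i.+1%:R by rewrite h1 (le_trans h2).
have hy : i%:R <= y <= i.+1%:R by rewrite h3 (le_trans h1).
rewrite /wcurve (polygonE _ hx) (polygonE _ hy).
have -> : lerp (wpoint i) (wpoint i.+1) (y - i%:R) - lerp (wpoint i) (wpoint i.+1) (x - i%:R) =
 (y - x) *: (wpoint i.+1 - wpoint i).
 by rewrite /lerp opprD addrACA subrr add0r -scalerBl; congr (_ *: _); ring.
rewrite normrZ ger0_norm ?subr_ge0// mulrC; apply: ler_wpM2r; first by rewrite subr_ge0.
rewrite (bigD1 (Ordinal iM))//= lerDl; exact: sumr_ge0.
Qed.

(** On each segment of the word the formula is exact. Crossing a vertex costs a defect quadratic in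
    the diameter D, and there are finitely many vertices; the factor 4 appears because the second
    arc, measured from its own origin, has diameter at most 2 D. *)
Lemma wedge_height : exists2 C : R, 0 <= C & forall x y D, 0 <= x -> x <= y -> y <= r.+1.*2%:R ->
 (forall w, x <= w <= y -> `|wcurve w - wcurve x| <= D) ->
 `|wedge (wcurve x) (wcurve y) - (wheight y - wheight x)| <= C * D ^+ 2.
have [K K0 hK] := wcurve_lip; set M := r.+1.*2 in hK *.
pose B := `|wcurve 0| + K * M%:R; have B0 : 0 <= B by rewrite addr_ge0// mulr_ge0.
have hB x : 0 <= x <= M%:R -> `|wcurve x| <= B.
 move=> /andP[x0 xM]; have -> : wcurve x = wcurve 0 + (wcurve x - wcurve 0) by rewrite addrC subrK.
 apply: normD_le; apply: lerD => //; apply: le_trans (hK _ _ (lexx _) x0 xM) _.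
 by rewrite subr0; apply: ler_wpM2l.
have [T' T'0 hT] := wedge_corner B0.
pose T := T' * 4; have T0 : 0 <= T by rewrite mulr_ge0.
have tri x y w D : 0 <= x -> x <= y -> y <= w -> w <= M%:R -> `|wcurve y - wcurve x| <= D ->
 `|wcurve w - wcurve x| <= D ->
 `|wedge (wcurve x) (wcurve w) - (wedge (wcurve x) (wcurve y) + wedge (wcurve y) (wcurve w))| <= T * D ^+ 2.
 move=> x0 xy yw wM hy hw; have D0 : 0 <= D := le_trans (normr_ge0 _) hy.
 have -> : T * D ^+ 2 = T' * (2 * D) ^+ 2 by rewrite /T; ring.
 apply: hT.
 - by apply: hB; rewrite x0 (le_trans xy)// (le_trans yw).
 - by apply: hB; rewrite (le_trans x0)// (le_trans yw).
 - by apply: hB; rewrite wM (le_trans x0)// (le_trans xy).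
 - by apply: le_trans hy _; rewrite ler_peMl// ler1n.
 have -> : wcurve w - wcurve y = (wcurve w - wcurve x) - (wcurve y - wcurve x).
 by rewrite opprB addrA subrK.
 by apply: normB_le; rewrite mulr_natl mulr2n; exact: lerD.
pose Pr (x y : R) := exists2 C : R, 0 <= C & forall x' y' D, x <= x' -> x' <= y' -> y' <= y ->
 (forall w, x' <= w <= y' -> `|wcurve w - wcurve x'| <= D) ->
 `|wedge (wcurve x') (wcurve y') - (wheight y' - wheight x')| <= C * D ^+ 2.
have : forall x y, 0 <= x -> x <= y -> y <= M%:R -> Pr x y.
 apply: segment_ind => [//|i x y iM h1 h2 h3|x y w x0 xy yw wM [C1 C10 hC1] [C2 C20 hC2]].
 exists 0 => // x' y' D xx' xy' yy' _.
 rewrite (wedge_exact iM) ?subrr ?normr0 ?mul0r//.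
 by rewrite (le_trans h1 xx') (le_trans xy' (le_trans yy' h3)).
 by rewrite (le_trans h1 (le_trans xx' xy')) (le_trans yy' h3).
 exists (T + C1 + C2 * 4) => [|x' w' D xx' xw' ww' hD]; first by rewrite !addr_ge0 ?mulr_ge0.
 have D2 : 0 <= D ^+ 2 := sqr_ge0 _.
 have t2 : 0 <= T * D ^+ 2 := mulr_ge0 T0 D2.
 have c12 : 0 <= C1 * D ^+ 2 := mulr_ge0 C10 D2.
 have c22 : 0 <= C2 * D ^+ 2 := mulr_ge0 C20 D2.
 have EE : (T + C1 + C2 * 4) * D ^+ 2 = T * D ^+ 2 + C1 * D ^+ 2 + 4 * (C2 * D ^+ 2) by ring.
 have [wy|wy] := leP w' y.
 apply: le_trans (hC1 x' w' D xx' xw' wy hD) _; rewrite EE.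
 by move: t2 c12 c22; move: (T * _) (C1 * _) (C2 * _) => a b c; clear; lra.
 have [yx|yx] := leP y x'.
 apply: le_trans (hC2 x' w' D yx xw' ww' hD) _; rewrite EE.
 by move: t2 c12 c22; move: (T * _) (C1 * _) (C2 * _) => a b c; clear; lra.
 have hyD : `|wcurve y - wcurve x'| <= D by apply: hD; rewrite (ltW yx) (ltW wy).
 have a1 := hC1 x' y D xx' (ltW yx) (lexx _).
 have {}a1 : `|wedge (wcurve x') (wcurve y) - (wheight y - wheight x')| <= C1 * D ^+ 2.
 by apply: a1 => v /andP[v1 v2]; apply: hD; rewrite v1 (le_trans v2)// ltW.
 have a2 : `|wedge (wcurve y) (wcurve w') - (wheight w' - wheight y)| <= C2 * (2 * D) ^+ 2.
 apply: hC2 => //; first exact: ltW.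
 move=> v /andP[v1 v2].
 have -> : wcurve v - wcurve y = (wcurve v - wcurve x') - (wcurve y - wcurve x') by rewrite opprB addrA subrK.
 apply: normB_le; rewrite mulr_natl mulr2n; apply: lerD => //.
 by apply: hD; rewrite v2 (le_trans (ltW yx)).
 have a3 := tri x' y w' D (le_trans x0 xx') (ltW yx) (ltW wy) (le_trans ww' wM) hyD _.
 have {}a3 : `|wedge (wcurve x') (wcurve w') - (wedge (wcurve x') (wcurve y) + wedge (wcurve y) (wcurve w'))|
 <= T * D ^+ 2 by apply: a3; apply: hD; rewrite xw' lexx.
 move: a1 a2 a3; rewrite EE; have -> : C2 * (2 * D) ^+ 2 = 4 * (C2 * D ^+ 2) by ring.
 move: (wedge _ _) (wedge _ _) (wedge _ _) (wheight _) (wheight _) (wheight _) => e1 e2 e3 p1 p2 p3.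
 move: (T * _) (C1 * _) (C2 * _) => a b c; rewrite !ler_norml; clear.
 by move=> /andP[? ?] /andP[? ?] /andP[? ?]; lra2.
move=> h; have [C C0 hC] := h 0 M%:R (lexx _) (ler0n _ _) (lexx _).
by exists C.
Qed.

End WordLoop.

Section LoopLength.
Context {R : realType} {r : nat} (r0 : (0 < r)%N).
Local Notation Q := (filiprod R r false).
Local Notation row := 'rV[R]_(3 + r).
Variable g : leftinv_metric (filiLieG R r false).
Local Notation dist := (@riem_dist R (3 + r) (filiLieG R r false) g).
Variables (k1 k2 : R) (n : nat).
Hypothesis k20 : 0 <= k2.
Hypothesis hk2 : forall v, bn g v <= k2 * `|v|.

(** The hypothesis says that the segment from 1 to the quotient is a one-parameter subgroup, of
    constant velocity. The bound then holds at every scale with the constant [k2], which keeps the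
    length of the test loop linear in n. *)
Lemma straight_dist (x y : Q) : (forall t : R, ((x^-1 * y)%g : row) *m
 actxV (e := false) (t *: ((x^-1 * y)%g : row) : Q) = (x^-1 * y)%g) ->
 dist x y <= k2 * `|(x^-1 * y)%g : row|.
pose z : row := (x^-1 * y)%g; rewrite -/z => hz.
have [cz vz] := C1_ray g z.
have [cx vx lx] := C1_mull (x : Q) cz.
have := dist_le_length cx; rewrite /= scale0r scale1r.
rewrite -[(x * 0)%g]/(x * 1)%g mulg1 /z mulVKg lx -/z => h; apply: le_trans h _.
have [P hP ->] := length_primitive cz.
have h := @derive_compare R P _ id (fun=> 1) (k2 * `|z|) 0 1 ler01 hP.
apply: le_trans (ler_norm _) _; rewrite subr0 mulr1 in h; apply: h.
by move=> t t01; rewrite (ger0_norm (bn_ge0 g _)) (vz t t01) hz.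
Qed.

Lemma norm_mkA (a : R) : `|(mk a 0 0 0 : Q) : row| <= `|a|.
apply/norm_bnd => // i; have := (bndP `|a| (mk a 0 0 0 : Q)).2.
apply; rewrite cAmk cUmk cVmk cPmk normr0 lexx normr_ge0; split=> // k.
by rewrite mxE normr0.
Qed.

Lemma norm_mkP (a : R) (k : 'I_r) : `|(mk 0 0 0 (a *: delta_mx 0 k) : Q) : row| <= `|a|.
apply/norm_bnd => // i; have := (bndP `|a| (mk 0 0 0 (a *: delta_mx 0 k) : Q)).2.
apply; rewrite cAmk cUmk cVmk cPmk normr0 normr_ge0; split=> // l.
by rewrite !mxE normrM eqxx/=; case: eqP => _; rewrite ?normr1 ?mulr1// normr0 mulr0.
Qed.
Let actE (d x : row) : [/\ cA (d *m actxV (e := false) (x : Q) : Q) = cA (d : Q),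
 cU (d *m actxV (e := false) (x : Q) : Q) = cU (d : Q),
 cV (d *m actxV (e := false) (x : Q) : Q) = cV (d : Q) &
 forall k, cP (d *m actxV (e := false) (x : Q) : Q) 0 k =
 \sum_j cP (d : Q) 0 j * ('C(k, j)%:R * (- cA (x : Q)) ^+ (k - j))].
rewrite /actxV cA_act cU_act cV_act; split=> // k.
rewrite cP_act mxE lsub_heis !mul0r if_same add0r mxE; apply: eq_bigr => j _.
by rewrite [pascal _ _ _ _]mxE.
Qed.

Lemma wcurve_dist x y : 0 <= x -> x <= y -> y <= r.+1.*2%:R ->
 dist (wcurve (r := r) n x) (wcurve (r := r) n y) <= k2 * (n%:R * 2 ^+ r) * (y - x).
move: x y; apply: segment_ind => [//|i x y iM h1 h2 h3|x y w x0 xy yw wM a1 a2]; last first.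
 apply: le_trans (dist_triangle g _ (wcurve n y : Q) _) _.
 have -> : w - x = (y - x) + (w - y) by ring.
 by rewrite mulrDr; exact: lerD.
have hx : i%:R <= x <= i.+1%:R by rewrite h1 (le_trans h2).
have hy : i%:R <= y <= i.+1%:R by rewrite h3 (le_trans h1).
have yx0 : 0 <= y - x by rewrite subr_ge0.
pose c1 := wcurve (r := r) n x; pose c2 := wcurve (r := r) n y.
have cE : c2 - c1 = (y - x) *: (wpoint (r := r) n i.+1 - wpoint (r := r) n i).
 rewrite /c1 /c2 /wcurve (polygonE _ hx) (polygonE _ hy).
 by rewrite /lerp opprD addrACA subrr add0r -scalerBl; congr (_ *: _); ring.
have cAx (s : R) (v : row) : cA (s *: v : Q) = s * cA (v : Q) by rewrite /cA !mxE.
have cUx (s : R) (v : row) : cU (s *: v : Q) = s * cU (v : Q) by rewrite /cU !mxE.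
have cVx (s : R) (v : row) : cV (s *: v : Q) = s * cV (v : Q) by rewrite /cV !mxE.
have cPx (s : R) (v : row) k : cP (s *: v : Q) 0 k = s * cP (v : Q) 0 k by rewrite /cP !mxE.
suff [w [wE ws wn]] : exists w : row, [/\ (c2 - c1) *m actxV (e := false) (c1 : Q) = w,
 (forall t : R, w *m actxV (e := false) (t *: w : Q) = w) & `|w| <= (y - x) * (n%:R * 2 ^+ r)].
 have dE : ((c1 : Q)^-1 * c2)%g = w :> row by rewrite divE.
 have := @straight_dist (c1 : Q) (c2 : Q); rewrite dE => /(_ ws) h; apply: le_trans h _.
 by rewrite -mulrA; apply: ler_wpM2l => //; rewrite mulrC.
rewrite cE; case: (wstep r0 (0 : R) n iM) => [[da [dan [dE _]]]|[m [mn aE dE _]]].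
 exists ((y - x) *: ((mk da 0 0 0 : Q) : row)); split.
 - rewrite dE; have [eA eU eV eP] := actE ((y - x) *: ((mk da 0 0 0 : Q) : row)) c1.
 apply: (@filiprodP R r false) => // k; rewrite eP big1 => [|j _].
 by rewrite cPx cPmk mxE mulr0.
 by rewrite cPx cPmk mxE mulr0 mul0r.
 - move=> t; set w := (y - x) *: _; have [eA eU eV eP] := actE w (t *: w).
 apply: (@filiprodP R r false) => // k; rewrite eP big1 => [|j _].
 by rewrite cPx cPmk mxE mulr0.
 by rewrite cPx cPmk mxE mulr0 mul0r.
 by rewrite normrZ ger0_norm//; apply: ler_wpM2l => //; apply: le_trans (norm_mkA _) _.
pose o := Ordinal r0; set al : R := m%:R * n%:R in aE dE.
have cA1 : cA (c1 : Q) = al.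
 by rewrite /c1 /wcurve (polygonE _ hx) cA_lerp dE aE cAmk mulr0 addr0.
pose w : row := mk 0 0 0 (((y - x) * wcoef (r := r) n m) *: delta_mx 0 o) : Q.
exists w; split.
- rewrite dE; set d := _ *: _; have [eA eU eV eP] := actE d c1.
 apply: (@filiprodP R r false); rewrite ?eA ?eU ?eV /w ?cAmk ?cUmk ?cVmk /d ?cAx ?cUx ?cVx ?cAmk ?cUmk ?cVmk ?mulr0//.
 move=> k; rewrite eP cPmk !mxE eqxx cA1.
 have -> : \sum_j cP (d : Q) 0 j * ('C(k, j)%:R * (- al) ^+ (k - j)) =
 (y - x) * wcoef (r := r) n m * \sum_(j < r) (- al) ^+ (k - j) * al ^+ j *+ 'C(k, j).
 rewrite mulr_sumr; apply: eq_bigr => j _; rewrite /d cPx cPmk !mxE -mulr_natr; ring.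
 congr (_ * _).
 have -> : \sum_(j < r) (- al) ^+ (k - j) * al ^+ j *+ 'C(k, j) = (- al + al) ^+ k.
 rewrite exprDn (big_ord_widen_cond _ xpredT (fun j => (- al) ^+ (k - j) * al ^+ j *+ 'C(k, j)) (ltn_ord k)).
 rewrite [LHS](bigID (fun j : 'I_r => (j < k.+1)%N))/= [X in _ + X]big1 ?addr0// => j.
 by rewrite -leqNgt => kj; rewrite bin_small.
 by rewrite addNr expr0n; congr (_ : bool)%:R; apply/eqP/eqP => [h|->//]; apply: val_inj.
- move=> t; have [eA eU eV eP] := actE w (t *: w).
 apply: (@filiprodP R r false) => // k; rewrite eP cAx /w cAmk mulr0 oppr0.
 rewrite (bigD1 k)//= big1 => [|j jk].
 by rewrite subnn binn expr0 !mulr1 addr0.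
 rewrite expr0n subn_eq0; case: leqP => [kj|_]; last by rewrite !mulr0.
 by rewrite bin_small ?mul0r ?mulr0// ltn_neqAle kj andbT eq_sym.
apply: le_trans (norm_mkP _ _) _; rewrite normrM ger0_norm//; exact: ler_wpM2l.
Qed.

Definition wloop (t : R) : row := wcurve (r := r) n (r.+1.*2%:R * t).

Lemma wloop_length : loop_of_length_le g (wloop : R -> filiLieG R r false)
 (k2 * (n%:R * 2 ^+ r) * r.+1.*2%:R).
set M := r.+1.*2; have M0 : 0 <= M%:R :> R := ler0n _ _.
have MM (t : R) : 0 <= t <= 1 -> 0 <= M%:R * t <= M%:R.
 by move=> /andP[t0 t1]; rewrite mulr_ge0//= -[leRHS]mulr1; apply: ler_wpM2l.
split.
- have [K K0 hK] := wcurve_lip (R := R) (r := r) n.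
 apply: (within_eq (g := wloop \o clamp)); last first.
 by move=> t; rewrite inE/= in_itv/= => t01; rewrite clamp_id.
 have lip (s t : R) : `|(wloop \o clamp) t - (wloop \o clamp) s| <= K * M%:R * `|clamp t - clamp s|.
 wlog st : s t / clamp s <= clamp t.
 by move=> h; case: (leP (clamp s) (clamp t)) => [/h//|/ltW/h]; rewrite distrC [X in _ <= _ * X]distrC.
 have /andP[s0 s1] := MM _ (clamp01 s); have /andP[t0 t1] := MM _ (clamp01 t).
 have h : M%:R * clamp s <= M%:R * clamp t by apply: ler_wpM2l.
 apply: le_trans (hK _ _ s0 h t1) _.
 by rewrite ger0_norm ?subr_ge0// -mulrBr mulrA.
 have KM : 0 < K * M%:R + 1 by rewrite ltr_wpDl// mulr_ge0.
 move=> t; apply/cvgrPdist_le => ep ep0; near=> s.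
 rewrite distrC; apply: le_trans (lip t s) _.
 apply: (@le_trans _ _ ((K * M%:R + 1) * `|clamp s - clamp t|)); first by apply: ler_wpM2r => //; rewrite lerDl.
 rewrite mulrC -ler_pdivlMr// distrC; near: s.
 by apply: cvgr_dist_le; [exact: clamp_continuous|rewrite divr_gt0].
- by rewrite /wloop mulr0 mulr1 -[0]/(0%:R) !wcurve_nat wpoint0 wpoint_end.
apply: ge_ereal_sup => _ [s [ps ls] <-]; rewrite lee_fin /chord_sum.
set La := k2 * _; have La0 : 0 <= La by rewrite !mulr_ge0// exprn_ge0.
suff h (a : R) (s' : seq R) : 0 <= a -> path <%R a s' -> last a s' <= 1 ->
 \sum_(p <- zip (a :: s') s') dist (wloop p.1) (wloop p.2) <= La * M%:R * (last a s' - a).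
 by have := h 0 s (lexx _) ps; rewrite (eqP ls) subr0 mulr1; apply.
elim: s' a => [|b s' IH] a a0 /=; first by rewrite big_nil subrr mulr0.
move=> /andP[ab bs] l1; rewrite big_cons/=.
have lb : b <= last b s'.
 move: bs; clear; elim: s' b => //= c s' IH b /andP[bc cs]; exact: le_trans (ltW bc) (IH _ cs).
have b1 : b <= 1 := le_trans lb l1.
have -> : La * M%:R * (last b s' - a) = La * M%:R * (b - a) + La * M%:R * (last b s' - b) by ring.
apply: lerD; last by apply: IH => //; exact: le_trans a0 (ltW ab).
have h : M%:R * a <= M%:R * b by apply: ler_wpM2l => //; exact: ltW.
have hb : 0 <= b <= 1 by rewrite b1 (le_trans a0) ?ltW.
apply: le_trans (wcurve_dist (mulr_ge0 M0 a0) h _) _; first by case/andP: (MM b hb).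
by rewrite -/La -mulrBr mulrA.
Unshelve. all: by end_near.
Qed.

End LoopLength.

Section EdgeSums.
Context {R : realType} {m : nat}.
Variables (U W : R * R -> 'rV[R]_m).

Lemma edge_opp (p q : R * R) : edge U W q p = - edge U W p q.
by rewrite /edge -sumrN; apply: eq_bigr => j _; ring. Qed.

Lemma edge_side (F : nat -> R) (nd : nat -> R * R) (c : R) (N : nat) :
 (forall i, (i < N)%N -> `|edge U W (nd i) (nd i.+1) - (F i.+1 - F i)| <= c) ->
 `|\sum_(i < N) edge U W (nd i) (nd i.+1) - (F N - F 0%N)| <= N%:R * c.
elim: N => [|N IH] h; first by rewrite big_ord0 !subrr normr0 mul0r.
rewrite big_ord_recr/=.
have -> : \sum_(i < N) edge U W (nd i) (nd i.+1) + edge U W (nd N) (nd N.+1) - (F N.+1 - F 0%N) =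
 (\sum_(i < N) edge U W (nd i) (nd i.+1) - (F N - F 0%N)) +
 (edge U W (nd N) (nd N.+1) - (F N.+1 - F N)) by ring.
apply: normD_le; rewrite -[N.+1%:R]natr1 mulrDl mul1r; apply: lerD; last exact: h.
by apply: IH => i iN; apply: h; exact: ltnW.
Qed.

End EdgeSums.

Section Quadrants.
Context {R : realType}.

Lemma sin_cos_quadrants (a : R) : 0 <= a <= 1 ->
 [/\ 0 < sin (2 * pi * a) -> a <= 1 / 2, sin (2 * pi * a) < 0 -> 1 / 2 <= a,
 cos (2 * pi * a) < 0 -> 1 / 4 <= a <= 3 / 4 & 0 < cos (2 * pi * a) -> a <= 1 / 4 \/ 3 / 4 <= a].
move=> /andP[a0 a1]; have p0 := pi_gt0 R.
have pm (x y : R) : x <= y -> 2 * pi * x <= 2 * pi * y by move=> xy; apply: ler_wpM2l => //; lra.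
split=> h.
- rewrite leNgt; apply/negP => ha.
 have : 0 <= sin (2 * pi * a - pi).
 have := pm _ _ (ltW ha); have := pm _ _ a1 => ? ?; apply: sin_ge0_pi; lra2.
 by rewrite sinB sinpi cospi mulr0 subr0 mulrN1; lra.
- rewrite leNgt; apply/negP => ha.
 have := pm _ _ (ltW ha); have := pm _ _ a0 => ? ?.
 have : 0 <= sin (2 * pi * a) by apply: sin_ge0_pi; lra2.
 lra.
- apply/andP; split; rewrite leNgt; apply/negP => ha.
 have := pm _ _ (ltW ha); have := pm _ _ a0 => ? ?.
 have : 0 <= cos (2 * pi * a) by apply: cos_ge0_pihalf; lra2.
 lra.
 have := pm _ _ (ltW ha); have := pm _ _ a1 => ? ?.
 have : 0 <= cos (2 * pi * a - 2 * pi) by apply: cos_ge0_pihalf; lra2.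
 have -> : cos (2 * pi * a - 2 * pi) = cos (2 * pi * a).
 by rewrite -cosD2pi; congr cos; rewrite -mulr_natl; ring.
 lra.
- have [|ha] := leP a (1 / 4); [by left|right; rewrite leNgt; apply/negP => ha'].
 have := pm _ _ (ltW ha); have := pm _ _ (ltW ha') => ? ?.
 have : 0 <= cos (2 * pi * a - pi) by apply: cos_ge0_pihalf; lra2.
 by rewrite cosB sinpi cospi mulr0 addr0 mulrN1; lra.
Qed.

End Quadrants.

(** * The boundary sum of a filling of the test loop *)

Section Boundary.
Context {R : realType} {r : nat} (r0 : (0 < r)%N).
Local Notation Q := (filiprod R r false).
Local Notation row := 'rV[R]_(3 + r).
Variable g : leftinv_metric (filiLieG R r false).
Variables (lam : R) (n : nat) (phi : R * R -> Q) (s : R -> R).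
Hypothesis hphi : lipschitz_disc g (phi : R * R -> filiLieG R r false).
Hypothesis s_cont : {within `[0, 1], continuous s}.
Hypothesis s_homo : {in `[0, 1] &, {homo s : x y / x <= y}}.
Hypotheses (s0 : s 0 = 0) (s1 : s 1 = 1).
Hypothesis s_fill : forall t : R, 0 <= t <= 1 ->
 wloop (r := r) n t = phi (cos (2 * pi * s t), sin (2 * pi * s t)) :> row.

Local Notation wl := (wloop (r := r) n).
Local Notation U := (extU lam phi).
Local Notation W := (extW phi).
Let M : R := r.+1.*2%:R.
Let M0 : 0 < M. by rewrite ltr0n. Qed.
Let H (t : R) : R := wheight (r := r) lam n (M * t).
Let kap : R := wpot (r := r) lam n r.+1.*2.
Let circ (a : R) : R * R := (cos (2 * pi * a), sin (2 * pi * a)).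
Let H0 : H 0 = 0. by rewrite /H mulr0 -[0]/(0%:R) wheight_nat wpot0. Qed.
Let H1 : H 1 = kap. by rewrite /H mulr1 wheight_nat. Qed.
Let euclid_circ a : euclid (circ a) = 1.
by rewrite /euclid cos2Dsin2 sqrtr1. Qed.
Let wl_ext t : 0 <= t <= 1 -> wl t = ext phi (circ (s t)).
by move=> t01; rewrite s_fill// /ext ret_in// euclid_circ. Qed.
Let circ_lip a a' : `|circ a' - circ a| <= 2 * pi * `|a' - a|.
apply: le_trans (circle_lip _ _) _; rewrite -mulrBr normrM ger0_norm//.
by rewrite mulr_ge0 ?pi_ge0.
Qed.
(** The loop factors through the Lipschitz filling, hence is Lipschitz as a function of s t, even
    where s is constant. *)
Let loop_lip : exists2 K : R, 0 <= K & forall t t', 0 <= t <= 1 -> 0 <= t' <= 1 ->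
 `|wl t' - wl t| <= K * `|s t' - s t|.
have [L L0 hL] := ext_lip hphi; exists (L * (2 * pi)); first by rewrite !mulr_ge0 ?pi_ge0.
move=> t t' ht ht'; rewrite !wl_ext//; apply: le_trans (hL _ _) _; rewrite -mulrA.
by apply: ler_wpM2l => //; exact: circ_lip.
Qed.
(** In particular parameters with the same value of s have the same height, so that the height is a
    function of the angle, whichever preimage [tau] selects. *)
Let loop_wedge : exists2 C : R, 0 <= C & forall t t', 0 <= t <= 1 -> 0 <= t' <= 1 ->
 `|wedge lam (wl t) (wl t') - (H t' - H t)| <= C * `|s t' - s t| ^+ 2.
have [K K0 hK] := loop_lip; have [C C0 hC] := wedge_height r0 lam n.
exists (C * K ^+ 2) => [|t t' ht ht']; first by rewrite mulr_ge0// sqr_ge0.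
wlog tt' : t t' ht ht' / t <= t'.
 move=> h; case: (leP t t') => [/(h _ _ ht ht')//|/ltW/(h _ _ ht' ht)].
 have E : wedge lam (wl t') (wl t) - (H t - H t') = - (wedge lam (wl t) (wl t') - (H t' - H t)).
 by rewrite wedge_opp; ring.
 by rewrite E normrN [`|s t - s t'|]distrC.
have /andP[t0 t1] := ht; have /andP[t'0 t'1] := ht'.
rewrite -mulrA -exprMn; apply: hC.
- by rewrite mulr_ge0// ltW.
- by apply: ler_wpM2l => //; exact: ltW.
- by rewrite -[leRHS]mulr1; apply: ler_wpM2l => //; exact: ltW.
move=> w /andP[w1 w2]; have wE : M * (w / M) = w by rewrite mulrC divfK// gt_eqF.
have w3 : t <= w / M by rewrite ler_pdivlMr// mulrC.
have w4 : w / M <= t' by rewrite ler_pdivrMr// mulrC.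
have w01 : 0 <= w / M <= 1 by rewrite (le_trans t0 w3) (le_trans w4 t'1).
have := hK t (w / M) ht w01; rewrite /wloop wE => h; apply: le_trans h _; apply: ler_wpM2l => //.
have h1 : s t <= s (w / M) by apply: s_homo; rewrite ?in_itv.
have h2 : s (w / M) <= s t' by apply: s_homo; rewrite ?in_itv.
by rewrite !ger0_norm ?subr_ge0// ?(le_trans h1)// lerD2r.
Qed.
Let param (a : R) : exists t, 0 <= a <= 1 -> 0 <= t <= 1 /\ s t = a.
have [a01|na] := pselect (0 <= a <= 1); last by exists 0.
have [|t ht st] := IVT ler01 s_cont (v := a).
 by rewrite s0 s1 min_l// max_r.
by exists t => _; split=> //; rewrite in_itv in ht.
Qed.
Let tau := projT1 (choice param).
Let tauP a : 0 <= a <= 1 -> 0 <= tau a <= 1 /\ s (tau a) = a.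
exact: projT2 (choice param) a. Qed.
Let ang := projT1 (choice (@polar R)).
Let angP (p : R * R) : 0 <= ang p <= 1 /\ p = (euclid p * cos (2 * pi * ang p), euclid p * sin (2 * pi * ang p)).
exact: projT2 (choice (@polar R)) p. Qed.
Let K (p : R * R) : R := H (tau (ang p)).
Let ret_ang p : 1 <= euclid p -> ret p = circ (ang p).
move=> e1; have [_ pE] := angP p; have e0 : euclid p != 0 by rewrite gt_eqF// (lt_le_trans ltr01).
rewrite ret_out//; have -> : (euclid p)^-1 *: p = ((euclid p)^-1 * p.1, (euclid p)^-1 * p.2) by [].
have p1 : p.1 = euclid p * cos (2 * pi * ang p) by rewrite {1}pE.
have p2 : p.2 = euclid p * sin (2 * pi * ang p) by rewrite {1}pE.
by rewrite p1 p2 !mulKf.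
Qed.
Let ext_ang p : 1 <= euclid p -> ext phi p = wl (tau (ang p)).
move=> e1; have [a01 _] := angP p; have [t01 st] := tauP a01.
by rewrite wl_ext// st -(ret_ang e1) ext_ret.
Qed.
Let edgeE p q : edge U W p q = wedge lam (ext phi p) (ext phi q).
by rewrite /edge /wedge; apply: eq_bigr => j _; rewrite !mxE. Qed.
Let ang_near p q : 1 <= euclid p -> 1 <= euclid q ->
 Num.min `|ang q - ang p| (1 - `|ang q - ang p|) <= 3 * `|q - p|.
move=> p1 q1; have [a01 pE] := angP p; have [a'01 qE] := angP q.
have e0 : 0 < euclid p := lt_le_trans ltr01 p1.
apply: le_trans (angle_dist e0 (euclid_ge0 q) a01 a'01 pE qE) _.
by rewrite ler_pdivrMr//; apply: ler_peMr => //; rewrite mulr_ge0.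
Qed.
Let edge_near : exists2 C : R, 0 <= C & forall p q, 1 <= euclid p -> 1 <= euclid q ->
 `|ang q - ang p| <= 1 / 2 -> `|edge U W p q - (K q - K p)| <= C * `|q - p| ^+ 2.
have [C C0 hC] := loop_wedge; exists (C * 9) => [|p q p1 q1 h]; first by rewrite mulr_ge0.
have [a01 _] := angP p; have [a'01 _] := angP q.
have [t01 st] := tauP a01; have [t'01 st'] := tauP a'01.
rewrite edgeE !ext_ang//; apply: le_trans (hC _ _ t01 t'01) _; rewrite st st' -mulrA; apply: ler_wpM2l => //.
have := ang_near p1 q1; rewrite min_l; last by lra.
move=> h'; have -> : 9 * `|q - p| ^+ 2 = (3 * `|q - p|) ^+ 2 by ring.
by rewrite ler_pXn2r ?nnegrE ?mulr_ge0.
Qed.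
(** The edge is split at the point of angle 0, which is both the start and the end of the loop;
    there the height jumps by its total [kap]. *)
Let edge_wrap : exists2 C : R, 0 <= C & forall p q, 1 <= euclid p -> 1 <= euclid q ->
 1 / 2 <= ang p - ang q -> `|edge U W p q - (K q + kap - K p)| <= C * `|q - p| ^+ 2.
have [C C0 hC] := loop_wedge; have [L L0 eL] := ext_lip hphi.
have [B B0 eB] := ext_bounded hphi; have [T T0 hT] := wedge_corner (r := r) lam B0.
exists (18 * C + T * (L * (6 * pi)) ^+ 2) => [|p q p1 q1 h].
 by rewrite addr_ge0 ?mulr_ge0 ?pi_ge0.
have [a01 _] := angP p; have [a'01 _] := angP q.
have [t01 st] := tauP a01; have [t'01 st'] := tauP a'01.
have := ang_near p1 q1; rewrite distrC ger0_norm; last by lra.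
rewrite min_r; last by lra.
set d := `|q - p| => hd; have d0 : 0 <= d := normr_ge0 _.
have /andP[pa0 pa1] := a01; have /andP[qa0 qa1] := a'01.
have e0 : 0 <= (0 : R) <= 1 by rewrite lexx ler01.
have e1 : 0 <= (1 : R) <= 1 by rewrite lexx ler01.
have w01 : wl 0 = ext phi (circ 0) by rewrite (wl_ext e0) s0.
have c01 : circ 1 = circ 0.
 by rewrite /circ mulr0 mulr1 sin0 cos0 -[2 * pi]add0r mulr_natl cosD2pi sinD2pi cos0 sin0.
have w11 : wl 1 = ext phi (circ 0) by rewrite (wl_ext e1) s1 c01.
have h1 : `|edge U W p (circ 0) - (kap - K p)| <= C * (9 * d ^+ 2).
 rewrite edgeE (ext_ang p1) -w11 -H1; apply: le_trans (hC _ _ t01 e1) _; apply: ler_wpM2l => //.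
 rewrite s1 st; have -> : 9 * d ^+ 2 = (3 * d) ^+ 2 by ring.
 by rewrite ler_pXn2r ?nnegrE ?mulr_ge0// ger0_norm; lra.
have h2 : `|edge U W (circ 0) q - K q| <= C * (9 * d ^+ 2).
 have Kq : K q = H (tau (ang q)) - H 0 by rewrite H0 subr0.
 rewrite edgeE (ext_ang q1) -w01 Kq; apply: le_trans (hC _ _ e0 t'01) _; apply: ler_wpM2l => //.
 rewrite s0 st'; have -> : 9 * d ^+ 2 = (3 * d) ^+ 2 by ring.
 by rewrite ler_pXn2r ?nnegrE ?mulr_ge0// ger0_norm; lra.
have pi2 : 0 <= 2 * pi :> R by rewrite mulr_ge0 ?pi_ge0.
have pd (x : R) : x <= 3 * d -> 2 * pi * x <= 6 * pi * d.
 move=> hx; have -> : 6 * pi * d = 2 * pi * (3 * d) by ring.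
 by apply: ler_wpM2l.
have h3 : `|edge U W p q - (edge U W p (circ 0) + edge U W (circ 0) q)| <=
 T * (L * (6 * pi * d)) ^+ 2.
 rewrite !edgeE; apply: hT => //.
 rewrite -[ext phi p]ext_ret ret_ang//; apply: le_trans (eL _ _) _; apply: ler_wpM2l => //.
 by rewrite -c01; apply: le_trans (circ_lip _ _) _; apply: pd; rewrite ger0_norm; lra.
 rewrite -[ext phi q]ext_ret ret_ang//; apply: le_trans (eL _ _) _; apply: ler_wpM2l => //.
 by apply: le_trans (circ_lip _ _) _; apply: pd; rewrite ger0_norm; lra.
have -> : (18 * C + T * (L * (6 * pi)) ^+ 2) * d ^+ 2 =
 C * (9 * d ^+ 2) + C * (9 * d ^+ 2) + T * (L * (6 * pi * d)) ^+ 2 by ring.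
have -> : edge U W p q - (K q + kap - K p) = (edge U W p (circ 0) - (kap - K p)) +
 (edge U W (circ 0) q - K q) + (edge U W p q - (edge U W p (circ 0) + edge U W (circ 0) q)) by ring.
apply: normD_le; apply: lerD h3.
by apply: normD_le; exact: lerD.
Qed.

(** Circulations telescope to the four sides of the grid, which surround the disc. Each edge
    contributes a difference of heights up to O(h^2), and (N + 1) h = 4, so the total error is O(h).
    Only the right side crosses the angle 0, and that leaves [kap]. *)
Lemma boundary_sum : exists C : R, forall (N : nat) (o : R * R), 4 / N.+1%:R <= 1 :> R ->
 0 <= o.1 < 4 / N.+1%:R -> 0 <= o.2 < 4 / N.+1%:R ->
 `|kap| - C * (4 / N.+1%:R) <=
 `|\sum_(i < N.+1) \sum_(k < N.+1) tile U W (4 / N.+1%:R) (node o (4 / N.+1%:R) i k)|.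
have [C1 C10 hC1] := edge_near; have [C2 C20 hC2] := edge_wrap.
exists (16 * (C1 + C2)); move=> N o; set h : R := 4 / N.+1%:R.
move=> h1 /andP[b1 b3] /andP[b2 b4].
have hN : N.+1%:R * h = 4 by rewrite /h mulrC divfK.
have h0 : 0 <= h by rewrite divr_ge0.
rewrite sum_tiles; set nd := node o h.
have ndE i k : nd i k = (o.1 - 2 + i%:R * h, o.2 - 2 + k%:R * h) by [].
have big (p : R * R) : 1 <= `|p.1| \/ 1 <= `|p.2| -> 1 <= euclid p.
 move=> hp; apply: le_trans (norm_le_euclid p); rewrite norm_pair le_max.
 by case: hp => ->; rewrite ?orbT.
have quad (p : R * R) : 1 <= euclid p -> [/\ 0 < p.2 -> ang p <= 1 / 2, p.2 < 0 -> 1 / 2 <= ang p,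
 p.1 < 0 -> 1 / 4 <= ang p <= 3 / 4 & 0 < p.1 -> ang p <= 1 / 4 \/ 3 / 4 <= ang p].
 move=> e1; have [a01 pE] := angP p; have e0 : 0 < euclid p := lt_le_trans ltr01 e1.
 have p1 : p.1 = euclid p * cos (2 * pi * ang p) by rewrite {1}pE.
 have p2 : p.2 = euclid p * sin (2 * pi * ang p) by rewrite {1}pE.
 have [q1 q2 q3 q4] := sin_cos_quadrants a01.
 rewrite p1 p2 !(pmulr_rgt0 _ e0) !(pmulr_rlt0 _ e0); split; [exact: q1|exact: q2|exact: q3|exact: q4].
have bot i : (nd i 0%N).2 = o.2 - 2 by rewrite ndE/= mul0r addr0.
have top i : (nd i N.+1).2 = o.2 + 2 by rewrite ndE/= hN; ring.
have lef k : (nd 0%N k).1 = o.1 - 2 by rewrite ndE/= mul0r addr0.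
have rig k : (nd N.+1 k).1 = o.1 + 2 by rewrite ndE/= hN; ring.
have bB i : 1 <= euclid (nd i 0%N) by apply: big; right; rewrite bot ltr0_norm; lra.
have bT i : 1 <= euclid (nd i N.+1) by apply: big; right; rewrite top gtr0_norm; lra.
have bL k : 1 <= euclid (nd 0%N k) by apply: big; left; rewrite lef ltr0_norm; lra.
have bR k : 1 <= euclid (nd N.+1 k) by apply: big; left; rewrite rig gtr0_norm; lra.
have a01 p : 0 <= ang p <= 1 := (angP p).1.
have nrm1 i k : `|nd i.+1 k - nd i k| = h.
 by rewrite /nd -(node_right o h i k) [X in `|X|]addrC addKr norm_h1 ger0_norm.
have nrm2 i k : `|nd i k.+1 - nd i k| = h.
 by rewrite /nd -(node_up o h i k) [X in `|X|]addrC addKr norm_h2 ger0_norm.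
pose c := (C1 + C2) * h ^+ 2; have hh : 0 <= h ^+ 2 := sqr_ge0 _.
have cC1 : C1 * h ^+ 2 <= c by apply: ler_wpM2r => //; rewrite lerDl.
have cC2 : C2 * h ^+ 2 <= c by apply: ler_wpM2r => //; rewrite lerDr.
have half (x y : R) : 0 <= x <= 1 / 2 -> 0 <= y <= 1 / 2 -> `|x - y| <= 1 / 2.
 by move=> /andP[? ?] /andP[? ?]; rewrite ler_norml; lra2.
have half' (x y : R) : 1 / 2 <= x <= 1 -> 1 / 2 <= y <= 1 -> `|x - y| <= 1 / 2.
 by move=> /andP[? ?] /andP[? ?]; rewrite ler_norml; lra2.
have half'' (x y : R) : 1 / 4 <= x <= 3 / 4 -> 1 / 4 <= y <= 3 / 4 -> `|x - y| <= 1 / 2.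
 by move=> /andP[? ?] /andP[? ?]; rewrite ler_norml; lra2.
have SB := @edge_side R r U W (fun i => K (nd i 0%N)) (fun i => nd i 0%N) c N.+1.
have {}SB : `|\sum_(i < N.+1) edge U W (nd i 0%N) (nd i.+1 0%N) - (K (nd N.+1 0%N) - K (nd 0%N 0%N))| <= N.+1%:R * c.
 apply: SB => i _; apply: le_trans cC1; rewrite -(nrm1 i 0%N); apply: hC1 => //.
 have q (j : nat) : 1 / 2 <= ang (nd j 0%N) <= 1.
 by have [_ q2 _ _] := quad _ (bB j); have /andP[_ ->] := a01 (nd j 0%N); rewrite andbT q2// bot; lra.
 exact: half'.
have ST := @edge_side R r U W (fun i => K (nd i N.+1)) (fun i => nd i N.+1) c N.+1.
have {}ST : `|\sum_(i < N.+1) edge U W (nd i N.+1) (nd i.+1 N.+1) - (K (nd N.+1 N.+1) - K (nd 0%N N.+1))| <= N.+1%:R * c.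
 apply: ST => i _; apply: le_trans cC1; rewrite -(nrm1 i N.+1); apply: hC1 => //.
 have q (j : nat) : 0 <= ang (nd j N.+1) <= 1 / 2.
 by have [q1 _ _ _] := quad _ (bT j); have /andP[-> _] := a01 (nd j N.+1); rewrite q1// top; lra.
 exact: half.
have SL := @edge_side R r U W (fun k => K (nd 0%N k)) (fun k => nd 0%N k) c N.+1.
have {}SL : `|\sum_(k < N.+1) edge U W (nd 0%N k) (nd 0%N k.+1) - (K (nd 0%N N.+1) - K (nd 0%N 0%N))| <= N.+1%:R * c.
 apply: SL => k _; apply: le_trans cC1; rewrite -(nrm2 0%N k); apply: hC1 => //.
 have q (j : nat) : 1 / 4 <= ang (nd 0%N j) <= 3 / 4.
 by have [_ _ q3 _] := quad _ (bL j); apply: q3; rewrite lef; lra.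
 exact: half''.
(* On the right side all angles are at most 1/4 or at least 3/4; adding [kap] to the former removes
   the jump at the angle 0. *)
pose K' p := K p + (if ang p <= 1 / 4 then kap else 0).
have SR := @edge_side R r U W (fun k => K' (nd N.+1 k)) (fun k => nd N.+1 k) c N.+1.
have {}SR : `|\sum_(k < N.+1) edge U W (nd N.+1 k) (nd N.+1 k.+1) - (K' (nd N.+1 N.+1) - K' (nd N.+1 0%N))| <= N.+1%:R * c.
 apply: SR => k _.
 have q (j : nat) : ang (nd N.+1 j) <= 1 / 4 \/ 3 / 4 <= ang (nd N.+1 j).
 by have [_ _ _ q4] := quad _ (bR j); apply: q4; rewrite rig; lra.
 have /andP[x0 x1] := a01 (nd N.+1 k); have /andP[y0 y1] := a01 (nd N.+1 k.+1).
 rewrite /K'; case: (leP (ang (nd N.+1 k)) (1 / 4)) => hx; case: (leP (ang (nd N.+1 k.+1)) (1 / 4)) => hy.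
 - have -> : K (nd N.+1 k.+1) + kap - (K (nd N.+1 k) + kap) = K (nd N.+1 k.+1) - K (nd N.+1 k) by ring.
 apply: le_trans cC1; rewrite -(nrm2 N.+1 k); apply: hC1 => //.
 by apply: half; lra2.
 - have y3 : 3 / 4 <= ang (nd N.+1 k.+1) by case: (q k.+1) => //; lra.
 apply: le_trans cC2; rewrite -(nrm2 N.+1 k) distrC edge_opp.
 have -> : K (nd N.+1 k.+1) + 0 - (K (nd N.+1 k) + kap) - - edge U W (nd N.+1 k.+1) (nd N.+1 k) =
 edge U W (nd N.+1 k.+1) (nd N.+1 k) - (K (nd N.+1 k) + kap - K (nd N.+1 k.+1)) by ring.
 rewrite [X in _ * X ^+ 2]distrC; apply: hC2 => //; lra.
 - have x3 : 3 / 4 <= ang (nd N.+1 k) by case: (q k) => //; lra.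
 rewrite addr0; apply: le_trans cC2; rewrite -(nrm2 N.+1 k); apply: hC2 => //; lra.
 have x3 : 3 / 4 <= ang (nd N.+1 k) by case: (q k) => //; lra.
 have y3 : 3 / 4 <= ang (nd N.+1 k.+1) by case: (q k.+1) => //; lra.
 rewrite !addr0; apply: le_trans cC1; rewrite -(nrm2 N.+1 k); apply: hC1 => //.
 by apply: half'; lra2.
have kTR : K' (nd N.+1 N.+1) = K (nd N.+1 N.+1) + kap.
 rewrite /K' ifT//; have [q1 _ _ q4] := quad _ (bR N.+1).
 have t1 : ang (nd N.+1 N.+1) <= 1 / 2 by apply: q1; rewrite top; lra.
 have [|//|] := q4; [by rewrite rig; lra|lra].
have kBR : K' (nd N.+1 0%N) = K (nd N.+1 0%N).
 rewrite /K' ifF ?addr0//; have [_ q2 _ _] := quad _ (bR 0%N).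
 have t1 : 1 / 2 <= ang (nd N.+1 0%N) by apply: q2; rewrite bot; lra.
 by apply/negbTE; rewrite -ltNge; lra.
have cE : N.+1%:R * c = 4 * (C1 + C2) * h by rewrite /c -hN; ring.
move: SB ST SL SR; rewrite !big_split/= !sumrN kTR kBR cE.
move: (\sum_(i < N.+1) edge U W (nd i 0%N) (nd i.+1 0%N)) => S1.
move: (\sum_(i < N.+1) edge U W (nd i N.+1) (nd i.+1 N.+1)) => S2.
move: (\sum_(k < N.+1) edge U W (nd 0%N k) (nd 0%N k.+1)) => S3.
move: (\sum_(k < N.+1) edge U W (nd N.+1 k) (nd N.+1 k.+1)) => S4.
move: (K _) (K _) (K _) (K _) => k1 k2 k3 k4.
have -> : 16 * (C1 + C2) * h = 4 * (4 * (C1 + C2) * h) by ring.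
move: (4 * (C1 + C2) * h) => e SB ST SL SR.
rewrite lerBlDr.
have -> : kap = (S1 - S2 + (S4 - S3)) - ((S1 - (k4 - k3)) - (S2 - (k2 - k1)) + (S4 - (k2 + kap - k4)) - (S3 - (k1 - k3))) by ring.
apply: normB_le; rewrite lerD2l.
have -> : 4 * e = e + e + e + e by ring.
apply: normB_le; apply: lerD => //.
apply: normD_le; apply: lerD => //.
by apply: normB_le; apply: lerD.
Qed.

End Boundary.

(** * Lower bound for the Dehn function of the Lie group G *)

Section LieDehnLower.
Context {R : realType} {r : nat} (r0 : (0 < r)%N).
Local Notation Q := (filiprod R r false).
Local Notation row := 'rV[R]_(3 + r).
Local Notation mu2 := (@lebesgue_measure R \x @lebesgue_measure R)%E.
Variable g : leftinv_metric (filiLieG R r false).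

Lemma area_density_ge0 (phi : R * R -> filiLieG R r false) p : 0 <= area_density g phi p.
exact: sqrtr_ge0. Qed.
Let null2 (A B : set (R * R)) : measurable A -> measurable B -> mu2 A = 0%E -> mu2 B = 0%E ->
 mu2 (A `|` B) = 0%E.
move=> mA mB A0 B0; apply/eqP; rewrite eq_le measure_ge0 andbT.
have E : (mu2 A + mu2 B = 0)%E by rewrite A0 B0 adde0.
by apply: le_trans (measureU2 mu2 mA mB) _; exact: (eq_ind_r (fun z => z <= 0)%E (lexx _) E).
Qed.

(** Green's formula bounds the height by the integral of the Jacobian of the extended filling.
    Inside the disc this is dominated by the area density, outside it vanishes, and the circle is
    discarded as a null set. *)
Lemma filling_area (k1 lam : R) (n : nat) (phi : R * R -> filiLieG R r false) :
 0 < k1 -> (forall w, k1 * `|w| <= bn g w) -> lam * r%:R = k1 ^+ 2 / 2 ->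
 lipschitz_disc g phi -> disc_fills phi (wloop (r := r) n : R -> filiLieG R r false) ->
 (`|wpot (r := r) lam n r.+1.*2|%:E <= disc_area g phi)%E.
move=> k10 hk lr hphi [s [sc sh s0 s1 sf]].
have [C hC] := boundary_sum r0 lam hphi sc sh s0 s1 sf.
have [L L0 [uL wL]] := extUW_lip lam hphi; have [L' L'0 eL] := ext_lip hphi.
have kr : (r.-1 < r)%N by rewrite prednK.
pose k : 'I_r := Ordinal kr.
pose Gd := good (ext phi) (1, 0) `&` good (ext phi) (0, 1) `&` ~` circle.
have mA : measurable (good (ext phi) (1, 0)) := good_measurable eL _.
have mB : measurable (good (ext phi) (0, 1)) := good_measurable eL _.
have mG : measurable Gd.
 by apply: measurableI; [exact: measurableI|apply: measurableC; exact: circle_measurable].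
have G0 : mu2 (~` Gd) = 0%E.
 rewrite /Gd !setCI setCK; apply: null2; last exact: circle_null.
 - by apply: measurableU; exact: measurableC.
 - exact: circle_measurable.
 apply: null2; try exact: measurableC.
 - by apply: (good_full eL); left.
 - by apply: (good_full eL); right.
have JP p : Gd p -> (detq (extU lam phi) (extW phi) h p / h ^+ 2) @[h --> 0^'] --> extJ lam phi k p.
 by move=> [[g1 g2] _]; apply: extJ_limit => //; exact: good_derivable.
have := green L0 uL wL mG G0 JP hC; move=> h; apply: le_trans h _.
pose F p := if p \in (open_disc : set (R * R)) then area_density g phi p else 0.
have -> : disc_area g phi = (\int[mu2]_p (F p)%:E)%E.
 rewrite /disc_area integral_mkcond; apply: eq_integral => p _.
 by rewrite /patch /F; case: ifP.
apply: (@integral_le_dominated R _ F setT) => p.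
 by rewrite /F; case: ifP => // _; exact: area_density_ge0.
move=> _; apply/andP; split; first by rewrite mulr_ge0// indicE.
have F0 : 0 <= F p by rewrite /F; case: ifP => // _; exact: area_density_ge0.
rewrite indicE; case: (boolP (p \in _)) => [|_]; last by rewrite mulr0.
rewrite inE mulr1 => -[_ [[g1 g2] np]].
have d1 : derivable (ext phi) p (1, 0) by exact: good_derivable g1.
have d2 : derivable (ext phi) p (0, 1) by exact: good_derivable g2.
have [p1|p1] := ltP (euclid p) 1.
 rewrite /F mem_set; first exact: (ext_density k k10 hk lr p1 d1 d2).
 suff : p.1 ^+ 2 + p.2 ^+ 2 < 1 by [].
 by rewrite -euclid_sqr expr_lt1// euclid_ge0.
rewrite (extJ_out lam k) ?normr0// lt_neqAle p1 andbT.
by apply/eqP => e1; apply: np.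
Qed.

Theorem lie_dehn_lower : exists L D : nat, (0 < D)%N /\ forall n : nat,
 (((n ^ r.+1)%:R / D%:R)%:E <= lie_dehn g (L * n)%N%:R)%E.
have [k1 [k2 [k10 k20 hk]]] := bn_equiv g.
have hk1 v : k1 * `|v| <= bn g v by case/andP: (hk v).
have hk2 v : bn g v <= k2 * `|v| by case/andP: (hk v).
have rR : 0 < r%:R :> R by rewrite ltr0n.
(* The normalization for which the constant of [gram_minor] is absorbed and the 2-form is dominated
   by the area density. *)
pose lam : R := k1 ^+ 2 / 2 / r%:R.
have lam0 : 0 < lam by rewrite !divr_gt0// exprn_gt0.
have lr : lam * r%:R = k1 ^+ 2 / 2 by rewrite divfK// gt_eqF.
pose A : R := k2 * 2 ^+ r * r.+1.*2%:R; have A0 : 0 <= A by rewrite !mulr_ge0 ?exprn_ge0// ltW.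
pose B : R := (lam * (r`!)%:R)^-1.
have f0 : 0 < lam * (r`!)%:R by rewrite mulr_gt0// ltr0n fact_gt0.
have B0 : 0 <= B by rewrite invr_ge0 ltW.
have /andP[_ At] := Num.Theory.trunc_itv A0; have /andP[_ Bt] := Num.Theory.trunc_itv B0.
exists (Num.trunc A).+1, (Num.trunc B).+1; split=> // n.
apply: le_ereal_inf_tmp => _ [D hD <-].
have [] := hD (wloop (r := r) n : R -> filiLieG R r false).
 have [h1 h2 h3] := wloop_length r0 n (ltW k20) hk2; split=> //; apply: le_trans h3 _.
 rewrite lee_fin natrM; have -> : k2 * (n%:R * 2 ^+ r) * r.+1.*2%:R = A * n%:R by rewrite /A; ring.
 by apply: ler_wpM2r => //; exact: ltW.
move=> phi [hphi fphi area]; apply: le_trans (le_trans (filling_area k10 hk1 lr hphi fphi) area).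
rewrite lee_fin wpot_end.
have -> : `|lam * (n%:R ^+ r.+1 * ((-1) ^+ r * (r`!)%:R))| = n%:R ^+ r.+1 * (lam * (r`!)%:R).
 have E (a b c : R) : 0 < a -> 0 <= b -> 0 <= c -> `|a * (b * ((-1) ^+ r * c))| = b * (a * c).
 move=> a0 b0 c0; rewrite !normrM normrX normrN normr1 expr1n mul1r.
 by rewrite (gtr0_norm a0) (ger0_norm b0) (ger0_norm c0) mulrCA.
 by apply: E => //; exact: exprn_ge0.
rewrite natrX; apply: ler_wpM2l; first exact: exprn_ge0.
rewrite -[leRHS]invrK lef_pV2 ?posrE ?ltr0n ?invr_gt0//; exact: ltW.
Qed.

End LieDehnLower.

Section LieDehnNonneg.
Context {R : realType} {r : nat} {e : bool}.
Local Notation Q := (filiprod R r e).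
Variable g : leftinv_metric (filiLieG R r e).

Lemma lie_dehn_ge0 (n : nat) : (0 <= lie_dehn g n%:R)%E.
apply: le_ereal_inf_tmp => _ [D hD <-].
have [] := hD (fun=> 1%g : filiLieG R r e).
 split=> //; first by move=> x; exact: cvg_cst.
 apply: ge_ereal_sup => _ [s _ <-]; rewrite lee_fin /chord_sum big1// => p _.
 exact: (distxx g (1%g : Q)).
move=> phi [_ _]; apply: le_trans; apply: integral_ge0 => p _.
by rewrite lee_fin; exact: sqrtr_ge0.
Qed.

End LieDehnNonneg.

(** * The pair of Lie groups and the conclusion *)

Theorem lie_pair (R : realType) (r : nat) (hr : (3 <= r)%N) :
 exists (n m : nat) (G : lieGroup R n) (H : lieGroup R m),
 [/\ simply_connected R G /\ simply_connected R H,
 nilpotent_of_step G r /\ nilpotent_of_step H r,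
 forall (g : leftinv_metric G) (h : leftinv_metric H),
 bilipschitz_cones (riem_dist g) 1%g (riem_dist h) 1%g &
 forall (g : leftinv_metric G) (h : leftinv_metric H),
 ~ growth_eq (fun k => lie_dehn g k%:R) (fun k => lie_dehn h k%:R)].
have r1 : (1 < r)%N := ltnW hr.
exists (3 + r)%N, (3 + r)%N, (filiLieG R r false), (filiLieG R r true); split.
- by split; exact: filiLie_simply_connected.
- by split; apply: (@filiprod_step R r _ r1).
- move=> g h; apply: (@comparable_cones R r hr _ id false true _ _ (1%g : filiprod R r false)) => //.
 + exact: riem_comparable.
 + exact: riem_comparable.
move=> g h [le _]; have [L [D [D0 hL]]] := lie_dehn_lower (ltnW r1) g.
have [C hC] := lie_dehn_upper hr h.
by apply: (growth_gap D0 hL _ hC) le => n; apply: lie_dehn_ge0.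
Qed.

Theorem corollary2 (R : realType) (r : nat) (hr : (3 <= r)%N) :
  (exists G H : groupType,
     [/\ finitely_generated G /\ finitely_generated H,
         nilpotent_of_step G r /\ nilpotent_of_step H r,
         finitely_presented G /\ finitely_presented H,
         forall (s : finite_genset G) (t : finite_genset H),
           bilipschitz_cones (word_dist R s) 1%g (word_dist R t) 1%g &
         forall (P : finite_presentation G) (Q : finite_presentation H),
           ~ growth_eq (dehn R P) (dehn R Q)]) /\
  (exists (n m : nat) (G : lieGroup R n) (H : lieGroup R m),
     [/\ simply_connected R G /\ simply_connected R H,
         nilpotent_of_step G r /\ nilpotent_of_step H r,
         forall (g : leftinv_metric G) (h : leftinv_metric H),
           bilipschitz_cones (riem_dist g) 1%g (riem_dist h) 1%g &
         forall (g : leftinv_metric G) (h : leftinv_metric H),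
           ~ growth_eq (fun k => lie_dehn g k%:R) (fun k => lie_dehn h k%:R)]).
Proof. by split; [exact: discrete_pair|exact: lie_pair]. Qed.
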